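(* Let $0<\theta<1$ and $\theta+\frac12<\gamma<\min\{\frac32,\,2\theta+\frac12\}$. Assume that the initial value $\eta_0\in\mathbb{P}$ satisfies $\eta_0-\nu\eta^*_\theta\in L^2_\gamma$ for some $\nu>0$, and let $\eta\in C^0([0,\infty),\mathbb{P})$ be the unique solution with initial data $\eta_0$ of the rescaled coarsening equation in integral form (see context). Then there exists $C>0$ such that $$\|\eta(\tau)-\eta^*_\theta\|_{2,\gamma-\theta}\le C\,e^{-(\gamma-\theta-1/2)\tau}\quad\text{for }\tau\ge0.$$
   Context: Fix an integer $N\ge 1$ and real numbers $p_1,\dots,p_N\ge 0$ with $p_1+\dots+p_N=1$; let $Q(z)=\sum_{j=1}^N p_jz^j$, $q=Q'(1)$, and $\mathbb{Q}[\rho]=\sum_{j=1}^N p_j\,\rho^{*j}$, where $\rho^{*j}$ is the $j$-fold convolution power on $\mathbb{R}$. Functions on $[1,\infty)$ are extended by $0$ to $(-\infty,1)$, so $\mathbb{Q}[\eta]$ makes sense for $\eta\in L^1_{\rm loc}([1,\infty))$. $L^1=L^1((1,\infty),\mathbb{R})$; $\mathbb{P}=\{\eta\in L^1((1,\infty),\mathbb{R}_+) : \int_1^\infty \eta(y)\,dy=1\}$. For $\gamma\ge0$: $\|w\|_{2,\gamma}=\left(\int_1^\infty y^{2\gamma}|w(y)|^2\,dy\right)^{1/2}$ and $L^2_\gamma=\{w\in L^1_{\rm loc}([1,\infty),\mathbb{R}) : \|w\|_{2,\gamma}<\infty\}$. $(S_\tau\eta)(y)=e^\tau\eta(e^\tau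 y)$ for $y\ge1$ and $0$ for $y<1$; $(T_1\eta)(y)=\eta(y-1)$ for $y\ge2$ and $0$ for $y<2$. Rescaled coarsening equation: for $\eta_0\in\mathbb{P}$ there is a unique $\eta\in C^0([0,\infty),L^1)$ (with trace $\beta\in L^1_{\rm loc}([0,\infty))$) such that $\eta(\tau)=S_\tau\eta_0+\int_0^\tau\beta(s)S_{\tau-s}T_1\mathbb{Q}[\eta(s)]\,ds$ for all $\tau\ge0$ and, for every $\tau_0\ge0$, $\beta(\tau)=e^{\tau-\tau_0}\eta(\tau_0,e^{\tau-\tau_0})$ for almost all $\tau\in[\tau_0,\tau_0+\log2]$. One has $\eta(\tau)\in\mathbb{P}$ for all $\tau\ge 0$. For $0<\theta\le 1$, $\eta^*_\theta\in\mathbb{P}$ is the unique locally absolutely continuous function $\eta:[1,\infty)\to\mathbb{R}$ satisfying $(y\eta)'(y)+\frac{\theta}{q}(T_1\mathbb{Q}[\eta])(y)=0$ for almost all $y>1$ and $\eta(1)=\frac{\theta}{q}$. *)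

(* Defs.v *)
(* Elements of the spaces of (classes of) functions on (1, +oo) are represented
   by Borel functions R -> R whose values on ]-oo, 1] are irrelevant.  Equality
   in these spaces is equality almost everywhere on ]1, +oo[. *)
From HB Require Import structures.
From mathcomp Require Import all_boot all_order all_algebra.
From mathcomp Require Import all_classical all_reals all_analysis.
From mathcomp Require Import measurable_realfun.

Set Implicit Arguments.
Unset Strict Implicit.
Unset Printing Implicit Defensive.

Import Order.TTheory GRing.Theory Num.Theory.
Import numFieldNormedType.Exports.

Local Open Scope classical_set_scope.
Local Open Scope ring_scope.

Section FunctionSpaces.
Context {R : realType}.
Local Notation mu := (@lebesgue_measure R).

Definition in_L1 (w : R -> R) : Prop :=
  mu.-integrable `]1, +oo[%classic (EFin \o w).

Definition L1norm (w : R -> R) : \bar R :=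
  (\int[mu]_(y in `]1%R, +oo[%classic) `|w y|%:E)%E.

Definition is_density (w : R -> R) : Prop :=
  [/\ in_L1 w,
      {ae mu, forall y : R, 1 < y -> 0 <= w y} &
      (\int[mu]_(y in `]1%R, +oo[%classic) (w y)%:E)%E = 1%E].

(* The library's [locally_integrable] only covers open domains. *)
Definition loc_integrable_from (a : R) (w : R -> R) : Prop :=
  forall b : R, mu.-integrable `[a, b]%classic (EFin \o w).

Definition norm2 (gamma : R) (w : R -> R) : \bar R :=
  ((\int[mu]_(y in `]1%R, +oo[%classic) (y `^ (2 * gamma) * `|w y| ^+ 2)%:E)
     `^ 2^-1%R)%E.

Definition in_L2 (gamma : R) (w : R -> R) : Prop :=
  loc_integrable_from 1 w /\ (norm2 gamma w < +oo)%E.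

Definition continuous_L1 (f : R -> R -> R) : Prop :=
  (forall t : R, 0 <= t -> in_L1 (f t)) /\
  (forall s : R, 0 <= s ->
     (fun t => L1norm (f t \- f s)) @ within `[0, +oo[%classic (nbhs s)
       --> 0%E).

Definition abs_continuous_on (a b : R) (f : R -> R) : Prop :=
  forall e : R, 0 < e -> exists2 d : R, 0 < d &
    forall (n : nat) (l r : 'I_n -> R),
      (forall i, [/\ a <= l i, l i <= r i & r i <= b]) ->
      (forall i j, i != j -> r i <= l j \/ r j <= l i) ->
      \sum_(i < n) (r i - l i) < d ->
      \sum_(i < n) `|f (r i) - f (l i)| < e.

End FunctionSpaces.

Section Bochner.
Context {R : realType}.
Local Notation mu := (@lebesgue_measure R).

Record L1_simple := L1Simple {
  pieces : nat;
  piece : 'I_pieces -> set R;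
  piece_val : 'I_pieces -> R -> R;
  measurable_piece : forall i, measurable (piece i);
  piece_val_L1 : forall i, in_L1 (piece_val i) }.

Definition simple_eval (g : L1_simple) (s : R) : R -> R :=
  fun y => \sum_i \1_(@piece g i) s * @piece_val g i y.

Definition simple_integral (a b : R) (g : L1_simple) : R -> R :=
  fun y => \sum_i fine (mu (`[a, b]%classic `&` @piece g i))
                  * @piece_val g i y.

(* [I] is (a representative of) the Bochner integral of [F], as a function from
   [a, b] to L^1(1, +oo). *)
Definition is_bochner_integral (a b : R) (F : R -> R -> R) (I : R -> R) : Prop :=
  [/\ (forall s : R, a <= s <= b -> in_L1 (F s)), in_L1 I &
  exists g : nat -> L1_simple,
    [/\ forall n, measurable_fun `[a, b]%classic
          (fun s => L1norm (F s \- simple_eval (g n) s)),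
        (fun n => \int[mu]_(s in `[a, b]%classic)
                    L1norm (F s \- simple_eval (g n) s)%R)%E @ \oo --> 0%E &
        (fun n => L1norm (I \- simple_integral a b (g n))) @ \oo --> 0%E]].

End Bochner.

Section Coarsening.
Context {R : realType}.
Local Notation mu := (@lebesgue_measure R).

Definition ext0 (w : R -> R) : R -> R := fun y => if 1 <= y then w y else 0.

(* 0 at the (null set of) points where the integral diverges *)
Definition convolution (f g : R -> R) : R -> R :=
  fun x => \int[mu]_y (f (x - y) * g y).

(* meaningful for j >= 1 *)
Definition conv_pow (f : R -> R) (j : nat) : R -> R := iter j.-1 (convolution f) f.

Definition Qpoly (N : nat) (p : nat -> R) : {poly R} :=
  \sum_(1 <= j < N.+1) p j *: 'X^j.

Definition qcst (N : nat) (p : nat -> R) : R := ((Qpoly N p)^`()).[1].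

Definition Qconv (N : nat) (p : nat -> R) (w : R -> R) : R -> R :=
  fun y => \sum_(1 <= j < N.+1) p j * conv_pow (ext0 w) j y.

Definition S_op (tau : R) (w : R -> R) : R -> R :=
  fun y => if 1 <= y then expR tau * w (expR tau * y) else 0.

Definition T1 (w : R -> R) : R -> R :=
  fun y => if 2 <= y then w (y - 1) else 0.

Definition is_solution (N : nat) (p : nat -> R) (eta0 : R -> R)
    (eta : R -> R -> R) : Prop :=
  continuous_L1 eta /\
  exists beta : R -> R,
    [/\ loc_integrable_from 0 beta,
        forall tau : R, 0 <= tau ->
          is_bochner_integral 0 tau
            (fun s y => beta s * S_op (tau - s) (T1 (Qconv N p (eta s))) y)
            (eta tau \- S_op tau eta0) &
        forall tau0 : R, 0 <= tau0 ->
          {ae mu, forall tau : R, tau0 <= tau <= tau0 + ln 2 ->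
            beta tau = expR (tau - tau0) * eta tau0 (expR (tau - tau0))}].

Definition is_profile (N : nat) (p : nat -> R) (theta : R)
    (eta : R -> R) : Prop :=
  [/\ is_density eta,
      forall b : R, abs_continuous_on 1 b eta,
      {ae mu, forall y : R, 1 < y ->
        derivable (fun z : R => z * eta z) y 1 /\
        derive1 (fun z : R => z * eta z) y
          + theta / qcst N p * T1 (Qconv N p eta) y = 0} &
      eta 1 = theta / qcst N p].

End Coarsening.

(* Submission.v *)
Require Import Defs.
From HB Require Import structures.
From mathcomp Require Import all_boot all_order all_algebra.
From mathcomp Require Import all_classical all_reals all_analysis.
From mathcomp Require Import measurable_realfun.
From mathcomp Require Import complex ring lra.
From mathcomp Require polyrcf.
Import Order.TTheory GRing.Theory Num.Theory.
Import numFieldNormedType.Exports.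
Local Open Scope classical_set_scope.
Local Open Scope ring_scope.

(* Let [al = gamma - theta], and let [A_t], [B] be the Laplace transforms of
   [eta t] and of the profile.  Along the characteristics [xi -> e^t xi] the
   equation becomes [dA/dt = - beta(t) e^(-xi e^t) (1 - Q(A))], hence
   [Phi(A_t) = L u_t] where [Phi' = 1 / (1 - Q)], [Phi(0) = 0] and
   [u_t(y) = beta(t + ln y) / y] for [y > 1]; the profile satisfies the same
   relation with [beta] replaced by the constant [theta / q].  [Phi] is only
   available as the limit of the polynomials [Phi n], primitives of
   [1 + Q + ... + Q^(n-1)].  Differentiating along rays gives
   [L(y eta_t) = (1 - Q(A_t)) L(y u_t)].

   The quantity [n_t = || beta(t + ln y) - theta / q ||_(2, al - 1)] decays like
   [e^(-(al - 1/2) t)] by a mere change of variables, as soon as [n_0] is finite.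
   Weighted norms are read off the transforms by Plancherel's formula on the
   lines [Re xi = e], integrated against [e^(1 - 2 al) de]; the finiteness of
   [n_0] then follows from the relation at [t = 0], the lower bound
   [|1 - B| >= c |xi|^theta], and a Hardy inequality for the perturbation
   [eta0 - nu eta_star].  Finally
   [L(y eta_t) - L(y eta_star) = (1 - Q(A_t)) L(y (u_t - u)) + (Q(B) - Q(A_t)) L(y u)],
   and [|A_t - B| <= C e^(-(al - 1/2) t) |1 - Q(B)|] because [Phi(A_t) - Phi(B)]
   is small for large [t] (and by a Gronwall argument for bounded [t]).

   Transforms are evaluated on [Re xi > 0, Im xi >= 0], and [cn] is the modulus
   as an element of [R]. *)

(** * Integrals over the line *)

(** Near [xi = 0] both [1 - A_0] and [1 - B] have size about [|xi|^theta], so solving the initial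
    relation for [L(y u_0)] costs a factor [|xi|^(-theta)]: this is why the weight drops from
    [gamma] to [al]. The hypothesis [al > 1/2] gives the decay rate, and it makes [int w - L w] of
    order [|xi|^s] with some [s > theta] for the perturbation [w], hence negligible against [1 - B].
    The bound [al < theta + 1/2] puts the profile itself into the weighted space, and [gamma < 3/2]
    is the condition of the Hardy inequality with kernel [min(1, r y)]. Added together, these two
    upper bounds give [al < 1], which makes [e^(1 - 2 al)] integrable at 0.

    The obstacle is that [Phi'] blows up at 1, the limit of all transforms as [xi -> 0], so
    estimates must be uniform there. Two facts provide this: [1 / (1 - Q)] has real part at least
    [1/2] on the unit disc, so [Phi] contracts distances by at most 2; and at distance small
    compared with [|1 - Q(B)|] it is nearly linear. Derivatives are only taken in real parameters
    (along rays and segments), and [Phi] is only reached through polynomials. *)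

Section Measurability.
Context {R : realType}.

Lemma measurable_cos : measurable_fun setT (@cos R).
Proof. by apply: continuous_measurable_fun => x; exact: continuous_cos. Qed.

Lemma measurable_sin : measurable_fun setT (@sin R).
Proof. by apply: continuous_measurable_fun => x; exact: continuous_sin. Qed.

(** The inverse is not continuous at 0, so it is glued from the power function of exponent [-1] on
    each half-line. *)
Lemma measurable_invr : measurable_fun setT (@GRing.inv R).
Proof.
rewrite (_ : @GRing.inv R =
  fun x => if 0 <= x then x `^ (-1) else - ((- x) `^ (-1))).
  apply: measurable_fun_ifT.
  - by apply: measurable_fun_ler => //; exact: measurable_cst.
  - exact: measurable_powR.
  - apply: measurableT_comp => //; apply: (measurableT_comp (measurable_powR _)).
    exact: oppr_measurable.
apply/funext => x; case: ifPn => x0; first by rewrite powR_inv1.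
by rewrite powR_inv1 ?invrN ?opprK// oppr_ge0 ltW// ltNge.
Qed.

Lemma measurable_comp_real d (T : measurableType d) (f : R -> R) (g : T -> R) :
  measurable_fun setT f -> measurable_fun setT g ->
  measurable_fun setT (fun x => f (g x)).
Proof. by move=> mf mg; exact: (measurableT_comp mf mg). Qed.

End Measurability.

(** Proves measurability over [setT] by recursion on the shape of the function; the last case
    eta-expands so that the others can match. An application of a variable [f] is closed by a
    hypothesis [measurable_fun setT f], which is why such facts are put into the context just before
    a call. *)
Ltac mfun := repeat first
  [ assumption
  | exact: measurable_fst
  | exact: measurable_snd
  | match goal with
    | |- measurable_fun _ (fun x => x) => exact: measurable_id
    | |- measurable_fun _ (fun x => ?c) => exact: measurable_cst
    | |- measurable_fun _ (fun x => _ <= _) => apply: measurable_fun_ler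
    | |- measurable_fun _ (fun x => _ < _) => apply: measurable_fun_ltr
    | |- measurable_fun _ (fun x => (_ && _)) => apply: measurable_and
    | |- measurable_fun _ (fun x => if _ then _ else _) => apply: measurable_fun_ifT
    | |- measurable_fun _ (fun x => EFin _) => apply/measurable_EFinP
    | |- measurable_fun _ (EFin \o _) => apply/measurable_EFinP
    | |- measurable_fun _ (fun x => (_ + _)%R) => apply: measurable_funD
    | |- measurable_fun _ (fun x => (_ * _)%R) => apply: measurable_funM
    | |- measurable_fun _ (fun x => (- _)%R) => (apply: measurable_comp_real; first exact: oppr_measurable)
    | |- measurable_fun _ (fun x => `| _ |%R) => (apply: measurable_comp_real; first exact: normr_measurable)
    | |- measurable_fun _ (fun x => (_ ^+ _)%R) => apply: measurable_funX
    | |- measurable_fun _ (fun x => (expR _)%R) => (apply: measurable_comp_real; first exact: measurable_expR)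
    | |- measurable_fun _ (fun x => (cos _)%R) => (apply: measurable_comp_real; first exact: measurable_cos)
    | |- measurable_fun _ (fun x => (sin _)%R) => (apply: measurable_comp_real; first exact: measurable_sin)
    | |- measurable_fun _ (fun x => (ln _)%R) => (apply: measurable_comp_real; first exact: measurable_ln)
    | |- measurable_fun _ (fun x => (_ `^ _)%R) => apply: (measurableT_comp (measurable_powR _))
    | |- measurable_fun _ (fun x => (_ ^-1)%R) => (apply: measurable_comp_real; first exact: measurable_invr)
    | H : measurable_fun setT ?f |- measurable_fun _ (fun x => ?f _) => first [apply: (measurable_comp_real H) | apply: (measurableT_comp H)]
    | |- measurable_fun _ (fun x => (\1_?D _)%R) => apply: (measurableT_comp (measurable_indic _))
    | |- @measurable_fun _ _ ?T _ _ ?f => lazymatch f with fun _ => _ => fail | _ =>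
        change f with (fun x => f x); cbv beta end
    end ].

Section Integrals.
Context {R : realType}.
Local Notation mu := (@lebesgue_measure R).

(** Everything is integrated over the whole line, with functions extended by 0, so that
    translations, dilations and convolutions carry no domain. *)
Definition L1 (f : R -> R) := mu.-integrable setT (EFin \o f).

Implicit Types (f g h : R -> R).

Lemma L1_meas f : L1 f -> measurable_fun setT f.
Proof. by case/integrableP => /measurable_EFinP. Qed.

Lemma L1_fin f : L1 f -> (\int[mu]_x `|f x|%:E < +oo)%E.
Proof. by case/integrableP. Qed.

Lemma L1P f : measurable_fun setT f -> (\int[mu]_x `|f x|%:E < +oo)%E -> L1 f.
Proof. by move=> mf f_fin; apply/integrableP; split => //; exact/measurable_EFinP. Qed.

Lemma L1_le f g : measurable_fun setT f -> (forall x, `|f x| <= g x) -> L1 g -> L1 f.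
Proof.
move=> mf fg; apply: le_integrable => //; first exact/measurable_EFinP.
by move=> x _ /=; rewrite lee_fin (le_trans (fg x))// ler_norm.
Qed.

Lemma eq_L1 f g : f =1 g -> L1 f -> L1 g.
Proof. by move=> /funext ->. Qed.

Lemma L1D f g : L1 f -> L1 g -> L1 (fun x => f x + g x).
Proof. exact: integrableD. Qed.

Lemma L1N f : L1 f -> L1 (fun x => - f x).
Proof. exact: integrableN. Qed.

Lemma L1B f g : L1 f -> L1 g -> L1 (fun x => f x - g x).
Proof. by move=> f1 g1; apply: L1D => //; exact: L1N. Qed.

Lemma L1Z (a : R) f : L1 f -> L1 (fun x => a * f x).
Proof. exact: integrableZl. Qed.

Lemma L1_norm f : L1 f -> L1 (fun x => `|f x|).
Proof. exact: integrable_norm. Qed.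

Lemma L1_bndM (M : R) f h : measurable_fun setT h -> (forall x, `|h x| <= M) ->
  L1 f -> L1 (fun x => h x * f x).
Proof.
move=> mh hM f1; apply: (@L1_le _ (fun x => M * `|f x|)).
- by have mf := L1_meas _ f1; mfun.
- by move=> x; rewrite normrM ler_wpM2r.
- exact/L1Z/L1_norm.
Qed.

Lemma L1_0 : L1 (fun=> 0).
Proof. exact: integrable0. Qed.

Lemma ItgD f g : L1 f -> L1 g -> \int[mu]_x (f x + g x) = \int[mu]_x f x + \int[mu]_x g x.
Proof. exact: RintegralD. Qed.

Lemma ItgB f g : L1 f -> L1 g -> \int[mu]_x (f x - g x) = \int[mu]_x f x - \int[mu]_x g x.
Proof. exact: RintegralB. Qed.

Lemma ItgZ (a : R) f : L1 f -> \int[mu]_x (a * f x) = a * \int[mu]_x f x.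
Proof. by move=> f1; rewrite RintegralZl. Qed.

Lemma ItgN f : L1 f -> \int[mu]_x (- f x) = - \int[mu]_x f x.
Proof.
move=> f1; rewrite -mulN1r -ItgZ//.
by apply: eq_Rintegral => x _; rewrite mulN1r.
Qed.

Lemma eq_Itg f g : f =1 g -> \int[mu]_x f x = \int[mu]_x g x.
Proof. by move=> fg; apply: eq_Rintegral => x _; exact: fg. Qed.

Lemma Itg_le f g : L1 f -> L1 g -> (forall x, f x <= g x) ->
  \int[mu]_x f x <= \int[mu]_x g x.
Proof. by move=> f1 g1 fg; exact: le_Rintegral. Qed.

Lemma Itg_ge0 f : (forall x, 0 <= f x) -> 0 <= \int[mu]_x f x.
Proof. by move=> f0; exact: Rintegral_ge0. Qed.

Lemma Itg_norm f : L1 f -> `|\int[mu]_x f x| <= \int[mu]_x `|f x|.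
Proof. by move=> f1; exact: le_normr_Rintegral. Qed.

Lemma Itg_norm_le f g : L1 g -> measurable_fun setT f -> (forall x, `|f x| <= g x) ->
  `|\int[mu]_x f x| <= \int[mu]_x g x.
Proof.
move=> g1 mf fg; have f1 : L1 f by exact: (L1_le _ g).
by apply: (le_trans (Itg_norm _ f1)); apply: Itg_le => //; exact: L1_norm.
Qed.

Lemma EFin_Itg f : L1 f -> (\int[mu]_x f x)%:E = (\int[mu]_x (f x)%:E)%E.
Proof. by move=> f1; rewrite /Rintegral fineK//; exact: integrable_fin_num. Qed.

Lemma ge0_L1 f (M : R) : measurable_fun setT f -> (forall x, 0 <= f x) ->
  (\int[mu]_x (f x)%:E <= M%:E)%E -> L1 f /\ \int[mu]_x f x <= M.
Proof.
move=> mf f0 fM; have f1 : L1 f.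
  apply: L1P => //; under eq_integral => x _ do rewrite ger0_norm//.
  by rewrite (le_lt_trans fM) ?ltry.
by split => //; rewrite -lee_fin EFin_Itg.
Qed.

Lemma ge0_integral_le (F G : R -> R) : measurable_fun setT F -> measurable_fun setT G ->
  (forall x, 0 <= F x <= G x) ->
  (\int[mu]_x (F x)%:E <= \int[mu]_x (G x)%:E)%E.
Proof.
move=> mF mG FG; apply: ge0_le_integral => //.
- by move=> x _; rewrite lee_fin; case/andP: (FG x).
- exact/measurable_EFinP.
- exact/measurable_EFinP.
- by move=> x _; rewrite lee_fin; case/andP: (FG x).
Qed.

Lemma aeS (P Q : R -> Prop) : (forall x, P x -> Q x) ->
  {ae mu, forall x, P x} -> {ae mu, forall x, Q x}.
Proof.
move=> PQ; apply: filterS => //; exact: (ae_filter_ringOfSetsType mu).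
Qed.

Lemma aeS2 (P Q S : R -> Prop) : (forall x, P x -> Q x -> S x) ->
  {ae mu, forall x, P x} -> {ae mu, forall x, Q x} -> {ae mu, forall x, S x}.
Proof.
move=> PQ; apply: filterS2 => //; exact: (ae_filter_ringOfSetsType mu).
Qed.

Lemma ae_eq_L1 f g : measurable_fun setT g -> {ae mu, forall x, f x = g x} -> L1 f -> L1 g.
Proof.
move=> mg fg f1; apply: L1P => //.
rewrite (_ : (\int[mu]_x _)%E = (\int[mu]_x `|f x|%:E)%E); first exact: L1_fin.
apply: ae_eq_integral => //.
- by mfun.
- by have mf := L1_meas _ f1; mfun.
- by apply: aeS fg => x -> _.
Qed.

Lemma ae_eq_Itg f g : measurable_fun setT f -> measurable_fun setT g ->
  {ae mu, forall x, f x = g x} -> \int[mu]_x f x = \int[mu]_x g x.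
Proof.
move=> mf mg fg; rewrite /Rintegral; congr fine; apply: ae_eq_integral => //.
- by mfun.
- by mfun.
- by apply: aeS fg => x -> _.
Qed.

Lemma Itg_mkcond (D : set R) f : \int[mu]_(x in D) f x = \int[mu]_x (f x * \1_D x).
Proof.
rewrite Rintegral_mkcond; apply: eq_Itg => x; rewrite patchE indicE.
by case: ifPn => _; rewrite ?mulr1 ?mulr0.
Qed.

Lemma L1_mkcond (D : set R) f : measurable D ->
  mu.-integrable D (EFin \o f) <-> L1 (fun x => f x * \1_D x).
Proof.
move=> mD; rewrite /L1 -(_ : (EFin \o f) \_ D = EFin \o (fun x => f x * \1_D x)).
  exact: integrable_mkcond.
apply/funext => x; rewrite patchE/= indicE.
by case: ifPn => _; rewrite ?mulr1 ?mulr0.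
Qed.

Lemma meas_mkcond (D : set R) f : measurable D ->
  measurable_fun D f <-> measurable_fun setT (fun x => f x * \1_D x).
Proof.
move=> mD; rewrite -(_ : f \_ D = (fun x => f x * \1_D x)).
  exact: measurable_restrictT.
apply/funext => x; rewrite patchE/= indicE.
by case: ifPn => _; rewrite ?mulr1 ?mulr0.
Qed.

Lemma integral_mkcond1 (D : set R) f :
  (\int[mu]_(x in D) (f x)%:E = \int[mu]_x (f x * \1_D x)%:E)%E.
Proof.
rewrite integral_mkcond; apply: eq_integral => x _; rewrite patchE indicE.
by case: ifPn => _; rewrite ?mulr1 ?mulr0.
Qed.

End Integrals.

(** * Measurability of parametric integrals and Fubini's theorem *)

Section Fubini_real.
Context {R : realType}.
Local Notation mu := (@lebesgue_measure R).

Lemma meas_Itg_ge0 d (T : measurableType d) (F : T -> R -> R) :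
  measurable_fun setT (fun z : T * R => F z.1 z.2) -> (forall x y, 0 <= F x y) ->
  measurable_fun setT (fun x => \int[mu]_y (F x y)%:E)%E.
Proof.
move=> /measurable_EFinP mF F0.
exact: (@measurable_fun_fubini_tonelli_F _ _ T _ R mu (fun z => (F z.1 z.2)%:E)
  mF (fun z => F0 z.1 z.2)).
Qed.

(** The extended integral is the difference of those of the positive and negative parts, each
    measurable by Tonelli. Applying [fine] keeps measurability even at parameters where the
    integrand is not integrable. *)
Lemma meas_Itg d (T : measurableType d) (F : T -> R -> R) :
  measurable_fun setT (fun z : T * R => F z.1 z.2) ->
  measurable_fun setT (fun x => \int[mu]_y (F x y)).
Proof.
move=> mF.
rewrite (_ : (fun x => _) = fine \o ((fun x => \int[mu]_y ((fun z : T * R => (F z.1 z.2)%:E)^\+ (x, y))) \-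
   (fun x => \int[mu]_y ((fun z : T * R => (F z.1 z.2)%:E)^\- (x, y))))%E); last first.
  apply: funext => x /=. rewrite /Rintegral. rewrite integralE. by congr (fine (_ - _)%E); apply: eq_integral => y _; rewrite ?funeposE ?funenegE.
have mE : measurable_fun setT (fun z : T * R => (F z.1 z.2)%:E) by exact/measurable_EFinP.
apply: measurableT_comp; first exact: fine_measurable.
apply: emeasurable_funB.
- exact: (@measurable_fun_fubini_tonelli_F _ _ T _ R mu _ (measurable_funepos mE) (fun=> funepos_ge0 _ _)).
- exact: (@measurable_fun_fubini_tonelli_F _ _ T _ R mu _ (measurable_funeneg mE) (fun=> funeneg_ge0 _ _)).
Qed.

Lemma Tonelli (F : R -> R -> R) :
  measurable_fun setT (fun z : R * R => F z.1 z.2) -> (forall x y, 0 <= F x y) ->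
  (\int[mu]_x \int[mu]_y (F x y)%:E = \int[mu]_y \int[mu]_x (F x y)%:E)%E.
Proof.
move=> /measurable_EFinP mF F0.
exact: (@fubini_tonelli _ _ _ _ R mu mu (fun z => (F z.1 z.2)%:E) mF (fun z => F0 z.1 z.2)).
Qed.

Lemma meas_swap (F : R -> R -> R) :
  measurable_fun setT (fun z : R * R => F z.1 z.2) ->
  measurable_fun setT (fun z : R * R => F z.2 z.1).
Proof.
move=> mF.
exact: (measurableT_comp mF (@measurable_swap _ _ _ _)).
Qed.

(** Almost every slice is integrable, and only there does the real inner integral agree with the
    extended one; the last equality therefore goes through an a.e. comparison. *)
Lemma Fubini_aux (F : R -> R -> R) :
  measurable_fun setT (fun z : R * R => F z.1 z.2) ->
  (\int[mu]_x \int[mu]_y `|F x y|%:E < +oo)%E ->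
  [/\ {ae mu, forall x, L1 (F x)},
   L1 (fun x => \int[mu]_y F x y) &
   (\int[mu]_x \int[mu]_y F x y)%:E = (\int[mu]_x \int[mu]_y (F x y)%:E)%E ].
Proof.
move=> mF Foo.
have iF : (mu \x mu)%E.-integrable setT (fun z : R * R => (F z.1 z.2)%:E).
  have mE : measurable_fun setT (fun z : R * R => (F z.1 z.2)%:E) by exact/measurable_EFinP.
  exact: ((@integrable12ltyP _ _ _ _ R mu mu _ mE).2 Foo).
have a1 := ae_integrable1 iF.
have i1 := integrable_fubini_F iF.
have mI := meas_Itg _ _ F mF.
have E : {ae mu, forall x : R, (\int[mu]_y F x y)%:E = (\int[mu]_y (F x y)%:E)%E}.
  by apply: aeS a1 => x; exact: EFin_Itg.
have L : L1 (fun x : R => \int[mu]_y F x y).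
  apply/integrableP; split; first exact/measurable_EFinP.
  case/integrableP : i1 => m1; apply: le_lt_trans.
  apply: ge0_le_integral => //.
  - by apply: measurableT_comp => //; exact/measurable_EFinP.
  - exact: measurableT_comp.
  - move=> x _ /=; rewrite /fubini_F /Rintegral; case: (integral _ _ _) => [r||] /=;
      by rewrite ?normr0 ?leey.
split => //.
rewrite (EFin_Itg _ L); apply: ae_eq_integral => //.
- exact/measurable_EFinP.
- exact: (measurable_int _ i1).
- by apply: aeS E => x.
Qed.

Lemma Fubini_real (F : R -> R -> R) :
  measurable_fun setT (fun z : R * R => F z.1 z.2) ->
  (\int[mu]_x \int[mu]_y `|F x y|%:E < +oo)%E ->
  [/\ {ae mu, forall x, L1 (F x)}, L1 (fun x => \int[mu]_y F x y),
     L1 (fun y => \int[mu]_x F x y) &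
   \int[mu]_x \int[mu]_y F x y = \int[mu]_y \int[mu]_x F x y].
Proof.
move=> mF Foo; have [a1 l1 e1] := Fubini_aux F mF Foo.
have mF' := meas_swap F mF.
have Foo' : (\int[mu]_y \int[mu]_x `|F x y|%:E < +oo)%E.
  rewrite -(Tonelli (fun x y => `|F x y|))//.
  by mfun.
have [a2 l2 e2] := Fubini_aux (fun y x => F x y) mF' Foo'.
split => //.
apply: EFin_inj; rewrite e1 e2.
apply: (@Fubini _ _ _ _ R mu mu (fun z : R * R => (F z.1 z.2)%:E)).
have mE : measurable_fun setT (fun z : R * R => (F z.1 z.2)%:E) by exact/measurable_EFinP.
exact: ((@integrable12ltyP _ _ _ _ R mu mu _ mE).2 Foo).
Qed.

End Fubini_real.

(** * Affine and exponential changes of variables *)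

Section ChangeOfVariables.
Context {R : realType}.
Local Notation mu := (@lebesgue_measure R).

Section pushforward.
Variables (phi : R -> R) (mphi : measurable_fun setT phi).

Let mphi' : @measurable_fun _ _ (measurableTypeR R) (measurableTypeR R) setT phi.
Proof. exact: mphi. Qed.

Definition pushforward_real (m : {measure set (measurableTypeR R) -> \bar R}) :
    {measure set (measurableTypeR R) -> \bar R} :=
  measure_function_pushforward__canonical__measure_function_Measure m mphi'.

Lemma pushforward_realE m A : pushforward_real m A = m (phi @^-1` A).
Proof. by []. Qed.

Lemma integral_pushforward_real m (f : R -> R) : measurable_fun setT f ->
  (forall x, 0 <= f x) ->
  (\int[pushforward_real m]_x (f x)%:E = \int[m]_x (f (phi x))%:E)%E.
Proof.
move=> mf f0.
have mf' : @measurable_fun _ _ (measurableTypeR R) (\bar R) setT (EFin \o f).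
  by apply/measurable_EFinP.
rewrite (@ge0_integral_pushforward _ _ (measurableTypeR R) (measurableTypeR R) R phi mphi' m setT (EFin \o f))//.
by move=> y _; rewrite lee_fin.
Qed.

End pushforward.

Lemma measurable_affine (a b : R) : measurable_fun setT (fun x : R => a * x + b).
Proof. by mfun. Qed.

(** The image of [mu] under [x -> a x + b], multiplied by [a], gives every interval []u, v]] its
    length, and this characterises Lebesgue measure. *)
Lemma ge0_integral_affine (a b : R) (f : R -> R) : 0 < a -> measurable_fun setT f ->
  (forall x, 0 <= f x) ->
  (\int[mu]_x (f (a * x + b)%R)%:E = (a^-1)%:E * \int[mu]_x (f x)%:E)%E.
Proof.
move=> a0 mf f0.
pose nu : {measure set (measurableTypeR R) -> \bar R} :=
  mscale (NngNum (ltW a0)) (pushforward_real _ (measurable_affine a b) mu).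
have E A : measurable A -> mu A = nu A.
  apply: lebesgue_measure_unique => // _ [[u v]] _ <-.
  rewrite /nu/= /mscale/= pushforward_realE; last exact: measurable_affine.
  rewrite (_ : _ @^-1` _ = `](u - b) / a, (v - b) / a]%classic); last first.
    apply/seteqP; split => x /=; rewrite !in_itv/= ltr_pdivrMr// ler_pdivlMr//; lra.
  rewrite lebesgue_measure_itv/= lte_fin.
  have -> : mu `](u - b) / a, (v - b) / a]%classic = (if u < v then ((v - u) / a)%:E else 0%E).
    rewrite lebesgue_measure_itv/= lte_fin (ltr_pM2r (_ : 0 < a^-1)) ?invr_gt0// ltrD2r.
    by case: ifP => // _; rewrite -EFinB -mulrBl; congr (_ / _)%:E; ring.
  case: ifPn => uv; last by rewrite mule0.
  by rewrite -EFinD -EFinM mulrC divfK// gt_eqF.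
transitivity (\int[pushforward_real _ (measurable_affine a b) mu]_x (f x)%:E)%E.
  by symmetry; exact: integral_pushforward_real.
rewrite [in RHS](@eq_measure_integral _ _ _ setT nu mu); last by move=> A mA _; exact: E.
rewrite ge0_integral_mscale//=.
- by rewrite muleA -EFinM mulVf ?gt_eqF// mul1e.
- exact/measurable_EFinP.
- by move=> x _; rewrite lee_fin.
Qed.

Lemma ge0_integral_opp (f : R -> R) : measurable_fun setT f -> (forall x, 0 <= f x) ->
  (\int[mu]_x (f (- x)%R)%:E = \int[mu]_x (f x)%:E)%E.
Proof.
move=> mf f0.
have mN := @oppr_measurable R setT.
transitivity (\int[pushforward_real _ mN mu]_x (f x)%:E)%E.
  by symmetry; exact: integral_pushforward_real.
apply: eq_measure_integral => A mA _; rewrite pushforward_realE.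
exact: lebesgue_measureN.
Qed.

(** Writing [f] as [(|f| + f) - |f|] reduces a signed function to two nonnegative ones, to which the
    assumed formula applies. *)
Lemma L1_transfer (phi : R -> R) (k : R) (f : R -> R) : measurable_fun setT phi ->
  (forall g : R -> R, measurable_fun setT g -> (forall x, 0 <= g x) ->
    (\int[mu]_x (g (phi x))%:E = k%:E * \int[mu]_x (g x)%:E)%E) ->
  L1 f -> L1 (fun x => f (phi x)) /\ \int[mu]_x f (phi x) = k * \int[mu]_x f x.
Proof.
move=> mphi H f1; have mf := L1_meas _ f1.
have mfp : measurable_fun setT (fun x => f (phi x)) by mfun.
have f1p : L1 (fun x => f (phi x)).
  apply: L1P => //; rewrite (H (fun x => `|f x|))//; last by mfun.
  have := integrable_fin_num _ (L1_norm _ f1) => /(_ measurableT).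
  by case: (integral _ _ _) => //= r _; rewrite -EFinM ltry.
split => //.
have K g : L1 g -> (forall x, 0 <= g x) -> L1 (fun x => g (phi x)) ->
    \int[mu]_x g (phi x) = k * \int[mu]_x g x.
  move=> g1 g0 gp1; have mg := L1_meas _ g1.
  by apply: EFin_inj; rewrite EFinM !EFin_Itg// H.
have e1 : L1 (fun x => `|f x| + f x) by apply: L1D => //; exact: L1_norm.
have e1p : L1 (fun x => `|f (phi x)| + f (phi x)) by apply: L1D => //; exact: L1_norm.
have E1 := K (fun x => `|f x| + f x) e1 _ e1p.
have E2 := K (fun x => `|f x|) (L1_norm _ f1) _ (L1_norm _ f1p).
rewrite (eq_Itg _ (fun x => (`|f (phi x)| + f (phi x)) - `|f (phi x)|)); last first.
  by move=> x; rewrite addrC addrA addNr add0r.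
rewrite ItgB//; last exact: L1_norm.
rewrite E1; last by move=> x; rewrite -lerBlDr sub0r -normrN ler_norm.
rewrite E2//; rewrite -mulrBr -ItgB//; last exact: L1_norm.
by congr (_ * _); apply: eq_Itg => x; rewrite addrC addrA addNr add0r.
Qed.

Lemma L1_affine (a b : R) (f : R -> R) : 0 < a -> L1 f ->
  L1 (fun x => f (a * x + b)) /\ \int[mu]_x f (a * x + b) = a^-1 * \int[mu]_x f x.
Proof.
move=> a0 f1; apply: (L1_transfer (fun x => a * x + b)) => //; first exact: measurable_affine.
by move=> g mg g0; exact: ge0_integral_affine.
Qed.

Lemma L1_shift (b : R) (f : R -> R) : L1 f ->
  L1 (fun x => f (x + b)) /\ \int[mu]_x f (x + b) = \int[mu]_x f x.
Proof.
move=> f1; have [L E] := @L1_affine 1 b f ltr01 f1; split.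
  by apply: (eq_L1 _ _ _ L) => x; rewrite mul1r.
by rewrite -[RHS]mul1r -[in RHS]invr1 -E; apply: eq_Itg => x; rewrite mul1r.
Qed.

Lemma L1_opp (f : R -> R) : L1 f ->
  L1 (fun x => f (- x)) /\ \int[mu]_x f (- x) = \int[mu]_x f x.
Proof.
move=> f1; have [//|] := L1_transfer -%R 1 f (@oppr_measurable R setT) _ f1.
  by move=> g mg g0; rewrite mul1e; exact: ge0_integral_opp.
by rewrite mul1r.
Qed.

Lemma integral_inv (s : R) :
  (\int[mu]_y (if (0 < y)%R && (expR (s - 1) <= y <= expR s)%R then y^-1 else 0)%:E = 1)%E.
Proof.
rewrite (_ : (\int[mu]_y _)%E = (\int[mu]_(y in `[expR (s - 1), expR s]) (y^-1)%:E)%E); last first.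
  rewrite [RHS]integral_mkcond; apply: eq_integral => y _; rewrite patchE.
  case: ifPn => [/andP[y0 h]|h]; first by rewrite mem_set//= in_itv.
  rewrite memNset//= in_itv/= => h'; move: h; rewrite h' andbT => /negP; apply.
  by case/andP: h' => + _; apply: lt_le_trans; exact: expR_gt0.
have lt : expR (s - 1) < expR s by rewrite ltr_expR; lra.
have pos y : y \in `[expR (s - 1), expR s] -> 0 < y.
  by rewrite in_itv/= => /andP[+ _]; apply: lt_le_trans; exact: expR_gt0.
rewrite (@continuous_FTC2 _ _ (@ln R))//.
- by rewrite !expRK -EFinD; congr EFin; lra.
- apply: continuous_in_subspaceT => y; rewrite inE/= => /pos y0.
  by apply: inv_continuous; rewrite gt_eqF.
- split.
  + move=> y yI; apply: (@ex_derive _ _ _ _ _ _ _ (is_derive1_ln _)).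
    by apply: pos; exact: subset_itv_oo_cc yI.
  + by apply: cvg_at_right_filter; apply: continuous_ln; rewrite expR_gt0.
  + by apply: cvg_at_left_filter; apply: continuous_ln; rewrite expR_gt0.
- move=> y yI; rewrite derive1E; apply: derive_val; apply: is_derive1_ln.
  by apply: pos; exact: subset_itv_oo_cc yI.
Qed.

(* Uniqueness of Haar measure: [f (y e^s) e^s] is integrated over [s] in ]0, 1]
   and [y > 0], in both orders. *)
Lemma ge0_integral_exp (f : R -> R) : measurable_fun setT f -> (forall x, 0 <= f x) ->
  (\int[mu]_x (if (0 < x)%R then f x else 0)%:E = \int[mu]_x (f (expR x) * expR x)%:E)%E.
Proof.
move=> mf f0.
pose f1 (x : R) := if 0 < x then f x else 0.
have mf1 : measurable_fun setT f1 by rewrite /f1; mfun.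
have f10 x : 0 <= f1 x by rewrite /f1; case: ifP.
pose phi (x : R) : R := if (0 <= x) && (x <= 1) then 1 else 0.
have mphi : measurable_fun setT phi by rewrite /phi; mfun.
have phi0 x : 0 <= phi x by rewrite /phi; case: ifP.
transitivity (\int[mu]_s \int[mu]_y (phi s * (f1 (expR s * y) * expR s))%:E)%E.
  transitivity (\int[mu]_s ((phi s)%:E * \int[mu]_x (f1 x)%:E))%E.
    rewrite ge0_integralZr//; last 3 first.
    - by mfun.
    - by move=> x _; rewrite lee_fin.
    - by apply: integral_ge0 => x _; rewrite lee_fin.
    rewrite (_ : (\int[mu]_s (phi s)%:E)%E = 1%E) ?mul1e//.
    transitivity (\int[mu]_(x in `[0%R, 1%R]) 1)%E.
      rewrite [RHS]integral_mkcond; apply: eq_integral => x _; rewrite patchE /phi.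
      case: ifPn => h; first by rewrite mem_set//= in_itv.
      by rewrite memNset//= in_itv/=; exact/negP.
    have E : mu `[0%R, 1%R]%classic = 1%E.
      by rewrite lebesgue_measure_itv/= lte_fin ltr01 -EFinB subr0.
    rewrite (@integral_cst _ _ _ mu `[0%R, 1%R]%classic _ 1%E)//.
    by rewrite mul1e; exact: E.
  apply: eq_integral => s _.
  transitivity (\int[mu]_y ((phi s * expR s)%:E * (f1 (expR s * y + 0))%:E))%E; last first.
    by apply: eq_integral => y _; rewrite -EFinM addr0; congr EFin; ring.
  rewrite ge0_integralZl//; last 3 first.
  - by apply/measurable_EFinP; have ? := measurable_affine (expR s) 0; mfun.
  - by move=> y _; rewrite lee_fin.
  - by rewrite lee_fin mulr_ge0// expR_ge0.
  rewrite (ge0_integral_affine _ 0 _ (expR_gt0 s))// muleA -EFinM.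
  by rewrite mulfK// gt_eqF// expR_gt0.
rewrite (Tonelli (fun s y => phi s * (f1 (expR s * y) * expR s))); last 2 first.
- by mfun.
- by move=> s y; rewrite !mulr_ge0// expR_ge0.
pose psi (s y : R) : R := if (0 < y) && (expR (s - 1) <= y <= expR s) then y^-1 else 0.
have psi0 s y : 0 <= psi s y.
  by rewrite /psi; case: ifP => // /andP[y0 _]; rewrite invr_ge0 ltW.
have mpsi : measurable_fun setT (fun z : R * R => psi z.1 z.2) by rewrite /psi; mfun.
transitivity (\int[mu]_y \int[mu]_s (psi s y * (f (expR s) * expR s))%:E)%E.
  apply: eq_integral => y _.
  have [y0|y0] := ltP 0 y; last first.
    transitivity (0%E : \bar R).
      apply: integral0_eq => s _; rewrite /f1 ltNge mulr_ge0_le0 ?expR_ge0//=.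
      by rewrite mul0r mulr0.
    by apply/esym/integral0_eq => s _; rewrite /psi ltNge y0/= mul0r.
  (* The shift [s -> s - ln y] removes [y] from the argument of [f1]: the condition [0 <= s <= 1]
     becomes [e^(s-1) <= y <= e^s], and the factor [e^s] produces the [1 / y] of [psi]. *)
  have := @ge0_integral_affine 1 (- ln y) (fun s => phi s * (f1 (expR s * y) * expR s)) ltr01.
  rewrite invr1 mul1e => <-; last 2 first.
  - by mfun.
  - by move=> s; rewrite !mulr_ge0// expR_ge0.
  apply: eq_integral => s _; congr EFin.
  rewrite mul1r expRD expRN lnK ?posrE// mulfVK ?gt_eqF// /f1 expR_gt0.
  rewrite /phi /psi y0/= subr_ge0 -(ler_expR (ln y)) lnK ?posrE//.
  rewrite lerBlDr -lerBlDl -(ler_expR _ (ln y)) lnK ?posrE// [in RHS]andbC.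
  by case: ifP => _; rewrite ?mul0r// mul1r [RHS]mulrC -mulrA.
rewrite -(Tonelli (fun s y => psi s y * (f (expR s) * expR s))); last 2 first.
- by mfun.
- by move=> s y; rewrite !mulr_ge0// expR_ge0.
apply: eq_integral => s _.
under eq_integral do rewrite EFinM.
rewrite ge0_integralZr//; last 3 first.
- apply/measurable_EFinP; rewrite /psi; mfun.
- by move=> y _; rewrite lee_fin.
- by rewrite lee_fin mulr_ge0// expR_ge0.
by rewrite integral_inv mul1e.
Qed.

End ChangeOfVariables.

(** * Laplace transforms *)

Local Notation Re := complex.Re.
Local Notation Im := complex.Im.
Local Open Scope complex_scope.

Section ComplexModulus.
Context {R : realType}.
Implicit Types z w : R[i].

Definition cn z : R := Num.sqrt (Re z ^+ 2 + Im z ^+ 2).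

Lemma cnE z : `|z| = (cn z)%:C.
Proof. by rewrite normc_def. Qed.

Lemma cn_sq z : cn z ^+ 2 = Re z ^+ 2 + Im z ^+ 2.
Proof. by rewrite sqr_sqrtr// addr_ge0// sqr_ge0. Qed.

Lemma cn_ge0 z : 0 <= cn z. Proof. exact: sqrtr_ge0. Qed.

Lemma cnM z w : cn (z * w) = cn z * cn w.
Proof. by apply: (@complexI R); rewrite -cnE normrM !cnE -rmorphM. Qed.

Lemma cnN z : cn (- z) = cn z.
Proof. by apply: (@complexI R); rewrite -!cnE normrN. Qed.

Lemma cnBC z w : cn (z - w) = cn (w - z).
Proof. by rewrite -cnN opprB. Qed.

Lemma cnD z w : cn (z + w) <= cn z + cn w.
Proof. by rewrite -lecR rmorphD/= -!cnE ler_normD. Qed.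

Lemma cnB z w : cn (z - w) <= cn z + cn w.
Proof. by rewrite -(cnN w); exact: cnD. Qed.

Lemma cn_tri z w u : cn (z - w) <= cn (z - u) + cn (u - w).
Proof. by rewrite (le_trans _ (cnD _ _))// addrA subrK. Qed.

Lemma cn0 : cn 0 = 0. Proof. by apply: (@complexI R); rewrite -cnE normr0. Qed.
Lemma cn1 : cn 1 = 1. Proof. by apply: (@complexI R); rewrite -cnE normr1. Qed.

Lemma cn_eq0 z : (cn z == 0) = (z == 0).
Proof. by rewrite -(inj_eq (@complexI R)) -cnE normr_eq0. Qed.

Lemma cn_gt0 z : (0 < cn z) = (z != 0).
Proof. by rewrite lt_def cn_ge0 andbT cn_eq0. Qed.

Lemma cnV z : cn z^-1 = (cn z)^-1.
Proof. by apply: (@complexI R); rewrite -cnE normfV cnE fmorphV. Qed.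

Lemma cnX z n : cn (z ^+ n) = cn z ^+ n.
Proof. by apply: (@complexI R); rewrite -cnE normrX cnE rmorphXn. Qed.

Lemma cnC (x : R) : cn x%:C = `|x|.
Proof. by rewrite /cn/= expr0n addr0 sqrtr_sqr. Qed.

Lemma Re_cn z : `|Re z| <= cn z.
Proof. by rewrite -sqrtr_sqr ler_wsqrtr// lerDl sqr_ge0. Qed.

Lemma Im_cn z : `|Im z| <= cn z.
Proof. by rewrite -sqrtr_sqr ler_wsqrtr// lerDr sqr_ge0. Qed.

Lemma cn_ReIm z : cn z <= `|Re z| + `|Im z|.
Proof.
rewrite -[leRHS]ger0_norm ?addr_ge0// -sqrtr_sqr ler_wsqrtr//.
by rewrite sqrrD !real_normK ?num_real// lerD2r lerDl mulrn_wge0// mulr_ge0.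
Qed.

Lemma cn_sum I (r : seq I) (P : pred I) (F : I -> R[i]) :
  cn (\sum_(i <- r | P i) F i) <= \sum_(i <- r | P i) cn (F i).
Proof.
elim/big_rec2 : _ => [|i y z _ h]; first by rewrite cn0.
by rewrite (le_trans (cnD _ _))// lerD2l.
Qed.

Lemma cn_le_add z w : cn z - cn w <= cn (z - w).
Proof. by rewrite lerBlDr (le_trans _ (cnD _ _))// subrK. Qed.

End ComplexModulus.

Section ComplexIntegral.
Context {R : realType}.
Local Notation mu := (@lebesgue_measure R).

Definition cmeas d (T : measurableType d) (F : T -> R[i]) :=
  measurable_fun setT (fun x => Re (F x)) /\ measurable_fun setT (fun x => Im (F x)).

Lemma cmeasM d (T : measurableType d) (F G : T -> R[i]) :
  cmeas _ _ F -> cmeas _ _ G -> cmeas _ _ (fun x => F x * G x).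
Proof.
move=> [F1 F2] [G1 G2]; split.
- rewrite (_ : (fun x => _) = fun x => Re (F x) * Re (G x) - Im (F x) * Im (G x)).
    by mfun.
  by apply: funext => x; case: (F x) (G x) => a b [].
- rewrite (_ : (fun x => _) = fun x => Re (F x) * Im (G x) + Im (F x) * Re (G x)).
    by mfun.
  by apply: funext => x; case: (F x) (G x) => a b [].
Qed.

Lemma cmeasD d (T : measurableType d) (F G : T -> R[i]) :
  cmeas _ _ F -> cmeas _ _ G -> cmeas _ _ (fun x => F x + G x).
Proof.
move=> [F1 F2] [G1 G2]; split.
- rewrite (_ : (fun x => _) = fun x => Re (F x) + Re (G x)); first by mfun.
  by apply: funext => x; case: (F x) (G x) => a b [].
- rewrite (_ : (fun x => _) = fun x => Im (F x) + Im (G x)); first by mfun.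
  by apply: funext => x; case: (F x) (G x) => a b [].
Qed.

Lemma cmeasN d (T : measurableType d) (F : T -> R[i]) :
  cmeas _ _ F -> cmeas _ _ (fun x => - F x).
Proof.
move=> [F1 F2]; split.
- rewrite (_ : (fun x => _) = fun x => - Re (F x)); first by mfun.
  by apply: funext => x; case: (F x).
- rewrite (_ : (fun x => _) = fun x => - Im (F x)); first by mfun.
  by apply: funext => x; case: (F x).
Qed.

Lemma cmeasC d (T : measurableType d) (f : T -> R) :
  measurable_fun setT f -> cmeas _ _ (fun x => (f x)%:C).
Proof. by move=> mf; split => //=; exact: measurable_cst. Qed.

Lemma cmeas_cst d (T : measurableType d) (c : R[i]) : cmeas _ T (fun=> c).
Proof. by split; exact: measurable_cst. Qed.

Lemma cmeas_cn d (T : measurableType d) (F : T -> R[i]) :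
  cmeas _ _ F -> measurable_fun setT (fun x => cn (F x)).
Proof.
move=> [F1 F2]; apply: (@measurable_comp_real _ _ _ Num.sqrt); last by mfun.
by apply: continuous_measurable_fun => x; exact: sqrt_continuous.
Qed.

Definition cL1 (F : R -> R[i]) := L1 (fun x => Re (F x)) /\ L1 (fun x => Im (F x)).

Definition cI (F : R -> R[i]) : R[i] :=
  (\int[mu]_x Re (F x)) +i* (\int[mu]_x Im (F x)).

Lemma cL1_le (F : R -> R[i]) (g : R -> R) : cmeas _ _ F -> L1 g ->
  (forall x, cn (F x) <= g x) -> cL1 F.
Proof.
move=> [m1 m2] g1 Fg; split; apply: (L1_le _ g) => // x.
- exact: le_trans (Re_cn _) (Fg x).
- exact: le_trans (Im_cn _) (Fg x).
Qed.

Lemma cL1_cmeas F : cL1 F -> cmeas _ _ F.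
Proof. by case=> ? ?; split; exact: L1_meas. Qed.

Lemma cL1_cn F : cL1 F -> L1 (fun x => cn (F x)).
Proof.
move=> [h1 h2]; apply: (L1_le _ (fun x => `|Re (F x)| + `|Im (F x)|)).
- by apply: cmeas_cn; exact: cL1_cmeas.
- by move=> x; rewrite ger0_norm ?cn_ge0 ?cn_ReIm.
- by apply: L1D; exact: L1_norm.
Qed.

Lemma cL1Z (c : R[i]) F : cL1 F -> cL1 (fun x => c * F x).
Proof.
move=> F1; apply: (cL1_le _ (fun x => cn c * cn (F x))).
- by apply: cmeasM; [exact: cmeas_cst|exact: cL1_cmeas].
- by apply: L1Z; exact: cL1_cn.
- by move=> x; rewrite cnM.
Qed.

Lemma cL1D F G : cL1 F -> cL1 G -> cL1 (fun x => F x + G x).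
Proof.
move=> F1 G1; apply: (cL1_le _ (fun x => cn (F x) + cn (G x))).
- by apply: cmeasD; exact: cL1_cmeas.
- by apply: L1D; exact: cL1_cn.
- by move=> x; exact: cnD.
Qed.

Lemma eq_cI F G : F =1 G -> cI F = cI G.
Proof. by move=> /funext ->. Qed.

Lemma cID F G : cL1 F -> cL1 G -> cI (fun x => F x + G x) = cI F + cI G.
Proof.
move=> [F1 F2] [G1 G2]; rewrite /cI; apply/eqP; rewrite eq_complex/= -!ItgD//.
apply/andP; split; apply/eqP; apply: eq_Itg => x; by case: (F x) (G x) => a b [].
Qed.

Lemma cIZ (c : R[i]) F : cL1 F -> cI (fun x => c * F x) = c * cI F.
Proof.
case: c => a b [F1 F2]; rewrite /cI; apply/eqP; rewrite eq_complex/= -!ItgZ//.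
rewrite -ItgB ?L1Z// -ItgD ?L1Z//.
by apply/andP; split; apply/eqP; apply: eq_Itg => x; case: (F x).
Qed.

Lemma cIN F : cL1 F -> cI (fun x => - F x) = - cI F.
Proof.
move=> F1; rewrite -mulN1r -cIZ//.
by apply: eq_cI => x; rewrite mulN1r.
Qed.

Lemma cL1N F : cL1 F -> cL1 (fun x => - F x).
Proof. by move=> [? ?]; split; rewrite /=; [apply: (eq_L1 (fun x => - Re (F x)))|apply: (eq_L1 (fun x => - Im (F x)))]; try exact: L1N; move=> x; case: (F x). Qed.

Lemma cIB F G : cL1 F -> cL1 G -> cI (fun x => F x - G x) = cI F - cI G.
Proof. by move=> F1 G1; rewrite cID ?cIN//; exact: cL1N. Qed.

(** Rotating by the unit number [u] that makes [cI F] real and nonnegative turns the modulus into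
    the integral of [Re (u F)], which is at most [g] pointwise. *)
Lemma cI_cn F (g : R -> R) : cmeas _ _ F -> L1 g -> (forall x, cn (F x) <= g x) ->
  cn (cI F) <= \int[mu]_x g x.
Proof.
move=> mF g1 Fg; have F1 := cL1_le _ _ mF g1 Fg.
have [I0|I0] := eqVneq (cI F) 0.
  by rewrite I0 cn0; apply: Itg_ge0 => x; exact: le_trans (cn_ge0 _) (Fg x).
pose u := (cI F)^* / (cn (cI F))%:C.
have cu : cn u = 1.
  rewrite cnM cnV cnC ger0_norm ?cn_ge0// (_ : cn _ = cn (cI F)).
    by rewrite divff// cn_eq0.
  by rewrite /cn; case: (cI F) => a b /=; rewrite sqrrN.
have uE : u * cI F = (cn (cI F))%:C.
  rewrite /u mulrAC -[X in X / _]mulrC -sqr_normc cnE expr2 mulfK//.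
  by rewrite -cnE normr_eq0.
rewrite -lecR -uE -cIZ// /cI.
have /Itg_le : L1 (fun x => Re (u * F x)) by case: (cL1Z u _ F1).
move=> /(_ _ g1) H.
have : \int[mu]_x Re (u * F x) <= \int[mu]_x g x.
  apply: H => x; apply: le_trans (ler_norm _) _; apply: le_trans (Re_cn _) _.
  by rewrite cnM cu mul1r.
have -> : \int[mu]_x Re (u * F x) = Re (u * cI F) by rewrite -cIZ.
have -> : \int[mu]_x Im (u * F x) = Im (u * cI F) by rewrite -cIZ.
by rewrite uE/= => h; rewrite lecR.
Qed.

Lemma measurable_comp_pair1 (p : R -> R -> R) (x : R) :
  measurable_fun setT (fun z : R * R => p z.1 z.2) -> measurable_fun setT (p x).
Proof.
move=> mp; apply: (@measurableT_comp _ _ _ _ _ _ (fun z : R * R => p z.1 z.2) setT (fun y => (x, y)) mp).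
exact: pair1_measurable.
Qed.

Lemma cI_Fubini (F : R -> R -> R[i]) (g : R -> R -> R) :
  cmeas _ _ (fun z : R * R => F z.1 z.2) ->
  measurable_fun setT (fun z : R * R => g z.1 z.2) ->
  (forall x y, cn (F x y) <= g x y) ->
  (\int[mu]_x \int[mu]_y (g x y)%:E < +oo)%E ->
  [/\ cL1 (fun x => cI (F x)), cL1 (fun y => cI (F ^~ y)) &
   cI (fun x => cI (F x)) = cI (fun y => cI (F ^~ y))].
Proof.
move=> [m1 m2] mg Fg goo.
have fin (p : R -> R -> R) : measurable_fun setT (fun z : R * R => p z.1 z.2) ->
    (forall x y, `|p x y| <= cn (F x y)) -> (\int[mu]_x \int[mu]_y `|p x y|%:E < +oo)%E.
  move=> mp pF; apply: le_lt_trans goo; apply: ge0_le_integral => //.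
  - by move=> x _; apply: integral_ge0.
  - by apply: (meas_Itg_ge0 _ _ (fun x y => `|p x y|)) => //; mfun.
  - apply: (meas_Itg_ge0 _ _ g) => // x y; exact: le_trans (cn_ge0 _) (Fg x y).
  - move=> x _; apply: ge0_integral_le.
    + by have ? := measurable_comp_pair1 p x mp; mfun.
    + exact: measurable_comp_pair1.
    + by move=> y; rewrite normr_ge0/= (le_trans (pF x y)).
have [_ a1 a2 a3] := Fubini_real (fun x y => Re (F x y)) m1 (fin _ m1 (fun x y => Re_cn _)).
have [_ b1 b2 b3] := Fubini_real (fun x y => Im (F x y)) m2 (fin _ m2 (fun x y => Im_cn _)).
by split => //; rewrite /cI/= a3 b3.
Qed.

End ComplexIntegral.

Section Laplace.
Context {R : realType}.
Local Notation mu := (@lebesgue_measure R).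
Implicit Types (f g : R -> R) (xi : R[i]).

(** This is [exp(- xi y)], given by its real and imaginary parts. *)
Definition ce xi (y : R) : R[i] :=
  (expR (- Re xi * y) * cos (Im xi * y)) +i* (- (expR (- Re xi * y) * sin (Im xi * y))).

Lemma cn_ce xi y : cn (ce xi y) = expR (- Re xi * y).
Proof.
rewrite /cn/= sqrrN !exprMn -mulrDr cos2Dsin2 mulr1 sqrtr_sqr.
by rewrite ger0_norm// expR_ge0.
Qed.

Lemma ceD xi x y : ce xi (x + y) = ce xi x * ce xi y.
Proof.
rewrite /ce !mulrDr expRD cosD sinD; apply/eqP; rewrite eq_complex/=.
by apply/andP; split; apply/eqP; ring.
Qed.

Lemma ceZ xi (r y : R) : ce (r%:C * xi) y = ce xi (r * y).
Proof.
case: xi => a b; rewrite /ce/= !mul0r subr0 addr0.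
have -> : - (r * a) * y = - a * (r * y) by ring.
by have -> : r * b * y = b * (r * y) by ring.
Qed.

Lemma cmeas_ce xi : cmeas _ _ (ce xi).
Proof. by split => /=; mfun. Qed.

Lemma cmeas_comp d (T : measurableType d) (F : R -> R[i]) (g : T -> R) :
  cmeas _ _ F -> measurable_fun setT g -> cmeas _ _ (fun z => F (g z)).
Proof. by move=> [m1 m2] mg; split; [exact: (measurableT_comp m1 mg)|exact: (measurableT_comp m2 mg)]. Qed.

Definition LT (e : R) f := L1 (fun y => expR (- e * y) * f y).

Lemma LT_meas e f : LT e f -> measurable_fun setT f.
Proof.
move=> /L1_meas h.
rewrite (_ : f = fun y => expR (e * y) * (expR (- e * y) * f y)); first by mfun.
by apply: funext => y; rewrite mulrA -expRD mulNr addrN expR0 mul1r.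
Qed.

Lemma LTD e f g : LT e f -> LT e g -> LT e (fun y => f y + g y).
Proof.
by move=> h1 h2; apply: (eq_L1 _ _ _ (L1D _ _ h1 h2)) => y; rewrite mulrDr.
Qed.

Lemma LTB e f g : LT e f -> LT e g -> LT e (fun y => f y - g y).
Proof.
by move=> h1 h2; apply: (eq_L1 _ _ _ (L1B _ _ h1 h2)) => y; rewrite mulrBr.
Qed.

Lemma LTZ e (a : R) f : LT e f -> LT e (fun y => a * f y).
Proof.
by move=> h1; apply: (eq_L1 _ _ _ (L1Z a _ h1)) => y; rewrite mulrCA.
Qed.

Lemma LT_le e f g : measurable_fun setT f -> (forall y, `|f y| <= g y) -> LT e g -> LT e f.
Proof.
move=> mf fg; apply: L1_le; first by mfun.
by move=> y; rewrite normrM ger0_norm ?expR_ge0// ler_wpM2l// expR_ge0.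
Qed.

Lemma LT_norm e f : LT e f -> LT e (fun y => `|f y|).
Proof.
move=> h; apply: (eq_L1 _ _ _ (L1_norm _ h)) => y.
by rewrite normrM ger0_norm ?expR_ge0.
Qed.

Lemma L1_LT (e : R) f : 0 <= e -> (forall y, y < 0 -> f y = 0) -> L1 f -> LT e f.
Proof.
move=> e0 f0 f1; apply: (L1_le _ (fun y => `|f y|)); last exact: L1_norm.
  by have := L1_meas _ f1; move=> ?; mfun.
move=> y; have [y0|y0] := ltP y 0; first by rewrite f0// mulr0.
rewrite normrM ger0_norm ?expR_ge0// ler_piMl// expR_le1 mulNr oppr_le0.
exact: mulr_ge0.
Qed.

Definition lap f xi : R[i] := cI (fun y => (f y)%:C * ce xi y).

Lemma lap_cL1 f xi : LT (Re xi) f -> cL1 (fun y => (f y)%:C * ce xi y).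
Proof.
move=> h; apply: (cL1_le _ _ _ (L1_norm _ h)).
  by apply: cmeasM; [exact: cmeasC (LT_meas _ _ h)|exact: cmeas_ce].
by move=> y; rewrite cnM cnC cn_ce normrM [X in _ <= X * _]ger0_norm ?expR_ge0// mulrC.
Qed.

Lemma cn_lap f g xi : LT (Re xi) g -> measurable_fun setT f -> (forall y, `|f y| <= g y) ->
  cn (lap f xi) <= \int[mu]_y (expR (- Re xi * y) * g y).
Proof.
move=> h mf fg; apply: cI_cn => //.
  by apply: cmeasM; [exact: cmeasC|exact: cmeas_ce].
by move=> y; rewrite cnM cnC cn_ce mulrC ler_wpM2l ?expR_ge0.
Qed.

Lemma eq_lap f g xi : f =1 g -> lap f xi = lap g xi.
Proof. by move=> /funext ->. Qed.

Lemma lapD f g xi : LT (Re xi) f -> LT (Re xi) g ->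
  lap (fun y => f y + g y) xi = lap f xi + lap g xi.
Proof.
move=> h1 h2; rewrite -cID; [|exact: lap_cL1..].
by apply: eq_cI => y; rewrite rmorphD mulrDl.
Qed.

Lemma lapZ (a : R) f xi : LT (Re xi) f -> lap (fun y => a * f y) xi = a%:C * lap f xi.
Proof.
move=> h1; rewrite -cIZ; last exact: lap_cL1.
by apply: eq_cI => y; rewrite rmorphM mulrA.
Qed.

Lemma lapB f g xi : LT (Re xi) f -> LT (Re xi) g ->
  lap (fun y => f y - g y) xi = lap f xi - lap g xi.
Proof.
move=> h1 h2; rewrite -cIB; [|exact: lap_cL1..].
by apply: eq_cI => y; rewrite rmorphB mulrBl.
Qed.

Lemma ae_eq_lap f g xi : measurable_fun setT f -> measurable_fun setT g ->
  {ae mu, forall y, f y = g y} -> lap f xi = lap g xi.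
Proof.
move=> mf mg fg; have [mc1 mc2] := cmeas_ce xi; rewrite /lap/cI.
congr (_ +i* _); apply: ae_eq_Itg.
- by case: (cmeasM _ _ _ _ (cmeasC _ _ _ mf) (cmeas_ce xi)).
- by case: (cmeasM _ _ _ _ (cmeasC _ _ _ mg) (cmeas_ce xi)).
- by apply: aeS fg => y ->.
- by case: (cmeasM _ _ _ _ (cmeasC _ _ _ mf) (cmeas_ce xi)).
- by case: (cmeasM _ _ _ _ (cmeasC _ _ _ mg) (cmeas_ce xi)).
- by apply: aeS fg => y ->.
Qed.

Lemma measurable_convolution f g : measurable_fun setT f -> measurable_fun setT g ->
  measurable_fun setT (convolution f g).
Proof.
move=> mf mg.
have m : measurable_fun setT (fun z : R * R => f (z.1 - z.2) * g z.2) by mfun.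
exact: (meas_Itg _ _ (fun x y : R => f (x - y) * g y) m).
Qed.

(** The weight [e^(- e x)] splits as [e^(- e (x - y)) e^(- e y)], so [K] is a product of two
    integrable functions after a shear. It is then absolutely integrable on the plane, and both
    orders of integration are available. *)
Lemma lap_convolution f g xi : LT (Re xi) f -> LT (Re xi) g ->
  LT (Re xi) (convolution f g) /\ lap (convolution f g) xi = lap f xi * lap g xi.
Proof.
move=> hf hg; set e := Re xi in hf hg *.
have mf := LT_meas _ _ hf; have mg := LT_meas _ _ hg.
pose wf y := expR (- e * y) * f y; pose wg y := expR (- e * y) * g y.
have [mwf mwg] : measurable_fun setT wf /\ measurable_fun setT wg by split; exact: L1_meas.
pose K x y := wf (x - y) * wg y.
have mK : measurable_fun setT (fun z : R * R => K z.1 z.2) by rewrite /K; mfun.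
have KE x y : K x y = expR (- e * x) * (f (x - y) * g y).
  rewrite /K /wf /wg mulrACA -expRD; congr (expR _ * _); ring.
have Kfin : (\int[mu]_x \int[mu]_y `|K x y|%:E < +oo)%E.
  rewrite (Tonelli (fun x y => `|K x y|))//; last by mfun.
  rewrite (_ : (\int[mu]_y _)%E =
      (\int[mu]_y ((\int[mu]_x `|wf x|)%:E * `|wg y|%:E))%E); last first.
    apply: eq_integral => y _.
    have [l E] := L1_shift (- y) _ (L1_norm _ hf).
    rewrite -E EFin_Itg// -ge0_integralZr//.
    - by apply: eq_integral => x _; rewrite -EFinM -normrM.
    - by apply/measurable_EFinP; mfun.
  rewrite -(_ : (\int[mu]_y ((\int[mu]_x `|wf x|) * `|wg y|))%:E =
     (\int[mu]_y ((\int[mu]_x `|wf x|)%:E * `|wg y|%:E))%E) ?ltry//.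
  by rewrite EFin_Itg//; apply: L1Z; exact: L1_norm.
have [a1 a2 _ _] := Fubini_real K mK Kfin.
(* The convolution takes a default value where its integral diverges, so this identity is claimed
   only at the points given by Fubini. *)
have convE : {ae mu, forall x, \int[mu]_y K x y = expR (- e * x) * convolution f g x}.
  apply: aeS a1 => x h; rewrite /convolution -ItgZ.
    by apply: eq_Itg => y; rewrite KE.
  apply: (eq_L1 _ _ _ (L1Z (expR (e * x)) _ h)) => y.
  by rewrite KE mulrA -expRD mulNr addrN expR0 mul1r.
have mconv : measurable_fun setT (convolution f g) by exact: measurable_convolution.
split; first by apply: (ae_eq_L1 _ _ _ convE a2); mfun.
(* The unimodular factor of [ce xi]; its modulus is already contained in [K]. *)
pose e0 x := ce (0 +i* Im xi) x.
have ceE x : ce xi x = (expR (- e * x))%:C * e0 x.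
  rewrite /ce /e0 /ce/=; apply/eqP; rewrite eq_complex/= oppr0 mul0r expR0 !mul1r.
  by rewrite !mul0r subr0 addr0 mulrN !eqxx.
have cn_e0 x : cn (e0 x) = 1 by rewrite /e0 cn_ce/= oppr0 mul0r expR0.
have m0 : cmeas _ _ e0 by exact: cmeas_ce.
have [_ _ FE] : [/\ cL1 (fun x => cI (fun y => (K x y)%:C * e0 x)),
   cL1 (fun y => cI (fun x => (K x y)%:C * e0 x)) &
   cI (fun x => cI (fun y => (K x y)%:C * e0 x)) =
   cI (fun y => cI (fun x => (K x y)%:C * e0 x)) ].
  apply: (cI_Fubini (fun x y => (K x y)%:C * e0 x) (fun x y => `|K x y|)) => //.
  - apply: cmeasM; first exact: (cmeasC _ _ _ mK).
    exact: (cmeas_comp _ _ _ _ m0 (@measurable_fst _ _ _ _)).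
  - by mfun.
  - by move=> x y; rewrite cnM cnC cn_e0 mulr1.
transitivity (cI (fun x => cI (fun y => (K x y)%:C * e0 x))).
  have mF : cmeas _ _ (fun x => (convolution f g x)%:C * ce xi x).
    by apply: cmeasM; [exact: cmeasC|exact: cmeas_ce].
  have mG : cmeas _ _ (fun x => (\int[mu]_y K x y)%:C * e0 x).
    apply: cmeasM; [apply: cmeasC; exact: L1_meas _ a2|exact: m0].
  have GE : {ae mu, forall x, (\int[mu]_y K x y)%:C * e0 x = cI (fun y => (K x y)%:C * e0 x)}.
    apply: aeS a1 => x h.
    transitivity (cI (fun y => e0 x * (K x y)%:C)); last by apply: eq_cI => y; rewrite mulrC.
    have cK : cL1 (fun y => (K x y)%:C) by split; [exact: h|exact: L1_0].
    rewrite (cIZ _ _ cK) mulrC; congr (_ * _); rewrite /cI/=; congr (_ +i* _).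
    by rewrite /Rintegral integral0.
  have FG : {ae mu, forall x, (convolution f g x)%:C * ce xi x = cI (fun y => (K x y)%:C * e0 x)}.
    by apply: aeS2 convE GE => x h <-; rewrite h ceE rmorphM mulrA -(mulrC (expR _)%:C).
  have mH : cmeas _ _ (fun x => cI (fun y => (K x y)%:C * e0 x)).
    have mKe : cmeas _ _ (fun z : R * R => (K z.1 z.2)%:C * e0 z.1).
      apply: cmeasM; first exact: (cmeasC _ _ _ mK).
      exact: (cmeas_comp _ _ _ _ m0 (@measurable_fst _ _ _ _)).
    case: mKe => k1 k2; split => /=.
    - exact: (meas_Itg _ _ (fun x y => Re ((K x y)%:C * e0 x)) k1).
    - exact: (meas_Itg _ _ (fun x y => Im ((K x y)%:C * e0 x)) k2).
  case: mF => mF1 mF2; case: mH => mH1 mH2.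
  have E1 : {ae mu, forall x, Re ((convolution f g x)%:C * ce xi x) = Re (cI (fun y => (K x y)%:C * e0 x))}.
    by apply: aeS FG => x ->.
  have E2 : {ae mu, forall x, Im ((convolution f g x)%:C * ce xi x) = Im (cI (fun y => (K x y)%:C * e0 x))}.
    by apply: aeS FG => x ->.
  rewrite /lap /cI (ae_eq_Itg _ _ mF1 mH1 E1) (ae_eq_Itg _ _ mF2 mH2 E2).
  reflexivity.
rewrite FE.
have cf : cL1 (fun x => (wf x)%:C * e0 x).
  have := lap_cL1 _ _ hf; congr cL1; apply: funext => x.
  by rewrite ceE rmorphM mulrCA mulrA.
have cg : cL1 (fun x => (wg x)%:C * e0 x).
  have := lap_cL1 _ _ hg; congr cL1; apply: funext => x.
  by rewrite ceE rmorphM mulrCA mulrA.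
have lapfE : lap f xi = cI (fun x => (wf x)%:C * e0 x).
  by apply: eq_cI => x; rewrite ceE rmorphM mulrCA mulrA.
have lapgE : lap g xi = cI (fun x => (wg x)%:C * e0 x).
  by apply: eq_cI => x; rewrite ceE rmorphM mulrCA mulrA.
rewrite lapgE -(cIZ _ _ cg); apply: eq_cI => y.
have [c1 c2] := cf.
have [l1 q1] := L1_shift (- y) _ c1.
have [l2 q2] := L1_shift (- y) _ c2.
have cfs : cL1 (fun x => (wf (x - y))%:C * e0 (x - y)) := conj l1 l2.
have lapfs : cI (fun x => (wf (x - y))%:C * e0 (x - y)) = lap f xi.
  by rewrite lapfE; exact: f_equal2 q1 q2.
rewrite -lapfs mulrC -(cIZ _ _ cfs).
apply: eq_cI => x; rewrite /K -/(e0 _).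
have -> : e0 x = e0 (x - y) * e0 y by rewrite /e0 -ceD subrK.
rewrite rmorphM/=; move: (e0 _) (e0 _) (wf _)%:C (wg _)%:C => a b c d'.
by ring.
Qed.

End Laplace.

(** * Differentiation of transforms along rays *)

Section LaplaceDerivative.
Context {R : realType}.
Local Notation mu := (@lebesgue_measure R).
Implicit Types (f g : R -> R) (xi : R[i]).

Definition causal f := forall y, y < 0 -> f y = 0.
Definition LTall f := forall e, 0 < e -> LT e f.

Lemma id_le_expR (a y : R) : 0 < a -> y <= a^-1 * expR (a * y).
Proof.
move=> a0; rewrite ler_pdivlMl//.
by rewrite (le_trans _ (expR_ge1Dx _))// lerDr.
Qed.

(** Half of the exponential absorbs the factor [y], since [y <= (2 / e) e^(e y / 2)]. *)
Lemma LTall_id f : causal f -> LTall f -> LTall (fun y => y * f y).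
Proof.
move=> cf hf e e0; have e20 : 0 < e / 2 by rewrite divr_gt0.
have h := hf _ e20; have mf := LT_meas _ _ h.
apply: (L1_le _ (fun y => (e / 2)^-1 * `|expR (- (e / 2) * y) * f y|)).
- by mfun.
- move=> y; have [y0|y0] := ltP y 0; first by rewrite cf// !mulr0 normr0 mulr0.
  rewrite !normrM !(ger0_norm (expR_ge0 _)) (ger0_norm y0) !mulrA ler_wpM2r//.
  apply: le_trans (ler_wpM2l (expR_ge0 (- e * y)) (id_le_expR _ y e20)) _.
  by rewrite mulrCA -expRD (_ : - e * y + e / 2 * y = - (e / 2) * y)//; field.
- by apply: L1Z; exact: L1_norm.
Qed.

Lemma lap_causal_eq f xi (r : R) :
  lap f (r%:C * xi) = (\int[mu]_y (f y * (expR (- Re xi * (r * y)) * cos (Im xi * (r * y)))))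
   +i* (\int[mu]_y (f y * - (expR (- Re xi * (r * y)) * sin (Im xi * (r * y))))).
Proof.
rewrite /lap /cI; congr (_ +i* _); apply: eq_Itg => y; rewrite ceZ/= !mul0r ?subr0 ?addr0//.
Qed.

Lemma is_derive_expcos (a b y r : R) :
  is_derive r 1 (fun r => expR (- a * (r * y)) * cos (b * (r * y)))
   (- y * (expR (- a * (r * y)) * (a * cos (b * (r * y)) + b * sin (b * (r * y))))).
Proof.
apply: is_derive_eq; rewrite /GRing.scale/=; ring.
Qed.

Lemma is_derive_expsin (a b y r : R) :
  is_derive r 1 (fun r => - (expR (- a * (r * y)) * sin (b * (r * y))))
   (- y * (expR (- a * (r * y)) * (b * cos (b * (r * y)) - a * sin (b * (r * y))))).
Proof.
apply: is_derive_eq; rewrite /GRing.scale/=; ring.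
Qed.

Lemma normr_cos_le (x : R) : `|cos x| <= 1.
Proof. by rewrite ler_norml cos_le1 cos_geN1. Qed.

Lemma normr_sin_le (x : R) : `|sin x| <= 1.
Proof. by rewrite ler_norml sin_le1 sin_geN1. Qed.

(** For parameters in []r/2, 2 r[] the exponential is at most [e^(- a (r/2) y)]. Half of that
    exponent absorbs the factor [y] coming from the derivative; what remains, with exponent
    [a (r/4)], is the integrable majorant [G]. *)
Lemma is_derive_under (a b : R) (h dh : R -> R -> R) f (r : R) :
  causal f -> LTall f -> 0 < a -> 0 < r ->
  measurable_fun setT (fun z : R * R => h z.1 z.2) ->
  (forall r y : R, is_derive r 1 (h ^~ y) (dh r y)) ->
  (forall r y : R, 0 <= r -> 0 <= y -> `|h r y| <= expR (- a * (r * y))) ->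
  (forall r y : R, 0 <= r -> 0 <= y -> `|dh r y| <= y * (expR (- a * (r * y)) * b)) ->
  is_derive r 1 (fun r => \int[mu]_y (f y * h r y)) (\int[mu]_y (f y * dh r y)).
Proof.
move=> cf hf a0 r0 mh dhE hb dhb.
have mf := LT_meas _ _ (hf _ a0).
have ar0 : 0 < a * (r / 4) by rewrite mulr_gt0// divr_gt0.
pose G y := (a * (r / 4))^-1 * `|b| * `|expR (- (a * (r / 4)) * y) * f y|.
have Ir : `]r / 2, 2 * r[%classic r by rewrite /= in_itv/=; apply/andP; split; lra.
have intf x : `]r / 2, 2 * r[%classic x -> mu.-integrable setT (EFin \o (fun y => f y * h x y)).
  rewrite /= in_itv/= => /andP[x1 x2].
  apply: (L1_le _ (fun y => `|expR (- (a * (r / 2)) * y) * f y|)).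
  - by have := measurable_comp_pair1 h x mh; move=> ?; mfun.
  - move=> y; have [y0|y0] := ltP y 0; first by rewrite cf// mul0r mulr0 normr0.
    rewrite !normrM mulrC ler_wpM2r// (ger0_norm (expR_ge0 _)).
    apply: le_trans (hb _ _ _ _) _ => //; first by lra.
    by rewrite ler_expR mulNr mulNr lerN2 -mulrA ler_pM2l// ler_wpM2r//; lra.
  - by apply: L1_norm; apply: hf; rewrite mulr_gt0// divr_gt0.
have der x y : `]r / 2, 2 * r[%classic x -> setT y -> derivable ((fun x y => f y * h x y) ^~ y) x 1.
  move=> _ _; apply: derivableM; first exact: derivable_cst.
  exact: (@ex_derive _ _ _ _ _ _ _ (dhE x y)).
have dE x y : partial1of2 (fun x y => f y * h x y) x y = f y * dh x y.
  have H := dhE x y.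
  have H2 : is_derive x 1 (fun x => f y * h x y) (f y * dh x y).
    by apply: is_derive_eq; rewrite /GRing.scale/=; ring.
  by rewrite /partial1of2 derive1E (@derive_val _ _ _ _ _ _ _ H2).
have G0 y : 0 <= G y by rewrite /G !mulr_ge0// invr_ge0 ltW.
have iG : mu.-integrable setT (EFin \o G) by apply: L1Z; apply: L1_norm; exact: hf.
have Gub x y : `]r / 2, 2 * r[%classic x -> setT y ->
    `|partial1of2 (fun x y => f y * h x y) x y| <= G y.
  rewrite /= in_itv/= => /andP[x1 x2] _; rewrite dE /G.
  have [y0|y0] := ltP y 0; first by rewrite cf// mul0r !mulr0 normr0 mulr0.
  rewrite !normrM [X in _ <= X]mulrA [X in X <= _]mulrC ler_wpM2r// (ger0_norm (expR_ge0 _)).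
  apply: le_trans (dhb _ _ _ _) _ => //; first by lra.
  have -> : (a * (r / 4))^-1 * `|b| * expR (- (a * (r / 4)) * y) =
    ((a * (r / 4))^-1 * expR (- (a * (r / 4)) * y)) * `|b| by ring.
  rewrite mulrA (le_trans (ler_wpM2l _ (ler_norm b)))//.
    by rewrite mulr_ge0// expR_ge0.
  rewrite ler_wpM2r//.
  have H := id_le_expR _ y ar0.
  apply: le_trans (ler_wpM2r _ H) _; first exact: expR_ge0.
  rewrite -[X in X <= _]mulrA ler_pM2l ?invr_gt0// -expRD ler_expR.
  rewrite (_ : _ + _ = - (a * y) * (x - r / 4)); last by ring.
  rewrite (_ : - _ * y = - (a * y) * (r / 4)); last by ring.
  by apply: ler_wnM2l; [rewrite oppr_le0 mulr_ge0// ltW|lra].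
have D1 := derivable_under_integral measurableT Ir intf der G0 iG Gub.
have D2 := differentiation_under_integral measurableT Ir intf der G0 iG Gub.
apply: DeriveDef; first exact: D1.
rewrite -derive1E D2; apply: eq_Itg => y; exact: dE.
Qed.

(** Differentiating [e^(- r xi y)] in the real variable [r] brings down [- xi y]. This is how the
    first moment [y f] enters, and it is used on real and imaginary parts separately. *)
Lemma is_derive_lap f xi (r : R) : causal f -> LTall f -> 0 < Re xi -> 0 < r ->
  is_derive r 1 (fun r => Re (lap f (r%:C * xi)))
    (Re (- (xi * lap (fun y => y * f y) (r%:C * xi)))) /\
  is_derive r 1 (fun r => Im (lap f (r%:C * xi)))
    (Im (- (xi * lap (fun y => y * f y) (r%:C * xi)))).
Proof.
move=> cf hf xi0 r0; case: xi xi0 => a b a0; have {}a0 : 0 < a := a0.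
have l1 : cL1 (fun y => (y * f y)%:C * ce (r%:C * (a +i* b)) y).
  apply: lap_cL1; rewrite /= mul0r subr0; apply: LTall_id => //; exact: mulr_gt0.
have E : - ((a +i* b) * lap (fun y => y * f y) (r%:C * (a +i* b))) =
   (\int[mu]_y (f y * (- y * (expR (- a * (r * y)) * (a * cos (b * (r * y)) + b * sin (b * (r * y)))))))
   +i* (\int[mu]_y (f y * (- y * (expR (- a * (r * y)) * (b * cos (b * (r * y)) - a * sin (b * (r * y))))))).
  rewrite -mulNr -cIZ// /cI; congr (_ +i* _); apply: eq_Itg => y; rewrite ceZ/=; ring.
rewrite E [Re (_ +i* _)]/= [Im (_ +i* _)]/=.
have bnd (s : R) (r' y : R) : `|s| <= 1 -> `|expR (- a * (r' * y)) * s| <= expR (- a * (r' * y)).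
  by move=> s1; rewrite normrM (ger0_norm (expR_ge0 _)) ler_piMr// expR_ge0.
split.
- rewrite (_ : (fun r => _) = fun r : R => \int[mu]_y (f y * (expR (- a * (r * y)) * cos (b * (r * y))))); last first.
    by apply: funext => s; rewrite lap_causal_eq.
  apply: (is_derive_under a (a + `|b|)
    (fun r y => expR (- a * (r * y)) * cos (b * (r * y)))
    (fun r y => - y * (expR (- a * (r * y)) * (a * cos (b * (r * y)) + b * sin (b * (r * y)))))) => //.
  + by mfun.
  + by move=> s y; exact: is_derive_expcos.
  + by move=> s y _ _; apply: bnd; exact: normr_cos_le.
  + move=> s y s0 y0; rewrite normrM normrN (ger0_norm y0) ler_wpM2l// normrM.
    rewrite (ger0_norm (expR_ge0 _)) ler_wpM2l ?expR_ge0// (le_trans (ler_normD _ _))//.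
    rewrite !normrM (gtr0_norm a0) lerD// ?ler_piMr ?normr_cos_le ?normr_sin_le//.
    exact: ltW.
- rewrite (_ : (fun r => _) = fun r : R => \int[mu]_y (f y * - (expR (- a * (r * y)) * sin (b * (r * y))))); last first.
    by apply: funext => s; rewrite lap_causal_eq.
  apply: (is_derive_under a (`|b| + a)
    (fun r y => - (expR (- a * (r * y)) * sin (b * (r * y))))
    (fun r y => - y * (expR (- a * (r * y)) * (b * cos (b * (r * y)) - a * sin (b * (r * y)))))) => //.
  + by mfun.
  + by move=> s y; exact: is_derive_expsin.
  + by move=> s y _ _; rewrite normrN; apply: bnd; exact: normr_sin_le.
  + move=> s y s0 y0; rewrite normrM normrN (ger0_norm y0) ler_wpM2l// normrM.
    rewrite (ger0_norm (expR_ge0 _)) ler_wpM2l ?expR_ge0// (le_trans (ler_normB _ _))//.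
    rewrite !normrM (gtr0_norm a0) lerD// ?ler_piMr ?normr_cos_le ?normr_sin_le//.
    exact: ltW.
Qed.

End LaplaceDerivative.

(** * Plancherel formula *)

Section LimitTheorems.
Context {R : realType}.
Local Notation mu := (@lebesgue_measure R).

Lemma Fatou_bound (F_ : nat -> R -> R) (F : R -> R) (M : \bar R) :
  (forall n, measurable_fun setT (F_ n)) -> measurable_fun setT F ->
  (forall n x, 0 <= F_ n x) ->
  {ae mu, forall x, F_ n x @[n --> \oo] --> F x} ->
  (forall n, \int[mu]_x (F_ n x)%:E <= M)%E -> (\int[mu]_x (F x)%:E <= M)%E.
Proof.
move=> mF_ mF F0 FF FM.
have meF n : measurable_fun setT (fun x => (F_ n x)%:E) by exact/measurable_EFinP.
have H := @fatou _ _ _ mu setT measurableT (fun n x => (F_ n x)%:E)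
  meF (fun n x _ => F0 n x).
have mlim : measurable_fun setT (fun x => limn_einf (fun n => (F_ n x)%:E)).
  rewrite (_ : (fun x => _) = fun x => - limn_esup (fun n => - (F_ n x)%:E))%E.
    apply: measurableT_comp => //.
    apply: (measurable_fun_limn_esup (f := fun n x => - (F_ n x)%:E)%E) => n.
    exact: measurableT_comp.
  apply: funext => x; rewrite -limn_einfN; congr limn_einf.
  by apply: funext => n; rewrite /= opprK.
apply: le_trans (le_trans _ H) _.
  rewrite le_eqVlt; apply/orP; left; apply/eqP.
  apply: ae_eq_integral => //; first exact/measurable_EFinP.
  apply: aeS FF => x Fx _; apply/esym.
  have : (F_ n x)%:E @[n --> \oo] --> (F x)%:E by apply: cvg_EFin => //; exact: nearW.
  by move=> /cvg_limn_einf_sup[].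
rewrite limn_einf_lim; apply: lime_le; first exact: is_cvg_einfs.
apply: nearW => n; apply: le_trans (FM n).
by apply: ereal_inf_lbound => /=; exists n => //=.
Qed.

Lemma dct (F_ : nat -> R -> R) (F g : R -> R) :
  (forall n, measurable_fun setT (F_ n)) -> measurable_fun setT F -> L1 g ->
  (forall n x, `|F_ n x| <= g x) ->
  {ae mu, forall x, F_ n x @[n --> \oo] --> F x} ->
  L1 F /\ \int[mu]_x F_ n x @[n --> \oo] --> \int[mu]_x F x.
Proof.
move=> mF_ mF g1 Fg FF.
have [|||||iF _ cv] := @dominated_convergence _ _ _ mu setT measurableT
  (fun n x => (F_ n x)%:E) (fun x => (F x)%:E) (EFin \o g).
- by move=> n; apply/measurable_EFinP; exact: mF_.
- by apply/measurable_EFinP; exact: mF.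
- by apply: aeS FF => x h _; apply: cvg_EFin => //; exact: nearW.
- exact: g1.
- by apply: aeW => x n _; rewrite lee_fin.
split; first exact: iF.
have L_ n : L1 (F_ n) by exact: (L1_le _ g).
apply: fine_cvg; rewrite fineK; last exact: integrable_fin_num.
exact: cv.
Qed.

End LimitTheorems.

(** * The Poisson kernel as a cosine transform *)

Section PoissonKernel.
Context {R : realType}.
Local Notation mu := (@lebesgue_measure R).

Lemma L1_halfline (a : R) (f : R -> R) (M : R) : measurable_fun setT f ->
  (forall x, a <= x -> 0 <= f x) -> (\int[mu]_(x in `[a, +oo[) (f x)%:E = M%:E)%E ->
  L1 (fun x => if a <= x then f x else 0) /\
  \int[mu]_x (if a <= x then f x else 0) = M.
Proof.
move=> mf f0 E.
have mf' : measurable_fun setT (fun x => if a <= x then f x else 0) by mfun.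
have E' : (\int[mu]_x (if a <= x then f x else 0)%:E = M%:E)%E.
  rewrite -E [RHS]integral_mkcond; apply: eq_integral => x _; rewrite patchE.
  case: ifPn => h; first by rewrite mem_set//= in_itv/= andbT.
  by rewrite memNset//= in_itv/= andbT; exact/negP.
have l1 : L1 (fun x => if a <= x then f x else 0).
  apply: (ge0_L1 _ M mf' _ _).1; last by rewrite E'.
  by move=> x; case: ifPn => // /f0.
by split => //; apply: EFin_inj; rewrite EFin_Itg.
Qed.

Lemma derivable_cont (f : R -> R) (x : R) : derivable f x 1 -> {for x, continuous f}.
Proof. by move=> /derivable1_diffP/differentiable_continuous. Qed.

Lemma cvg_expR_oo (l : R) : 0 < l -> expR (- l * x) @[x --> +oo] --> 0.
Proof.
move=> l0.
have -> : (fun x : R => expR (- l * x)) = (fun x => expR (- x)) \o (fun x => x * l).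
  by apply: funext => x /=; rewrite mulNr mulrC.
by apply: cvg_comp; [apply: gt0_cvgMly => //; exact: cvg_id|exact: cvgr_expR].
Qed.

Definition wexp (l k : R) : R := if 0 <= k then expR (- l * k) else 0.

Lemma measurable_wexp l : measurable_fun setT (wexp l).
Proof. by rewrite /wexp; mfun. Qed.

Lemma wexp_ge0 l k : 0 <= wexp l k.
Proof. by rewrite /wexp; case: ifP => // _; exact: expR_ge0. Qed.

(** The integrand contains [1 + cos] and not [cos] because the fundamental theorem on the half-line
    is applied to a nonnegative function; the term without cosine is subtracted in
    [Itg_wexp_cos]. *)
Let wexp_aux (l s : R) : 0 < l ->
  L1 (fun k => if 0 <= k then expR (- l * k) * (1 + cos (k * s)) else 0) /\
  \int[mu]_k (if 0 <= k then expR (- l * k) * (1 + cos (k * s)) else 0) =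
  l^-1 + l / (l ^+ 2 + s ^+ 2).
Proof.
move=> l0.
have ls0 : 0 < l ^+ 2 + s ^+ 2 by rewrite ltr_wpDr ?sqr_ge0// exprn_gt0.
pose F (k : R) := - (l^-1 * expR (- l * k)) + (l ^+ 2 + s ^+ 2)^-1 * (expR (- l * k) * (s * sin (k * s) - l * cos (k * s))).
have dF (k : R) : is_derive k 1 F (expR (- l * k) * (1 + cos (k * s))).
  apply: is_derive_eq; rewrite /GRing.scale/=; field.
  by rewrite !gt_eqF.
apply: L1_halfline.
- by mfun.
- by move=> x _; rewrite mulr_ge0 ?expR_ge0// -lerBlDl sub0r cos_geN1.
- rewrite (@ge0_continuous_FTC2y _ _ F 0 0).
  + rewrite /F !mulr0 mul0r expR0 sin0 cos0 -EFinB; congr EFin; field.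
    by rewrite !gt_eqF.
  + by move=> x _; rewrite mulr_ge0 ?expR_ge0// -lerBlDl sub0r cos_geN1.
  + apply: continuous_subspaceT => x.
    apply: derivable_cont; exact: ex_derive.
  + pose C := l^-1 + (l ^+ 2 + s ^+ 2)^-1 * (`|s| + l).
    have C0 : C * expR (- l * x) @[x --> +oo] --> 0.
      by rewrite -[X in _ --> X](mulr0 C); apply: cvgM; [exact: cvg_cst|exact: cvg_expR_oo].
    apply: norm_cvg0; apply: (squeeze_cvgr _ (cvg_cst 0) C0).
    apply: nearW => x; rewrite normr_ge0/= /F /C.
    apply: le_trans (ler_normD _ _) _.
    rewrite normrN !normrM !(ger0_norm (expR_ge0 _)).
    have l10 : 0 < l^-1 by rewrite invr_gt0.
    have ls10 : 0 < (l ^+ 2 + s ^+ 2)^-1 by rewrite invr_gt0.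
    rewrite (gtr0_norm l10) (gtr0_norm ls10) mulrDl lerD2l -mulrA (ler_pM2l ls10) mulrC.
    rewrite ler_wpM2r ?expR_ge0//.
    rewrite (le_trans (ler_normB _ _))// !normrM (gtr0_norm l0).
    by rewrite lerD// ler_piMr ?normr_sin_le ?normr_cos_le// ltW.
  + by move=> x _; exact: (@ex_derive _ _ _ _ _ _ _ (dF x)).
  + apply: cvg_at_right_filter; apply: derivable_cont.
    exact: (@ex_derive _ _ _ _ _ _ _ (dF 0)).
  + by move=> x _; rewrite derive1E (@derive_val _ _ _ _ _ _ _ (dF x)).
Qed.

Lemma L1_wexp l : 0 < l -> L1 (wexp l).
Proof.
move=> l0; have [h _] := wexp_aux l 0 l0.
apply: (eq_L1 _ _ _ (L1Z 2^-1 _ h)) => k; rewrite /wexp.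
by case: ifP => _; rewrite ?mulr0// cos0; field.
Qed.

Lemma Itg_wexp_cos l s : 0 < l ->
  \int[mu]_k (wexp l k * cos (k * s)) = l / (l ^+ 2 + s ^+ 2).
Proof.
move=> l0; have [h1 E1] := wexp_aux l s l0; have [h0 E0] := wexp_aux l 0 l0.
have {}E0 : \int[mu]_k wexp l k = l^-1.
  have -> : l^-1 = 2^-1 * (l^-1 + l / (l ^+ 2 + 0 ^+ 2)) by field; rewrite gt_eqF.
  rewrite -E0 -ItgZ//; apply: eq_Itg => k; rewrite /wexp.
  by case: ifP => _; rewrite ?mulr0// cos0; field.
have -> : l / (l ^+ 2 + s ^+ 2) = (l^-1 + l / (l ^+ 2 + s ^+ 2)) - l^-1 by rewrite addrAC subrr add0r.
rewrite -E1 -E0 -ItgB//; last exact: L1_wexp.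
apply: eq_Itg => k; rewrite /wexp; case: ifP => _; last by rewrite mul0r subrr.
ring.
Qed.

(** The total mass of the Poisson kernel, that is pi; it is the constant of Plancherel's formula on
    the half-line [k >= 0]. *)
Definition arctan_mass : R := \int[mu]_t (1 + t ^+ 2)^-1.

Lemma L1_arctan : L1 (fun t : R => (1 + t ^+ 2)^-1).
Proof.
have mf : measurable_fun setT (fun t : R => (1 + t ^+ 2)^-1) by mfun.
have f0 (x : R) : 0 <= (1 + x ^+ 2)^-1 by rewrite invr_ge0 addr_ge0// sqr_ge0.
apply: (ge0_L1 _ pi mf f0 _).1.
rewrite (@ge0_symfun_integralT R (fun t : R => (1 + t ^+ 2)^-1) f0); last 2 first.
- by move=> x; exact: continuous_oneDsqrV.
- by move=> x /=; rewrite sqrrN.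
have -> : (pi%:E = 2%:E * (pi / 2)%:E :> \bar R)%E by rewrite -EFinM; congr EFin; field.
rewrite lee_pmul2l// -set_itvcy.
have cv := @ge0_cvgn_integral R mu _ f0 mf.
rewrite -(cvg_lim _ cv)//.
apply: lime_le; first by apply/cvg_ex; eexists; exact: cv.
apply: nearW => n.
have l : mu.-integrable `[0, n%:R : R] (EFin \o (fun t : R => (1 + t ^+ 2)^-1)).
  apply: continuous_compact_integrable; first exact: segment_compact.
  by apply: continuous_subspaceT => x; exact: continuous_oneDsqrV.
rewrite -[leLHS]fineK; last exact: integrable_fin_num.
rewrite lee_fin [leLHS](_ : _ = atan n%:R); last exact: integral0_oneDsqr.
by rewrite ltW// atan_ltpi2.
Qed.

Lemma arctan_mass_gt0 : 0 < arctan_mass.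
Proof.
have m1 : measurable_fun setT (fun x : R => if (0 <= x) && (x <= 1) then 2^-1 else 0 : R) by mfun.
have : (2^-1%:E <= \int[mu]_x (if (0 <= x) && (x <= 1) then 2^-1 else 0 : R)%:E)%E.
  rewrite (_ : (\int[mu]_x _)%E = (\int[mu]_(x in `[0%R, 1%R]) (2^-1)%:E)%E); last first.
    rewrite [RHS]integral_mkcond; apply: eq_integral => x _; rewrite patchE.
    case: ifPn => h; first by rewrite mem_set//= in_itv.
    by rewrite memNset//= in_itv/=; exact/negP.
  rewrite (@integral_cst _ _ _ mu `[0%R, 1%R]%classic _ (2^-1)%:E)//.
  have E : mu `[0%R, 1%R]%classic = 1%E.
    by rewrite lebesgue_measure_itv/= lte_fin ltr01 -EFinB subr0.
  by rewrite [X in (_ * X)%E](E : _ = 1%E) mule1.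
move=> /le_trans/(_ (ge0_integral_le _ (fun t : R => (1 + t ^+ 2)^-1) m1 _ _)) H.
rewrite -lte_fin /arctan_mass EFin_Itg; last exact: L1_arctan.
apply: lt_le_trans (H _ _); first by rewrite lte_fin invr_gt0.
- by mfun.
- move=> x; case: ifPn => [/andP[x0 x1]|_]; last by rewrite lexx invr_ge0 addr_ge0// sqr_ge0.
  rewrite invr_ge0 ler0n/= lef_pV2 ?posrE//; last by rewrite ltr_wpDr// sqr_ge0.
  by rewrite -[leRHS](_ : 1 + 1 = 2)// lerD2l expr_le1.
Qed.

End PoissonKernel.

Section Plancherel.
Context {R : realType}.
Local Notation mu := (@lebesgue_measure R).
Implicit Types (f g : R -> R).

Definition ft2 f k := cn (lap f (0 +i* k)) ^+ 2.

Lemma ft2_ge0 f k : 0 <= ft2 f k. Proof. exact: sqr_ge0. Qed.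

Let fcos f (k : R) := \int[mu]_x (f x * cos (k * x)).
Let fsin f (k : R) := \int[mu]_x (f x * sin (k * x)).

Lemma ft2E f k : L1 f -> ft2 f k = (fcos f k) ^+ 2 + (fsin f k) ^+ 2.
Proof.
move=> f1; rewrite /ft2 cn_sq /lap /cI/= oppr0; congr (_ ^+ 2 + _).
  by apply: eq_Itg => y; rewrite mul0r expR0 mul1r mul0r subr0.
rewrite -[RHS]sqrrN -ItgN.
  by congr (_ ^+ 2); apply: eq_Itg => y; rewrite mul0r expR0 mul1r mul0r addr0 mulrN.
apply: (eq_L1 _ _ _ (L1_bndM 1 _ (fun x => sin (k * x)) _ _ f1)).
- by move=> x; rewrite mulrC.
- by mfun.
- by move=> x; exact: normr_sin_le.
Qed.

Lemma measurable_ft2 f : L1 f -> measurable_fun setT (ft2 f).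
Proof.
move=> f1; have mf := L1_meas _ f1.
rewrite (_ : ft2 f = fun k => (fcos f k) ^+ 2 + (fsin f k) ^+ 2); last first.
  by apply: funext => k; exact: ft2E.
have m1 : measurable_fun setT (fun z : R * R => f z.2 * cos (z.1 * z.2)) by mfun.
have m2 : measurable_fun setT (fun z : R * R => f z.2 * sin (z.1 * z.2)) by mfun.
have h1 : measurable_fun setT (fcos f) := meas_Itg _ _ (fun k x : R => f x * cos (k * x)) m1.
have h2 : measurable_fun setT (fsin f) := meas_Itg _ _ (fun k x : R => f x * sin (k * x)) m2.
by mfun.
Qed.

Let mulcosL1 f (k a : R) : L1 f -> L1 (fun x => f x * cos (k * x + a)).
Proof.
move=> f1; apply: (eq_L1 _ _ _ (L1_bndM 1 _ (fun x => cos (k * x + a)) _ _ f1)).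
- by move=> x; rewrite mulrC.
- by mfun.
- by move=> x; exact: normr_cos_le.
Qed.

Let mulsinL1 f (k a : R) : L1 f -> L1 (fun x => f x * sin (k * x + a)).
Proof.
move=> f1; apply: (eq_L1 _ _ _ (L1_bndM 1 _ (fun x => sin (k * x + a)) _ _ f1)).
- by move=> x; rewrite mulrC.
- by mfun.
- by move=> x; exact: normr_sin_le.
Qed.

(** The real part of [e^(i k x)] times the Fourier transform of [f] at [k]; integrating it against
    [f] gives the squared modulus of that transform. *)
Let T f (k x : R) := \int[mu]_y (f y * cos (k * (x - y))).

Let TE f k x : L1 f -> T f k x = fcos f k * cos (k * x) + fsin f k * sin (k * x).
Proof.
move=> f1; have h1 := mulcosL1 f k 0 f1; have h2 := mulsinL1 f k 0 f1.
have {}h1 : L1 (fun x => f x * cos (k * x)) by apply: (eq_L1 _ _ _ h1) => y; rewrite addr0.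
have {}h2 : L1 (fun x => f x * sin (k * x)) by apply: (eq_L1 _ _ _ h2) => y; rewrite addr0.
rewrite -(mulrC (cos _)) -(mulrC (sin _)) -!ItgZ// -ItgD; [|exact: L1Z..].
by apply: eq_Itg => y; rewrite mulrBr cosB; ring.
Qed.

Let T_le f k x : L1 f -> `|T f k x| <= \int[mu]_y `|f y|.
Proof.
move=> f1; have mf := L1_meas _ f1; apply: Itg_norm_le; [exact: L1_norm|by mfun|].
by move=> y; rewrite normrM ler_piMr// normr_cos_le.
Qed.

Let ft2T f k : L1 f -> ft2 f k = \int[mu]_x (f x * T f k x).
Proof.
move=> f1; have h1 := mulcosL1 f k 0 f1; have h2 := mulsinL1 f k 0 f1.
have {}h1 : L1 (fun x => f x * cos (k * x)) by apply: (eq_L1 _ _ _ h1) => y; rewrite addr0.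
have {}h2 : L1 (fun x => f x * sin (k * x)) by apply: (eq_L1 _ _ _ h2) => y; rewrite addr0.
rewrite ft2E// !expr2 -!ItgZ// -ItgD; [|exact: L1Z..].
by apply: eq_Itg => x; rewrite TE//; ring.
Qed.

Let measurable_T f : L1 f -> measurable_fun setT (fun z : R * R => T f z.1 z.2).
Proof.
move=> f1; have mf := L1_meas _ f1.
have m1 : measurable_fun setT (fun z : R * R * R => f z.2 * cos (z.1.1 * (z.1.2 - z.2))).
  apply: measurable_funM; first by apply: (measurableT_comp mf); exact: measurable_snd.
  apply: measurable_comp_real; first exact: measurable_cos.
  apply: measurable_funM; first exact: (measurableT_comp (@measurable_fst _ _ _ _) (@measurable_fst _ _ _ _)).
  apply: measurable_funB; last exact: measurable_snd.
  exact: (measurableT_comp (@measurable_snd _ _ _ _) (@measurable_fst _ _ _ _)).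
exact: (meas_Itg _ _ (fun (z : R * R) y => f y * cos (z.1 * (z.2 - y))) m1).
Qed.

(** Abel summation: the factor [e^(- l k)] makes the integral of [f(x) f(y) cos(k (x - y))]
    absolutely convergent. Carrying out the integration in [k] first then produces the Poisson
    kernel. *)
Lemma poisson_identity f (l : R) : 0 < l -> L1 f ->
  [/\ L1 (fun k => wexp l k * ft2 f k),
      L1 (fun x => f x * \int[mu]_y (f y * (l / (l ^+ 2 + (x - y) ^+ 2)))) &
  \int[mu]_k (wexp l k * ft2 f k) =
  \int[mu]_x (f x * \int[mu]_y (f y * (l / (l ^+ 2 + (x - y) ^+ 2))))].
Proof.
move=> l0 f1; have mf := L1_meas _ f1.
have w1 := L1_wexp l l0; have mw := measurable_wexp (R := R) l.
have mT := measurable_T f f1.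
pose M := \int[mu]_y `|f y|.
have M0 : 0 <= M by apply: Itg_ge0.
pose F k x := wexp l k * (f x * T f k x).
have mF : measurable_fun setT (fun z : R * R => F z.1 z.2) by rewrite /F; mfun.
(* Serves for both exchanges of integrals below: first in [(k, x)], then in [(k, y)] at fixed
   [x]. *)
have fin2 (G : R -> R -> R) (K : R) : measurable_fun setT (fun z : R * R => G z.1 z.2) ->
    (forall k x, `|G k x| <= wexp l k * (`|f x| * K)) ->
    (\int[mu]_k \int[mu]_x `|G k x|%:E < +oo)%E.
  move=> mG GK.
  have L (k : R) : L1 (fun x => wexp l k * (`|f x| * K)).
    by apply: L1Z; apply: (eq_L1 _ _ _ (L1Z K _ (L1_norm _ f1))) => x; rewrite mulrC.
  apply: (@le_lt_trans _ _ (\int[mu]_k (wexp l k * \int[mu]_x (`|f x| * K))%:E)%E).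
    apply: ge0_le_integral => //.
    - by move=> k _; exact: integral_ge0.
    - by apply: (meas_Itg_ge0 _ _ (fun k x => `|G k x|)) => //; mfun.
    - by mfun.
    - move=> k _; rewrite -ItgZ; last first.
        by apply: (eq_L1 _ _ _ (L1Z K _ (L1_norm _ f1))) => x; rewrite mulrC.
      rewrite EFin_Itg; last exact: L.
      apply: ge0_integral_le.
      + by have := measurable_comp_pair1 G k mG; move=> ?; mfun.
      + exact: L1_meas.
      + by move=> x; rewrite normr_ge0/=.
  rewrite -EFin_Itg ?ltry//.
  by apply: (eq_L1 _ _ _ (L1Z (\int[mu]_x (`|f x| * K)) _ w1)) => k; rewrite mulrC.
have Ffin : (\int[mu]_k \int[mu]_x `|F k x|%:E < +oo)%E.
  apply: (fin2 F M mF) => k x; rewrite /F !normrM (ger0_norm (wexp_ge0 _ _)).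
  apply: ler_wpM2l; first exact: wexp_ge0.
  by apply: ler_wpM2l; [exact: normr_ge0|exact: T_le].
have [_ a1 a2 a3] := Fubini_real F mF Ffin.
have fT1 k : L1 (fun x => f x * T f k x).
  apply: (eq_L1 _ _ _ (L1_bndM M _ (fun x => T f k x) _ _ f1)).
  - by move=> x; rewrite mulrC.
  - exact: (measurable_comp_pair1 (T f) k).
  - by move=> x; exact: T_le.
have E1 k : \int[mu]_x F k x = wexp l k * ft2 f k by rewrite (ft2T f k f1) -(ItgZ _ _ (fT1 k)).
have E2 x : \int[mu]_k F k x = f x * \int[mu]_y (f y * (l / (l ^+ 2 + (x - y) ^+ 2))).
  pose G k y := wexp l k * (f y * cos (k * (x - y))).
  have mG : measurable_fun setT (fun z : R * R => G z.1 z.2) by rewrite /G; mfun.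
  have Gfin : (\int[mu]_k \int[mu]_y `|G k y|%:E < +oo)%E.
    apply: (fin2 G 1 mG) => k y; rewrite /G !normrM (ger0_norm (wexp_ge0 _ _)).
    apply: ler_wpM2l; first exact: wexp_ge0.
    by apply: ler_wpM2l; [exact: normr_ge0|exact: normr_cos_le].
  have [_ b1 b2 b3] := Fubini_real G mG Gfin.
  have cosk k : L1 (fun y => f y * cos (k * (x - y))).
    by apply: (eq_L1 _ _ _ (mulcosL1 f (- k) (k * x) f1)) => y; congr (_ * cos _); ring.
  have E3 k : \int[mu]_y G k y = wexp l k * T f k x := ItgZ _ _ (cosk k).
  transitivity (\int[mu]_k (f x * \int[mu]_y G k y)).
    by apply: eq_Itg => k; rewrite E3 /F mulrCA.
  rewrite (ItgZ (f x) _ b1) b3; congr (_ * _); apply: eq_Itg => y.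
  rewrite -(Itg_wexp_cos l (x - y) l0) -ItgZ.
    by apply: eq_Itg => k; rewrite /G mulrCA.
  apply: (eq_L1 _ _ _ (L1_bndM 1 _ (fun k => cos (k * (x - y))) _ _ w1)).
  - by move=> k; rewrite mulrC.
  - by mfun.
  - by move=> k; exact: normr_cos_le.
split.
- by apply: (eq_L1 _ _ _ a1) => k; rewrite E1.
- by apply: (eq_L1 _ _ _ a2) => x; rewrite E2.
- transitivity (\int[mu]_k \int[mu]_x F k x); first by apply: eq_Itg => k; rewrite E1.
  by rewrite a3; apply: eq_Itg => x; rewrite E2.
Qed.

End Plancherel.

Section PlancherelUpper.
Context {R : realType}.
Local Notation mu := (@lebesgue_measure R).
Local Notation K0 := (@arctan_mass R).
Implicit Types (f g : R -> R).

Definition pk (l s : R) : R := l / (l ^+ 2 + s ^+ 2).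

Lemma measurable_pk l : measurable_fun setT (pk l).
Proof. by rewrite /pk; mfun. Qed.

Lemma pk_ge0 l s : 0 < l -> 0 <= pk l s.
Proof. by move=> l0; rewrite divr_ge0 ?addr_ge0 ?sqr_ge0// ltW. Qed.

Lemma pk_le l s : 0 < l -> `|pk l s| <= l^-1.
Proof.
move=> l0; rewrite ger0_norm ?pk_ge0// /pk ler_pdivrMr; last first.
  by rewrite ltr_wpDr ?sqr_ge0// exprn_gt0.
by rewrite expr2 mulrDr mulKf ?gt_eqF// lerDl mulr_ge0 ?sqr_ge0// invr_ge0 ltW.
Qed.

Lemma pkN l s : pk l (- s) = pk l s. Proof. by rewrite /pk sqrrN. Qed.

Lemma Itg_pk l (x : R) : 0 < l ->
  L1 (fun y => pk l (x - y)) /\ \int[mu]_y pk l (x - y) = K0.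
Proof.
move=> l0; have il0 : 0 < l^-1 by rewrite invr_gt0.
have [h E] := @L1_affine R (l^-1) (- (l^-1 * x)) _ il0 L1_arctan.
have EE y : l^-1 * (1 + (l^-1 * y + - (l^-1 * x)) ^+ 2)^-1 = pk l (x - y).
  have -> : 1 + (l^-1 * y + - (l^-1 * x)) ^+ 2 = l^-1 * l^-1 * (l ^+ 2 + (x - y) ^+ 2).
    by field; rewrite gt_eqF.
  by rewrite /pk !invfM !invrK mulrA mulrA mulVf ?gt_eqF// mul1r.
split; first by apply: (eq_L1 _ _ _ (L1Z (l^-1) _ h)).
transitivity (l^-1 * \int[mu]_x0 (1 + (l^-1 * x0 + - (l^-1 * x)) ^+ 2)^-1).
  by rewrite -(ItgZ _ _ h); apply: eq_Itg.
by rewrite E invrK mulrA mulVf ?gt_eqF// mul1r.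
Qed.

Lemma L1_mulpk l f (x : R) : 0 < l -> L1 f -> L1 (fun y => f y * pk l (x - y)).
Proof.
move=> l0 f1; have mp := measurable_pk l.
apply: (eq_L1 _ _ _ (L1_bndM l^-1 _ (fun y => pk l (x - y)) _ _ f1)).
- by move=> y; rewrite mulrC.
- by mfun.
- by move=> y; exact: pk_le.
Qed.

(** Schur's test: [2 f(x) f(y) <= f(x)^2 + f(y)^2], and the Poisson kernel has mass [K0] in each
    variable separately. *)
Lemma wexp_ft2_le f (l : R) : 0 < l -> L1 f -> L1 (fun x => f x ^+ 2) ->
  \int[mu]_k (wexp l k * ft2 f k) <= K0 * \int[mu]_x (f x ^+ 2).
Proof.
move=> l0 f1 f2; have mf := L1_meas _ f1; have mp := measurable_pk l.
have [_ L E] := poisson_identity f l l0 f1; rewrite E.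
pose G y x := f y ^+ 2 * pk l (x - y).
have mG : measurable_fun setT (fun z : R * R => G z.1 z.2) by rewrite /G; mfun.
have pkS (y : R) : L1 (fun x => pk l (x - y)) /\ \int[mu]_x pk l (x - y) = K0.
  have [h1 h2] := Itg_pk l y l0; rewrite -h2.
  have e x : pk l (y - x) = pk l (x - y) by rewrite -pkN opprB.
  by split; [apply: (eq_L1 _ _ _ h1)|apply: eq_Itg => x; rewrite e].
have GI y : \int[mu]_x G y x = f y ^+ 2 * K0.
  by have [h1 h2] := pkS y; rewrite (ItgZ _ _ h1) h2.
have Gfin : (\int[mu]_y \int[mu]_x `|G y x|%:E < +oo)%E.
  rewrite (_ : (\int[mu]_y _)%E = (\int[mu]_y (f y ^+ 2 * K0)%:E)%E).
    rewrite -EFin_Itg ?ltry//.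
    by apply: (eq_L1 _ _ _ (L1Z K0 _ f2)) => y; rewrite mulrC.
  apply: eq_integral => y _; rewrite -GI EFin_Itg.
    apply: eq_integral => x _; rewrite ger0_norm// /G mulr_ge0 ?sqr_ge0//.
    exact: pk_ge0.
  by apply: L1Z; exact: (pkS y).1.
have [_ _ g2 g3] := Fubini_real G mG Gfin.
have GG : \int[mu]_x \int[mu]_y G y x = K0 * \int[mu]_y (f y ^+ 2).
  by rewrite -g3 -(ItgZ _ _ f2); apply: eq_Itg => y; rewrite GI mulrC.
have K2 : L1 (fun x => 2^-1 * (K0 * f x ^+ 2)) := L1Z _ _ (L1Z _ _ f2).
have G2 : L1 (fun x => 2^-1 * \int[mu]_y G y x) := L1Z _ _ g2.
have -> : K0 * \int[mu]_x f x ^+ 2 =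
    \int[mu]_x (2^-1 * (K0 * f x ^+ 2) + 2^-1 * \int[mu]_y G y x).
  rewrite (ItgD _ _ K2 G2) (ItgZ _ _ (L1Z _ _ f2)) (ItgZ _ _ f2) (ItgZ _ _ g2) GG.
  by field.
apply: (Itg_le _ _ L (L1D _ _ K2 G2)).
move=> x; have hx : L1 (fun y => f y * pk l (x - y)) := L1_mulpk l f x l0 f1.
have [p1 p2] := Itg_pk l x l0.
have g1 : L1 (fun y => G y x) := L1_mulpk l (fun y => f y ^+ 2) x l0 f2.
have p3 : L1 (fun y => 2^-1 * (f x ^+ 2 * pk l (x - y))) := L1Z _ _ (L1Z _ _ p1).
have g4 : L1 (fun y => 2^-1 * G y x) := L1Z _ _ g1.
have -> : 2^-1 * (K0 * f x ^+ 2) + 2^-1 * \int[mu]_y G y x =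
    \int[mu]_y (2^-1 * (f x ^+ 2 * pk l (x - y)) + 2^-1 * G y x).
  by rewrite (ItgD _ _ p3 g4) (ItgZ _ _ (L1Z _ _ p1)) (ItgZ _ _ p1) (ItgZ _ _ g1) p2 (mulrC K0).
rewrite -(ItgZ _ _ hx); apply: (Itg_le _ _ (L1Z _ _ hx) (L1D _ _ p3 g4)).
move=> y; rewrite /G; have := pk_ge0 l (x - y) l0; move: (pk l _) => P P0.
  rewrite -subr_ge0 (_ : _ - _ = 2^-1 * ((f x - f y) ^+ 2 * P)); last by field.
  apply: mulr_ge0; first by rewrite invr_ge0 ler0n.
  by apply: mulr_ge0; [exact: sqr_ge0|exact: P0].
Qed.

Lemma wexp_cvg (k : R) : wexp (n.+1%:R^-1) k @[n --> \oo] --> (if 0 <= k then 1 else 0 : R).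
Proof.
rewrite /wexp; case: ifP => k0; last exact: cvg_cst.
rewrite -[X in _ --> X](expR0 R) (_ : (fun n => _) = (fun n => expR (- (n.+1%:R^-1 * k))))//; last first.
  by apply: funext => n; rewrite mulNr.
apply: continuous_cvg; first exact: continuous_expR.
rewrite -[X in _ --> X]oppr0; apply: cvgN; rewrite -[X in _ --> X](mul0r k).
by apply: cvgM; [exact: cvg_harmonic|exact: cvg_cst].
Qed.

(** The Abel factors tend to 1 as [l -> 0], and Fatou's lemma transfers the uniform bound of
    [wexp_ft2_le] to the limit. *)
Lemma plancherel_le f : L1 f ->
  (\int[mu]_k (if (0 <= k)%R then ft2 f k else 0)%:E <= K0%:E * \int[mu]_x (f x ^+ 2)%:E)%E.
Proof.
move=> f1; have mf := L1_meas _ f1; have mft := measurable_ft2 f f1.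
have K00 := @arctan_mass_gt0 R.
have [foo|] := leP (+oo)%E (\int[mu]_x (f x ^+ 2)%:E)%E.
  by move: foo; rewrite leye_eq => /eqP ->; rewrite gt0_muley ?lte_fin// leey.
move=> ffin; have f2 : L1 (fun x => f x ^+ 2).
  apply: L1P; first by mfun.
  by under eq_integral => x _ do rewrite ger0_norm ?sqr_ge0//.
rewrite -(EFin_Itg _ f2) -EFinM.
apply: (Fatou_bound (fun n k => wexp (n.+1%:R^-1) k * ft2 f k)).
- by move=> n; have mw := measurable_wexp (R := R) n.+1%:R^-1; mfun.
- by mfun.
- by move=> n x; rewrite mulr_ge0 ?wexp_ge0 ?ft2_ge0.
- apply: aeW => k; rewrite (_ : (if _ then _ else _) = (if 0 <= k then 1 else 0) * ft2 f k).
    by apply: cvgM; [exact: wexp_cvg|exact: cvg_cst].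
  by case: ifP; rewrite ?mul1r ?mul0r.
- move=> n; have n0 : 0 < n.+1%:R^-1 :> R by rewrite invr_gt0.
  have [h _ _] := poisson_identity f _ n0 f1.
  by rewrite -(EFin_Itg _ h) lee_fin; exact: wexp_ft2_le.
Qed.

End PlancherelUpper.

Section PlancherelLower.
Context {R : realType}.
Local Notation mu := (@lebesgue_measure R).
Local Notation K0 := (@arctan_mass R).
Implicit Types (f g : R -> R).

Definition ft2_mass f : \bar R := (\int[mu]_k (if (0 <= k)%R then ft2 f k else 0)%:E)%E.

Lemma wexp_ft2_mass f (l : R) : 0 < l -> L1 f ->
  ((\int[mu]_k (wexp l k * ft2 f k))%:E <= ft2_mass f)%E.
Proof.
move=> l0 f1; have [h _ _] := poisson_identity f l l0 f1.
have mw := measurable_wexp (R := R) l; have mft := measurable_ft2 f f1.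
rewrite (EFin_Itg _ h); apply: ge0_integral_le; [by mfun|by mfun|].
move=> k; rewrite /wexp; case: ifPn => k0; last by rewrite mul0r lexx.
rewrite mulr_ge0 ?expR_ge0 ?ft2_ge0//= ler_piMl ?ft2_ge0//.
by rewrite expR_le1 mulNr oppr_le0 mulr_ge0// ltW.
Qed.

Lemma cvg_harmonicM (u : R) : n.+1%:R^-1 * u @[n --> \oo] --> 0.
Proof.
by rewrite -[X in _ --> X](mul0r u); apply: cvgM; [exact: cvg_harmonic|exact: cvg_cst].
Qed.

(** With [y = x + lam u] the Poisson integral of [g] becomes a weighted average of its translates,
    which tends to [K0 g(x)] by continuity and boundedness. Dominated convergence then computes the
    limit of the regularised integrals, each of which is at most [ft2_mass g]. *)
Lemma plancherel_ge_cont g (B : R) : L1 g -> continuous g -> (forall x, `|g x| <= B) ->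
  (K0%:E * \int[mu]_x (g x ^+ 2)%:E <= ft2_mass g)%E.
Proof.
move=> g1 cg gB; have mg := L1_meas _ g1.
have B0 : 0 <= B by exact: le_trans (normr_ge0 _) (gB 0).
have [Moo|Mfin] := leP +oo%E (ft2_mass g).
  by move: Moo; rewrite leye_eq => /eqP ->; rewrite leey.
have M0 : (0 <= ft2_mass g)%E.
  by apply: integral_ge0 => k _; rewrite lee_fin; case: ifP; rewrite ?ft2_ge0.
have Mf : ft2_mass g \is a fin_num by rewrite ge0_fin_numE.
have g2 : L1 (fun x => g x ^+ 2).
  by apply: (eq_L1 _ _ _ (L1_bndM B _ g mg gB g1)) => x; rewrite expr2.
pose lam (n : nat) : R := n.+1%:R^-1.
have lam0 n : 0 < lam n by rewrite invr_gt0.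
pose J n x := \int[mu]_u ((1 + u ^+ 2)^-1 * g (lam n * u + x)).
have B1 : L1 (fun u : R => (1 + u ^+ 2)^-1 * B).
  by apply: (eq_L1 _ _ _ (L1Z B _ L1_arctan)) => u; rewrite mulrC.
have at_ge0 (u : R) : 0 <= (1 + u ^+ 2)^-1 by rewrite invr_ge0 addr_ge0// sqr_ge0.
have mJ0 n x : measurable_fun setT (fun u : R => (1 + u ^+ 2)^-1 * g (lam n * u + x)) by mfun.
have Jbnd n x u : `|(1 + u ^+ 2)^-1 * g (lam n * u + x)| <= (1 + u ^+ 2)^-1 * B.
  by rewrite normrM (ger0_norm (at_ge0 u)); exact: ler_wpM2l.
have JE n x : \int[mu]_y (g y * (lam n / (lam n ^+ 2 + (x - y) ^+ 2))) = J n x.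
  have h := L1_mulpk (lam n) g x (lam0 n) g1.
  have [_ E] := L1_affine (lam n) x _ (lam0 n) h.
  rewrite -[LHS](mulVKf (lt0r_neq0 (lam0 n))) -E -(ItgZ _ _ (L1_affine (lam n) x _ (lam0 n) h).1).
  apply: eq_Itg => u; rewrite /pk.
  rewrite (_ : lam n ^+ 2 + (x - (lam n * u + x)) ^+ 2 = lam n * (lam n * (1 + u ^+ 2))); last by ring.
  by rewrite !invfM mulrA (mulrC (lam n)) -!mulrA !(mulVKf (lt0r_neq0 (lam0 n))) mulrC.
have Jcv x : J n x @[n --> \oo] --> K0 * g x.
  have [|||||_ cv] := dct (fun n (u : R) => (1 + u ^+ 2)^-1 * g (lam n * u + x))
      (fun u : R => (1 + u ^+ 2)^-1 * g x) (fun u : R => (1 + u ^+ 2)^-1 * B).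
  - by move=> n; exact: mJ0.
  - by mfun.
  - exact: B1.
  - by move=> n u; exact: Jbnd.
  - apply: aeW => u; apply: cvgM; first exact: cvg_cst.
    have hcv : lam n * u + x @[n --> \oo] --> x.
      rewrite -[X in _ --> X]add0r; apply: cvgD; last exact: cvg_cst.
      exact: cvg_harmonicM.
    exact: (cvg_comp _ _ hcv (cg x)).
  rewrite (_ : K0 * g x = \int[mu]_u ((1 + u ^+ 2)^-1 * g x)); first exact: cv.
  rewrite (mulrC K0) -(ItgZ _ _ L1_arctan).
  by apply: eq_Itg => u; rewrite mulrC.
have Jle n x : `|J n x| <= K0 * B.
  apply: le_trans (Itg_norm_le _ _ B1 (mJ0 n x) (Jbnd n x)) _.
  rewrite (mulrC K0) -(ItgZ _ _ L1_arctan) le_eqVlt; apply/orP; left; apply/eqP.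
  by apply: eq_Itg => u; rewrite mulrC.
have mJ n : measurable_fun setT (J n).
  have m : measurable_fun setT (fun z : R * R => (1 + z.2 ^+ 2)^-1 * g (lam n * z.2 + z.1)) by mfun.
  exact: (meas_Itg _ _ (fun x u : R => (1 + u ^+ 2)^-1 * g (lam n * u + x)) m).
have [|||||_ cv] := dct (fun n (x : R) => g x * J n x) (fun x : R => g x * (K0 * g x))
    (fun x => (K0 * B) * `|g x|).
- by move=> n; have mJn := mJ n; mfun.
- by mfun.
- by apply: L1Z; exact: L1_norm.
- by move=> n x; rewrite normrM mulrC; apply: ler_wpM2r; [exact: normr_ge0|exact: Jle].
- by apply: aeW => x; apply: cvgM; [exact: cvg_cst|exact: Jcv].
rewrite -(EFin_Itg _ g2) -EFinM -(fineK Mf) lee_fin -(ItgZ _ _ g2).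
have -> : \int[mu]_x (K0 * g x ^+ 2) = \int[mu]_x (g x * (K0 * g x)).
  by apply: eq_Itg => x; rewrite expr2 mulrCA.
rewrite -(cvg_lim _ cv)//; apply: limr_le; first by apply/cvg_ex; eexists; exact: cv.
apply: nearW => n; have [_ _ E] := poisson_identity g (lam n) (lam0 n) g1.
have H := wexp_ft2_mass g (lam n) (lam0 n) g1.
rewrite -lee_fin (fineK Mf); apply: (le_trans _ H); rewrite lee_fin E le_eqVlt.
by apply/orP; left; apply/eqP; apply: eq_Itg => x; rewrite JE.
Qed.

(** Placed to the left of 0 so that convolution with it averages [f] over []x, x + h]], a forward
    difference quotient of [prim f]. *)
Definition box (h y : R) : R := if (- h <= y) && (y < 0) then h^-1 else 0.

Lemma measurable_box h : measurable_fun setT (box h).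
Proof. by rewrite /box; mfun. Qed.

Lemma Itg_box h : 0 < h -> L1 (box h) /\ \int[mu]_y box h y = 1.
Proof.
move=> h0; have b0 y : 0 <= box h y by rewrite /box; case: ifP => // _; rewrite invr_ge0 ltW.
have E : (\int[mu]_y (box h y)%:E = 1%:E)%E.
  transitivity (\int[mu]_(y in `[(- h)%R, 0%R[) (h^-1)%:E)%E.
    rewrite [RHS]integral_mkcond; apply: eq_integral => y _; rewrite patchE /box.
    case: ifPn => hy; first by rewrite mem_set//= in_itv.
    by rewrite memNset//= in_itv/=; exact/negP.
  rewrite (@integral_cst _ _ _ mu `[- h, 0%R[%classic _ (h^-1)%:E)//.
  have M : mu `[- h, 0%R[%classic = h%:E.
    by rewrite lebesgue_measure_itv/= lte_fin oppr_lt0 h0 -EFinB sub0r opprK.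
  by rewrite [X in (_ * X)%E](M : _ = h%:E) -EFinM mulVf ?gt_eqF.
have l : L1 (box h).
  by apply: (ge0_L1 _ 1 (measurable_box h) b0 _).1; rewrite E.
by split; [exact: l|apply: EFin_inj; rewrite (EFin_Itg _ l)].
Qed.

Lemma LT0 f : L1 f -> LT (Re (0 +i* 0 : R[i])) f.
Proof. by move=> f1; apply: (eq_L1 _ _ _ f1) => y; rewrite /= oppr0 mul0r expR0 mul1r. Qed.

Lemma ft2_conv f (h k : R) : 0 < h -> L1 f ->
  L1 (convolution f (box h)) /\ 0 <= ft2 (convolution f (box h)) k <= ft2 f k.
Proof.
move=> h0 f1; have [b1 b2] := Itg_box h h0.
have hf : LT (Re (0 +i* k)) f := LT0 f f1.
have hb : LT (Re (0 +i* k)) (box h) := LT0 _ b1.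
have [c1 c2] := lap_convolution f (box h) (0 +i* k) hf hb.
split; first by apply: (eq_L1 _ _ _ c1) => y; rewrite /= oppr0 mul0r expR0 mul1r.
rewrite ft2_ge0 /ft2 c2 cnM exprMn ler_piMr ?sqr_ge0// expr_le1 ?cn_ge0//.
have mb := L1_meas _ b1.
apply: le_trans (cn_lap (box h) _ _ (LT_norm _ _ hb) mb (fun y => lexx _)) _.
rewrite -b2 le_eqVlt; apply/orP; left; apply/eqP; apply: eq_Itg => y.
rewrite /= oppr0 mul0r expR0 mul1r ger0_norm// /box; case: ifP => // _.
by rewrite invr_ge0 ltW.
Qed.

Definition prim f (x : R) := \int[mu]_(t in `]-oo, x]) f t.

Lemma L1_on f (D : set R) : measurable D -> L1 f -> mu.-integrable D (EFin \o f).
Proof. by move=> mD f1; apply: integrableS f1. Qed.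

Lemma primB f (x y : R) : L1 f -> x <= y -> prim f y - prim f x = \int[mu]_(t in `]x, y]) f t.
Proof.
move=> f1 xy; rewrite /prim Rintegral_itvB//; exact: L1_on.
Qed.

Lemma convolution_box f (h x : R) : 0 < h -> L1 f ->
  convolution f (box h) x = h^-1 * (prim f (x + h) - prim f x).
Proof.
move=> h0 f1; have mf := L1_meas _ f1; have mb := measurable_box h.
have f1s : L1 (fun y => f (x - y)).
  have [s1 _] := L1_shift x _ (L1_opp _ f1).1.
  have [s2 _] := L1_opp _ (L1_shift x _ f1).1.
  by apply: (eq_L1 _ _ _ s2) => y; rewrite addrC.
have bb y : `|box h y| <= h^-1.
  have hi : 0 <= h^-1 by rewrite invr_ge0 ltW.
  by rewrite /box; case: ifP => _; rewrite ?normr0// ger0_norm.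
have l : L1 (fun y => f (x - y) * box h y).
  by apply: (eq_L1 _ _ _ (L1_bndM _ _ _ mb bb f1s)) => y; rewrite mulrC.
rewrite primB//; last by rewrite lerDl ltW.
have [l2 e2] := L1_opp _ l.
have [_ e3] := L1_shift (- x) _ l2.
rewrite /convolution -e2 -e3.
have m1 : measurable_fun setT (fun t : R => if (x < t) && (t <= x + h) then f t else 0) by mfun.
have l1 : L1 (fun t : R => if (x < t) && (t <= x + h) then f t else 0).
  apply: (L1_le _ _ m1 _ (L1_norm _ f1)) => t.
  by case: ifP => _; rewrite ?normr0.
transitivity (h^-1 * \int[mu]_t (if (x < t) && (t <= x + h) then f t else 0)).
  rewrite -(ItgZ _ _ l1); apply: eq_Itg => t; rewrite (_ : x - - (t - x) = t); last by ring.
  rewrite /box lerN2 oppr_lt0 subr_gt0 lerBlDl andbC.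
  by case: ifP => _; rewrite ?mulr0// mulrC.
congr (_ * _); rewrite [RHS]Itg_mkcond; apply: eq_Itg => t; rewrite indicE.
by case: ifPn => ht; [rewrite mem_set//= ?in_itv//= mulr1|
  rewrite memNset ?mulr0//= in_itv/=; exact/negP].
Qed.

Lemma continuous_prim f : L1 f -> continuous (prim f).
Proof.
move=> f1 x.
have xx : x - 1 < x + 1 by lra.
have H := @parameterized_integral_continuous R (x - 1) (x + 1) f (ltW xx) (L1_on _ _ (measurable_itv _) f1).
have [Hc _ _] := (continuous_within_itvP _ xx).1 H.
have xI : x \in `](x - 1), (x + 1)[ by rewrite in_itv/=; apply/andP; split; lra.
have {}Hc := Hc x xI.
have E y : x - 1 <= y -> prim f y = prim f (x - 1) + parameterized_integral mu (x - 1) y f.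
  move=> xy; rewrite /parameterized_integral -Rintegral_itv_obnd_cbnd; last exact: L1_on.
  by rewrite -(primB f (x - 1) y f1 xy) addrC subrK.
have E1 : \forall y \near x, prim f (x - 1) + parameterized_integral mu (x - 1) y f = prim f y.
  exists 1 => //= y; rewrite /ball/= ltr_norml => /andP[y1 y2].
  by rewrite -E//; lra.
rewrite /continuous_at (E x); last by lra.
apply: cvg_trans (near_eq_cvg E1) _.
by apply: cvgD; [exact: cvg_cst|exact: Hc].
Qed.

(** Lebesgue's differentiation theorem: the averages are difference quotients of [prim f] with step
    [1 / (n + 1)]. *)
Lemma cvg_box f : L1 f -> {ae mu, forall x,
  convolution f (box (n.+1%:R^-1)) x @[n --> \oo] --> f x}.
Proof.
move=> f1.
have locf : locally_integrable [set: R] f.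
  by apply: open_integrable_locally f1; exact: openT.
have := @FTC1Ny R f (fun y => L1_on _ _ (measurable_itv _) f1) locf.
apply: aeS => x [dF F'].
have h0 n : 0 < n.+1%:R^-1 :> R by rewrite invr_gt0.
have -> : (fun n => convolution f (box (n.+1%:R^-1)) x) =
    (fun n => (n.+1%:R^-1)^-1 * (prim f (x + n.+1%:R^-1) - prim f x)).
  by apply: funext => n; rewrite convolution_box.
have /cvg_ex[/= l Fl] := dF.
have fl : f x = l.
  by rewrite -F' derive1E; apply: cvg_lim.
have xa0 : (forall n : nat, n.+1%:R^-1 != 0 :> R) /\ (n.+1%:R^-1 : R) @[n --> \oo] --> 0.
  by split; [move=> n; rewrite gt_eqF|exact: cvg_harmonic].
move: Fl => /cvgr_dnbhsP/(_ _ xa0); rewrite -fl.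
have -> : (fun n : nat => n.+1%:R^-1 ^-1 *: (prim f (n.+1%:R^-1 *: 1 + x) - prim f x)) =
    (fun n => (n.+1%:R^-1)^-1 * (prim f (x + n.+1%:R^-1) - prim f x)).
  by apply: funext => n; rewrite /GRing.scale/= mulr1 (addrC x).
by [].
Qed.

(** Averages of [f] over short intervals are continuous and bounded, so the previous case applies to
    them. Averaging multiplies the transform by a factor of modulus at most 1, and Fatou's lemma
    recovers [f] since the averages converge almost everywhere. *)
Lemma plancherel_ge f : L1 f ->
  (K0%:E * \int[mu]_x (f x ^+ 2)%:E <= ft2_mass f)%E.
Proof.
move=> f1; have mf := L1_meas _ f1; have mft := measurable_ft2 f f1.
have h0 n : 0 < n.+1%:R^-1 :> R by rewrite invr_gt0.
have K00 := @arctan_mass_gt0 R.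
have mfn n : measurable_fun setT (convolution f (box (n.+1%:R^-1))).
  exact: measurable_convolution mf (measurable_box _).
rewrite -ge0_integralZl//; last 3 first.
- by mfun.
- by move=> x _; rewrite lee_fin sqr_ge0.
- by rewrite lee_fin ltW.
apply: (Fatou_bound (fun n x => K0 * convolution f (box (n.+1%:R^-1)) x ^+ 2)).
- by move=> n; have mn := mfn n; mfun.
- by mfun.
- by move=> n x; rewrite mulr_ge0 ?sqr_ge0// ltW.
- apply: aeS (cvg_box f f1) => x cx.
  by apply: cvgM; [exact: cvg_cst|rewrite expr2; under eq_fun do rewrite expr2; exact: cvgM].
move=> n; have [c1 _] := ft2_conv f _ 0 (h0 n) f1.
have mn := mfn n; have mfc := measurable_ft2 _ c1.
apply: le_trans (_ : (ft2_mass (convolution f (box (n.+1%:R^-1))) <= _)%E); last first.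
  apply: ge0_integral_le; [by mfun|by mfun|].
  by move=> k; case: ifP; rewrite ?lexx// => _; exact: (ft2_conv f _ k (h0 n) f1).2.
apply: le_trans (plancherel_ge_cont _ (n.+1%:R * \int[mu]_x `|f x|) c1 _ _).
- rewrite -ge0_integralZl//; last 3 first.
  + by mfun.
  + by move=> x _; rewrite lee_fin sqr_ge0.
  + by rewrite lee_fin ltW.
- move=> x.
  rewrite (_ : convolution f _ = fun y => (n.+1%:R^-1)^-1 * (prim f (y + n.+1%:R^-1) - prim f y)).
    apply: cvgM; first exact: cvg_cst.
    apply: cvgB; last exact: continuous_prim.
    have hx : y + n.+1%:R^-1 @[y --> x] --> x + n.+1%:R^-1.
      by apply: cvgD; [exact: cvg_id|exact: cvg_cst].
    exact: (cvg_comp _ _ hx (continuous_prim f f1 _)).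
  by apply: funext => y; rewrite convolution_box.
- move=> x; rewrite convolution_box// invrK normrM ger0_norm ?ler0n//.
  apply: ler_wpM2l; first exact: ler0n.
  have xle : x <= x + n.+1%:R^-1 by rewrite lerDl ltW.
  rewrite (primB _ _ _ f1 xle).
  rewrite [X in `|X| <= _]Itg_mkcond.
  have l := (L1_mkcond _ _ (measurable_itv _)).1 (L1_on f _ (measurable_itv (`]x, x + n.+1%:R^-1])) f1).
  apply: (Itg_norm_le _ _ (L1_norm _ f1) (L1_meas _ l)).
  by move=> t; rewrite normrM ler_piMr// indicE; case: (_ \in _); rewrite ?normr0 ?normr1.
Qed.

End PlancherelLower.

(** * Weighted norms and Hardy inequalities *)

Section Powers.
Context {R : realType}.
Local Notation mu := (@lebesgue_measure R).
Implicit Types (f g : R -> R).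

Lemma ge0_integral_scale (y : R) f : 0 < y -> measurable_fun setT f -> (forall x, 0 <= f x) ->
  (\int[mu]_x (f (y * x)%R)%:E = (y^-1)%:E * \int[mu]_x (f x)%:E)%E.
Proof.
move=> y0 mf f0; have E := ge0_integral_affine y 0 f y0 mf f0.
by rewrite -E; apply: eq_integral => x _; rewrite addr0.
Qed.

Lemma L1_exp f : measurable_fun setT f -> (forall x, 0 <= f x) ->
  (forall x, x <= 0 -> f x = 0) ->
  L1 (fun s => f (expR s) * expR s) -> L1 f.
Proof.
move=> mf f0 fneg l.
have E : (\int[mu]_x (f x)%:E = (\int[mu]_s (f (expR s) * expR s))%:E)%E.
  rewrite (EFin_Itg _ l) -ge0_integral_exp//; apply: eq_integral => x _.
  by case: ifPn => //; rewrite -leNgt => /fneg ->.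
by apply: (ge0_L1 _ (\int[mu]_s (f (expR s) * expR s)) mf f0 _).1; rewrite E.
Qed.

(** The substitution [x = e^s] turns the truncated power into a one-sided exponential. *)
Lemma L1_powR_near0 (a r : R) : -1 < a -> 0 < r ->
  L1 (fun x => if (0 < x) && (x <= r) then x `^ a else 0).
Proof.
move=> a1 r0; apply: L1_exp.
- by mfun.
- by move=> x; case: ifP => // _; exact: powR_ge0.
- by move=> x x0; rewrite ltNge x0.
have a0 : 0 < a + 1 by lra.
have [s1 _] := L1_shift (ln r) _ (L1_opp _ (L1_wexp _ a0)).1.
have [s2 _] := L1_opp _ (L1_shift (ln r) _ (L1_wexp _ a0)).1.
apply: (eq_L1 _ _ _ (L1Z (expR ((a + 1) * ln r)) _ s2)) => s.
rewrite /wexp expR_gt0/= (_ : (expR s <= r) = (s <= ln r)); last by rewrite -[in RHS]ler_expR lnK ?posrE.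
rewrite (addrC (- s)) subr_ge0.
case: ifP => _; last by rewrite mulr0 mul0r.
rewrite -expRM -!expRD; congr expR; ring.
Qed.

Lemma L1_powR_oo (a r : R) : a < -1 -> 0 < r ->
  L1 (fun x => if r <= x then x `^ a else 0).
Proof.
move=> a1 r0.
have -> : (fun x => if r <= x then x `^ a else 0) = (fun x => if (0 < x) && (r <= x) then x `^ a else 0).
  by apply: funext => x; have [h|] := leP r x; rewrite ?andbF// (lt_le_trans r0 h).
apply: L1_exp.
- by mfun.
- by move=> x; case: ifP => // _; exact: powR_ge0.
- by move=> x x0; rewrite ltNge x0.
have a0 : 0 < - (a + 1) by lra.
have [s1 _] := L1_shift (- ln r) _ (L1_wexp _ a0).
apply: (eq_L1 _ _ _ (L1Z (expR ((a + 1) * ln r)) _ s1)) => s.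
rewrite /wexp expR_gt0/= (_ : (r <= expR s) = (ln r <= s)); last by rewrite -[in RHS]ler_expR lnK ?posrE.
rewrite subr_ge0.
case: ifP => _; last by rewrite mulr0 mul0r.
rewrite -expRM -!expRD; congr expR; ring.
Qed.

End Powers.

Section WeightedNorm.
Context {R : realType}.
Local Notation mu := (@lebesgue_measure R).
Local Notation K0 := (@arctan_mass R).
Implicit Types (f g : R -> R).
Variable al : R.
Hypotheses (al_gt : 2^-1 < al) (al_lt : al < 1).

(** The weight over vertical lines: by scaling, integrating [e^(- 2 e y)] against it gives a
    multiple of [y^(2 al - 2)]. *)
Definition wt (e : R) : R := if 0 < e then e `^ (1 - 2 * al) else 0.

Lemma measurable_wt : measurable_fun setT wt.
Proof. by rewrite /wt; mfun. Qed.

Lemma wt_ge0 e : 0 <= wt e.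
Proof. by rewrite /wt; case: ifP => // _; exact: powR_ge0. Qed.

(** Equal to [2^(2 al - 2) Gamma(2 - 2 al)]. *)
Definition gam : R := \int[mu]_e (wt e * expR (- 2 * e)).

Lemma L1_gam : L1 (fun e => wt e * expR (- 2 * e)).
Proof.
have mw := measurable_wt.
have ag := al_gt; have al1 := al_lt.
have a1 : -1 < 1 - 2 * al by lra.
have a2 : -2 < -1 :> R by lra.
apply: (L1_le _ (fun e => (if (0 < e) && (e <= 1) then e `^ (1 - 2 * al) else 0) +
  (if 1 <= e then e `^ (-2) else 0)) _ _ (L1D _ _ (L1_powR_near0 _ _ a1 ltr01) (L1_powR_oo _ _ a2 ltr01))).
  by mfun.
move=> e; rewrite ger0_norm ?mulr_ge0 ?wt_ge0 ?expR_ge0// /wt.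
have [e0|e0] := ltP 0 e; last first.
  by rewrite mul0r addr_ge0//; case: ifP => // _; rewrite powR_ge0.
have [e1|e1] := leP e 1.
  apply: (@le_trans _ _ (e `^ (1 - 2 * al))).
    by rewrite ler_piMr ?powR_ge0// expR_le1; lra.
  by rewrite lerDl; case: ifP => // _; rewrite powR_ge0.
rewrite (ltW e1) add0r; apply: (@le_trans _ _ (expR (- 2 * e))).
  rewrite ler_piMl ?expR_ge0// -[leRHS](powRr0 e); apply: ler_powR; [exact: ltW|lra].
have -> : e `^ (-2) = (e ^+ 2)^-1.
  by rewrite -(powR_invn 2 (ltW e0)).
rewrite mulNr expRN lef_pV2 ?posrE ?expR_gt0 ?exprn_gt0// mulrC expRM_natr.
apply: lerXn2r; rewrite ?nnegrE ?expR_ge0//; first exact: ltW.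
by rewrite (le_trans _ (expR_ge1Dx _))// lerDr.
Qed.

Lemma gam_gt0 : 0 < gam.
Proof.
have ag := al_gt; have al1 := al_lt.
have mw := measurable_wt.
have h0 : 0 < 2^-1 :> R by rewrite invr_gt0.
have [b1 b2] := Itg_box _ h0.
have [s1 s2] := L1_shift (- 1) _ b1.
have hh : L1 (fun e => (2^-1 * expR (-2)) * box 2^-1 (e + - 1)) := L1Z _ _ s1.
apply: (@lt_le_trans _ _ (\int[mu]_e ((2^-1 * expR (-2)) * box 2^-1 (e + - 1)))).
  by rewrite (ItgZ _ _ s1) s2 b2 mulr1 mulr_gt0 ?invr_gt0// expR_gt0.
apply: (Itg_le _ _ hh L1_gam) => e; rewrite /box.
case: ifPn => [/andP[e1 e2]|_]; last by rewrite mulr0 mulr_ge0 ?wt_ge0 ?expR_ge0.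
have e0 : 0 < e by lra.
have e1' : e <= 1 by lra.
rewrite mulrAC divff ?invr_eq0 ?pnatr_eq0// mul1r.
rewrite /wt e0; apply: (@le_trans _ _ (expR (-2 * e))).
  by rewrite ler_expR; lra.
rewrite ler_peMl ?expR_ge0// -[leLHS](powRr0 e); apply: ger_powR; last by lra.
by rewrite e0.
Qed.

Lemma wt_exp (y : R) : 0 < y ->
  (\int[mu]_e (wt e * expR (- 2 * e * y))%:E = (gam * y `^ (2 * al - 2))%:E)%E.
Proof.
move=> y0; have mw := measurable_wt.
pose h e := wt e * expR (- 2 * e).
have mh : measurable_fun setT h by rewrite /h; mfun.
have h0 e : 0 <= h e by rewrite mulr_ge0 ?wt_ge0 ?expR_ge0.
have E := ge0_integral_scale y h y0 mh h0.
have wy e : h (y * e) = y `^ (1 - 2 * al) * (wt e * expR (- 2 * e * y)).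
  rewrite /h /wt pmulr_rgt0//; case: ifPn => e0; last by rewrite !mul0r mulr0.
  by rewrite powRM ?ltW// -mulrA; congr (_ * (_ * expR _)); ring.
have mk : measurable_fun setT (fun e => wt e * expR (- 2 * e * y)) by mfun.
move: E; under eq_integral do rewrite wy EFinM.
rewrite ge0_integralZl//; last 3 first.
- by apply/measurable_EFinP.
- by move=> e _; rewrite lee_fin mulr_ge0 ?wt_ge0 ?expR_ge0.
- by rewrite lee_fin powR_ge0.
rewrite -(EFin_Itg _ L1_gam) -/gam => E.
have yn : y `^ (1 - 2 * al) != 0 by rewrite gt_eqF// powR_gt0.
have : ((y `^ (1 - 2 * al))^-1%:E * ((y `^ (1 - 2 * al))%:E *
   \int[mu]_e (wt e * expR (-2 * e * y))%:E) = (y `^ (1 - 2 * al))^-1%:E * ((y^-1)%:E * gam%:E))%E.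
  by congr (_ * _)%E.
rewrite muleA -EFinM mulVf// mul1e => ->.
rewrite -!EFinM; congr EFin; rewrite mulrA mulrC; congr (_ * _).
rewrite -powRN -(powR_inv1 (ltW y0)) -powRD; last by apply/implyP => _; rewrite gt_eqF.
by congr powR; ring.
Qed.

Definition Nrm g : \bar R :=
  (\int[mu]_e \int[mu]_k (wt e * (if (0 <= k)%R then cn (lap g (e +i* k)) ^+ 2 else 0))%:E)%E.

Lemma lap_damp g (e k : R) : lap g (e +i* k) = lap (fun y => expR (- e * y) * g y) (0 +i* k).
Proof.
apply: eq_cI => y; rewrite /ce/= oppr0 mul0r expR0 !mul1r.
by apply/eqP; rewrite eq_complex/= !mul0r !subr0 !addr0; apply/andP; split; apply/eqP; ring.
Qed.

(** On the line [Re xi = e] the transform of [g] is the Fourier transform of [e^(- e y) g], so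
    Plancherel's formula applies for each [e]. Tonelli then integrates [e^(- 2 e y)] over [e] by
    [wt_exp]. For functions of the form [y f(y)] the right-hand side is the norm of [f] with weight
    [y^(2 al)]. *)
Lemma NrmE g : LTall g -> (forall y, y < 1 -> g y = 0) ->
  (Nrm g = (K0 * gam)%:E * \int[mu]_y (y `^ (2 * al - 2) * g y ^+ 2)%:E)%E.
Proof.
move=> hg g1; have mg := LT_meas _ _ (hg 1 ltr01); have mw := measurable_wt.
have K00 := @arctan_mass_gt0 R; have g0 := gam_gt0.
transitivity (\int[mu]_e \int[mu]_y (wt e * K0 * (expR (- e * y) * g y) ^+ 2)%:E)%E.
  apply: eq_integral => e _; have [e0|e0] := ltP 0 e; last first.
    rewrite /wt ltNge e0/=.
    by rewrite !integral0_eq// => x _; rewrite !mul0r.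
  have he : L1 (fun y => expR (- e * y) * g y) := hg e e0.
  have mf := measurable_ft2 _ he.
  under eq_integral => k _.
    rewrite EFinM lap_damp -/(ft2 _ k); over.
  rewrite ge0_integralZl//; last 3 first.
  - by mfun.
  - by move=> k _; rewrite lee_fin; case: ifP => // _; exact: ft2_ge0.
  - by rewrite lee_fin wt_ge0.
  under [in RHS]eq_integral => y _ do rewrite EFinM.
  rewrite ge0_integralZl//; last 3 first.
  - by mfun.
  - by move=> y _; rewrite lee_fin sqr_ge0.
  - by rewrite lee_fin mulr_ge0 ?wt_ge0// ltW.
  rewrite EFinM -muleA; congr (_ * _)%E.
  by apply/le_anti/andP; split; [exact: plancherel_le|exact: plancherel_ge].
rewrite (Tonelli (fun e y => wt e * K0 * (expR (- e * y) * g y) ^+ 2)); last 2 first.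
- by mfun.
- by move=> e y; rewrite mulr_ge0 ?sqr_ge0// mulr_ge0 ?wt_ge0// ltW.
rewrite -ge0_integralZl//; last 3 first.
- by mfun.
- by move=> y _; rewrite lee_fin mulr_ge0 ?powR_ge0 ?sqr_ge0.
- by rewrite lee_fin mulr_ge0// ltW.
apply: eq_integral => y _; have [y1|y1] := ltP y 1.
  rewrite g1// integral0_eq => [|e _]; last by rewrite mulr0 expr0n/= mulr0.
  by rewrite expr0n/= mulr0 mule0.
have y0 : 0 < y by lra.
transitivity (\int[mu]_e ((K0 * g y ^+ 2)%:E * (wt e * expR (- 2 * e * y))%:E))%E.
  apply: eq_integral => e _; rewrite -EFinM; congr EFin.
  rewrite exprMn (_ : expR (- e * y) ^+ 2 = expR (- 2 * e * y)); first by ring.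
  by rewrite -expRM_natr; congr expR; ring.
rewrite ge0_integralZl//; last 3 first.
- by mfun.
- by move=> e _; rewrite lee_fin mulr_ge0 ?wt_ge0 ?expR_ge0.
- by rewrite lee_fin mulr_ge0 ?sqr_ge0// ltW.
by rewrite wt_exp// -!EFinM; congr EFin; ring.
Qed.

End WeightedNorm.

(** * Weighted integrals over the quarter-plane of frequencies *)

Section QuarterPlane.
Context {R : realType}.
Local Notation mu := (@lebesgue_measure R).
Implicit Types (f g : R -> R) (A B : R -> R -> R).

Lemma measurable_cnlap g : measurable_fun setT g ->
  measurable_fun setT (fun z : R * R => cn (lap g (z.1 +i* z.2)) ^+ 2).
Proof.
move=> mg; apply: measurable_funX; apply: cmeas_cn.
have p1 : measurable_fun setT (fun z : R * R * R => z.1.1).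
  exact: (measurableT_comp (@measurable_fst _ _ _ _) (@measurable_fst _ _ _ _)).
have p2 : measurable_fun setT (fun z : R * R * R => z.1.2).
  exact: (measurableT_comp (@measurable_snd _ _ _ _) (@measurable_fst _ _ _ _)).
have p3 : measurable_fun setT (fun z : R * R * R => z.2) by exact: measurable_snd.
have pg : measurable_fun setT (fun z : R * R * R => g z.2) by exact: (measurableT_comp mg p3).
have m1 : measurable_fun setT (fun z : R * R * R => Re ((g z.2)%:C * ce (z.1.1 +i* z.1.2) z.2)).
  by rewrite /=; mfun.
have m2 : measurable_fun setT (fun z : R * R * R => Im ((g z.2)%:C * ce (z.1.1 +i* z.1.2) z.2)).
  by rewrite /=; mfun.
split.
- exact: (meas_Itg _ _ (fun (z : R * R) y => Re ((g y)%:C * ce (z.1 +i* z.2) y)) m1).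
- exact: (meas_Itg _ _ (fun (z : R * R) y => Im ((g y)%:C * ce (z.1 +i* z.2) y)) m2).
Qed.

Definition meas2 A := measurable_fun setT (fun z : R * R => A z.1 z.2).

Variable al : R.
Hypotheses (al_gt : 2^-1 < al) (al_lt : al < 1).
Local Notation wt := (wt al).

(** Extended-real and defined for any integrand, so that norms of functions become pointwise
    comparisons between moduli of transforms, including majorants that are not transforms. Only
    [e > 0] and [k >= 0] contribute. *)
Definition II A : \bar R :=
  (\int[mu]_e \int[mu]_k (wt e * (if (0 <= k)%R then A e k else 0))%:E)%E.

Lemma NrmII g : Nrm al g = II (fun e k => cn (lap g (e +i* k)) ^+ 2).
Proof. by []. Qed.

Lemma measII A : meas2 A ->
  meas2 (fun e k => wt e * (if (0 <= k)%R then A e k else 0)).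
Proof.
move=> mA; have mw := measurable_wt (R := R) al; rewrite /meas2 in mA *; mfun.
Qed.

Lemma II_le A B : meas2 A -> meas2 B ->
  (forall e k, 0 < e -> 0 <= k -> 0 <= A e k <= B e k) -> (II A <= II B)%E.
Proof.
move=> /measII mA /measII mB AB.
have AB' e k : 0 <= wt e * (if 0 <= k then A e k else 0) <= wt e * (if 0 <= k then B e k else 0).
  rewrite /Submission.wt; case: ifPn => e0; last by rewrite !mul0r lexx.
  case: ifPn => k0; last by rewrite mulr0 lexx.
  have /andP[h1 h2] := AB e k e0 k0.
  by rewrite mulr_ge0 ?powR_ge0//= ler_wpM2l ?powR_ge0.
apply: ge0_le_integral => //.
- by move=> e _; apply: integral_ge0 => k _; rewrite lee_fin; case/andP: (AB' e k).
- by apply: meas_Itg_ge0 => // e k; case/andP: (AB' e k).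
- by apply: meas_Itg_ge0 => // e k; have /andP[] := AB' e k; exact: le_trans.
- move=> e _; apply: ge0_integral_le.
  + exact: (measurable_comp_pair1 (fun e k => wt e * (if 0 <= k then A e k else 0))).
  + exact: (measurable_comp_pair1 (fun e k => wt e * (if 0 <= k then B e k else 0))).
  + exact: AB'.
Qed.

Lemma II_ge0 A : (forall e k, 0 < e -> 0 <= k -> 0 <= A e k) -> (0 <= II A)%E.
Proof.
move=> A0; apply: integral_ge0 => e _; apply: integral_ge0 => k _; rewrite lee_fin.
rewrite /Submission.wt; case: ifPn => e0; last by rewrite mul0r.
by case: ifPn => k0; rewrite ?mulr0// mulr_ge0 ?powR_ge0 ?A0.
Qed.

Lemma wtif_ge0 A : (forall e k, 0 < e -> 0 <= k -> 0 <= A e k) ->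
  forall e k, 0 <= wt e * (if 0 <= k then A e k else 0).
Proof.
move=> A0 e k; rewrite /Submission.wt; case: ifPn => e0; last by rewrite mul0r.
by case: ifPn => k0; rewrite ?mulr0// mulr_ge0 ?powR_ge0 ?A0.
Qed.

Lemma II_D A B : meas2 A -> meas2 B ->
  (forall e k, 0 < e -> 0 <= k -> 0 <= A e k) ->
  (forall e k, 0 < e -> 0 <= k -> 0 <= B e k) ->
  (II (fun e k => A e k + B e k)%R = II A + II B)%E.
Proof.
move=> /measII mA /measII mB /wtif_ge0 A0 /wtif_ge0 B0.
rewrite /II -ge0_integralD//; last 4 first.
- by move=> e _; apply: integral_ge0 => k _; rewrite lee_fin.
- exact: meas_Itg_ge0.
- by move=> e _; apply: integral_ge0 => k _; rewrite lee_fin.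
- exact: meas_Itg_ge0.
apply: eq_integral => e _; rewrite -ge0_integralD//; last 4 first.
- by move=> k _; rewrite lee_fin.
- by apply/measurable_EFinP; exact: (measurable_comp_pair1 (fun e k => wt e * (if 0 <= k then A e k else 0))).
- by move=> k _; rewrite lee_fin.
- by apply/measurable_EFinP; exact: (measurable_comp_pair1 (fun e k => wt e * (if 0 <= k then B e k else 0))).
by apply: eq_integral => k _; rewrite -EFinD -mulrDr; case: ifP => _; rewrite ?addr0.
Qed.

Lemma II_Z (c : R) A : 0 <= c -> meas2 A ->
  (forall e k, 0 < e -> 0 <= k -> 0 <= A e k) ->
  (II (fun e k => c * A e k)%R = c%:E * II A)%E.
Proof.
move=> c0 /measII mA /wtif_ge0 A0; rewrite /II -ge0_integralZl//; last 2 first.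
- exact: meas_Itg_ge0.
- by move=> e _; apply: integral_ge0 => k _; rewrite lee_fin.
apply: eq_integral => e _; rewrite -ge0_integralZl//; last 2 first.
- by apply/measurable_EFinP; exact: (measurable_comp_pair1 (fun e k => wt e * (if 0 <= k then A e k else 0))).
- by move=> k _; rewrite lee_fin.
by apply: eq_integral => k _; rewrite -EFinM mulrCA; case: ifP => _; rewrite ?mulr0.
Qed.

(* Only a pointwise bound by a series is assumed, so the right-hand side may
   well be infinite. *)
Lemma II_le_series A (As : nat -> R -> R -> R) : meas2 A -> (forall n, meas2 (As n)) ->
  (forall e k, 0 < e -> 0 <= k -> 0 <= A e k) ->
  (forall n e k, 0 < e -> 0 <= k -> 0 <= As n e k) ->
  (forall e k, 0 < e -> 0 <= k -> ((A e k)%:E <= \sum_(n <oo) (As n e k)%:E)%E) ->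
  (II A <= \sum_(n <oo) II (As n))%E.
Proof.
move=> mA mAs A0 As0 AAs; have {}mA := measII _ mA.
have {}mAs n := measII _ (mAs n).
have {}A0' := wtif_ge0 _ A0; have As0' n := wtif_ge0 _ (As0 n).
rewrite /II -integral_nneseries//; last 2 first.
- by move=> n; exact: (meas_Itg_ge0 _ _ _ (mAs n) (As0' n)).
- by move=> n e _; apply: integral_ge0 => k _; rewrite lee_fin.
apply: ge0_le_integral => //.
- by move=> e _; apply: integral_ge0 => k _; rewrite lee_fin.
- exact: meas_Itg_ge0.
- apply: ge0_emeasurable_sum => [n e _ _|n _]; last exact: (meas_Itg_ge0 _ _ _ (mAs n) (As0' n)).
  by apply: integral_ge0 => k _; rewrite lee_fin.
- move=> e _; rewrite -integral_nneseries//; last 2 first.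
  + by move=> n; apply/measurable_EFinP; exact: (measurable_comp_pair1 (fun e k => wt e * (if 0 <= k then As n e k else 0)) e (mAs n)).
  + by move=> n k _; rewrite lee_fin.
  apply: ge0_le_integral => //.
  + by move=> k _; rewrite lee_fin.
  + by apply/measurable_EFinP; exact: (measurable_comp_pair1 (fun e k => wt e * (if 0 <= k then A e k else 0))).
  + apply: ge0_emeasurable_sum => [n k _ _|n _]; first by rewrite lee_fin.
    by apply/measurable_EFinP; exact: (measurable_comp_pair1 (fun e k => wt e * (if 0 <= k then As n e k else 0)) e (mAs n)).
  + move=> k _; rewrite /Submission.wt; case: ifPn => e0; last first.
      by rewrite mul0r; apply: nneseries_ge0 => n _ _; rewrite mul0r.
    case: ifPn => k0; last by rewrite mulr0; apply: nneseries_ge0.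
    rewrite EFinM (eq_eseriesr (g := fun n => (e `^ (1 - 2 * al))%:E * (As n e k)%:E)%E)//.
    rewrite nneseriesZl//; last by move=> n _; rewrite lee_fin As0.
    by apply: lee_wpmul2l; [rewrite lee_fin powR_ge0|exact: AAs].
Qed.

(** Equal to [1 / (2 - 2 al)]. *)
Definition radc : R := \int[mu]_e (if e <= 1 then wt e else 0).

Lemma L1_radc : L1 (fun e => if e <= 1 then wt e else 0).
Proof.
have ag := al_gt; have a1 := al_lt.
have a2 : -1 < 1 - 2 * al by lra.
apply: (eq_L1 _ _ _ (L1_powR_near0 _ _ a2 ltr01)) => e.
by rewrite /Submission.wt; case: (0 < e); case: (e <= 1).
Qed.

Lemma radial_inner (r : R) : 0 < r ->
  (\int[mu]_e (if (e <= r)%R then wt e else 0)%:E = (radc * r `^ (2 - 2 * al))%:E)%E.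
Proof.
move=> r0; have mw := measurable_wt (R := R) al.
pose h e := if e <= r then wt e else 0.
have mh : measurable_fun setT h by rewrite /h; mfun.
have h0 e : 0 <= h e by rewrite /h; case: ifP => // _; exact: wt_ge0.
have E := ge0_integral_scale r h r0 mh h0.
have hE e : h (r * e) = r `^ (1 - 2 * al) * (if e <= 1 then wt e else 0).
  rewrite /h -[leRHS]mulr1 (ler_pM2l r0); case: ifP => _; last by rewrite mulr0.
  rewrite /Submission.wt (pmulr_rgt0 _ r0); case: ifPn => e0; last by rewrite mulr0.
  by rewrite powRM// ltW.
have L : L1 (fun e => r `^ (1 - 2 * al) * (if e <= 1 then wt e else 0)) := L1Z _ _ L1_radc.
have : (r%:E * \int[mu]_x (h (r * x)%R)%:E = r%:E * ((r^-1)%:E * \int[mu]_x (h x)%:E))%E.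
  by congr (_ * _)%E.
rewrite muleA -EFinM mulfV ?gt_eqF// mul1e => <-.
under eq_integral do rewrite hE.
rewrite -(EFin_Itg _ L) (ItgZ _ _ L1_radc) -EFinM; congr EFin.
rewrite mulrA mulrC; congr (_ * _).
rewrite -[X in X * _](powRr1 (ltW r0)) -powRD; last by apply/implyP => _; rewrite gt_eqF.
by congr powR; ring.
Qed.

(** The quantity [e + k] replaces the modulus of [e + i k], to which it is comparable on the
    quadrant: the substitution [r = e + k] is a mere translation, and the weight over [0 < e <= r]
    integrates to a power of [r]. *)
Lemma II_radial (F : R -> R) : measurable_fun setT F -> (forall x, 0 <= F x) ->
  (II (fun e k => F (e + k))%R =
   radc%:E * \int[mu]_r (if (0 < r)%R then r `^ (2 - 2 * al) * F r else 0)%:E)%E.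
Proof.
move=> mF F0; have mw := measurable_wt (R := R) al.
have r0 : 0 <= radc.
  by apply: Itg_ge0 => e; case: ifP => // _; exact: wt_ge0.
transitivity (\int[mu]_e \int[mu]_r (wt e * (if (e <= r)%R then F r else 0))%:E)%E.
  apply: eq_integral => e _.
  have := @ge0_integral_affine R 1 (- e) (fun k => wt e * (if 0 <= k then F (e + k) else 0)) ltr01.
  rewrite invr1 mul1e => <-.
  - apply: eq_integral => r _; rewrite mul1r subr_ge0 (_ : e + (r - e) = r)//; ring.
  - by mfun.
  - by move=> k; rewrite mulr_ge0 ?wt_ge0//; case: ifP.
rewrite (Tonelli (fun e r => wt e * (if (e <= r)%R then F r else 0))); last 2 first.
- by mfun.
- by move=> e k; rewrite mulr_ge0 ?wt_ge0//; case: ifP.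
rewrite -ge0_integralZl//; last 2 first.
- by mfun.
- by move=> r _; rewrite lee_fin; case: ifP => // _; rewrite mulr_ge0 ?powR_ge0.
apply: eq_integral => r _; have [rp|rn] := ltP 0 r; last first.
  rewrite mule0 integral0_eq// => e _; rewrite /Submission.wt.
  case: ifPn => e0; last by rewrite mul0r.
  by rewrite leNgt (le_lt_trans rn e0) mulr0.
transitivity (\int[mu]_e ((F r)%:E * (if (e <= r)%R then wt e else 0)%:E))%E.
  apply: eq_integral => e _; rewrite -EFinM; congr EFin.
  by case: ifP; rewrite ?mulr0// mulrC.
rewrite ge0_integralZl//; last 3 first.
- by mfun.
- by move=> e _; rewrite lee_fin; case: ifP => // _; exact: wt_ge0.
- by rewrite lee_fin.
by rewrite radial_inner// -!EFinM; congr EFin; ring.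
Qed.

End QuarterPlane.

Lemma measurable_sqrt {R : realType} : measurable_fun setT (@Num.sqrt R).
Proof. by apply: continuous_measurable_fun => x; exact: sqrt_continuous. Qed.

(** * A Hardy inequality for the kernel min(1, r y) *)

Section Hardy.
Context {R : realType}.
Local Notation mu := (@lebesgue_measure R).
Implicit Types (f g v w : R -> R).

Lemma cauchy_schwarz f g : measurable_fun setT f -> measurable_fun setT g ->
  L1 (fun x => f x ^+ 2) -> L1 (fun x => g x ^+ 2) ->
  L1 (fun x => f x * g x) /\
  (\int[mu]_x (f x * g x)) ^+ 2 <= (\int[mu]_x (f x ^+ 2)) * (\int[mu]_x (g x ^+ 2)).
Proof.
move=> mf mg f2 g2.
have fg : L1 (fun x => f x * g x).
  have mfg : measurable_fun setT (fun x => f x * g x) by mfun.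
  apply: (L1_le _ _ mfg _ (L1D _ _ f2 g2)) => x.
  rewrite ler_norml; apply/andP; split; rewrite -subr_ge0.
    rewrite (_ : _ - _ = 2^-1 * ((f x + g x) ^+ 2 + f x ^+ 2 + g x ^+ 2)); last by field.
    by rewrite mulr_ge0 ?invr_ge0// !addr_ge0 ?sqr_ge0.
  rewrite (_ : _ - _ = 2^-1 * ((f x - g x) ^+ 2 + f x ^+ 2 + g x ^+ 2)); last by field.
  by rewrite mulr_ge0 ?invr_ge0// !addr_ge0 ?sqr_ge0.
split => //.
set a := \int[mu]_x (f x ^+ 2); set b := \int[mu]_x (g x ^+ 2); set c := \int[mu]_x (f x * g x).
have P t : 0 <= a - 2 * t * c + t ^+ 2 * b.
  have l1 : L1 (fun x => (- 2 * t) * (f x * g x)) := L1Z _ _ fg.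
  have l2 : L1 (fun x => t ^+ 2 * g x ^+ 2) := L1Z _ _ g2.
  have -> : a - 2 * t * c + t ^+ 2 * b =
      \int[mu]_x (f x ^+ 2 + (- 2 * t) * (f x * g x) + t ^+ 2 * g x ^+ 2).
    rewrite (ItgD _ _ (L1D _ _ f2 l1) l2) (ItgD _ _ f2 l1) (ItgZ _ _ fg) (ItgZ _ _ g2).
    by rewrite -/a -/b -/c; ring.
  apply: Itg_ge0 => x.
  by rewrite (_ : _ + _ = (f x - t * g x) ^+ 2) ?sqr_ge0//; ring.
have a0 : 0 <= a by apply: Itg_ge0 => x; exact: sqr_ge0.
have b0 : 0 <= b by apply: Itg_ge0 => x; exact: sqr_ge0.
move: (b0); rewrite le_eqVlt => /predU1P[bz|bp]; last first.
  have := P (c / b); rewrite (_ : _ + _ = (a * b - c ^+ 2) / b); last first.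
    by field; rewrite gt_eqF.
  by rewrite pmulr_lge0 ?invr_gt0// subr_ge0.
have [->|c0] := eqVneq c 0; first by rewrite expr0n/= mulr_ge0.
(* When the integral of [g^2] is 0 the polynomial is affine in [t]; this [t] makes it equal to [-1],
   so [c] must vanish. *)
have := P ((a + 1) / (2 * c)); rewrite -bz mulr0 addr0.
rewrite (_ : _ - _ = - 1); last by field.
by rewrite lerNr oppr0 ler10.
Qed.

Lemma ae0_le_L1 (F : R -> R) : measurable_fun setT F -> (forall x, 0 <= F x) ->
  (\int[mu]_x (F x)%:E < +oo)%E -> L1 F.
Proof.
by move=> mF F0 Fo; apply: L1P => //; under eq_integral => x _ do rewrite ger0_norm//.
Qed.

Variable gm : R.
Hypotheses (gm1 : 2^-1 < gm) (gm2 : gm < 3 / 2).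

(** Pointwise, [|w|] is at most [y^(2 gm) w^2 + y^(- 2 gm)], and the last power is integrable at
    infinity because [2 gm > 1]. *)
Lemma L2w_L1 w : measurable_fun setT w -> (forall y, y < 1 -> w y = 0) ->
  L1 (fun y => y `^ (2 * gm) * w y ^+ 2) -> L1 w.
Proof.
move=> mw w1 w2; have g1 := gm1.
have a : - (2 * gm) < -1 by lra.
apply: (L1_le _ _ mw _ (L1D _ _ w2 (L1_powR_oo _ _ a ltr01))) => y.
have [y1|y1] := leP 1 y; last by rewrite w1// normr0 expr0n/= mulr0 addr0.
have y0 : 0 < y by lra.
have y0' : 0 < y by lra.
rewrite powRN.
have := powR_gt0 (2 * gm) y0; move: (y `^ _) => p p0.
rewrite -(ler_pM2l p0) mulrDr divff ?gt_eqF// -[w y ^+ 2]real_normK ?num_real//.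
set a1 : R := `|w y|; suff h : p * a1 <= p * (p * (a1 * a1)) + 1 by exact: h.
have := sqr_ge0 (p * a1 - 1); have := sqr_ge0 (p * a1); rewrite !expr2; clearbody a1; clear; lra.
Qed.

(** Half of the room left by the conditions [gm < 3/2] (behaviour at 0) and [gm > 1/2] (behaviour at
    infinity). *)
Let de := Num.min (3 - 2 * gm) (2 * gm - 1) / 2.

Let de_bnd : [/\ 0 < de, de < 3 - 2 * gm & de < 2 * gm - 1].
Proof.
have g1 := gm1; have g2 := gm2.
rewrite /de; case: (leP (3 - 2 * gm) (2 * gm - 1)) => h; split; lra.
Qed.

(** Together with [phi2] it factorises the kernel [x^(-1 - 2 gm) min(1, x)^2] into two integrable
    functions, as Cauchy-Schwarz requires; the exponents at 0 and at infinity are shifted by [de] in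
    opposite directions. *)
Definition phi1 (x : R) := (if (0 < x) && (x <= 1) then x `^ (de - 1) else 0) +
  (if 1 < x then x `^ (- de - 1) else 0).

Definition phi2 (x : R) := (if (0 < x) && (x <= 1) then x `^ (2 - de - 2 * gm) else 0) +
  (if 1 < x then x `^ (de - 2 * gm) else 0).

Lemma L1_phi1 : L1 phi1.
Proof.
have [d0 d1 d2] := de_bnd.
have e1 : -1 < de - 1 by lra.
have e2 : - de - 1 < -1 by lra.
apply: L1D; first exact: (L1_powR_near0 _ _ e1 ltr01).
have m : measurable_fun setT (fun x : R => if 1 < x then x `^ (- de - 1) else 0) by mfun.
apply: (L1_le _ _ m _ (L1_powR_oo _ _ e2 ltr01)) => x.
case: ltP => h; last by rewrite normr0; case: ifP => // _; exact: powR_ge0.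
by rewrite (ltW h) ger0_norm ?powR_ge0.
Qed.

Lemma L1_phi2 : L1 phi2.
Proof.
have [d0 d1 d2] := de_bnd.
have e1 : -1 < 2 - de - 2 * gm by lra.
have e2 : de - 2 * gm < -1 by lra.
apply: L1D; first exact: (L1_powR_near0 _ _ e1 ltr01).
have m : measurable_fun setT (fun x : R => if 1 < x then x `^ (de - 2 * gm) else 0) by mfun.
apply: (L1_le _ _ m _ (L1_powR_oo _ _ e2 ltr01)) => x.
case: ltP => h; last by rewrite normr0; case: ifP => // _; exact: powR_ge0.
by rewrite (ltW h) ger0_norm ?powR_ge0.
Qed.

Lemma phi_ge0 x : 0 <= phi1 x /\ 0 <= phi2 x.
Proof. by split; rewrite addr_ge0//; case: ifP => // _; exact: powR_ge0. Qed.

Lemma phi12 x : 0 < x -> phi1 x * phi2 x = x `^ (- 1 - 2 * gm) * Num.min 1 x ^+ 2.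
Proof.
move=> x0; have xn : x != 0 by rewrite gt_eqF.
have D a b : x `^ a * x `^ b = x `^ (a + b) by rewrite -powRD//; apply/implyP.
rewrite /phi1 /phi2 x0/=; case: leP => h.
  rewrite !addr0 D -(powR_mulrn 2 (ltW x0)) D; congr powR; rewrite -[2%:R]/2; ring.
by rewrite !add0r expr1n mulr1 D; congr powR; ring.
Qed.

(** With [r = Re xi + Im xi], this bounds [int w - lap w xi] up to a factor 2, and [r] times the
    part of [lap (y w) xi] coming from [y < 1 / r]. *)
Definition hrd w (r : R) := \int[mu]_y (`|w y| * Num.min 1 (r * y)).

Lemma measurable_min (d : measure_display) (T : measurableType d) (F : T -> R) :
  measurable_fun setT F -> measurable_fun setT (fun x => Num.min 1 (F x)).
Proof.
move=> mF; rewrite (_ : (fun x => _) = fun x => if F x < 1 then F x else 1); first by mfun.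
by apply: funext => x; case: (ltP (F x) 1).
Qed.

Lemma measurable_hrd w : measurable_fun setT w -> measurable_fun setT (hrd w).
Proof.
move=> mw.
have m0 : measurable_fun setT (fun z : R * R => z.1 * z.2) by mfun.
have m1 := measurable_min _ _ _ m0.
have m : measurable_fun setT (fun z : R * R => `|w z.2| * Num.min 1 (z.1 * z.2)) by mfun.
exact: (meas_Itg _ _ (fun r y : R => `|w y| * Num.min 1 (r * y)) m).
Qed.

Lemma hrd_ge0 w r : (forall y, y < 1 -> w y = 0) -> 0 < r -> 0 <= hrd w r.
Proof.
move=> w1 r0; apply: Itg_ge0 => y; have [y1|y1] := ltP y 1; first by rewrite w1// normr0 mul0r.
by rewrite mulr_ge0// le_min ler01/= mulr_ge0// ?ltW//; lra.
Qed.

(** The added 1 makes it positive, so that its product with an infinite integral is infinite. *)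
Definition C2 : R := \int[mu]_x phi2 x + 1.

Lemma C2_gt0 : 0 < C2.
Proof. by rewrite ltr_wpDl// Itg_ge0// => x; case: (phi_ge0 x). Qed.

(** Cauchy-Schwarz for the square roots of [F] and [G]: the product [F G] is the square of
    [r^(- gm) |w| min(1, r y)] by [phi12], and [G] has the mass of [phi2] whatever [r]. *)
Lemma hrd_sq w (r : R) : measurable_fun setT w -> (forall y, y < 1 -> w y = 0) ->
  L1 w -> 0 < r ->
  ((r `^ (- (2 * gm)) * hrd w r ^+ 2)%:E <=
   C2%:E * \int[mu]_y (phi1 (r * y) * (y * (y `^ (2 * gm) * w y ^+ 2)))%:E)%E.
Proof.
move=> mw w1 w2 r0.
have p1 := L1_meas _ L1_phi1; have p2 := L1_meas _ L1_phi2.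
have mr : measurable_fun setT (fun y : R => r * y) by mfun.
have q1 := measurable_comp_real _ _ _ _ p1 mr.
have q2 := measurable_comp_real _ _ _ _ p2 mr.
pose F y := phi1 (r * y) * (y * (y `^ (2 * gm) * w y ^+ 2)).
pose G y := phi2 (r * y) * r.
have mF : measurable_fun setT F by rewrite /F; mfun.
have F0 y : 0 <= F y.
  have [y1|y1] := ltP y 1; first by rewrite /F w1// expr0n/= !mulr0.
  case: (phi_ge0 (r * y)) => h _; have y0 : 0 <= y by lra.
  exact: (mulr_ge0 h (mulr_ge0 y0 (mulr_ge0 (powR_ge0 _ _) (sqr_ge0 _)))).
have G0 y : 0 <= G y by case: (phi_ge0 (r * y)) => _ h; rewrite mulr_ge0// ltW.
have [Fo|Ffin] := eqVneq (\int[mu]_y (F y)%:E)%E +oo%E.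
  by rewrite Fo gt0_muley ?lte_fin ?C2_gt0// leey.
have LF : L1 F.
  apply: (ae0_le_L1 _ mF F0); rewrite ltey; exact: Ffin.
have [LG' EG] := L1_affine r 0 phi2 r0 L1_phi2.
have LG : L1 G.
  by apply: (eq_L1 _ _ _ (L1Z r _ LG')) => y; rewrite /G addr0 mulrC.
have IG : \int[mu]_x G x = \int[mu]_x phi2 x.
  transitivity (\int[mu]_x (r * phi2 (r * x + 0))).
    by apply: eq_Itg => y; rewrite /G addr0 mulrC.
  by rewrite (ItgZ _ _ LG') EG mulrA divff ?mul1r// gt_eqF.
have mf : measurable_fun setT (fun y => Num.sqrt (F y)).
  exact: (measurable_comp_real _ _ _ _ measurable_sqrt mF).
have mg : measurable_fun setT (fun y => Num.sqrt (G y)).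
  have mG := L1_meas _ LG.
  exact: (measurable_comp_real _ _ _ _ measurable_sqrt mG).
have Lf : L1 (fun x => Num.sqrt (F x) ^+ 2) by apply: (eq_L1 _ _ _ LF) => y; rewrite sqr_sqrtr.
have Lg : L1 (fun x => Num.sqrt (G x) ^+ 2) by apply: (eq_L1 _ _ _ LG) => y; rewrite sqr_sqrtr.
have [_] := cauchy_schwarz _ _ mf mg Lf Lg.
rewrite (eq_Itg _ F (fun y => sqr_sqrtr (F0 y))) (eq_Itg _ G (fun y => sqr_sqrtr (G0 y))) IG.
have -> : \int[mu]_x (Num.sqrt (F x) * Num.sqrt (G x)) = r `^ (- gm) * hrd w r.
  rewrite -ItgZ; last first.
    have mm := measurable_min _ _ _ mr.
    have m : measurable_fun setT (fun y => `|w y| * Num.min 1 (r * y)) by mfun.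
    apply: (L1_le _ _ m _ (L1_norm _ w2)) => y.
    have [y1|y1] := ltP y 1; first by rewrite w1// normr0 mul0r normr0.
    rewrite normrM normr_id ler_piMr// ger0_norm ?ge_min ?lexx//.
    by rewrite le_min ler01/= mulr_ge0// ltW// (lt_le_trans ltr01).
  apply: eq_Itg => y; rewrite -sqrtrM//.
  have [y1|y1] := ltP y 1; first by rewrite /F w1// expr0n/= normr0 !(mulr0,mul0r) sqrtr0.
  have y0 : 0 < y := lt_le_trans ltr01 y1.
  have ry0 : 0 < r * y by rewrite mulr_gt0.
  have E0 : F y * G y = (phi1 (r * y) * phi2 (r * y)) * ((r * y) * y `^ (2 * gm)) * w y ^+ 2.
    by rewrite /F /G; ring.
  have E1 : (r * y) `^ (-1 - 2 * gm) = (r * y)^-1 * (r `^ (- gm) ^+ 2 * (y `^ (2 * gm))^-1).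
    rewrite powRD; last by rewrite (gt_eqF ry0) implybT.
    rewrite powR_inv1 ?(ltW ry0)// powRM ?(ltW r0) ?(ltW y0)// -(powRN y); congr (_ * (_ * _)).
    by rewrite -(powR_mulrn 2 (powR_ge0 _ _)) -powRrM; congr powR; ring.
  have -> : F y * G y = (r `^ (- gm) * (`|w y| * Num.min 1 (r * y))) ^+ 2.
    rewrite E0 (phi12 _ ry0) E1 [in RHS]exprMn [in RHS]exprMn [`|w y| ^+ 2]real_normK ?num_real//.
    have := powR_gt0 (2 * gm) y0; move: (y `^ _) => yp yp0.
    by field; rewrite !gt_eqF.
  have m0 : 0 <= Num.min 1 (r * y) by rewrite le_min ler01/= ltW.
  by rewrite sqrtr_sqr ger0_norm// (mulr_ge0 (powR_ge0 _ _) (mulr_ge0 (normr_ge0 _) m0)).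
move=> CS; rewrite -(EFin_Itg _ LF) -EFinM lee_fin.
rewrite exprMn -(powR_mulrn 2 (powR_ge0 _ _)) -powRrM in CS.
rewrite (_ : - gm * 2%:R = - (2 * gm)) in CS; last by ring.
apply: (le_trans CS); rewrite mulrC ler_wpM2r ?Itg_ge0//.
by rewrite /C2 lerDl.
Qed.

(** After integrating [hrd_sq] in [r] and exchanging the integrals, the substitution [x = r y]
    consumes the factor [y], and the inner integral is the mass of [phi1]. *)
Lemma hardy w : measurable_fun setT w -> (forall y, y < 1 -> w y = 0) ->
  L1 (fun y => y `^ (2 * gm) * w y ^+ 2) ->
  (\int[mu]_r (if (0 < r)%R then r `^ (- (2 * gm)) * hrd w r ^+ 2 else 0)%:E < +oo)%E.
Proof.
move=> mw w1 w2; have wL := L2w_L1 _ mw w1 w2.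
pose H r y := if 0 < r then phi1 (r * y) * (y * (y `^ (2 * gm) * w y ^+ 2)) else 0.
have p1 := L1_meas _ L1_phi1.
have m0 : measurable_fun setT (fun z : R * R => z.1 * z.2) by mfun.
have m1 : measurable_fun setT (fun z : R * R => phi1 (z.1 * z.2)).
  exact: (measurableT_comp p1 m0).
have mH : measurable_fun setT (fun z : R * R => H z.1 z.2) by rewrite /H; mfun.
have H0 x y : 0 <= H x y.
  rewrite /H; case: ifP => // x0; have [y1|y1] := ltP y 1; first by rewrite w1// expr0n/= !mulr0.
  case: (phi_ge0 (x * y)) => h _; have y0 : 0 <= y by lra.
  exact: (mulr_ge0 h (mulr_ge0 y0 (mulr_ge0 (powR_ge0 _ _) (sqr_ge0 _)))).
have mh := measurable_hrd _ mw.
have mh2 : measurable_fun setT (fun r : R => if 0 < r then r `^ (- (2 * gm)) * hrd w r ^+ 2 else 0) by mfun.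
apply: (@le_lt_trans _ _ (C2%:E * \int[mu]_r \int[mu]_y (H r y)%:E)%E).
  rewrite -ge0_integralZl//; last 3 first.
  - exact: (meas_Itg_ge0 _ _ _ mH H0).
  - by move=> x _; apply: integral_ge0 => y _; rewrite lee_fin.
  - by rewrite lee_fin ltW// C2_gt0.
  apply: ge0_le_integral => //.
  - by move=> r _; rewrite lee_fin; case: ifP => // _; rewrite mulr_ge0 ?powR_ge0 ?sqr_ge0.
  - exact/measurable_EFinP.
  - by apply: emeasurable_funM => //; exact: (meas_Itg_ge0 _ _ _ mH H0).
  move=> r _; rewrite /H; case: ifP => r0; first exact: hrd_sq.
  by rewrite mule_ge0// ?lee_fin ?(ltW C2_gt0)// integral_ge0.
rewrite (Tonelli _ mH H0).
have -> : (\int[mu]_y \int[mu]_x (H x y)%:E = \int[mu]_y ((\int[mu]_x phi1 x) * (y `^ (2 * gm) * w y ^+ 2))%:E)%E.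
  apply: eq_integral => y _; rewrite /H.
  have [y1|y1] := ltP y 1.
    rewrite w1// expr0n/= !mulr0; apply: integral0_eq => x _.
    by rewrite !mulr0; case: ifP.
  have y0 : 0 < y by lra.
  transitivity (\int[mu]_x ((y * (y `^ (2 * gm) * w y ^+ 2))%:E * (phi1 (y * x))%:E))%E.
    apply: eq_integral => x _; rewrite -EFinM; congr EFin; rewrite mulrC (mulrC x).
    case: ifPn => // x0; rewrite /phi1 pmulr_rgt0// (negbTE x0)/= ltNge.
    by rewrite (le_trans (_ : _ <= 0))//= ?addr0 ?mulr0// pmulr_rle0// leNgt.
  have mr : measurable_fun setT (fun x : R => y * x) by mfun.
  have q1 := measurable_comp_real _ _ _ _ p1 mr.
  rewrite ge0_integralZl//; last 3 first.
  - exact/measurable_EFinP.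
  - by move=> x _; rewrite lee_fin; case: (phi_ge0 (y * x)).
  - by rewrite lee_fin (mulr_ge0 (ltW y0) (mulr_ge0 (powR_ge0 _ _) (sqr_ge0 _))).
  rewrite (ge0_integral_scale _ _ y0 p1); last by move=> x; case: (phi_ge0 x).
  rewrite -(EFin_Itg _ L1_phi1) -!EFinM; congr EFin; field; by rewrite gt_eqF.
rewrite -(EFin_Itg _ (L1Z _ _ w2)) -EFinM; exact: ltry.
Qed.

End Hardy.

Local Notation K0 := (@arctan_mass _).

(** * Dyadic decomposition of the transform of y w at low frequency *)

Section Dyadic.
Context {R : realType}.

Lemma dyadic_bracket (x : R) : 1 < x -> exists j : nat, 2 ^+ j < x /\ x <= 2 ^+ j.+1.
Proof.
move=> x1.
have P : exists n : nat, x <= 2 ^+ n.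
  exists (Num.truncn x).+1; have := truncnS_gt x => h.
  rewrite (le_trans (ltW h))// -natrX ler_nat; exact: ltnW (ltn_expl _ _).
have [n xn mn] := ex_minnP P; case: n xn mn => [|j] xn mn; first by move: xn; rewrite expr0 leNgt x1.
by exists j; split => //; rewrite ltNge; apply/negP => /mn; rewrite ltnn.
Qed.

Variable a : R.
Hypothesis a_gt1 : 1 < a.

(** A geometric sum is controlled by its last term: all indices up to the last selected one are
    added, and at that index the power is at most [Y]. *)
Lemma dyadic_sum_le (b : nat -> bool) (m : nat) (Y : R) : 0 <= Y ->
  (forall i, b i -> a ^+ i <= Y) ->
  \sum_(i < m) (if b i then a ^+ i.+1 else 0) <= a ^+ 2 / (a - 1) * Y.
Proof.
move=> Y0 bY; have a1 := a_gt1; have a10 : 0 < a - 1 by lra.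
have geo k : \sum_(i < k) (if b i then a ^+ i.+1 else 0) <= a * a ^+ k / (a - 1).
  elim: k => [|k IH]; first by rewrite big_ord0 expr0 mulr1 divr_ge0//; lra.
  rewrite big_ord_recr/=; have ak : 0 < a ^+ k by rewrite exprn_gt0//; lra.
  have h : (if b k then a ^+ k.+1 else 0) <= a * a ^+ k.
    by case: ifP => _; rewrite ?exprS// mulr_ge0 ?(ltW ak)//; lra.
  apply: (le_trans (lerD IH h)); rewrite le_eqVlt; apply/orP; left; apply/eqP.
  by rewrite [in RHS]exprS; field; rewrite gt_eqF.
elim: m => [|m IH].
  by rewrite big_ord0 mulr_ge0// divr_ge0 ?sqr_ge0// ltW.
case bm : (b m); last by rewrite big_ord_recr/= bm addr0.
apply: (le_trans (geo m.+1)).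
rewrite (_ : a * a ^+ m.+1 / (a - 1) = a ^+ 2 / (a - 1) * a ^+ m); last first.
  by rewrite exprS expr2; ring.
by apply: ler_wpM2l (bY _ bm); rewrite divr_ge0 ?sqr_ge0// ltW.
Qed.
End Dyadic.

Section Kernel.
Context {R : realType}.
Local Notation mu := (@lebesgue_measure R).
Implicit Types (f g v w : R -> R).
Variables al th : R.
Hypotheses (al_gt : 2^-1 < al) (al_lt : al < 1) (th_gt : 0 < th) (gm_lt : al + th < 3 / 2).
Let gm := al + th.

Variable w : R -> R.
Hypotheses (mw : measurable_fun setT w) (w1 : forall y, y < 1 -> w y = 0)
  (w2 : L1 (fun y => y `^ (2 * gm) * w y ^+ 2)).

Let gm1 : 2^-1 < gm. Proof. rewrite /gm; have h1 := al_gt; have h2 := th_gt; lra. Qed.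

Lemma w_L1 : L1 w.
Proof. exact: L2w_L1 gm1 _ mw w1 w2. Qed.

Lemma w_causal : causal w.
Proof. by move=> y y0; apply: w1; rewrite (lt_trans y0). Qed.

Lemma w_LTall : LTall w.
Proof. by move=> e e0; apply: L1_LT (ltW e0) w_causal w_L1. Qed.

Definition hrdF (r : R) : R := if 0 < r then r `^ (- (2 + 2 * th)) * hrd w r ^+ 2 else 0.

Lemma measurable_hrdF : measurable_fun setT hrdF.
Proof. have mh := measurable_hrd w mw; rewrite /hrdF; mfun. Qed.

Lemma hrdF_ge0 r : 0 <= hrdF r.
Proof. by rewrite /hrdF; case: ifP => // _; rewrite mulr_ge0 ?powR_ge0 ?sqr_ge0. Qed.

Lemma II_hrdF : (II al (fun e k => hrdF (e + k)%R) < +oo)%E.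
Proof.
rewrite (II_radial _ al_gt al_lt _ measurable_hrdF hrdF_ge0).
apply: lte_mul_pinfty => //.
  rewrite lee_fin Itg_ge0// => e; case: ifP => // _; exact: (wt_ge0 al).
apply: le_lt_trans (hardy gm gm1 gm_lt w mw w1 w2).
rewrite le_eqVlt; apply/orP; left; apply/eqP; apply: eq_integral => r _; congr EFin.
rewrite /hrdF; case: ifP => // r0.
have -> : - (2 * gm) = (2 - 2 * al) + - (2 + 2 * th) by rewrite /gm; ring.
rewrite [in RHS]powRD; last by rewrite (gt_eqF r0) implybT.
by rewrite r0 mulrA.
Qed.

(** The part of [y w] beyond the cut-off [2^j], with [2^j] later chosen of order [1 / |xi|]. *)
Definition ytail (j : nat) (y : R) : R := if 2 ^+ j <= y then y * w y else 0.

Lemma ytail_le j y : `|ytail j y| <= `|y * w y|.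
Proof. by rewrite /ytail; case: ifP => // _; rewrite normr0. Qed.

Lemma yw_LTall : LTall (fun y => y * w y).
Proof. exact: LTall_id w_causal w_LTall. Qed.

Lemma ytail_LTall j : LTall (ytail j).
Proof.
move=> e e0; have m : measurable_fun setT (ytail j) by rewrite /ytail; mfun.
exact: (LT_le _ _ _ m (ytail_le j) (LT_norm _ _ (yw_LTall e e0))).
Qed.

(** Below the cut-off one has [(e + k) y < 1], hence [y |w| = (e + k)^-1 |w| min(1, (e + k) y)],
    which integrates to the Hardy term; beyond it nothing is estimated. *)
Lemma cn_lap_yw (j : nat) (e k : R) : 0 < e -> 0 <= k -> (e + k) * 2 ^+ j < 1 ->
  cn (lap (fun y => y * w y) (e +i* k)) <=
  (e + k)^-1 * hrd w (e + k) + cn (lap (ytail j) (e +i* k)).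
Proof.
move=> e0 k0 jr; have r0 : 0 < e + k by rewrite ltr_wpDr.
have h1 := yw_LTall e e0; have h2 := ytail_LTall j e e0.
rewrite -lerBlDr; apply: (le_trans (cn_le_add _ _)).
rewrite -(lapB _ _ (e +i* k) h1 h2).
have m2 := LT_meas _ _ h2.
have m : measurable_fun setT (fun y : R => y * w y - ytail j y) by mfun.
have mi : measurable_fun setT (fun y : R => ((e + k : R) * y : R)) by mfun.
have mm := measurable_min _ _ _ mi.
pose g y := (e + k)^-1 * (`|w y| * Num.min 1 ((e + k) * y)).
have mg : measurable_fun setT g by rewrite /g; mfun.
have g0 y : 0 <= g y.
  have [y1|y1] := ltP y 1; first by rewrite /g w1// normr0 mul0r mulr0.
  have y0 : 0 < y := lt_le_trans ltr01 y1.
  by rewrite /g mulr_ge0 ?invr_ge0 ?(ltW r0)// mulr_ge0// le_min ler01/= mulr_ge0// ltW.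
have Lg : L1 g.
  apply: (L1_le _ _ mg _ (L1Z (e + k)^-1 _ (L1_norm _ w_L1))) => y.
  by rewrite ger0_norm// /g ler_wpM2l ?invr_ge0 ?(ltW r0)// ler_piMr// ge_min lexx.
have hg : LT (Re (e +i* k)) g.
  apply: (L1_LT _ _ (ltW e0) _ Lg) => y y0; rewrite /g w1 ?normr0 ?mul0r ?mulr0//.
  exact: lt_trans y0 ltr01.
have fg y : `|y * w y - ytail j y| <= g y.
  rewrite /ytail; case: ifPn => [_|]; first by rewrite subrr normr0.
  rewrite -ltNge subr0 => yj; have [y1|y1] := ltP y 1; first by rewrite w1// mulr0 normr0.
  have y0 : 0 < y := lt_le_trans ltr01 y1.
  have ry : (e + k) * y < 1 by apply: lt_trans jr; rewrite ltr_pM2l.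
  rewrite /g min_r ?(ltW ry)// normrM (gtr0_norm y0).
  rewrite (_ : (e + k)^-1 * (`|w y| * ((e + k) * y)) = y * `|w y|)//.
  by field; rewrite gt_eqF.
apply: (le_trans (cn_lap _ _ _ hg m fg)).
rewrite /hrd -ItgZ.
  apply: (Itg_le _ _ hg).
    by apply: (eq_L1 _ _ _ Lg).
  move=> y; rewrite -[leRHS]mul1r -[X in _ <= 1 * X]/(g y).
  have [y1|y1] := ltP y 1; first by rewrite /g w1// normr0 mul0r !mulr0.
  rewrite ler_wpM2r//.
  by rewrite -expR0 ler_expR /= mulNr oppr_le0 mulr_ge0 ?(ltW e0)// (le_trans ler01).
by apply: (eq_L1 _ _ _ (L1Z (e + k) _ Lg)) => y; rewrite /g mulVKf// gt_eqF.
Qed.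

Let a2 := 2 `^ (2 * th) : R.

Let a2_gt1 : 1 < a2.
Proof.
have h := th_gt; rewrite /a2 /powR pnatr_eq0/= expR_gt1 mulr_gt0 ?mulr_gt0// ln_gt0// ltr1n//.
Qed.

(** The squared transform of [y w] with the loss [|xi|^(-2 th)] caused by dividing by [1 - B] at low
    frequency. *)
Definition kernF (e k : R) : R :=
  if e + k < 1 then (e + k) `^ (- (2 * th)) * cn (lap (fun y => y * w y) (e +i* k)) ^+ 2 else 0.

(** Term 0 is the Hardy part; term [j + 1] is the tail beyond [2^j], with a weight that dominates
    [(e + k)^(- 2 th)] when [1 / (e + k) <= 2^(j+1)]. The cut-off depends on the frequency, so the
    whole series serves as a majorant. *)
Definition kerns (n : nat) (e k : R) : R := match n with
  | 0%N => 2 * hrdF (e + k)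
  | j.+1 => (2 * a2 ^+ j.+1) * cn (lap (ytail j) (e +i* k)) ^+ 2 end.

Lemma meas2_kerns n : meas2 (kerns n).
Proof.
case: n => [|j]; rewrite /meas2/=.
  have m : measurable_fun setT (fun z : R * R => z.1 + z.2) by mfun.
  have h := measurable_comp_real _ _ _ _ measurable_hrdF m; mfun.
have h := measurable_cnlap _ (LT_meas _ _ (ytail_LTall j 1 ltr01)); mfun.
Qed.

Lemma meas2_kernF : meas2 kernF.
Proof.
have h := measurable_cnlap _ (LT_meas _ _ (yw_LTall 1 ltr01)); rewrite /meas2 /kernF; mfun.
Qed.

Lemma kerns_ge0 n e k : 0 <= kerns n e k.
Proof.
have a0 : 0 <= a2 := le_trans ler01 (ltW a2_gt1).
case: n => [|j]; first by rewrite /= mulr_ge0 ?hrdF_ge0.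
by rewrite /= mulr_ge0 ?sqr_ge0// mulr_ge0// exprn_ge0.
Qed.

Lemma kernF_le e k : 0 < e -> 0 <= k -> exists j, kernF e k <= kerns 0 e k + kerns j.+1 e k.
Proof.
move=> e0 k0; have r0 : 0 < e + k by rewrite ltr_wpDr.
rewrite /kernF; case: ifPn => r1; last first.
  by exists 0%N; rewrite addr_ge0 ?kerns_ge0.
have [j [j1 j2]] : exists j : nat, 2 ^+ j < (e + k)^-1 /\ (e + k)^-1 <= 2 ^+ j.+1.
  by apply: dyadic_bracket; rewrite invf_gt1.
exists j; have jr : (e + k) * 2 ^+ j < 1 by rewrite -ltr_pdivlMl// mulr1.
have := cn_lap_yw j e k e0 k0 jr; rewrite /= /hrdF r0.
set X := cn _; set Y := cn _; set H := hrd _ _ => hX.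
have X0 : 0 <= X := cn_ge0 _; have Y0 : 0 <= Y := cn_ge0 _.
have hX2 : X ^+ 2 <= 2 * ((e + k)^-1 * H) ^+ 2 + 2 * Y ^+ 2.
  have h : X ^+ 2 <= ((e + k)^-1 * H + Y) ^+ 2.
    by rewrite ler_sqr ?nnegrE// (le_trans X0).
  apply: (le_trans h); have := sqr_ge0 ((e + k)^-1 * H - Y); move: (_ * H) => Z hZ.
  rewrite -subr_ge0 (_ : _ - _ = (Z - Y) ^+ 2)//; ring.
apply: (@le_trans _ _ ((e + k) `^ (- (2 * th)) * (2 * ((e + k)^-1 * H) ^+ 2 + 2 * Y ^+ 2))).
  by rewrite ler_wpM2l// powR_ge0.
rewrite mulrDr; apply: lerD.
  rewrite (_ : - (2 + 2 * th) = - 2%:R + - (2 * th)); last by ring.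
  rewrite powRD; last by apply/implyP => _; rewrite gt_eqF.
  rewrite (powRN _ 2%:R) (powR_mulrn 2 (ltW r0)) exprMn exprVn le_eqVlt; apply/orP; left; apply/eqP; ring.
rewrite mulrA ler_wpM2r ?sqr_ge0// mulrC ler_wpM2l//.
have -> : (e + k) `^ (- (2 * th)) = (e + k)^-1 `^ (2 * th).
  by rewrite -(powR_inv1 (ltW r0)) -powRrM mulN1r.
have -> : a2 ^+ j.+1 = (2 ^+ j.+1) `^ (2 * th).
  by rewrite /a2 -(powR_mulrn j.+1 (powR_ge0 _ _)) -(powR_mulrn j.+1 (ler0n R 2)) -!powRrM mulrC.
by rewrite ge0_ler_powR ?nnegrE ?invr_ge0 ?(ltW r0) ?exprn_ge0// mulr_ge0// ltW.
Qed.

(** A fixed power [|xi|^(-2 th)] cannot be read off from Plancherel's formula directly. Each tail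
    term is the transform of a fixed function, so its norm is an integral with weight [y^(2 al)]
    over [y >= 2^j]. Summing the weights [a2^(j+1)] over all [j] with [2^j <= y] gives at most a
    multiple of [y^(2 th)], and the total weight is [y^(2 gm)]. *)
Lemma II_kernF : (II al kernF < +oo)%E.
Proof.
have k0 e k : 0 <= kernF e k by rewrite /kernF; case: ifP => // _; rewrite mulr_ge0 ?powR_ge0 ?sqr_ge0.
have K := II_le_series al kernF kerns meas2_kernF meas2_kerns (fun e k _ _ => k0 e k) (fun n e k _ _ => kerns_ge0 n e k).
apply: (le_lt_trans (K _)).
  move=> e k e0 k1; have [j hj] := kernF_le e k e0 k1.
  apply: (@le_trans _ _ (\sum_(0 <= i < j.+2) (kerns i e k)%:E)%E); last first.
    by apply: nneseries_lim_ge => i _ _; rewrite lee_fin kerns_ge0.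
  rewrite sumEFin lee_fin big_nat_recl// big_nat_recr//= (le_trans hj)// lerD2l lerDr.
  by rewrite sumr_ge0// => i _; exact: (kerns_ge0 i.+1).
have a0 : 0 < a2 := lt_trans ltr01 a2_gt1.
pose C := K0 * gam al * (2 * (a2 ^+ 2 / (a2 - 1))).
pose I := \int[mu]_y (y `^ (2 * gm) * w y ^+ 2).
have C0 : 0 <= K0 * gam al by rewrite mulr_ge0 ?ltW ?arctan_mass_gt0 ?gam_gt0.
have Itail j : II al (kerns j.+1) = ((K0 * gam al)%:E * \int[mu]_y (2 * (if 2 ^+ j <= y then a2 ^+ j.+1 else 0) * (y `^ (2 * al) * w y ^+ 2))%:E)%E.
  rewrite /= II_Z; last 3 first.
  - by rewrite mulr_ge0// exprn_ge0// ltW.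
  - exact: measurable_cnlap _ (LT_meas _ _ (ytail_LTall j 1 ltr01)).
  - by move=> e k _ _; exact: sqr_ge0.
  rewrite -NrmII (NrmE _ al_gt al_lt _ (ytail_LTall j)); last first.
    by move=> y y1; rewrite /ytail w1// mulr0 if_same.
  rewrite muleCA; congr (_ * _)%E.
  have m := LT_meas _ _ (ytail_LTall j 1 ltr01).
  rewrite -ge0_integralZl//; last 3 first.
  - by apply/measurable_EFinP; mfun.
  - by move=> y _; rewrite lee_fin mulr_ge0 ?powR_ge0 ?sqr_ge0.
  - by rewrite lee_fin mulr_ge0// exprn_ge0// ltW.
  apply: eq_integral => y _; rewrite -EFinM /ytail; congr EFin.
  case: ifPn => _; last by rewrite expr0n/= !mulr0 mul0r.
  have [y1|y1] := ltP y 1; first by rewrite w1// !(mulr0, expr0n).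
  have y0 : 0 < y := lt_le_trans ltr01 y1.
  rewrite (_ : 2 * al = (2 * al - 2) + 2%:R); last by ring.
  rewrite [in RHS]powRD; last by apply/implyP => _; rewrite gt_eqF.
  rewrite (powR_mulrn 2 (ltW y0)) (_ : 2 * al - 2 + 2%:R - 2 = 2 * al - 2); [ring|ring].
apply: (@le_lt_trans _ _ (II al (kerns 0) + (C * I)%:E)%E); last first.
  rewrite /= II_Z//; last 2 first.
  - have m : measurable_fun setT (fun z : R * R => z.1 + z.2) by mfun.
    exact: measurable_comp_real _ _ _ _ measurable_hrdF m.
  - by move=> e k _ _; exact: hrdF_ge0.
  by rewrite lte_add_pinfty ?ltry// lte_mul_pinfty// II_hrdF.
have IIk n : (0 <= II al (kerns n))%E by apply: II_ge0 => e k _ _; exact: kerns_ge0.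
apply: lime_le; first by apply: is_cvg_nneseries => n _ _; exact: IIk.
apply: nearW => n.
apply: (@le_trans _ _ (\sum_(0 <= i < n.+1) II al (kerns i))%E).
  by rewrite big_nat_recr//= leeDl.
rewrite big_nat_recl// leeD2l//.
under eq_bigr => i _ do rewrite Itail.
rewrite -ge0_sume_distrr; last first.
  move=> i _; apply: integral_ge0 => y _; rewrite lee_fin mulr_ge0//.
    by rewrite mulr_ge0//; case: ifP => // _; rewrite exprn_ge0// ltW.
  by rewrite mulr_ge0 ?powR_ge0 ?sqr_ge0.
rewrite -ge0_integral_sum//; last 2 first.
- by move=> i; apply/measurable_EFinP; mfun.
- move=> i y _; rewrite lee_fin mulr_ge0//.
    by rewrite mulr_ge0//; case: ifP => // _; rewrite exprn_ge0// ltW.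
  by rewrite mulr_ge0 ?powR_ge0 ?sqr_ge0.
rewrite (_ : C * I = K0 * gam al * (2 * (a2 ^+ 2 / (a2 - 1)) * I)); last by rewrite /C; ring.
rewrite (EFinM (K0 * gam al) (_ * I)); apply: lee_wpmul2l; first by rewrite lee_fin.
rewrite (EFinM _ I) (EFin_Itg _ w2) -ge0_integralZl//; last 3 first.
- by apply/measurable_EFinP; mfun.
- by move=> y _; rewrite lee_fin mulr_ge0 ?powR_ge0 ?sqr_ge0.
- by rewrite lee_fin mulr_ge0// divr_ge0 ?sqr_ge0// subr_ge0 ltW.
apply: ge0_le_integral => //.
- move=> y _; apply: sume_ge0 => i _; rewrite lee_fin mulr_ge0//.
    by rewrite mulr_ge0//; case: ifP => // _; rewrite exprn_ge0// ltW.
  by rewrite mulr_ge0 ?powR_ge0 ?sqr_ge0.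
- by apply: emeasurable_sum => i; apply/measurable_EFinP; mfun.
- by apply: emeasurable_funM; [exact: measurable_cst|apply/measurable_EFinP; mfun].
move=> y _; rewrite sumEFin -EFinM lee_fin big_mkord -mulr_suml -mulr_sumr.
have [y1|y1] := ltP y 1; first by rewrite w1// expr0n/= !mulr0.
have y0 : 0 < y := lt_le_trans ltr01 y1.
have hY i : 2 ^+ i <= y -> a2 ^+ i <= y `^ (2 * th).
  move=> yi; have -> : a2 ^+ i = (2 ^+ i) `^ (2 * th).
    by rewrite /a2 -(powR_mulrn i (powR_ge0 _ _)) -(powR_mulrn i (ler0n R 2)) -!powRrM mulrC.
  by rewrite ge0_ler_powR ?nnegrE ?(ltW y0) ?exprn_ge0// mulr_ge0// ltW.
have hT := dyadic_sum_le a2 a2_gt1 (fun i => 2 ^+ i <= y) n (y `^ (2 * th)) (powR_ge0 _ _) hY.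
have -> : y `^ (2 * gm) = y `^ (2 * th) * y `^ (2 * al).
  by rewrite -powRD /gm; [congr powR; ring|apply/implyP => _; rewrite gt_eqF].
have -> : 2 * (a2 ^+ 2 / (a2 - 1)) * (y `^ (2 * th) * y `^ (2 * al) * w y ^+ 2) =
  2 * (a2 ^+ 2 / (a2 - 1) * y `^ (2 * th)) * (y `^ (2 * al) * w y ^+ 2) by ring.
apply: ler_wpM2r; first exact: (mulr_ge0 (powR_ge0 _ _) (sqr_ge0 _)).
exact: ler_wpM2l hT.
Qed.
End Kernel.

(** * The polynomial Q and the primitive of 1 / (1 - Q) *)

Section ComplexPoly.
Context {R : realType}.
Implicit Types (z a b : R[i]) (P f : {poly R[i]}).

Definition Repoly P : {poly R} := \poly_(i < size P) Re P`_i.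

Lemma coef_Repoly P i : (Repoly P)`_i = Re P`_i.
Proof.
rewrite coef_poly; case: ltnP => // h.
by rewrite nth_default.
Qed.

Lemma ReD z a : Re (z + a) = Re z + Re a. Proof. by case: z a => ? ? []. Qed.

Lemma ReMr z (s : R) : Re (z * s%:C) = Re z * s.
Proof. by case: z => a b /=; rewrite mulr0 subr0. Qed.

Lemma ReMn z n : Re (z *+ n) = Re z *+ n.
Proof. by elim: n => // n IH; rewrite !mulrS ReD IH. Qed.

Lemma Re_horner P (s : R) : Re P.[s%:C] = (Repoly P).[s].
Proof.
rewrite (horner_coef_wide _ (size_poly _ _)) horner_coef.
rewrite (big_morph (@complex.Re R) ReD (erefl _)); apply: eq_bigr => i _.
by rewrite coef_Repoly -rmorphXn/= ReMr.
Qed.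

Lemma deriv_Repoly P : (Repoly P)^`() = Repoly P^`().
Proof. by apply/polyP => i; rewrite coef_deriv !coef_Repoly coef_deriv ReMn. Qed.

(** The real mean value theorem is applied on [[0, 1]] to the real part of [conj(Z)] times
    [P(b + s (a - b)) - m s (a - b)], whose increment is [|Z|^2]. The free slope [m] makes the lemma
    serve both for Lipschitz bounds ([m = 0]) and for linearisation. *)
Lemma poly_mvi P a b m (d : R) :
  (forall s : R, 0 <= s <= 1 -> cn (P^`().[b + s%:C * (a - b)] - m) <= d) ->
  cn (P.[a] - P.[b] - m * (a - b)) <= d * cn (a - b).
Proof.
move=> H; set Z := P.[a] - P.[b] - m * (a - b).
have d0 : 0 <= d by apply: le_trans (H 0 _); rewrite ?cn_ge0// lexx ler01.
have [->|Z0] := eqVneq Z 0; first by rewrite cn0 mulr_ge0 ?cn_ge0.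
have cZ : 0 < cn Z by rewrite cn_gt0.
pose L : {poly R[i]} := b%:P + (a - b) *: 'X.
pose q : {poly R[i]} := Z^* *: (P \Po L - (m * (a - b)) *: 'X).
have Lh s : L.[s] = b + s * (a - b) by rewrite !hornerE mulrC.
have qh s : q.[s] = Z^* * (P.[b + s * (a - b)] - m * (a - b) * s).
  by rewrite !hornerE horner_comp Lh.
have dL : L^`() = (a - b)%:P by rewrite derivD derivC derivZ derivX add0r alg_polyC.
have q'h s : q^`().[s] = Z^* * ((P^`().[b + s * (a - b)] - m) * (a - b)).
  rewrite derivZ derivB deriv_comp derivZ derivX dL !hornerE horner_comp Lh.
  by have E (x : R[i]) : Z^* * (x * (a - b) - m * (a - b)) = Z^* * (x - m) * (a - b); [ring|exact: E].
have [c c01] := polyrcf.poly_mvt (Repoly q) ltr01.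
rewrite deriv_Repoly -!Re_horner subr0 mulr1 rmorph1 rmorph0 q'h !qh.
rewrite mul1r mul0r mulr1 mulr0 addr0 subr0 [b + _]addrC subrK => E.
have : cn Z ^+ 2 <= cn Z * (d * cn (a - b)).
  have -> : cn Z ^+ 2 = Re (Z^* * (P.[a] - m * (a - b))) - Re (Z^* * P.[b]).
    have -> : P.[a] - m * (a - b) = Z + P.[b] by rewrite /Z; ring.
    rewrite mulrDr ReD addrK cn_sq; case: (Z) => x y /=; ring.
  rewrite E (le_trans (ler_norm _))// (le_trans (Re_cn _))// !cnM.
  have -> : cn Z^* = cn Z by rewrite /cn; case: (Z) => x y /=; rewrite sqrrN.
  rewrite ler_wpM2l ?cn_ge0// ler_wpM2r ?cn_ge0// H//.
  by move: c01; rewrite in_itv/= => /andP[/ltW -> /ltW ->].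
by rewrite expr2 ler_pM2l.
Qed.

Definition prim_poly f : {poly R[i]} :=
  \poly_(i < (size f).+1) (if i is k.+1 then f`_k / k.+1%:R else 0).

Lemma deriv_prim_poly f : (prim_poly f)^`() = f.
Proof.
apply/polyP => i; rewrite coef_deriv coef_poly ltnS; case: ltnP => h.
  by rewrite -[LHS]mulr_natr divfK// pnatr_eq0.
by rewrite mul0rn nth_default.
Qed.

Lemma prim_poly0 f : (prim_poly f).[0] = 0.
Proof. by rewrite horner_coef0 coef_poly. Qed.

Section ComposeQ.
Variables (N : nat) (p : nat -> R).
Hypotheses (p_ge0 : forall j, (1 <= j <= N)%N -> 0 <= p j)
  (p_sum1 : \sum_(1 <= j < N.+1) p j = 1).

Definition QC z : R[i] := \sum_(1 <= j < N.+1) (p j)%:C * z ^+ j.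

Definition QP : {poly R[i]} := \sum_(1 <= j < N.+1) (p j)%:C *: 'X^j.

Lemma QP_horner z : QP.[z] = QC z.
Proof. by rewrite /QP horner_sum; apply: eq_bigr => j _; rewrite !hornerE. Qed.

Lemma qcstE : qcst N p = \sum_(1 <= j < N.+1) p j * j%:R.
Proof.
rewrite /qcst /Qpoly raddf_sum horner_sum; apply: eq_bigr => j _ /=.
by rewrite derivZ derivXn !hornerE ?expr1n ?hornerMn ?hornerXn ?expr1n.
Qed.

Local Notation q := (qcst N p).

Lemma le_sum_Q (F G : nat -> R) : (forall j, (0 < j)%N -> F j <= G j) ->
  \sum_(1 <= j < N.+1) p j * F j <= \sum_(1 <= j < N.+1) p j * G j.
Proof.
move=> FG; rewrite big_nat_cond [leRHS]big_nat_cond; apply: ler_sum => j.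
by rewrite andbT => /andP[j1 jN]; rewrite ler_wpM2l ?FG// p_ge0// j1.
Qed.

Lemma q_ge1 : 1 <= q.
Proof.
rewrite qcstE -[leLHS]p_sum1 (eq_bigr (fun j => p j * 1)); last by move=> j _; rewrite mulr1.
apply: (le_sum_Q (fun=> 1) (fun j => j%:R)) => j j0; by rewrite ler1n.
Qed.

Lemma cn_sum_Q (F : nat -> R[i]) (G : nat -> R) : (forall j, (0 < j)%N -> cn (F j) <= G j) ->
  cn (\sum_(1 <= j < N.+1) (p j)%:C * F j) <= \sum_(1 <= j < N.+1) p j * G j.
Proof.
move=> FG; apply: (le_trans (cn_sum _ _ _ _)); apply: le_trans (le_sum_Q _ _ FG).
rewrite big_nat_cond [leRHS]big_nat_cond; apply: ler_sum => j.
by rewrite andbT => jN; rewrite cnM cnC ger0_norm// p_ge0.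
Qed.

Lemma cn_QC z : cn z <= 1 -> cn (QC z) <= cn z.
Proof.
move=> z1; apply: (le_trans (cn_sum_Q _ (fun=> cn z) _)).
  by case=> // j _; rewrite cnX exprS ler_piMr ?cn_ge0// exprn_ile1// cn_ge0.
by rewrite /= -mulr_suml p_sum1 mul1r.
Qed.

Lemma cn_subX a b (j : nat) : cn a <= 1 -> cn b <= 1 -> cn (a ^+ j - b ^+ j) <= j%:R * cn (a - b).
Proof.
move=> a1 b1; rewrite subrXX cnM mulrC ler_wpM2r ?cn_ge0//.
apply: (le_trans (cn_sum _ _ _ _)).
apply: (@le_trans _ _ (\sum_(i < j) 1)); last by rewrite sumr_const card_ord.
by apply: ler_sum => i _; rewrite cnM !cnX mulr_ile1// ?exprn_ge0 ?exprn_ile1 ?cn_ge0.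
Qed.

Lemma cn_QCB a b : cn a <= 1 -> cn b <= 1 -> cn (QC a - QC b) <= q * cn (a - b).
Proof.
move=> a1 b1; have -> : QC a - QC b = \sum_(1 <= j < N.+1) (p j)%:C * (a ^+ j - b ^+ j).
  by rewrite /QC -sumrB; apply: eq_bigr => j _; rewrite mulrBr.
apply: (le_trans (cn_sum_Q _ (fun j => j%:R * cn (a - b)) _)).
  by move=> j _; exact: cn_subX.
by rewrite qcstE mulr_suml; under eq_bigr => j _ do rewrite mulrA.
Qed.

Definition q2 : R := \sum_(1 <= j < N.+1) p j * (j%:R * j%:R).

Lemma q2_ge0 : 0 <= q2.
Proof.
rewrite /q2 big_nat_cond; apply: sumr_ge0 => j; rewrite andbT => jN.
by rewrite mulr_ge0 ?p_ge0 ?mulr_ge0.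
Qed.

Lemma QC1 : QC 1 = 1.
Proof.
rewrite /QC; under eq_bigr => j _ do rewrite expr1n mulr1.
by rewrite -(big_morph (real_complex R) (@rmorphD _ _ _) (erefl _)) p_sum1.
Qed.

(** Each [1 - z^j - j (1 - z)] is [1 - z] times a sum of [j] terms [z^i - 1], each of modulus at
    most [j |1 - z|]. *)
Lemma cn_QC_lin z : cn z <= 1 -> cn (1 - QC z - q%:C * (1 - z)) <= q2 * cn (1 - z) ^+ 2.
Proof.
move=> z1; have c1 : cn (1 : R[i]) <= 1 by rewrite cn1.
have -> : 1 - QC z - q%:C * (1 - z) =
    \sum_(1 <= j < N.+1) (p j)%:C * (1 - z ^+ j - j%:R * (1 - z)).
  rewrite -{1}QC1 qcstE /QC (big_morph (real_complex R) (@rmorphD _ _ _) (erefl _)).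
  rewrite mulr_suml -!sumrB; apply: eq_bigr => j _.
  by rewrite expr1n rmorphM rmorph_nat/=; ring.
apply: (le_trans (cn_sum_Q _ (fun j => j%:R * j%:R * cn (1 - z) ^+ 2) _)); last first.
  by rewrite /q2 mulr_suml; under eq_bigr => j _ do rewrite mulrA.
move=> j _; have -> : 1 - z ^+ j - j%:R * (1 - z) = (1 - z) * \sum_(i < j) (z ^+ i - 1).
  have E1 : 1 - z ^+ j = (1 - z) * \sum_(i < j) z ^+ i.
    rewrite -[X in X - z ^+ j](expr1n _ j) subrXX; congr (_ * _).
    by apply: eq_bigr => i _; rewrite expr1n mul1r.
  have E2 : \sum_(i < j) (z ^+ i - 1) = \sum_(i < j) z ^+ i - j%:R.
    by rewrite sumrB sumr_const card_ord.
  by rewrite E1 E2; ring.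
rewrite cnM mulrC expr2 [leRHS]mulrA ler_wpM2r ?cn_ge0//.
apply: (le_trans (cn_sum _ _ _ _)); rewrite -mulrA mulr_natl.
apply: (@le_trans _ _ (\sum_(i < j) (j%:R * cn (1 - z)))); last by rewrite sumr_const card_ord.
apply: ler_sum => i _; have := cn_subX z 1 i z1 c1; rewrite expr1n => h.
by apply: (le_trans h); rewrite cnBC; apply: ler_wpM2r; rewrite ?cn_ge0// ler_nat ltnW.
Qed.

Definition Phi (n : nat) : {poly R[i]} := prim_poly (\sum_(k < n) QP ^+ k).

Lemma Phi0 n : (Phi n).[0] = 0. Proof. exact: prim_poly0. Qed.

Lemma Phi_deriv n z : (1 - QC z) * (Phi n)^`().[z] = 1 - QC z ^+ n.
Proof.
rewrite deriv_prim_poly horner_sum; under eq_bigr => k _ do rewrite horner_exp QP_horner.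
by rewrite -[X in _ = X - _](expr1n _ n) subrXX; congr (_ * _); apply: eq_bigr => k _; rewrite expr1n mul1r.
Qed.

Lemma QC_neq1 z : cn z < 1 -> 1 - QC z != 0.
Proof.
move=> z1; rewrite subr_eq0; apply/negP => /eqP E.
by have := cn_QC z (ltW z1); rewrite -E cn1 leNgt z1.
Qed.

Lemma cn_1QC z : cn z <= 1 -> 1 - cn z <= cn (1 - QC z).
Proof.
move=> z1; apply: le_trans (cn_le_add _ _); rewrite cn1 lerD2l lerN2; exact: cn_QC.
Qed.

(** States that [u] is the value at [z] of the primitive of [1 / (1 - Q)] vanishing at 0. As a
    relation it lets the value be identified directly with a Laplace transform. *)
Definition Phi_lim z u := (fun n => cn ((Phi n).[z] - u)) @ \oo --> (0 : R).

Lemma cn_segment a b (s : R) : 0 <= s <= 1 -> cn (b + s%:C * (a - b)) <= Num.max (cn a) (cn b).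
Proof.
move=> /andP[s0 s1]; have -> : b + s%:C * (a - b) = (1 - s)%:C * b + s%:C * a.
  by rewrite rmorphB rmorph1; ring.
apply: (le_trans (cnD _ _)); rewrite !cnM !cnC !ger0_norm ?subr_ge0//.
set M := Num.max _ _; have -> : M = (1 - s) * M + s * M by ring.
by apply: lerD; apply: ler_wpM2l; rewrite ?subr_ge0// le_max lexx ?orbT.
Qed.

(** The derivative of [Phi n] is [(1 - Q^n) / (1 - Q)]. On the segment [|Q| <= r < 1], so it differs
    from [1 / (1 - Q)] by at most [r^n / (1 - r)], which disappears in the limit of [poly_mvi]. *)
Lemma Phi_lim_mvi a b u v m (d : R) : cn a < 1 -> cn b < 1 ->
  Phi_lim a u -> Phi_lim b v ->
  (forall s : R, 0 <= s <= 1 -> cn ((1 - QC (b + s%:C * (a - b)))^-1 - m) <= d) ->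
  cn (u - v - m * (a - b)) <= d * cn (a - b).
Proof.
move=> a1 b1 au bv H; pose r := Num.max (cn a) (cn b).
have r1 : r < 1 by rewrite gt_max a1.
have r0 : 0 <= r by rewrite le_max cn_ge0.
pose X n : R := cn ((Phi n).[a] - u) + cn ((Phi n).[b] - v) + (d + r ^+ n / (1 - r)) * cn (a - b).
have XL : X @ \oo --> 0 + 0 + (d + 0 / (1 - r)) * cn (a - b).
  apply: cvgD; first exact: cvgD.
  apply: cvgM; last exact: cvg_cst.
  apply: cvgD; first exact: cvg_cst.
  apply: cvgM; last exact: cvg_cst.
  by apply: cvg_expr; rewrite ger0_norm.
rewrite !add0r mul0r addr0 in XL.
apply: (cvgr_to_ge XL); apply: nearW => n.
have K : cn ((Phi n).[a] - (Phi n).[b] - m * (a - b)) <= (d + r ^+ n / (1 - r)) * cn (a - b).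
  apply: poly_mvi => s s01; set z := b + _.
  have zr : cn z <= r := cn_segment _ _ _ s01.
  have z1 : cn z < 1 := le_lt_trans zr r1.
  have Qz := QC_neq1 _ z1.
  have E : (Phi n)^`().[z] = (1 - QC z ^+ n) / (1 - QC z) by rewrite -Phi_deriv mulrC mulKf.
  have -> : (Phi n)^`().[z] - m = ((1 - QC z)^-1 - m) - QC z ^+ n / (1 - QC z).
    by rewrite E mulrBl mul1r; ring.
  apply: (le_trans (cnB _ _)); apply: lerD; first exact: H.
  rewrite cnM cnX cnV; apply: ler_pM; rewrite ?exprn_ge0 ?invr_ge0 ?cn_ge0//.
    by rewrite lerXn2r ?nnegrE ?cn_ge0// (le_trans (cn_QC _ (ltW z1))).
  have h := cn_1QC _ (ltW z1); have h2 : 1 - r <= cn (1 - QC z) by apply: le_trans h; rewrite lerD2l lerN2.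
  by rewrite lef_pV2 ?posrE ?subr_gt0// (lt_le_trans _ h2)// subr_gt0.
rewrite /X; have -> : u - v - m * (a - b) = ((Phi n).[a] - (Phi n).[b] - m * (a - b)) - ((Phi n).[a] - u) + ((Phi n).[b] - v) by ring.
apply: (le_trans (cnD _ _)).
have := cnB ((Phi n).[a] - (Phi n).[b] - m * (a - b)) ((Phi n).[a] - u); move: K; lra.
Qed.

(** For [|Q| <= r] the point [1 / (1 - Q)] lies in the half-plane [Re >= 1/2]; the disc used here is
    tangent to its boundary at [1/2], with radius large enough to contain all these points. *)
Lemma half_plane_disc z : cn z < 1 -> forall r : R, cn z <= r -> r < 1 ->
  cn ((1 - QC z)^-1 - (2^-1 + (1 - r ^+ 2)^-1)%:C) <= (1 - r ^+ 2)^-1.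
Proof.
move=> z1 r zr r1; have Qz := QC_neq1 _ z1.
have r0 : 0 <= r := le_trans (cn_ge0 _) zr.
have d0 : 0 < 1 - r ^+ 2 by rewrite subr_gt0 expr_lt1.
have qr : cn (QC z) ^+ 2 <= r ^+ 2.
  by rewrite lerXn2r ?nnegrE ?cn_ge0// (le_trans (cn_QC _ (ltW z1))).
set k := (1 - r ^+ 2)^-1; have k0 : 0 < k by rewrite invr_gt0.
have kd : k * (1 - r ^+ 2) = 1 by rewrite mulVf// gt_eqF.
clearbody k.
have -> : (1 - QC z)^-1 - (2^-1 + k)%:C = (1 - (2^-1 + k)%:C * (1 - QC z)) / (1 - QC z).
  by rewrite mulrBl mul1r mulfK.
have D0 : 0 < cn (1 - QC z) by rewrite cn_gt0.
rewrite cnM cnV ler_pdivrMr// -ler_sqr ?nnegrE ?cn_ge0 ?(mulr_ge0 (ltW k0) (cn_ge0 _))//.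
rewrite [leRHS]exprMn !cn_sq.
move: qr; rewrite cn_sq; case: (QC z) => x y /= hq.
rewrite !mul0r !subr0 !add0r addr0 -subr_ge0.
set L := (X in 0 <= X).
have -> : L = k * (1 - (x ^+ 2 + y ^+ 2)) - 4^-1 * ((1 + x) ^+ 2 + y ^+ 2) by rewrite /L; field.
have h1 : 1 <= k * (1 - (x ^+ 2 + y ^+ 2)) by rewrite -kd ler_wpM2l ?(ltW k0)//; lra.
have h2 : x ^+ 2 + y ^+ 2 <= 1 by apply: (le_trans hq); rewrite expr_le1 // ltW.
have : 0 <= (1 - x) ^+ 2 + y ^+ 2 by rewrite addr_ge0 ?sqr_ge0.
by rewrite sqrrB sqrrD; move: h1 h2; rewrite expr1n !mul1r; lra.
Qed.

(** The centre of the disc of [half_plane_disc] exceeds its radius by exactly [1/2] whatever [r], so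
    the factor 2 stays uniform as [a] and [b] approach the unit circle. *)
Lemma Phi_lim_le2 a b u v : cn a < 1 -> cn b < 1 -> Phi_lim a u -> Phi_lim b v ->
  cn (a - b) <= 2 * cn (u - v).
Proof.
move=> a1 b1 au bv; pose r := Num.max (cn a) (cn b).
have r1 : r < 1 by rewrite gt_max a1.
have r0 : 0 <= r by rewrite le_max cn_ge0.
have d0 : 0 < 1 - r ^+ 2 by rewrite subr_gt0 expr_lt1.
set k := (1 - r ^+ 2)^-1; have k0 : 0 < k by rewrite invr_gt0.
have K := Phi_lim_mvi a b u v (2^-1 + k)%:C k a1 b1 au bv.
have {}K : cn (u - v - (2^-1 + k)%:C * (a - b)) <= k * cn (a - b).
  apply: K => s s01; have zr : cn (b + s%:C * (a - b)) <= r := cn_segment _ _ _ s01.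
  exact: half_plane_disc (le_lt_trans zr r1) _ zr r1.
have := cn_le_add ((2^-1 + k)%:C * (a - b)) (u - v).
rewrite cnBC cnM cnC ger0_norm; last by rewrite addr_ge0 ?invr_ge0// ltW.
by move: K; rewrite mulrDl; lra.
Qed.

(* Near [b] the derivative [1 / (1 - Q)] of the limit of [Phi n] is nearly
   constant at the scale [|1 - Q b|]. *)
Lemma Phi_lim_rel a b u v : cn a < 1 -> cn b < 1 -> Phi_lim a u -> Phi_lim b v ->
  4 * q * cn (a - b) <= cn (1 - QC b) ->
  cn (u - v - (a - b) / (1 - QC b)) <= 4 / 3 * (q * cn (a - b)) / cn (1 - QC b) ^+ 2 * cn (a - b).
Proof.
move=> a1 b1 au bv H; rewrite [(a - b) / _]mulrC; apply: Phi_lim_mvi => // s s01.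
have z1 : cn (b + s%:C * (a - b)) < 1.
  by apply: (le_lt_trans (cn_segment _ _ _ s01)); rewrite gt_max a1.
move: z1; set z := b + _ => z1.
have Qz := QC_neq1 _ z1; have Qb := QC_neq1 _ b1.
have zb : cn (z - b) <= cn (a - b).
  rewrite /z addrAC subrr add0r cnM cnC; case/andP: s01 => s0 s1.
  by rewrite ger0_norm// ler_piMl ?cn_ge0.
have q1 := q_ge1; have q0 : 0 <= q by lra.
have hQ : cn (QC z - QC b) <= q * cn (a - b).
  by apply: (le_trans (cn_QCB _ _ (ltW z1) (ltW b1))); rewrite ler_wpM2l.
have Db : 0 < cn (1 - QC b) by rewrite cn_gt0.
have Dz : 3 / 4 * cn (1 - QC b) <= cn (1 - QC z).
  have := cn_le_add (1 - QC b) (QC z - QC b).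
  rewrite (_ : 1 - QC b - (QC z - QC b) = 1 - QC z); last by ring.
  by move: H hQ; rewrite -mulrA; lra.
have Dz0 : 0 < cn (1 - QC z) by rewrite cn_gt0.
have -> : (1 - QC z)^-1 - (1 - QC b)^-1 = (QC z - QC b) * ((1 - QC z)^-1 * (1 - QC b)^-1).
  by field; rewrite Qz Qb.
rewrite !cnM !cnV.
have e : (cn (1 - QC z))^-1 <= 4 / 3 * (cn (1 - QC b))^-1.
  have D34 : 0 < 3 / 4 * cn (1 - QC b) by rewrite mulr_gt0// divr_gt0.
  have -> : 4 / 3 * (cn (1 - QC b))^-1 = (3 / 4 * cn (1 - QC b))^-1 by field; rewrite gt_eqF.
  by rewrite lef_pV2.
have -> : 4 / 3 * (q * cn (a - b)) / cn (1 - QC b) ^+ 2 =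
  q * cn (a - b) * (4 / 3 * (cn (1 - QC b))^-1 * (cn (1 - QC b))^-1) by field; rewrite gt_eqF.
apply: ler_pM; rewrite ?cn_ge0 ?mulr_ge0 ?invr_ge0 ?cn_ge0//.
by rewrite ler_wpM2r// invr_ge0 cn_ge0.
Qed.

(** Under the smallness assumption the error of [Phi_lim_rel] is at most one third of
    [|a - b| / |1 - Q(b)|] and is absorbed by it. *)
Lemma Phi_lim_close a b u v : cn a < 1 -> cn b < 1 -> Phi_lim a u -> Phi_lim b v ->
  4 * q * cn (a - b) <= cn (1 - QC b) ->
  cn (a - b) <= 3 / 2 * cn (u - v) * cn (1 - QC b).
Proof.
move=> a1 b1 au bv H; have K := Phi_lim_rel _ _ _ _ a1 b1 au bv H.
have Qb := QC_neq1 _ b1; have Db : 0 < cn (1 - QC b) by rewrite cn_gt0.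
have K2 := cn_le_add ((a - b) / (1 - QC b)) (u - v).
rewrite cnBC cnM cnV in K2.
have c0 := cn_ge0 (a - b); move: K K2 H.
set D := cn (1 - QC b) in Db *; set X := cn (a - b) in c0 *; move=> K K2 H.
have e : 4 / 3 * (q * X) / D ^+ 2 * X <= 3^-1 * (X / D).
  have -> : 4 / 3 * (q * X) / D ^+ 2 * X = 3^-1 * ((4 * q * X) / D) * (X / D) by field; rewrite gt_eqF.
  rewrite ler_wpM2r ?divr_ge0 ?(ltW Db)// ler_piMr// ler_pdivrMr// mul1r//.
have h : 2 / 3 * (X / D) <= cn (u - v) by lra.
by rewrite -ler_pdivrMr//; lra.
Qed.

End ComposeQ.
End ComplexPoly.

(** * Transforms of densities *)

Section Densities.
Context {R : realType}.
Local Notation mu := (@lebesgue_measure R).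
Local Notation K0 := (@arctan_mass R).
Implicit Types (f g h : R -> R) (xi : R[i]).

Lemma lip1 f (df : R -> R) : (forall x : R, is_derive x (1 : R) f (df x)) -> (forall x, `|df x| <= 1) ->
  forall a b, `|f a - f b| <= `|a - b|.
Proof.
move=> hf hd a b; wlog ab : a b / a < b.
  move=> H; have [e|e|->] := ltgtP a b; [exact: H| |by rewrite !subrr].
  by rewrite distrC (distrC a); exact: H.
have [c _ E] := @MVT R f df a b ab (fun x _ => hf x)
  (continuous_subspaceT (fun x => derivable_cont f x (@ex_derive _ _ _ _ _ _ _ (hf x)))).
by rewrite distrC E normrM (distrC a) ler_piMl// hd.
Qed.

Lemma cos_lip (a b : R) : `|cos a - cos b| <= `|a - b|.
Proof. by apply: (lip1 cos (fun x => - sin x)) => x; rewrite normrN normr_sin_le. Qed.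

Lemma sin_lip (a b : R) : `|sin a - sin b| <= `|a - b|.
Proof. by apply: (lip1 sin cos) => x; rewrite normr_cos_le. Qed.

Lemma expRN_lip (a b : R) : 0 <= a -> 0 <= b -> `|expR (- a) - expR (- b)| <= `|a - b|.
Proof.
wlog ab : a b / a <= b.
  move=> H a0 b0; have [e|/ltW e] := leP a b; first exact: H.
  by rewrite distrC (distrC a); exact: H.
move=> a0 b0; rewrite ger0_norm ?subr_ge0 ?ler_expR ?lerN2// distrC ger0_norm ?subr_ge0//.
have -> : expR (- a) - expR (- b) = expR (- a) * (1 - expR (- (b - a))).
  by rewrite mulrBr mulr1 -expRD; congr (_ - expR _); ring.
have h1 : 1 - expR (- (b - a)) <= b - a by have := expR_ge1Dx (- (b - a)); lra.
have h2 : 0 <= 1 - expR (- (b - a)) by rewrite subr_ge0 -expR0 ler_expR oppr_le0 subr_ge0.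
have h3 : expR (- a) <= 1 by rewrite -expR0 ler_expR oppr_le0.
by apply: le_trans h1; rewrite ler_piMl.
Qed.

Lemma norm_le_id f : (forall y, 0 <= f y) -> forall y, `|f y| <= f y.
Proof. by move=> f0 y; rewrite ger0_norm. Qed.

Lemma expRN_le1 (a : R) : 0 <= a -> expR (- a) <= 1.
Proof. by move=> a0; rewrite -expR0 ler_expR oppr_le0. Qed.

Lemma ce_lip xi xj (y : R) : 0 <= Re xi -> 0 <= Re xj -> 0 <= y ->
  cn (ce xi y - ce xj y) <= 2 * (`|Re xi - Re xj| + `|Im xi - Im xj|) * y.
Proof.
case: xi xj => [a c] [a' c'] /= a0 a'0 y0.
have P (F : R -> R) : (forall x, `|F x| <= 1) -> (forall x z, `|F x - F z| <= `|x - z|) ->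
    `|expR (- a * y) * F (c * y) - expR (- a' * y) * F (c' * y)| <= (`|a - a'| + `|c - c'|) * y.
  move=> F1 F2.
  have -> : expR (- a * y) * F (c * y) - expR (- a' * y) * F (c' * y) =
    (expR (- (a * y)) - expR (- (a' * y))) * F (c * y) + expR (- (a' * y)) * (F (c * y) - F (c' * y)).
    by rewrite !mulNr; ring.
  apply: (le_trans (ler_normD _ _)); rewrite !normrM mulrDl; apply: lerD.
    have h := expRN_lip _ _ (mulr_ge0 a0 y0) (mulr_ge0 a'0 y0).
    rewrite -mulrBl normrM (ger0_norm y0) in h; apply: le_trans h.
    by rewrite ler_piMr.
  have h := F2 (c * y) (c' * y); rewrite -mulrBl normrM (ger0_norm y0) in h; apply: le_trans h.
  by rewrite ler_piMl// ger0_norm ?expR_ge0// expRN_le1// mulr_ge0.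
apply: (le_trans (cn_ReIm _)) => /=.
have h1 := P cos normr_cos_le cos_lip.
have h2 := P sin normr_sin_le sin_lip.
rewrite -opprD normrN (_ : 2 * (`|a - a'| + `|c - c'|) * y = (`|a - a'| + `|c - c'|) * y + (`|a - a'| + `|c - c'|) * y); last by ring.
exact: lerD.
Qed.

Lemma cn_1ce xi (y : R) : 0 <= Re xi -> 0 <= Im xi -> 0 <= y ->
  cn (1 - ce xi y) <= 2 * Num.min 1 ((Re xi + Im xi) * y).
Proof.
move=> e0 k0 y0; case: (leP 1 ((Re xi + Im xi) * y)) => h.
  rewrite (le_trans (cnB _ _))// cn1 cn_ce mulr1 -[2]/(1 + 1) lerD2l.
  by rewrite mulNr expRN_le1// mulr_ge0.
have c0 : ce (0 +i* 0) y = 1.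
  by apply/eqP; rewrite eq_complex/= !oppr0 !mul0r expR0 cos0 sin0 !mulr0 oppr0 mulr1 !eqxx.
by have := ce_lip (0 +i* 0) xi y (lexx _) e0 y0; rewrite c0 /= !sub0r !normrN !ger0_norm// mulrA.
Qed.

Lemma Itg_ce_lip h (b : R) xi xj : L1 h -> (forall y, 0 <= h y) -> (forall y, y < 0 \/ b < y -> h y = 0) ->
  0 <= Re xi -> 0 <= Re xj ->
  cn (lap h xi - lap h xj) <= 2 * (`|Re xi - Re xj| + `|Im xi - Im xj|) * b * \int[mu]_y h y.
Proof.
move=> h1 h0 hb e0 e0'; have hc : causal h by move=> y y0; apply: hb; left.
have l1 := L1_LT _ _ e0 hc h1; have l2 := L1_LT _ _ e0' hc h1.
have mh := L1_meas _ h1.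
have b1 := lap_cL1 _ _ l1; have b2 := lap_cL1 _ _ l2.
rewrite /lap -(cIB _ _ b1 b2) -(ItgZ _ _ h1).
apply: (cI_cn _ _ _ (L1Z _ _ h1)).
  by apply: cmeasD; [exact: cL1_cmeas b1|apply: cmeasN; exact: cL1_cmeas b2].
move=> y; rewrite -mulrBr cnM cnC (ger0_norm (h0 y)).
have [y0|y0] := ltP y 0; first by rewrite (hb y (or_introl y0)) mul0r mulr0.
have [yb|yb] := ltP b y; first by rewrite (hb y (or_intror yb)) mul0r mulr0.
rewrite mulrC ler_wpM2r//; apply: (le_trans (ce_lip _ _ _ e0 e0' y0)).
by rewrite ler_wpM2l// mulr_ge0// addr_ge0.
Qed.

(** Plancherel's bound makes the squared transform integrable, and the compact support makes the
    transform Lipschitz with constant [2 b m]. A value above [m / 2] at a large [k] would persist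
    above [m / 4] over a length [d = 1 / (8 b)], against the smallness of the tail integral. *)
Lemma riemann_lebesgue h (M b : R) : 0 < b -> L1 h -> (forall y, 0 <= h y <= M) ->
  (forall y, y < 0 \/ b < y -> h y = 0) -> 0 < \int[mu]_y h y ->
  exists K, forall k, K <= k -> cn (lap h (0 +i* k)) <= (\int[mu]_y h y) / 2.
Proof.
move=> b0 h1 hM hb; set m := \int[mu]_y h y => m0.
have mh := L1_meas _ h1.
have h0 y : 0 <= h y by case/andP: (hM y).
have h2 : L1 (fun y => h y ^+ 2).
  have m2 : measurable_fun setT (fun y => h y ^+ 2) by mfun.
  apply: (L1_le _ _ m2 _ (L1Z M _ h1)) => y; rewrite ger0_norm ?sqr_ge0// expr2 ler_wpM2r//.
  by case/andP: (hM y).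
have mft := measurable_ft2 h h1.
have mG : measurable_fun setT (fun k : R => if 0 <= k then ft2 h k else 0) by mfun.
have G0 k : 0 <= (if 0 <= k then ft2 h k else 0) by case: ifP => // _; exact: ft2_ge0.
have LG : L1 (fun k : R => if 0 <= k then ft2 h k else 0).
  apply: (ae0_le_L1 _ mG G0); apply: (le_lt_trans (plancherel_le h h1)).
  by rewrite -(EFin_Itg _ h2) -EFinM ltry.
pose F (n : nat) k : R := if n%:R <= k then ft2 h k else 0.
have mF n : measurable_fun setT (F n) by rewrite /F; mfun.
have FG n k : `|F n k| <= if 0 <= k then ft2 h k else 0.
  rewrite /F; case: ifP => nk; last by rewrite normr0.
  by rewrite (le_trans _ nk)// ger0_norm ?ft2_ge0.
have m00 : measurable_fun setT (fun _ : R => 0 : R) by mfun.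
have F0 : {ae mu, forall k, F n k @[n --> \oo] --> (0 : R)}.
  apply: aeW => k; apply: cvg_near_cst.
  exists (Num.truncn k).+1 => // n /= kn; rewrite /F leNgt (lt_le_trans (truncnS_gt k))// ler_nat//.
have [_] := dct F (fun=> 0) _ mF m00 LG FG F0.
rewrite (_ : \int[mu]_x 0 = 0); last by rewrite /Rintegral integral0.
pose d := (8 * b)^-1; have d0 : 0 < d by rewrite invr_gt0 mulr_gt0.
pose eta := d * (m / 4) ^+ 2; have eta0 : 0 < eta by rewrite mulr_gt0// exprn_gt0// divr_gt0.
move=> /cvgrPdist_lt /(_ _ eta0)[n _ /(_ n (leqnn n))] /=; rewrite sub0r normrN => Fn.
exists n%:R => k nk; rewrite leNgt; apply/negP => mk.
have LF : L1 (F n) := L1_le _ _ (mF n) (FG n) LG.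
have [b1 b2] := Itg_box d d0.
have [s1 s2] := L1_shift (- (k + d)) _ b1.
have : eta <= \int[mu]_k F n k.
  have -> : eta = \int[mu]_s (eta * box d (s + - (k + d))) by rewrite (ItgZ _ _ s1) s2 b2 mulr1.
  apply: (Itg_le _ _ (L1Z _ _ s1) LF) => s; rewrite /box.
  case: ifPn => hs; last by rewrite mulr0 /F; case: ifP => // _; exact: ft2_ge0.
  have [ks sk] : k <= s /\ s - k < d by move: hs => /andP[]; split; lra.
  rewrite /F (le_trans nk ks) /eta mulrAC divff ?gt_eqF// mul1r.
  rewrite /ft2 lerXn2r ?nnegrE ?cn_ge0 ?divr_ge0 ?(ltW m0)//.
  have := Itg_ce_lip h b (0 +i* k) (0 +i* s) h1 h0 hb (lexx _) (lexx _).
  rewrite /= subrr normr0 add0r distrC ger0_norm ?subr_ge0// -/m => L.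
  have := cn_le_add (lap h (0 +i* k)) (lap h (0 +i* k) - lap h (0 +i* s)).
  rewrite subKr => L2.
  have : 2 * (s - k) * b * m <= m / 4.
    rewrite mulrC ler_wpM2l ?(ltW m0)//; have : (s - k) * (8 * b) <= 1.
      by rewrite -ler_pdivlMr ?mulr_gt0// mul1r ltW.
    lra.
  by move: L L2 mk; lra.
by rewrite leNgt (le_lt_trans (ler_norm _) Fn).
Qed.

Lemma cn_phase (z : R[i]) : z != 0 -> exists u, cn u = 1 /\ Re (u * z) = cn z.
Proof.
move=> z0; have c0 : 0 < cn z by rewrite cn_gt0.
exists ((cn z)^-1%:C * z^*); rewrite cnM cnC ger0_norm ?invr_ge0 ?(ltW c0)//.
have -> : cn z^* = cn z by rewrite /cn; case: (z) => x y /=; rewrite sqrrN.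
rewrite mulVf ?gt_eqF//; split => //.
have := cn_sq z; move: c0; set c := cn z => c0; case: (z) => x y /= E.
by rewrite (_ : _ - _ = c^-1 * (x ^+ 2 + y ^+ 2)); [rewrite -E expr2 mulKf// gt_eqF|ring].
Qed.

Lemma Re_cI_le (F : R -> R[i]) (u : R[i]) g : cL1 F -> L1 g -> (forall y, Re (u * F y) <= g y) ->
  Re (u * cI F) <= \int[mu]_y g y.
Proof.
move=> F1 g1 Fg; rewrite -(cIZ _ _ F1) /cI /=.
exact: (Itg_le _ _ (cL1Z u _ F1).1 g1 Fg).
Qed.

Lemma LT_re0 h (k : R) : L1 h -> LT (Re (0 +i* k)) h.
Proof. by move=> f1; apply: (eq_L1 _ _ _ f1) => y; rewrite /= oppr0 mul0r expR0 mul1r. Qed.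

(* [1 - cos 2t <= 4 (1 - cos t)], integrated against [h]. *)
Lemma lap_doubling h (k : R) : L1 h -> (forall y, 0 <= h y) ->
  \int[mu]_y h y - cn (lap h (0 +i* (2 * k))) <= 4 * (\int[mu]_y h y - cn (lap h (0 +i* k))).
Proof.
move=> h1 h0; have m0 := Itg_ge0 _ h0.
have [->|z0] := eqVneq (lap h (0 +i* k)) 0.
  by rewrite cn0 subr0; have := cn_ge0 (lap h (0 +i* (2 * k))); lra.
have [u [u1 <-]] := cn_phase _ z0.
have L1k := lap_cL1 _ _ (LT_re0 h k h1); have L2k := lap_cL1 _ _ (LT_re0 h (2 * k) h1).
have E : Re (u ^+ 2 * lap h (0 +i* (2 * k))) <= cn (lap h (0 +i* (2 * k))).
  by rewrite (le_trans (ler_norm _))// (le_trans (Re_cn _))// cnM cnX u1 expr1n mul1r.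
have : 4 * Re (u * lap h (0 +i* k)) - Re (u ^+ 2 * lap h (0 +i* (2 * k))) <= 3 * \int[mu]_y h y; last by move: E; lra.
have -> : 4 * Re (u * lap h (0 +i* k)) - Re (u ^+ 2 * lap h (0 +i* (2 * k))) =
   Re (1 * cI (fun y => (4 * u) * ((h y)%:C * ce (0 +i* k) y) - u ^+ 2 * ((h y)%:C * ce (0 +i* (2 * k)) y))).
  rewrite (cIB _ _ (cL1Z _ _ L1k) (cL1Z _ _ L2k)) (cIZ _ _ L1k) (cIZ _ _ L2k) mul1r /lap.
  move: (cI _) (cI _) => [x1 y1] [x2 y2]; case: (u) => c s /=; ring.
rewrite -(ItgZ _ _ h1); apply: Re_cI_le => [||y].
- exact: (cL1D _ _ (cL1Z _ _ L1k) (cL1N _ (cL1Z _ _ L2k))).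
- exact: L1Z.
rewrite mul1r; have -> : ce (0 +i* (2 * k)) y = ce (0 +i* k) y ^+ 2.
  rewrite expr2 -ceD /ce /= !oppr0 !mul0r expR0.
  by rewrite (_ : 2 * k * y = k * (y + y))//; ring.
have : cn (u * ce (0 +i* k) y) ^+ 2 = 1.
  by rewrite cnM u1 cn_ce mul1r /= oppr0 mul0r expR0 expr1n.
have -> : (4 * u) * ((h y)%:C * ce (0 +i* k) y) - u ^+ 2 * ((h y)%:C * ce (0 +i* k) y ^+ 2) =
  (h y)%:C * (4 * (u * ce (0 +i* k) y) - (u * ce (0 +i* k) y) ^+ 2) by ring.
move: (u * _) => [c s]; rewrite cn_sq /= => cs.
set L := (X in X <= _); have -> : L = h y * (4 * c - c ^+ 2 + s ^+ 2).
  by rewrite /L; ring.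
have -> : s ^+ 2 = 1 - c ^+ 2 by rewrite -cs; ring.
by rewrite mulrC ler_wpM2r//; have := sqr_ge0 (c - 1); rewrite sqrrB; lra.
Qed.

Definition density f := [/\ L1 f, forall y, y < 1 -> f y = 0, forall y, 0 <= f y & \int[mu]_y f y = 1].

Lemma cn_lap_density f xi : density f -> 0 <= Re xi -> cn (lap f xi) <= expR (- Re xi).
Proof.
move=> [f1 fc f0 fm] e0; have hf : causal f by move=> y y0; apply: fc; exact: lt_trans ltr01.
have LTf := L1_LT _ _ e0 hf f1.
have := cn_lap f f xi LTf (L1_meas _ f1) (norm_le_id _ f0).
have := Itg_le _ _ LTf (L1Z (expR (- Re xi)) _ f1); rewrite (ItgZ _ _ f1) fm mulr1 => K h.
apply: (le_trans h); apply: K => y; have [y1|y1] := ltP y 1; first by rewrite fc// !mulr0.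
by rewrite ler_wpM2r// ler_expR mulNr lerN2 ler_peMr.
Qed.

(** Supplies the bounded, compactly supported piece to which [riemann_lebesgue] applies; truncations
    converge in mass to 1, so one of them has positive mass. *)
Lemma density_trunc f : density f -> exists h (M b : R),
  [/\ 0 < b, L1 h, forall y, 0 <= h y <= M, forall y, y < 0 \/ b < y -> h y = 0 &
      (forall y, h y <= f y) /\ 0 < \int[mu]_y h y].
Proof.
move=> [f1 fc f0 fm]; have mf := L1_meas _ f1.
pose H (n : nat) y : R := if y <= n%:R then Num.min n%:R (f y) else 0.
have Hm y n : Num.min n%:R (f y) = if n%:R < f y then n%:R else f y by [].
have mH n : measurable_fun setT (H n).
  have m1 : measurable_fun setT (fun y : R => if n%:R < f y then n%:R else f y) by mfun.
  have m2 : measurable_fun setT (fun y : R => if y <= n%:R then (if n%:R < f y then n%:R else f y) else 0) by mfun.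
  exact: m2.
have H0 n y : 0 <= H n y by rewrite /H; case: ifP => // _; rewrite le_min f0 ler0n.
have Hf n y : `|H n y| <= f y by rewrite ger0_norm// /H; case: ifP => // _; rewrite ge_min lexx orbT.
have HF : {ae mu, forall y, H n y @[n --> \oo] --> f y}.
  apply: aeW => y; apply: cvg_near_cst.
  exists (Num.truncn (`|y| + f y)).+1 => // n /= kn.
  have h : `|y| + f y < n%:R by rewrite (lt_le_trans (truncnS_gt _))// ler_nat.
  have y0 := normr_ge0 y; have yy := ler_norm y; have fy := f0 y.
  by rewrite /H (_ : y <= n%:R) ?min_r//; lra.
have [_] := dct H f f mH mf f1 Hf HF; rewrite fm => /cvgrPdist_lt /(_ _ ltr01)[n _ /(_ n.+1 (leqnSn n))] /=.
move=> D; exists (H n.+1), n.+1%:R, n.+1%:R; split.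
- by rewrite ltr0n.
- exact: (L1_le _ _ (mH _) (Hf _) f1).
- by move=> y; rewrite H0 /H/=; case: ifP => // _; rewrite ge_min lexx.
- move=> y [y0|y0]; rewrite /H; last by rewrite leNgt y0.
  by rewrite fc ?(lt_trans y0)// min_r// if_same.
split; first by move=> y; rewrite (le_trans (ler_norm _)).
by move: D; rewrite ltr_norml => /andP[_]; lra.
Qed.

Lemma gap_algebra (t m D X Y Z : R) : 0 < t -> D <= m - Z -> X <= Z ->
  Y - t * X <= (1 - t) * m -> Y <= m - t * D.
Proof.
move=> t0 h2 h3 h4; have h5 : X <= m - D by lra.
have h6 : t * X <= t * (m - D) by rewrite ler_wpM2l ?(ltW t0).
lra.
Qed.

(** If [Re xi >= r / 2] the exponential decay suffices. Otherwise [k >= r / 2], and on the imaginary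
    axis repeated doubling reaches a frequency where the Riemann-Lebesgue lemma leaves a gap of half
    the mass; [lap_doubling] brings the gap back with a loss of 4 at each doubling. *)
Lemma lap_density_gap f (r : R) : density f -> 0 < r -> exists2 c : R, 0 < c &
  forall e k, 0 < e -> 0 <= k -> r <= e + k -> cn (lap f (e +i* k)) <= 1 - c.
Proof.
move=> df r0; have [h [M [b [b0 h1 hM hb [hf m0]]]]] := density_trunc _ df.
have [f1 fc f0 fm] := df.
have h0 y : 0 <= h y by case/andP: (hM y).
have [K hK] := riemann_lebesgue _ _ _ b0 h1 hM hb m0.
move: hK m0; set m := \int[mu]_y h y => hK m0.
(* [J] doublings carry every frequency [k >= r / 2] beyond the threshold [K]. *)
have [J hJ] : exists J : nat, K <= 2 ^+ J * (r / 2).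
  exists (Num.truncn (K / (r / 2))).+1; rewrite -ler_pdivrMr ?divr_gt0//.
  by rewrite (le_trans (ltW (truncnS_gt _)))// -natrX ler_nat ltnW// ltn_expl.
have dbl (i : nat) k : m - cn (lap h (0 +i* (2 ^+ i * k))) <= 4 ^+ i * (m - cn (lap h (0 +i* k))).
  elim: i => [|i IH]; first by rewrite !expr0 !mul1r.
  have := lap_doubling h (2 ^+ i * k) h1 h0; rewrite -/m mulrA -!exprS => D.
  by apply: (le_trans D); rewrite exprS -mulrA ler_wpM2l.
have gap k : r / 2 <= k -> (m / 2) / 4 ^+ J <= m - cn (lap h (0 +i* k)).
  move=> rk; rewrite ler_pdivrMr ?exprn_gt0// [leRHS]mulrC; apply: le_trans (dbl J k).
  have : K <= 2 ^+ J * k by apply: (le_trans hJ); rewrite ler_wpM2l ?exprn_ge0.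
  by move=> /hK; lra.
have D0 : 0 < (m / 2) / 4 ^+ J by rewrite !divr_gt0 ?exprn_gt0.
set D := (m / 2) / 4 ^+ J in gap D0.
pose c1 := 1 - expR (- (r / 2)); pose c2 := expR (- (r / 2 * b)) * D.
have c10 : 0 < c1 by rewrite subr_gt0 -expR0 ltr_expR oppr_lt0 divr_gt0.
have c20 : 0 < c2 by rewrite mulr_gt0 ?expR_gt0.
exists (Num.min c1 c2); first by rewrite lt_min c10.
move=> e k e0 k0 ek; have [er|er] := leP (r / 2) e.
  apply: (le_trans (cn_lap_density f (e +i* k) df (ltW e0))); rewrite lerBrDr -lerBrDl ge_min /c1.
  by rewrite lerD2l lerN2 ler_expR lerN2 er.
have kr : r / 2 <= k by lra.
rewrite lerBrDr -lerBrDl ge_min; apply/orP; right.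
have hc : causal h by move=> y y0; apply: hb; left.
have fch : causal f by move=> y y0; apply: fc; exact: lt_trans ltr01.
have lf := L1_LT _ _ (ltW e0) fch f1; have lh := L1_LT _ _ (ltW e0) hc h1.
have lB : lap f (e +i* k) = lap h (e +i* k) + lap (fun y => f y - h y) (e +i* k).
  by rewrite lapB// addrC subrK.
have cB : cn (lap (fun y => f y - h y) (e +i* k)) <= 1 - m.
  have g0 y : 0 <= f y - h y by rewrite subr_ge0.
  have g1 := L1B _ _ f1 h1.
  have lg := LTB _ _ _ lf lh.
  apply: (le_trans (cn_lap _ _ (e +i* k) lg (L1_meas _ g1) (norm_le_id _ g0))).
  rewrite -fm /m -(ItgB _ _ f1 h1); apply: (Itg_le _ _ lg g1) => y.
  have [y0|y0] := ltP y 0; first by rewrite fch// hc// subrr mulr0.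
  by rewrite ler_piMl//= mulNr expRN_le1// mulr_ge0// ltW.
suff : cn (lap h (e +i* k)) <= m - c2.
  by move=> H; rewrite lB; have := cnD (lap h (e +i* k)) (lap (fun y => f y - h y) (e +i* k)); move: H cB; lra.
have [->|z0] := eqVneq (lap h (e +i* k)) 0.
  rewrite cn0 subr_ge0 /c2; have h4 : D <= m.
    by apply: (le_trans (gap _ kr)); rewrite lerBlDr lerDl cn_ge0.
  by apply: (le_trans _ h4); rewrite ler_piMl ?(ltW D0)// expRN_le1// mulr_ge0 ?ltW ?divr_gt0.
have [u [u1 uE]] := cn_phase _ z0.
have L0 := lap_cL1 h (0 +i* k) (LT_re0 h k h1); have Le := lap_cL1 h (e +i* k) lh.
(* On the support of [h], and for [e < r / 2], one has [e^(- e y) >= t]. Splitting the exponential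
   into [t] and a nonnegative rest bounds the transform at [e + i k] by [t] times the one at [i k]
   plus [(1 - t) m], so a fraction [t] of the gap survives. *)
pose t := expR (- (r / 2 * b)).
have t0 : 0 < t := expR_gt0 _.
have : Re (1 * cI (fun y => u * ((h y)%:C * ce (e +i* k) y) - (t%:C * u) * ((h y)%:C * ce (0 +i* k) y))) <= \int[mu]_y ((1 - t) * h y).
  apply: Re_cI_le => [||y].
  - exact: (cL1D _ _ (cL1Z _ _ Le) (cL1N _ (cL1Z _ _ L0))).
  - exact: L1Z.
  rewrite mul1r; have -> : ce (e +i* k) y = (expR (- e * y))%:C * ce (0 +i* k) y.
    by apply/eqP; rewrite eq_complex /ce/= oppr0 !mul0r expR0 !mul1r subr0 addr0 mulrN !eqxx.
  have -> : u * ((h y)%:C * ((expR (- e * y))%:C * ce (0 +i* k) y)) - (t%:C * u) * ((h y)%:C * ce (0 +i* k) y) =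
     ((h y)%:C * (expR (- e * y) - t)%:C) * (u * ce (0 +i* k) y) by rewrite rmorphB; ring.
  have : Re (u * ce (0 +i* k) y) <= 1.
    rewrite (le_trans (ler_norm _))// (le_trans (Re_cn _))// cnM u1 cn_ce/=.
    by rewrite oppr0 mul0r expR0 mulr1.
  move: (u * _) => z hz; rewrite -rmorphM mulrC ReMr mulrC.
  have [y0|y0] := ltP y 0; first by rewrite hc// !mul0r mulr0.
  have [yb|yb] := ltP b y; first by rewrite (hb y (or_intror yb)) !mul0r mulr0.
  have te : t <= expR (- e * y).
    by rewrite ler_expR mulNr lerN2 ler_pM// ltW.
  have e1 : expR (- e * y) <= 1 by rewrite mulNr expRN_le1// mulr_ge0// ltW.
  rewrite -mulrA (mulrC (1 - t)) ler_wpM2l//.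
  apply: (@le_trans _ _ (expR (- e * y) - t)); last by rewrite lerD2r.
  by rewrite ler_piMr// subr_ge0.
rewrite (cIB _ _ (cL1Z _ _ Le) (cL1Z _ _ L0)) (cIZ _ _ Le) (cIZ _ _ L0) mul1r -!/(lap _ _) (ItgZ _ _ h1) -/m.
have -> : Re (u * lap h (e +i* k) - t%:C * u * lap h (0 +i* k)) = Re (u * lap h (e +i* k)) - t * Re (u * lap h (0 +i* k)).
  move: (lap _ _) (lap h (0 +i* k)) => [x1 y1] [x2 y2]; case: (u) => c s /=; ring.
have G := gap _ kr.
have HX : Re (u * lap h (0 +i* k)) <= cn (lap h (0 +i* k)).
  by rewrite (le_trans (ler_norm _))// (le_trans (Re_cn _))// cnM u1 mul1r.
rewrite -[X in _ -> X <= _]uE.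
exact: (gap_algebra _ _ _ _ _ _ t0 G HX).
Qed.

End Densities.

(** * Representatives on the whole line and the transform of Q[eta] *)

Section FunctionSpaces.
Context {R : realType}.
Local Notation mu := (@lebesgue_measure R).
Implicit Types (f g h w : R -> R) (xi : R[i]).

(** Companion of [ext0] for the open half-line on which the spaces are defined; the two differ at
    the point 1 only. *)
Definition cut w (y : R) : R := if 1 < y then w y else 0.

Lemma cutE w : cut w = fun y => w y * \1_(`]1, +oo[%classic : set R) y.
Proof.
apply: funext => y; rewrite /cut indicE; case: ifPn => h.
  by rewrite mem_set ?mulr1//= in_itv/= h.
by rewrite memNset ?mulr0//= in_itv/= andbT; exact/negP.
Qed.

Lemma ae_neq1 : {ae mu, forall y : R, y != 1}.
Proof.
exists [set 1]; split; first exact: measurable_set1.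
  exact: lebesgue_measure_set1.
by move=> y /= /negP; rewrite negbK => /eqP.
Qed.

Lemma ext0_cut w (y : R) : y != 1 -> ext0 w y = cut w y.
Proof. by rewrite /ext0 /cut lt_neqAle eq_sym => ->. Qed.

Lemma meas_cut w : measurable_fun (`]1, +oo[%classic : set R) w -> measurable_fun setT (cut w).
Proof.
move=> m; rewrite cutE.
by have [h _] := meas_mkcond (`]1, +oo[%classic : set R) w (measurable_itv _); exact: h.
Qed.

Lemma meas_ext0 w : measurable_fun (`]1, +oo[%classic : set R) w -> measurable_fun setT (ext0 w).
Proof.
move=> /meas_cut m.
have -> : ext0 w = fun y => if 1 < y then cut w y else if 1 <= y then w 1 else 0.
  apply: funext => y; rewrite /ext0 /cut; case: (ltgtP 1 y) => [h|h|<-]; rewrite ?(ltW h)//.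
by mfun.
Qed.

Lemma in_L1_meas w : in_L1 w -> measurable_fun (`]1, +oo[%classic : set R) w.
Proof. by move=> /integrableP[/measurable_EFinP]. Qed.

Lemma ae_ext0_cut w : {ae mu, forall y, ext0 w y = cut w y}.
Proof. exact: (aeS _ _ (@ext0_cut w) ae_neq1). Qed.

Lemma L1_cut w : in_L1 w <-> L1 (cut w).
Proof. by rewrite cutE; apply: L1_mkcond. Qed.

Lemma L1_ext0 w : in_L1 w -> L1 (ext0 w).
Proof.
move=> h; apply: (ae_eq_L1 _ _ (meas_ext0 _ (in_L1_meas _ h)) _ ((L1_cut w).1 h)).
exact: (aeS _ _ (fun y (e : ext0 w y = cut w y) => esym e) (ae_ext0_cut w)).
Qed.

Lemma Itg_in_ext0 w (phi : R -> R) : measurable_fun (`]1, +oo[%classic : set R) w -> measurable_fun setT phi ->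
  (\int[mu]_(y in `]1%R, +oo[%classic) (w y * phi y)%:E = \int[mu]_y (ext0 w y * phi y)%:E)%E.
Proof.
move=> mw mp; have m1 := meas_cut _ mw; have m2 := meas_ext0 _ mw.
transitivity (\int[mu]_y (cut w y * phi y)%:E)%E.
  rewrite integral_mkcond1 cutE; apply: eq_integral => y _; congr EFin; ring.
apply: ae_eq_integral => //.
- by apply/measurable_EFinP; mfun.
- by apply/measurable_EFinP; mfun.
- by apply: (aeS _ _ _ (ae_ext0_cut w)) => y e _; rewrite e.
Qed.

Lemma L1normE w : in_L1 w -> L1norm w = (\int[mu]_y `|ext0 w y|)%:E.
Proof.
move=> h; have mw := in_L1_meas _ h; have L := L1_ext0 _ h.
rewrite (EFin_Itg _ (L1_norm _ L)) /L1norm.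
have mn : measurable_fun (`]1, +oo[%classic : set R) (fun y => `|w y|) by apply: measurableT_comp.
have m1 : measurable_fun setT (fun _ : R => 1 : R) by mfun.
have := Itg_in_ext0 _ _ mn m1.
move=> E; transitivity (\int[mu]_(y in `]1%R, +oo[) (`|w y| * 1)%:E)%E.
  by apply: eq_integral => y _; rewrite mulr1.
rewrite E; apply: eq_integral => y _; rewrite mulr1 /ext0; case: ifP => //; by rewrite normr0.
Qed.

(* The a.e. nonnegative representative [ext0 w] made nonnegative everywhere. *)
Definition pdens w (y : R) : R := `|ext0 w y|.

Lemma ae_pdens w : is_density w -> {ae mu, forall y, ext0 w y = pdens w y}.
Proof.
move=> [h1 h2 h3]; apply: (aeS2 _ _ _ _ h2 ae_neq1) => y h y1; rewrite /pdens.
case: (leP 1 y) => hy; last by rewrite /ext0 leNgt hy normr0.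
have y1' : 1 < y by rewrite lt_neqAle eq_sym y1.
by rewrite ger0_norm// /ext0 hy h.
Qed.

Lemma density_pdens w : is_density w -> density (pdens w).
Proof.
move=> hw; have [h1 h2 h3] := hw; have L := L1_ext0 _ h1; split.
- exact: L1_norm.
- by move=> y y1; rewrite /pdens /ext0 leNgt y1 normr0.
- by move=> y; exact: normr_ge0.
have Ln := L1_norm _ L.
rewrite -(ae_eq_Itg _ _ (L1_meas _ L) (L1_meas _ Ln) (ae_pdens w hw)).
apply: EFin_inj; rewrite (EFin_Itg _ L) -h3.
have m1 : measurable_fun setT (fun _ : R => 1 : R) by mfun.
have := Itg_in_ext0 _ _ (in_L1_meas _ h1) m1.
under eq_integral => y _ do rewrite mulr1.
by move=> ->; apply: eq_integral => y _; rewrite mulr1.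
Qed.

Lemma lap_pdens w xi : is_density w -> lap (ext0 w) xi = lap (pdens w) xi.
Proof.
move=> hw; have [h1 h2 h3] := hw; have L := L1_ext0 _ h1.
exact: (ae_eq_lap _ _ xi (L1_meas _ L) (L1_meas _ (L1_norm _ L)) (ae_pdens w hw)).
Qed.

Lemma ext0_lt1 w (y : R) : y < 1 -> ext0 w y = 0.
Proof. by move=> y1; rewrite /ext0 leNgt y1. Qed.

Lemma ext0_LTall w : in_L1 w -> LTall (ext0 w).
Proof.
move=> h e e0; apply: (L1_LT _ _ (ltW e0) _ (L1_ext0 _ h)) => y y0.
by apply: ext0_lt1; exact: lt_trans ltr01.
Qed.

Lemma LT0E f : LT 0 f <-> L1 f.
Proof.
by split; apply: eq_L1 => y; rewrite oppr0 mul0r expR0 mul1r.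
Qed.

Lemma LT_Re (e : R) f : LT (Re (e +i* 0 : R[i])) f = LT e f. Proof. by []. Qed.

Lemma lap_conv_pow f (j : nat) xi : LT (Re xi) f ->
  LT (Re xi) (conv_pow f j.+1) /\ lap (conv_pow f j.+1) xi = lap f xi ^+ j.+1.
Proof.
move=> hf; elim: j => [|j [IH1 IH2]]; first by rewrite expr1.
have -> : conv_pow f j.+2 = convolution f (conv_pow f j.+1) by [].
have [h1 h2] := lap_convolution f _ xi hf IH1.
by split; [exact: h1|rewrite h2 IH2 -exprS].
Qed.

Lemma conv_pow_lt1 f (j : nat) : (forall y, y < 1 -> f y = 0) ->
  forall y, y < 1 -> conv_pow f j.+1 y = 0.
Proof.
move=> f1; elim: j => [|j IH]; first exact: f1.
have -> : conv_pow f j.+2 = convolution f (conv_pow f j.+1) by [].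
move=> y y1; rewrite /convolution (eq_Itg _ (fun=> 0)); first by rewrite /Rintegral integral0.
move=> x; have [x1|x1] := ltP x 1; first by rewrite IH// mulr0.
by rewrite f1 ?mul0r//; lra.
Qed.

Section ConvolutionQ.
Variables (N : nat) (p : nat -> R).

Lemma lap_sum_Q (I : nat -> R -> R) xi : (forall j, (0 < j)%N -> LT (Re xi) (I j)) ->
  LT (Re xi) (fun y => \sum_(1 <= j < N.+1) p j * I j y) /\
  lap (fun y => \sum_(1 <= j < N.+1) p j * I j y) xi = \sum_(1 <= j < N.+1) (p j)%:C * lap (I j) xi.
Proof.
move=> hI; elim: N => [|n [IH1 IH2]].
  rewrite !big_geq//; have E : (fun y : R => \sum_(1 <= j < 1) p j * I j y) = fun=> 0.
    by apply: funext => y; rewrite big_geq.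
  rewrite E; have L0 : LT (Re xi) (fun=> 0).
    by apply: (eq_L1 _ _ _ L1_0) => y; rewrite mulr0.
  split; [exact: L0|]; rewrite /lap (eq_cI _ (fun=> 0)); last by move=> y; rewrite mul0r.
  by rewrite /cI /= /Rintegral integral0.
have E : (fun y : R => \sum_(1 <= j < n.+2) p j * I j y) =
    fun y => \sum_(1 <= j < n.+1) p j * I j y + p n.+1 * I n.+1 y.
  by apply: funext => y; rewrite big_nat_recr.
have h := LTZ _ (p n.+1) _ (hI n.+1 isT).
rewrite E; split; first exact: (LTD _ _ _ IH1 h).
by rewrite (lapD _ _ xi IH1 h) (lapZ (p n.+1) _ xi (hI n.+1 isT)) IH2 [in RHS]big_nat_recr.
Qed.

Lemma lap_Qconv w xi : LT (Re xi) (ext0 w) ->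
  LT (Re xi) (Qconv N p w) /\ lap (Qconv N p w) xi = QC N p (lap (ext0 w) xi).
Proof.
move=> hf.
have h (j : nat) : (0 < j)%N -> LT (Re xi) (conv_pow (ext0 w) j).
  by case: j => // j _; have [] := lap_conv_pow (ext0 w) j xi hf.
have [h1 h2] := lap_sum_Q (fun j => conv_pow (ext0 w) j) xi h.
split; [exact: h1|]; rewrite /Qconv h2 /QC; apply: eq_big_nat => -[|j]//= _.
by have [_ ->] := lap_conv_pow (ext0 w) j xi hf.
Qed.

Lemma Qconv_lt1 w (y : R) : y < 1 -> Qconv N p w y = 0.
Proof.
move=> y1; rewrite /Qconv; apply: big1_seq => -[|j]; rewrite mem_index_iota//= => _.
by rewrite conv_pow_lt1 ?mulr0// => x x1; exact: ext0_lt1.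
Qed.

Lemma L1_Qconv w : in_L1 w -> L1 (Qconv N p w).
Proof.
move=> h; apply/LT0E; rewrite -LT_Re; apply: (lap_Qconv w (0 +i* 0) _).1.
by rewrite LT_Re; apply/LT0E; exact: L1_ext0.
Qed.

(** [Qconv] already vanishes below 1, so the cut in [T1] removes nothing and the operator is a plain
    translation. *)
Lemma T1E w : T1 (Qconv N p w) = fun y => Qconv N p w (y + -1).
Proof.
apply: funext => y; rewrite /T1; case: leP => // y2; rewrite Qconv_lt1//; lra.
Qed.

Lemma L1_T1 w : in_L1 w -> L1 (T1 (Qconv N p w)).
Proof. by move=> h; rewrite T1E; exact: (L1_shift (-1) _ (L1_Qconv w h)).1. Qed.

Lemma lap_T1 w xi : in_L1 w -> 0 < Re xi ->
  lap (T1 (Qconv N p w)) xi = ce xi 1 * QC N p (lap (ext0 w) xi).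
Proof.
move=> hw e0; have hQ := lap_Qconv w xi (ext0_LTall w hw _ e0).
have L := lap_cL1 _ _ hQ.1; rewrite -hQ.2 T1E /lap -(cIZ (ce xi 1) _ L).
pose F y := ce xi 1 * ((Qconv N p w y)%:C * ce xi y).
have LF : cL1 F := cL1Z (ce xi 1) _ L.
have EF y : (Qconv N p w (y + -1))%:C * ce xi y = F (y + -1).
  have -> : ce xi y = ce xi (y - 1) * ce xi 1 by rewrite -ceD subrK.
  by rewrite /F; ring.
rewrite (eq_cI _ _ EF) /cI; congr (_ +i* _).
  exact: (L1_shift (-1) _ LF.1).2.
exact: (L1_shift (-1) _ LF.2).2.
Qed.

End ConvolutionQ.
End FunctionSpaces.

(** * Absolutely continuous functions *)

Section AbsoluteContinuity.
Context {R : realType}.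
Local Notation mu := (@lebesgue_measure R).
Implicit Types (f g h F H : R -> R).

Definition big_part (M : R) g (x : R) : R := if M < `|g x| then `|g x| else 0.

Lemma L1_big_part M g : L1 g -> L1 (big_part M g).
Proof.
move=> g1; have mg := L1_meas _ g1.
have m : measurable_fun setT (big_part M g) by rewrite /big_part; mfun.
apply: (L1_le _ _ m _ (L1_norm _ g1)) => x; rewrite /big_part.
by case: ifP => _; rewrite ?normr_id ?normr0.
Qed.

(** Uniform integrability by dominated convergence. Splitting [|g|] at level [M] bounds its integral
    over a short interval by [M] times the length plus a small amount; absolute continuity,
    [quad_const] and [gronwall] all rely on this. *)
Lemma big_part_small g (e : R) : L1 g -> 0 < e ->
  exists2 M, 0 < M & \int[mu]_x big_part M g x < e.
Proof.
move=> g1 e0; have mg := L1_meas _ g1.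
have mF (n : nat) := L1_meas _ (L1_big_part n.+1%:R g g1).
have m0 : measurable_fun setT (fun _ : R => 0 : R) by mfun.
have FG (n : nat) x : `|big_part n.+1%:R g x| <= `|g x|.
  by rewrite /big_part; case: ifP => _; rewrite ?normr_id ?normr0.
have F0 : {ae mu, forall x, big_part n.+1%:R g x @[n --> \oo] --> (0 : R)}.
  apply: aeW => x; apply: cvg_near_cst.
  exists (Num.truncn `|g x|).+1 => // n /= kn; rewrite /big_part ltNge (le_trans (ltW (truncnS_gt _)))//.
  by rewrite ler_nat (leq_trans kn).
have [_] := dct (fun n => big_part n.+1%:R g) (fun=> 0) _ mF m0 (L1_norm _ g1) FG F0.
rewrite (_ : \int[mu]_x 0 = 0); last by rewrite /Rintegral integral0.
move=> /cvgrPdist_lt /(_ _ e0)[n _ /(_ n (leqnn n))] /=; rewrite sub0r normrN => Fn.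
by exists n.+1%:R => //; apply: le_lt_trans (ler_norm _) Fn.
Qed.

Definition ooc (l r : R) (f : R -> R) (x : R) : R := if (l < x) && (x <= r) then f x else 0.

Lemma L1_ooc l r f : L1 f -> L1 (ooc l r f).
Proof.
move=> f1; have mf := L1_meas _ f1.
have m : measurable_fun setT (ooc l r f) by rewrite /ooc; mfun.
by apply: (L1_le _ _ m _ (L1_norm _ f1)) => x; rewrite /ooc; case: ifP => _; rewrite ?normr0.
Qed.

Lemma prim_ooc l r f : L1 f -> l <= r -> prim f r - prim f l = \int[mu]_x ooc l r f x.
Proof.
move=> f1 lr; rewrite (primB _ _ _ f1 lr) Itg_mkcond; apply: eq_Itg => x.
rewrite indicE /ooc; case: ifPn => h; first by rewrite mem_set ?mulr1//= in_itv/=.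
by rewrite memNset ?mulr0//= in_itv/=; exact/negP.
Qed.

Lemma ooc_cst l r (c : R) : l <= r ->
  L1 (ooc l r (fun=> c)) /\ \int[mu]_x ooc l r (fun=> c) x = c * (r - l).
Proof.
rewrite le_eqVlt => /predU1P[->|lr].
  have E x : 0 = ooc r r (fun=> c) x :> R by rewrite /ooc ltNge; case: (_ <= _).
  split; first exact: (eq_L1 _ _ E L1_0).
  by rewrite subrr mulr0 -(eq_Itg _ _ E) /Rintegral integral0.
have d0 : 0 < r - l by rewrite subr_gt0.
have [b1 b2] := Itg_box (r - l) d0.
have [c1 c2] := L1_opp _ b1.
have [s1 s2] := L1_shift (- l) _ c1.
have E x : c * (r - l) * box (r - l) (- (x + - l)) = ooc l r (fun=> c) x.
  rewrite /box /ooc lerN2 oppr_lt0 subr_gt0 lerD2r andbC.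
  by case: ifP => _; rewrite ?mulr0// mulfK// gt_eqF.
split; first exact: (eq_L1 _ _ E (L1Z _ _ s1)).
by rewrite -(eq_Itg _ _ E) (ItgZ _ _ s1) s2 c2 b2 mulr1.
Qed.

Lemma ooc_le_trunc M l r g : L1 g -> 0 < M -> l <= r ->
  \int[mu]_x ooc l r (fun x => `|g x|) x <= M * (r - l) + \int[mu]_x ooc l r (big_part M g) x.
Proof.
move=> g1 M0 lr; have [c1 <-] := ooc_cst l r M lr.
have b1 := L1_ooc l r _ (L1_big_part M _ g1).
rewrite -(ItgD _ _ c1 b1); apply: (Itg_le _ _ (L1_ooc l r _ (L1_norm _ g1)) (L1D _ _ c1 b1)) => x.
rewrite /ooc; case: ifP => _; last by rewrite addr0.
by rewrite /big_part; case: ltP => h; rewrite ?addr0// lerDr ltW.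
Qed.

Lemma Itg_sum n (F : 'I_n -> R -> R) : (forall i, L1 (F i)) ->
  L1 (fun x => \sum_(i < n) F i x) /\ \int[mu]_x (\sum_(i < n) F i x) = \sum_(i < n) \int[mu]_x F i x.
Proof.
elim: n F => [|n IH] F hF.
  have E x : 0 = \sum_(i < 0) F i x by rewrite big_ord0.
  by split; [exact: (eq_L1 _ _ E L1_0)|rewrite -(eq_Itg _ _ E) big_ord0 /Rintegral integral0].
have [h1 h2] := IH (fun i => F (lift ord0 i)) (fun i => hF _).
have E x : F ord0 x + \sum_(i < n) F (lift ord0 i) x = \sum_(i < n.+1) F i x by rewrite big_ord_recl.
split; first exact: (eq_L1 _ _ E (L1D _ _ (hF ord0) h1)).
by rewrite -(eq_Itg _ _ E) (ItgD _ _ (hF ord0) h1) h2 big_ord_recl.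
Qed.

Lemma norm_primB l r g : L1 g -> l <= r ->
  `|prim g r - prim g l| <= \int[mu]_x ooc l r (fun x => `|g x|) x.
Proof.
move=> g1 lr; rewrite (prim_ooc _ _ _ g1 lr).
have h := L1_ooc l r _ g1.
apply: (Itg_norm_le _ _ (L1_ooc l r _ (L1_norm _ g1)) (L1_meas _ h)) => x.
by rewrite /ooc; case: ifP => _; rewrite ?normr0.
Qed.

Lemma abs_continuous_prim a b g : L1 g -> abs_continuous_on a b (prim g).
Proof.
move=> g1 e e0; have e2 : 0 < e / 2 by rewrite divr_gt0.
have [M M0 hM] := big_part_small g _ g1 e2.
exists (e / 2 / M); first by rewrite divr_gt0.
move=> n l r lr dis len.
have lr' i : l i <= r i by case: (lr i).
apply: (@le_lt_trans _ _ (\sum_(i < n) (M * (r i - l i) + \int[mu]_x ooc (l i) (r i) (big_part M g) x))).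
  by apply: ler_sum => i _; exact: (le_trans (norm_primB _ _ _ g1 (lr' i)) (ooc_le_trunc M _ _ _ g1 M0 (lr' i))).
have b1 i := L1_ooc (l i) (r i) _ (L1_big_part M g g1).
have [s1 s2] := Itg_sum n _ b1.
rewrite big_split/= -mulr_sumr -s2 [ltRHS](splitr e); apply: ltrD.
  by rewrite mulrC -ltr_pdivlMr.
apply: le_lt_trans hM; apply: (Itg_le _ _ s1 (L1_big_part M g g1)) => x.
have bp0 : 0 <= big_part M g x by rewrite /big_part; case: ifP.
case: (pickP (fun i => (l i < x) && (x <= r i))) => [i0 hi|hn]; last first.
  by rewrite big1// => i _; rewrite /ooc hn.
rewrite (bigD1 i0)//= big1 ?addr0; first by rewrite /ooc hi.
move=> i ii0; rewrite /ooc; case: ifPn => // /andP[h1 h2].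
case/andP: hi => h3 h4; case: (dis _ _ ii0) => h5.
  by have := lt_le_trans h3 (le_trans h2 h5); rewrite ltxx.
by have := lt_le_trans h1 (le_trans h4 h5); rewrite ltxx.
Qed.

Lemma abs_continuousB a b F H : abs_continuous_on a b F -> abs_continuous_on a b H ->
  abs_continuous_on a b (fun x => F x - H x).
Proof.
move=> hF hH e e0; have e2 : 0 < e / 2 by rewrite divr_gt0.
have [d1 d10 h1] := hF _ e2; have [d2 d20 h2] := hH _ e2.
exists (Num.min d1 d2); first by rewrite lt_min d10.
move=> n l r lr dis; rewrite lt_min => /andP[l1 l2].
rewrite (splitr e); apply: le_lt_trans (ltrD (h1 n l r lr dis l1) (h2 n l r lr dis l2)).
rewrite -big_split/=; apply: ler_sum => i _.
rewrite (_ : F (r i) - _ - _ = (F (r i) - F (l i)) - (H (r i) - H (l i))); last by ring.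
exact: ler_normB.
Qed.

Lemma derive0_near H (y e : R) : derivable H y 1 -> derive1 H y = 0 -> 0 < e ->
  exists2 d : R, 0 < d & forall z, `|z - y| < d -> `|H z - H y| <= e * `|z - y|.
Proof.
move=> /cvg_ex[/= l hl]; rewrite derive1E => hd e0.
have l0 : l = 0 by rewrite -hd; apply/esym; apply: cvg_lim.
rewrite l0 in hl; move/cvgrPdist_le: hl => /(_ e e0) [d /= d0 hd'].
exists d => // z zy; have [->|zy0] := eqVneq z y; first by rewrite !subrr normr0 mulr0.
have := hd' (z - y); rewrite /= distrC subr0 subr_eq0 => /(_ zy zy0).
rewrite sub0r normrN /GRing.scale/= mulr1 subrK normrM normfV ler_pdivrMl ?normr_gt0 ?subr_eq0//.
by rewrite mulrC.
Qed.

Section Constancy.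
Variables (a b : R) (H : R -> R) (U : set R) (e : R).
Hypotheses (ab : a <= b) (e0 : 0 < e) (oU : open U) (mU : (mu U < +oo)%E).
Hypothesis good : forall y, a <= y <= b -> ~ U y ->
  exists2 d : R, 0 < d & forall z, `|z - y| < d -> `|H z - H y| <= e * `|z - y|.

Let m (x : R) := \int[mu]_t ooc a x (\1_U : R -> R) t.

Let L1U : L1 (\1_U : R -> R).
Proof.
have mU' : measurable U := open_measurable oU.
apply: L1P; first exact: measurable_indic.
under eq_integral => x _ do rewrite ger0_norm//.
by rewrite integral_indic// setIT.
Qed.

Let m_mono x y : x <= y -> m x <= m y.
Proof.
move=> xy; apply: (Itg_le _ _ (L1_ooc a x _ L1U) (L1_ooc a y _ L1U)) => t.
rewrite /ooc; case: ifPn => [/andP[-> tx]|_]; first by rewrite (le_trans tx xy).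
by case: ifP => // _; rewrite indicE.
Qed.

Let m_cover x y : a <= x -> x <= y -> (forall t, x < t <= y -> U t) -> m x + (y - x) <= m y.
Proof.
move=> ax xy hU; have [c1 c2] := ooc_cst x y 1 xy.
rewrite -[y - x]mul1r -c2 -(ItgD _ _ (L1_ooc a x _ L1U) c1).
apply: (Itg_le _ _ (L1D _ _ (L1_ooc a x _ L1U) c1) (L1_ooc a y _ L1U)) => t.
have i0 : 0 <= (\1_U t : R) by rewrite indicE.
rewrite /ooc; case: (leP t x) => tx /=.
  rewrite addr0 (le_trans tx xy); case: ifP => //; case: ifP => //.
have ta : a < t := le_lt_trans ax tx.
rewrite ta/= add0r.
case: ifPn => // ty.
by rewrite indicE mem_set//; apply: hU; rewrite tx ty.
Qed.

(* [s] lists the intervals of a partition of [a, x] that are contained in [U];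
   on the other ones [H] varies at most at rate [e]. *)
Definition good_chain (x : R) := a <= x <= b /\ exists s : seq (R * R),
  [/\ all (fun u => [&& a <= u.1, u.1 <= u.2 & u.2 <= x]) s, pairwise (fun u v => u.2 <= v.1) s,
   \sum_(u <- s) (u.2 - u.1) <= m x &
   `|H x - H a| <= \sum_(u <- s) `|H u.2 - H u.1| + e * (x - a)].

Let chain_U x y : good_chain x -> x <= y <= b -> (forall t, x < t <= y -> U t) -> good_chain y.
Proof.
move=> [/andP[ax xb] [s [s1 s2 s3 s4]]] /andP[xy yb] hU.
split; first by rewrite (le_trans ax xy) yb.
exists (rcons s (x, y)); split.
- rewrite all_rcons /= ax xy lexx/=; apply: sub_all s1 => u /and3P[-> -> h].
  by rewrite /= (le_trans h).
- rewrite pairwise_rcons s2 andbT; apply: sub_all s1 => u /and3P[_ _ h]; exact: h.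
- rewrite -cats1 big_cat big_seq1/=; apply: (le_trans _ (m_cover _ _ ax xy hU)); exact: lerD.
- rewrite -cats1 big_cat big_seq1/=.
  have h : `|H y - H a| <= `|H y - H x| + `|H x - H a| by rewrite -{1}(subrKA (H x)) ler_normD.
  have h2 : e * (x - a) <= e * (y - a) by rewrite ler_wpM2l ?(ltW e0)// lerD2r.
  by move: h h2 s4; lra.
Qed.

Let chain_G x y : good_chain x -> x <= y <= b -> `|H y - H x| <= e * (y - x) -> good_chain y.
Proof.
move=> [/andP[ax xb] [s [s1 s2 s3 s4]]] /andP[xy yb] hG.
split; first by rewrite (le_trans ax xy) yb.
exists s; split => //.
- apply: sub_all s1 => u /and3P[-> -> h].
  by rewrite /= (le_trans h).
- exact: le_trans s3 (m_mono _ _ xy).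
- have h : `|H y - H a| <= `|H y - H x| + `|H x - H a| by rewrite -{1}(subrKA (H x)) ler_normD.
  have h2 : e * (y - a) = e * (x - a) + e * (y - x) by ring.
  by move: h h2 s4 hG; lra.
Qed.

Let chain_a : good_chain a.
Proof.
split; first by rewrite lexx.
exists [::]; split => //; last by rewrite big_nil !subrr normr0 mulr0 addr0.
by rewrite big_nil Itg_ge0// => t; rewrite /ooc; case: ifP => // _; rewrite indicE.
Qed.

(** Continuous induction on the supremum [c] of the points reached: near [c] a chain can be
    prolonged, either inside the open set [U] or by the slow variation of [H] at [c]. *)
Lemma good_chain_b : good_chain b.
Proof.
pose c := sup good_chain.
have S0 : has_sup good_chain.
  split; first by exists a.
  by exists b => x [/andP[]].
have ac : a <= c by apply: ub_le_sup => //; exact: S0.2.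
have cb : c <= b by apply: ge_sup; [exact: S0.1|move=> x [/andP[]]].
have ubc x : good_chain x -> x <= c by move=> hx; apply: ub_le_sup => //; exact: S0.2.
(* If every point of the set within [d] to the left of [c] leads [d / 2] beyond [c], or to [b], then
   maximality of [c] forces [b] to be reached. *)
have fin (d : R) : 0 < d -> (forall x, c - d < x -> good_chain x -> good_chain (Num.min b (c + d / 2))) -> good_chain b.
  move=> d0 hd; have [x hx xc] := sup_adherent d0 S0.
  have := hd x xc hx; case: leP => h //.
  by move=> /ubc; rewrite leNgt ltrDl divr_gt0.
have [Uc|Uc] := pselect (U c).
  have /nbhs_ballP [d /= d0 hd] := open_nbhs_nbhs (conj oU Uc).
  apply: (fin d d0) => x xc hx; have xc' := ubc x hx.
  apply: (chain_U x) => //.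
    by rewrite le_min ge_min (le_trans xc' cb) lexx/= andbT; rewrite (le_trans xc')// lerDl divr_ge0// ltW.
  move=> t /andP[xt]; rewrite le_min => /andP[_ tc]; apply: hd; rewrite /ball/= ltr_norml.
  by apply/andP; split; lra.
have [d d0 hd] := good c (introT andP (conj ac cb)) Uc.
apply: (fin d d0) => x xc hx; have xc' := ubc x hx.
have yc : c <= Num.min b (c + d / 2) by rewrite le_min cb lerDl divr_ge0// ltW.
have yc2 : Num.min b (c + d / 2) <= c + d / 2 by rewrite ge_min lexx orbT.
have yb : Num.min b (c + d / 2) <= b by rewrite ge_min lexx.
move: yc yc2 yb; set y := Num.min _ _ => yc yc2 yb.
apply: (chain_G x) => //; first by rewrite (le_trans xc' yc).
have h1 := hd x; have h2 := hd y.
rewrite distrC (distrC (H x)) ger0_norm ?subr_ge0// in h1.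
rewrite (ger0_norm (_ : 0 <= y - c)) ?subr_ge0// in h2.
have h3 : `|H y - H x| <= `|H y - H c| + `|H c - H x| by rewrite -{1}(subrKA (H c)) ler_normD.
have h4 : c - x < d by lra.
have h5 : y - c < d by lra.
have := h1 h4; have := h2 h5; move: h3.
rewrite (_ : e * (y - x) = e * (y - c) + e * (c - x)); last by ring.
lra.
Qed.

Lemma m_le_U (d : R) : (mu U < d%:E)%E -> m b < d.
Proof.
move=> Ud; rewrite -lte_fin; apply: le_lt_trans Ud.
have E : (mu U = \int[mu]_x (\1_U x)%:E)%E.
  by rewrite integral_indic ?setIT//; exact: open_measurable.
rewrite E (EFin_Itg _ (L1_ooc a b _ L1U)).
apply: ge0_integral_le.
- exact: (L1_meas _ (L1_ooc a b _ L1U)).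
- exact: (L1_meas _ L1U).
- by move=> t; rewrite /ooc indicE; case: ifP; rewrite ?lexx ?ler0n.
Qed.
End Constancy.

(** The exceptional null set is covered by an open [U] of measure below the threshold that absolute
    continuity attaches to [e]. The chain intervals inside [U] then contribute less than [e], the
    rest at most [e (b - a)]; the choice of [e] makes the sum equal to [k]. *)
Lemma abs_continuous_const a b H : a <= b -> abs_continuous_on a b H ->
  {ae mu, forall y, a < y < b -> derivable H y 1 /\ derive1 H y = 0} -> H b = H a.
Proof.
move=> ab acH aeH; apply/eqP; rewrite -subr_eq0 -normr_le0; apply/ler_addgt0Pl => k k0; rewrite addr0.
have ba0 : 0 < b - a + 1 by rewrite ltr_wpDl// subr_ge0.
pose e := k / (b - a + 1).
have e0 : 0 < e by rewrite divr_gt0.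
have [d d0 hd] := acH e e0.
have [A [mA A0 hA]] := aeH.
pose N := A `|` [set a] `|` [set b].
have mN : measurable N by do 2! apply: measurableU => //.
have N0 : mu N = 0%E.
  rewrite measureU0//; [|exact: measurableU|exact: lebesgue_measure_set1].
  rewrite measureU0//; exact: lebesgue_measure_set1.
have Nle : (mu N <= 0)%E := eq_ind_r (fun z => (z <= 0)%E) (lexx _) N0.
have [U [oU NU mUN]] := lebesgue_regularity_outer mN (le_lt_trans Nle (ltry _)) d0.
have mU : (mu U < d%:E)%E.
  apply: le_lt_trans mUN.
  have -> : U = (U `\` N) `|` N by rewrite setUC setDUK.
  apply: (le_trans (measureU2 _ _ _)) => //.
    by apply: measurableD => //; exact: open_measurable.
  rewrite setDUl setDv setU0 (_ : (U `\` N) `\` N = U `\` N); last first.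
    by apply/seteqP; split => x /=; tauto.
  by rewrite -[leRHS]adde0; apply: leeD.
have good y : a <= y <= b -> ~ U y ->
    exists2 d : R, 0 < d & forall z, `|z - y| < d -> `|H z - H y| <= e * `|z - y|.
  move=> /andP[ay yb] Uy.
  have yN : ~ N y by move=> /NU.
  have ya : y != a by apply/eqP => E; apply: yN; left; right.
  have yb' : y != b by apply/eqP => E; apply: yN; right.
  have yy : a < y < b by rewrite !lt_neqAle ay yb yb' eq_sym ya.
  have [h1 h2] : derivable H y 1 /\ derive1 H y = 0.
    by apply: contrapT => h; apply: yN; left; left; apply: hA => /(_ yy).
  exact: derive0_near.
have [_ [s [s1 s2 s3 s4]]] := good_chain_b a b H U e ab e0 oU (lt_trans mU (ltry _)) good.
have s3' := le_lt_trans s3 (m_le_U a b U oU (lt_trans mU (ltry _)) d mU).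
pose l (i : 'I_(size s)) := (nth (0, 0) s i).1; pose r (i : 'I_(size s)) := (nth (0, 0) s i).2.
have E (G : R * R -> R) : \sum_(u <- s) G u = \sum_(i < size s) G (nth (0, 0) s i).
  by rewrite (big_nth (0, 0)) big_mkord.
rewrite E in s3'; rewrite E in s4.
have := hd (size s) l r; rewrite /l /r => /(_ _ _ s3') K.
have {}K : \sum_(i < size s) `|H (nth (0, 0) s i).2 - H (nth (0, 0) s i).1| < e.
  apply: K => [i|i j ij].
    by have /and3P[] := allP s1 _ (mem_nth (0, 0) (ltn_ord i)).
  have /(pairwiseP (0, 0)) P := s2.
  have [h|h] : (i < j)%N \/ (j < i)%N by apply/orP; rewrite -neq_ltn.
    by left; apply: P h; rewrite inE ltn_ord.
  by right; apply: P h; rewrite inE ltn_ord.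
apply: (le_trans s4); apply: (le_trans (lerD (ltW K) (lexx _))).
by rewrite -{1}[e]mulr1 -mulrDr addrC /e divfK// gt_eqF.
Qed.

(** [F - prim g] is absolutely continuous with zero derivative almost everywhere, hence constant. *)
Lemma abs_continuous_FTC a b F g : a <= b -> abs_continuous_on a b F -> L1 g ->
  {ae mu, forall y, a < y < b -> derivable F y 1 /\ derive1 F y = g y} ->
  F b - F a = prim g b - prim g a.
Proof.
move=> ab acF g1 aeF.
have locg : locally_integrable [set: R] g by apply: open_integrable_locally g1; exact: openT.
have hg := @FTC1Ny R g (fun y => L1_on _ _ (measurable_itv _) g1) locg.
have := abs_continuous_const a b (fun x => F x - prim g x) ab (abs_continuousB _ _ _ _ acF (abs_continuous_prim _ _ _ g1)).
move=> E; suff : F b - prim g b = F a - prim g a by lra.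
apply: E; apply: (aeS2 _ _ _ _ aeF hg) => y hF [d1 d2] yab.
have [d3 d4] := hF yab; split; first exact: derivableB.
by rewrite derive1E deriveB// -!derive1E d4 d2 subrr.
Qed.

End AbsoluteContinuity.

(** * The profile *)

Section HalfLine.
Context {R : realType}.
Local Notation mu := (@lebesgue_measure R).
Implicit Types (f g h F H : R -> R) (xi : R[i]).

(** The free phase covers the cosine ([ph = 0]) and minus the sine ([ph = pi / 2]) at once; the
    added 1 keeps the integrand nonnegative. *)
Lemma wexp_phase (l s ph : R) : 0 < l ->
  L1 (fun k => if 0 <= k then expR (- l * k) * (1 + cos (k * s + ph)) else 0) /\
  \int[mu]_k (if 0 <= k then expR (- l * k) * (1 + cos (k * s + ph)) else 0) =
  l^-1 + (l * cos ph - s * sin ph) / (l ^+ 2 + s ^+ 2).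
Proof.
move=> l0.
have ls0 : 0 < l ^+ 2 + s ^+ 2 by rewrite ltr_wpDr ?sqr_ge0// exprn_gt0.
pose F (k : R) := - (l^-1 * expR (- l * k)) + (l ^+ 2 + s ^+ 2)^-1 * (expR (- l * k) * (s * sin (k * s + ph) - l * cos (k * s + ph))).
have dF (k : R) : is_derive k 1 F (expR (- l * k) * (1 + cos (k * s + ph))).
  apply: is_derive_eq; rewrite /GRing.scale/=; field.
  by rewrite !gt_eqF.
have c0 x : 0 <= expR (- l * x) * (1 + cos (x * s + ph)).
  by rewrite mulr_ge0 ?expR_ge0// -lerBlDl sub0r cos_geN1.
apply: L1_halfline.
- by mfun.
- by move=> x _; exact: c0.
- rewrite (@ge0_continuous_FTC2y _ _ F 0 0).
  + have F0 : F 0 = - l^-1 + (l ^+ 2 + s ^+ 2)^-1 * (s * sin ph - l * cos ph).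
      by rewrite /F !mulr0 mul0r add0r expR0 mul1r mulr1.
    rewrite F0 -EFinB; congr EFin; field.
    by rewrite !gt_eqF.
  + by move=> x _; exact: c0.
  + apply: continuous_subspaceT => x.
    apply: derivable_cont; exact: ex_derive.
  + pose C := l^-1 + (l ^+ 2 + s ^+ 2)^-1 * (`|s| + l).
    have C0 : C * expR (- l * x) @[x --> +oo] --> 0.
      by rewrite -[X in _ --> X](mulr0 C); apply: cvgM; [exact: cvg_cst|exact: cvg_expR_oo].
    apply: norm_cvg0; apply: (squeeze_cvgr _ (cvg_cst 0) C0).
    apply: nearW => x; rewrite normr_ge0/= /F /C.
    apply: le_trans (ler_normD _ _) _.
    rewrite normrN !normrM !(ger0_norm (expR_ge0 _)).
    have l10 : 0 < l^-1 by rewrite invr_gt0.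
    have ls10 : 0 < (l ^+ 2 + s ^+ 2)^-1 by rewrite invr_gt0.
    rewrite (gtr0_norm l10) (gtr0_norm ls10) mulrDl lerD2l -mulrA (ler_pM2l ls10) mulrC.
    rewrite ler_wpM2r ?expR_ge0//.
    rewrite (le_trans (ler_normB _ _))// !normrM (gtr0_norm l0).
    by rewrite lerD// ler_piMr ?normr_sin_le ?normr_cos_le// ltW.
  + by move=> x _; exact: (@ex_derive _ _ _ _ _ _ _ (dF x)).
  + apply: cvg_at_right_filter; apply: derivable_cont.
    exact: (@ex_derive _ _ _ _ _ _ _ (dF 0)).
  + by move=> x _; rewrite derive1E (@derive_val _ _ _ _ _ _ _ (dF x)).
Qed.

(** The Heaviside function: convolution with it is the primitive [prim], so that taking primitives
    becomes division by [xi]. *)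
Definition hv (y : R) : R := if 0 <= y then 1 else 0.

Lemma measurable_hv : measurable_fun setT hv.
Proof. by rewrite /hv; mfun. Qed.

Lemma hv_LT (e : R) : 0 < e -> LT e hv.
Proof.
move=> e0; apply: (eq_L1 _ _ _ (L1_wexp e e0)) => y; rewrite /wexp /hv.
by case: ifP => _; rewrite ?mulr1 ?mulr0.
Qed.

Lemma lap_hv xi : 0 < Re xi -> lap hv xi = xi^-1.
Proof.
case: xi => l s /= l0.
have ls0 : 0 < l ^+ 2 + s ^+ 2 by rewrite ltr_wpDr ?sqr_ge0// exprn_gt0.
have P ph : \int[mu]_k (wexp l k * cos (k * s + ph)) = (l * cos ph - s * sin ph) / (l ^+ 2 + s ^+ 2).
  have [h1 E1] := wexp_phase l s ph l0; have hw := L1_wexp l l0.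
  have E0 : \int[mu]_k wexp l k = l^-1.
    have := Itg_wexp_cos l 0 l0; rewrite (eq_Itg _ (wexp l)); last by move=> k; rewrite mulr0 cos0 mulr1.
    by move=> ->; field; rewrite gt_eqF.
  have -> : (l * cos ph - s * sin ph) / (l ^+ 2 + s ^+ 2) = (l^-1 + (l * cos ph - s * sin ph) / (l ^+ 2 + s ^+ 2)) - l^-1 by rewrite addrAC subrr add0r.
  rewrite -E1 -E0 -(ItgB _ _ h1 hw).
  apply: eq_Itg => k; rewrite /wexp; case: ifP => _; last by rewrite mul0r subrr.
  ring.
have E y : (hv y)%:C * ce (l +i* s) y = (wexp l y * cos (y * s + 0)) +i* (wexp l y * cos (y * s + pi / 2)).
  apply/eqP; rewrite eq_complex/= /hv /wexp !mul0r subr0 addr0 addr0.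
  have -> : cos (y * s + pi / 2) = - sin (y * s).
    by rewrite cosD cos_pihalf sin_pihalf mulr0 sub0r mulr1.
  by rewrite (mulrC s y); case: ifP => _; rewrite ?mul1r ?mul0r ?mulrN ?eqxx.
have -> : (l +i* s)^-1 = (l / (l ^+ 2 + s ^+ 2)) +i* (- (s / (l ^+ 2 + s ^+ 2))).
  apply/eqP; rewrite -subr_eq0; apply/eqP.
  have n0 : (l +i* s : R[i]) != 0 by rewrite eq_complex/= negb_and gt_eqF.
  apply: (mulfI n0); rewrite mulr0 mulrBr mulfV//; apply/eqP; rewrite eq_complex/=.
  by rewrite !subrr eqxx.
rewrite /lap (eq_cI _ _ E) /cI/=.
rewrite [X in X +i* _]P [X in _ +i* X]P cos0 sin0 cos_pihalf sin_pihalf.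
by apply/eqP; rewrite eq_complex/=; apply/andP; split; apply/eqP; field; rewrite gt_eqF.
Qed.

Lemma lap_hv_shift xi : 0 < Re xi ->
  LT (Re xi) (fun y => hv (y - 1)) /\ lap (fun y => hv (y - 1)) xi = ce xi 1 / xi.
Proof.
move=> e0; have L := hv_LT _ e0; have cL := lap_cL1 hv xi L.
have mh := measurable_hv; split.
  have mh1 : measurable_fun setT (fun y : R => hv (y - 1)).
    have m1 : measurable_fun setT (fun y : R => y - 1) by mfun.
    exact: measurable_comp_real _ _ _ _ mh m1.
  apply: (LT_le _ _ _ mh1 _ L) => y; rewrite /hv subr_ge0; case: (leP 1 y) => h.
    by rewrite normr1 (le_trans ler01 h).
  by rewrite normr0; case: ifP.
rewrite -(lap_hv _ e0) /lap -(cIZ (ce xi 1) _ cL).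
have LF := cL1Z (ce xi 1) _ cL.
have EF y : (hv (y - 1))%:C * ce xi y = ce xi 1 * ((hv (y + -1))%:C * ce xi (y + -1)).
  have -> : ce xi y = ce xi (y - 1) * ce xi 1 by rewrite -ceD subrK.
  by ring.
rewrite (eq_cI _ _ EF) /cI; congr (_ +i* _).
  exact: (L1_shift (-1) _ LF.1).2.
exact: (L1_shift (-1) _ LF.2).2.
Qed.

Lemma convolution_hv g : convolution hv g = prim g.
Proof.
apply: funext => x; rewrite /convolution /prim [RHS]Itg_mkcond; apply: eq_Itg => y.
rewrite indicE /hv subr_ge0; case: ifPn => h; first by rewrite mem_set ?mulr1 ?mul1r//= in_itv/=.
by rewrite memNset ?mulr0 ?mul0r//= in_itv/=; exact/negP.
Qed.

(** The product rule for increments, once [f] is known to be bounded on [[1, b]]. *)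
Lemma abs_continuous_id_mul b f : (forall b, abs_continuous_on 1 b f) ->
  abs_continuous_on 1 b (fun y => y * f y).
Proof.
move=> acf; have [b1|b1] := leP b 1.
  move=> e e0; exists 1 => // n l r lr _ _; rewrite big1// => i _.
  by case: (lr i) => h1 h2 h3; rewrite (_ : l i = r i) ?subrr ?normr0//; lra.
have [d d0 hd] := acf b 1 ltr01.
have step x y : 1 <= x -> x <= y -> y <= b -> y - x < d -> `|f y - f x| < 1.
  move=> x1 xy yb yx; have := hd 1%N (fun=> x) (fun=> y); rewrite !big_ord1; apply => //.
  by move=> i j; rewrite !ord1 eqxx.
(* By [step] the function varies by less than 1 over a length [d / 2], so [k] such steps from 1 cost
   at most [k]. *)
have bnd (k : nat) y : 1 <= y <= b -> y <= 1 + k%:R * (d / 2) -> `|f y| <= `|f 1| + k%:R.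
  elim: k y => [|k IH] y /andP[y1 yb].
    by rewrite mul0r addr0 => y1'; rewrite (_ : y = 1) ?addr0//; lra.
  rewrite -natr1 mulrDl mul1r => yk.
  have [h|h] := leP (y - d / 2) 1.
    have := step 1 y (lexx _) y1 yb; have k0 := ler0n R k.
    have := ler_distD 0 (f y) 0; move=> _ H.
    have := ler_normD (f y - f 1) (f 1); rewrite subrK; have : y - 1 < d by lra.
    by move=> /H; lra.
  have := IH (y - d / 2); rewrite (ltW h)/= => IH'.
  have H := step (y - d / 2) y (ltW h).
  have := ler_normD (f y - f (y - d / 2)) (f (y - d / 2)); rewrite subrK.
  have : `|f y - f (y - d / 2)| < 1 by apply: H; lra.
  have : `|f (y - d / 2)| <= `|f 1| + k%:R by apply: IH'; lra.
  lra.
have [K K0 hK] : exists2 K : R, 0 < K & forall y, 1 <= y <= b -> `|f y| <= K.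
  pose k := (Num.truncn ((b - 1) / (d / 2))).+1.
  exists (`|f 1| + k%:R) => [|y yb]; first by rewrite ltr_wpDl// ltr0n.
  apply: bnd => //; case/andP: yb => _ yb.
  have : (b - 1) / (d / 2) < k%:R := truncnS_gt _.
  by rewrite ltr_pdivrMr ?divr_gt0//; lra.
move=> e e0; have e2 : 0 < e / 2 / b by rewrite !divr_gt0//; lra.
have [d1 d10 hd1] := acf b _ e2.
exists (Num.min d1 (e / 2 / K)); first by rewrite lt_min d10 !divr_gt0.
move=> n l r lr dis; rewrite lt_min => /andP[l1 l2].
have b0 : 0 < b by lra.
apply: (@le_lt_trans _ _ (\sum_(i < n) (b * `|f (r i) - f (l i)| + K * (r i - l i)))).
  apply: ler_sum => i _; have [h1 h2 h3] := lr i.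
  have -> : r i * f (r i) - l i * f (l i) = r i * (f (r i) - f (l i)) + (r i - l i) * f (l i) by ring.
  apply: (le_trans (ler_normD _ _)); rewrite !normrM; apply: lerD.
    by rewrite ler_wpM2r// ger0_norm//; lra.
  rewrite ger0_norm ?subr_ge0// mulrC ler_wpM2r ?subr_ge0// hK//.
  by rewrite h1 (le_trans h2 h3).
rewrite big_split/= -!mulr_sumr [ltRHS](splitr e); apply: ltrD.
  by rewrite mulrC -ltr_pdivlMr// hd1.
by rewrite mulrC -ltr_pdivlMr.
Qed.

(** The assumption bounds the logarithmic derivative of [Nf] in the variable [ln s], so the quotient
    [G] of [Nf] by [s^kp] is nonincreasing. *)
Lemma derive_ratio (Nf dN : R -> R) (kp r : R) : 0 < r -> r < 1 ->
  (forall s : R, 0 < s -> is_derive s (1 : R) Nf (dN s)) ->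
  (forall s, r < s < 1 -> s * dN s <= kp * Nf s) -> Nf 1 * r `^ kp <= Nf r.
Proof.
move=> r0 r1 hN hd.
pose G s := Nf s * expR (- kp * ln s).
have dG (s : R) : 0 < s -> is_derive s (1 : R) G (expR (- kp * ln s) * (dN s - kp * s^-1 * Nf s)).
  move=> s0; have h1 := hN s s0; have h2 := is_derive1_ln s0.
  apply: is_derive_eq; rewrite /GRing.scale/=; ring.
have hx x : x \in `]r, 1[ -> is_derive x (1 : R) G (expR (- kp * ln x) * (dN x - kp * x^-1 * Nf x)).
  by rewrite in_itv/= => /andP[h _]; apply: dG; exact: lt_trans h.
have cw : {within `[r, 1], continuous G}.
  apply: derivable_within_continuous => x; rewrite in_itv/= => /andP[h _].
  exact: (@ex_derive _ _ _ _ _ _ _ (dG x (lt_le_trans r0 h))).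
have [c cr E] := @MVT R G _ r 1 r1 hx cw.
have c0 : 0 < c by move: cr; rewrite in_itv/= => /andP[h _]; exact: lt_trans h.
have : G 1 - G r <= 0.
  rewrite E; have r10 : 0 < 1 - r by rewrite subr_gt0.
  rewrite pmulr_lle0// pmulr_rle0 ?expR_gt0// subr_le0.
  have := hd c; move: cr; rewrite in_itv/= => -> /(_ isT).
  move=> h; have -> : kp / c * Nf c = c^-1 * (kp * Nf c) by ring.
  by rewrite ler_pdivlMl.
rewrite subr_le0 /G ln1 mulr0 expR0 mulr1 => h.
rewrite /powR gt_eqF// -ler_pdivlMr ?expR_gt0// -expRN -mulNr//.
Qed.

Lemma derive_ratio_ge (Nf dN : R -> R) (kp r : R) : 0 < r -> r < 1 ->
  (forall s : R, 0 < s -> is_derive s (1 : R) Nf (dN s)) ->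
  (forall s, r < s < 1 -> kp * Nf s <= s * dN s) -> Nf r <= Nf 1 * r `^ kp.
Proof.
move=> r0 r1 hN hd; rewrite -lerN2 -mulNr.
apply: (derive_ratio (fun s => - Nf s) (fun s => - dN s) kp r r0 r1) => s hs.
  by have h := hN s hs; apply: is_derive_eq.
by rewrite !mulrN lerN2 hd.
Qed.

(** Integrates the pointwise bound of [|1 - e^(- xi y)|] by [2 min(1, (Re xi + Im xi) y)]. *)
Lemma cn_Itg_lap g xi : L1 g -> (forall y, y < 1 -> g y = 0) -> 0 <= Re xi -> 0 <= Im xi ->
  cn ((\int[mu]_y g y)%:C - lap g xi) <= 2 * hrd g (Re xi + Im xi).
Proof.
move=> g1 gc e0 k0; have mg := L1_meas _ g1.
have gca : causal g by move=> y y0; apply: gc; exact: lt_trans ltr01.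
have L := lap_cL1 g xi (L1_LT _ _ e0 gca g1).
have m0 : measurable_fun setT (fun _ : R => 0 : R) by mfun.
have C1 : cL1 (fun y => (g y)%:C) by split; [exact: g1|exact: L1_0].
have E : (\int[mu]_y g y)%:C = cI (fun y => (g y)%:C) by rewrite /cI/= /Rintegral integral0.
rewrite E /lap -(cIB _ _ C1 L) /hrd.
have mi : measurable_fun setT (fun y : R => ((Re xi + Im xi : R) * y : R)) by mfun.
have mm := measurable_min _ _ _ mi.
have Lm : L1 (fun y => `|g y| * Num.min 1 ((Re xi + Im xi) * y)).
  have m : measurable_fun setT (fun y => `|g y| * Num.min 1 ((Re xi + Im xi) * y)) by mfun.
  apply: (L1_le _ _ m _ (L1_norm _ g1)) => y.
  have [y1|y1] := ltP y 1; first by rewrite gc// normr0 mul0r normr0.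
  rewrite normrM normr_id ler_piMr// ger0_norm ?ge_min ?lexx//.
  by rewrite le_min ler01/= mulr_ge0 ?addr_ge0// (le_trans ler01).
rewrite -(ItgZ _ _ Lm); apply: (cI_cn _ _ _ (L1Z _ _ Lm)).
  by apply: cmeasD; [exact: cL1_cmeas C1|apply: cmeasN; exact: cL1_cmeas L].
move=> y; rewrite -{1}[(g y)%:C]mulr1 -mulrBr cnM cnC.
have [y1|y1] := ltP y 1; first by rewrite gc// normr0 !mul0r mulr0.
rewrite mulrCA ler_wpM2l//; apply: cn_1ce => //; exact: le_trans ler01 y1.
Qed.

Lemma hrd_small g (d : R) : L1 g -> (forall y, y < 1 -> g y = 0) -> 0 < d ->
  exists2 r0 : R, 0 < r0 & forall r, 0 <= r -> r <= r0 -> hrd g r <= d.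
Proof.
move=> g1 gc d0; have mg := L1_meas _ g1.
pose F (n : nat) y : R := `|g y| * Num.min 1 (n.+1%:R^-1 * y).
have mF n : measurable_fun setT (F n).
  have mi : measurable_fun setT (fun y : R => (n.+1%:R^-1 : R) * y : R) by mfun.
  have mm := measurable_min _ _ _ mi.
  by rewrite /F; mfun.
have min0 (r y : R) : 0 <= r -> 1 <= y -> 0 <= Num.min 1 (r * y).
  by move=> r0 y1; rewrite le_min ler01/= mulr_ge0// (le_trans ler01).
have FG n y : `|F n y| <= `|g y|.
  have [y1|y1] := ltP y 1; first by rewrite /F gc// normr0 mul0r normr0.
  by rewrite /F normrM normr_id ler_piMr// ger0_norm ?min0// ge_min lexx.
have m0 : measurable_fun setT (fun _ : R => 0 : R) by mfun.
have F0 : {ae mu, forall y, F n y @[n --> \oo] --> (0 : R)}.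
  apply: aeW => y; have [y1|y1] := ltP y 1.
    have -> : (fun n => F n y) = fun=> 0 by apply: funext => n; rewrite /F gc// normr0 mul0r.
    exact: cvg_cst.
  have C : `|g y| * (n.+1%:R^-1 * y) @[n --> \oo] --> `|g y| * (0 * y).
    by apply: cvgM; [exact: cvg_cst|apply: cvgM; [exact: cvg_harmonic|exact: cvg_cst]].
  rewrite mul0r mulr0 in C; apply: (squeeze_cvgr _ (cvg_cst 0) C).
  apply: nearW => n; rewrite /F mulr_ge0 ?min0//= ler_wpM2l// ge_min lexx orbT//.
have [_] := dct F (fun=> 0) _ mF m0 (L1_norm _ g1) FG F0.
rewrite (_ : \int[mu]_x 0 = 0); last by rewrite /Rintegral integral0.
move=> /cvgrPdist_lt /(_ _ d0)[n _ /(_ n (leqnn n))] /=; rewrite sub0r normrN => Fn.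
exists n.+1%:R^-1 => // r r0 rn; apply: le_trans (le_trans (ler_norm _) (ltW Fn)).
have LF := L1_le _ _ (mF n) (FG n) (L1_norm _ g1).
have mi : measurable_fun setT (fun y : R => r * y : R) by mfun.
have mm := measurable_min _ _ _ mi.
have m : measurable_fun setT (fun y => `|g y| * Num.min 1 (r * y)) by mfun.
have LH : L1 (fun y => `|g y| * Num.min 1 (r * y)).
  apply: (L1_le _ _ m _ (L1_norm _ g1)) => y.
  have [y1|y1] := ltP y 1; first by rewrite gc// normr0 mul0r normr0.
  by rewrite normrM normr_id ler_piMr// ger0_norm ?min0// ge_min lexx.
apply: (Itg_le _ _ LH LF) => y; rewrite /F.
have [y1|y1] := ltP y 1; first by rewrite gc// normr0 !mul0r.
by rewrite ler_wpM2l// le_min !ge_min lexx/= ler_wpM2r ?orbT// (le_trans ler01).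
Qed.

End HalfLine.

Section Profile.
Context {R : realType}.
Local Notation mu := (@lebesgue_measure R).
Variables (N : nat) (p : nat -> R).
Hypotheses (p_ge0 : forall j, (1 <= j <= N)%N -> 0 <= p j)
  (p_sum1 : \sum_(1 <= j < N.+1) p j = 1).
Variables (theta : R) (eta : R -> R).
Hypotheses (theta_gt0 : 0 < theta) (etaP : is_profile N p theta eta).
Local Notation q := (qcst N p).
Implicit Types (xi : R[i]).

Let c := theta / q.
Let q_gt0 : 0 < q. Proof. exact: lt_le_trans ltr01 (q_ge1 N p p_ge0 p_sum1). Qed.
Let c_gt0 : 0 < c. Proof. by rewrite divr_gt0. Qed.
Let in1 : in_L1 eta. Proof. by have [[]] := etaP. Qed.

Definition pf : R -> R := ext0 eta.
Definition BB xi : R[i] := lap pf xi.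
Definition MB xi : R[i] := lap (fun y => y * pf y) xi.

Lemma pf_causal : causal pf.
Proof. by move=> y y0; apply: ext0_lt1; exact: lt_trans ltr01. Qed.

Lemma pf_LTall : LTall pf. Proof. exact: ext0_LTall. Qed.

(** The differential equation integrated from 1: the Heaviside term carries the boundary value
    [eta 1 = c], and the primitive may start at minus infinity because the source vanishes below
    2. *)
Lemma profile_prim (y : R) : y * pf y = c * hv (y - 1) + - c * prim (T1 (Qconv N p eta)) y.
Proof.
have LT1 := L1_T1 N p _ in1.
have P0 x : x < 2 -> prim (T1 (Qconv N p eta)) x = 0.
  move=> x2; rewrite /prim Itg_mkcond (eq_Itg _ (fun=> 0)).
    by rewrite /Rintegral integral0.
  move=> t; rewrite indicE; case: (boolP (t \in _)) => ht; last by rewrite mulr0.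
  by move: ht; rewrite inE/= in_itv/= => tx; rewrite /T1 leNgt (le_lt_trans tx)//= mul0r.
rewrite /pf /ext0 /hv subr_ge0; case: (leP 1 y) => y1; last first.
  by rewrite P0 ?mulr0 ?addr0//; lra.
have [_ ac ae e1] := etaP.
have L := L1Z (- c) _ LT1.
have H := abs_continuous_FTC 1 y (fun z => z * eta z) _ y1 (abs_continuous_id_mul y _ ac) L.
have E x : prim (fun t => - c * T1 (Qconv N p eta) t) x = - c * prim (T1 (Qconv N p eta)) x.
  by rewrite /prim RintegralZl//; exact: (L1_on _ _ (measurable_itv _) LT1).
have : y * eta y - 1 * eta 1 = prim (fun t => - c * T1 (Qconv N p eta) t) y - prim (fun t => - c * T1 (Qconv N p eta) t) 1.
  apply: H; apply: (aeS _ _ _ ae) => x hx /andP[x1 xy]; have [d1 d2] := hx x1.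
  by split => //; apply/eqP; rewrite mulNr -subr_eq0 opprK; apply/eqP.
rewrite !E (P0 1) ?ltr1n// mulr0 subr0 mul1r e1 mulr1 -/c; lra.
Qed.

(** Both terms of [profile_prim] are convolutions with the Heaviside function up to a unit shift, so
    [e^(- xi) / xi] factors out. *)
Lemma MB_eq xi : 0 < Re xi -> MB xi = c%:C * ce xi 1 / xi * (1 - QC N p (BB xi)).
Proof.
move=> e0; have LT1 := L1_T1 N p _ in1.
have cT : causal (T1 (Qconv N p eta)).
  by move=> y y0; rewrite /T1 leNgt (lt_trans y0).
have LTT := L1_LT _ _ (ltW e0) cT LT1.
have [h1 h2] := lap_hv_shift xi e0.
have [l1 l2] := lap_convolution hv _ xi (hv_LT _ e0) LTT.
rewrite convolution_hv in l1 l2.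
rewrite /MB (eq_lap _ _ xi profile_prim) (lapD _ _ xi (LTZ _ c _ h1) (LTZ _ (- c) _ l1)).
rewrite (lapZ c _ xi h1) (lapZ (- c) _ xi l1) h2 l2 (lap_hv _ e0) (lap_T1 N p eta xi in1 e0) -/(BB xi).
by rewrite rmorphN; ring.
Qed.

Lemma cn_BB xi : 0 < Re xi -> cn (BB xi) <= expR (- Re xi).
Proof.
move=> e0; have [hd _ _ _] := etaP.
by rewrite /BB /pf (lap_pdens _ xi hd) cn_lap_density ?ltW//; exact: density_pdens.
Qed.

Lemma cn_BB1 xi : 0 < Re xi -> cn (BB xi) < 1.
Proof. by move=> e0; apply: (le_lt_trans (cn_BB xi e0)); rewrite -expR0 ltr_expR oppr_lt0. Qed.

Lemma BB_gap (r : R) : 0 < r -> exists2 k : R, 0 < k &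
  forall xi, 0 < Re xi -> 0 <= Im xi -> r <= Re xi + Im xi -> cn (BB xi) <= 1 - k.
Proof.
move=> r0; have [hd _ _ _] := etaP.
have [k k0 H] := lap_density_gap _ r (density_pdens _ hd) r0.
by exists k => // -[e x] /= h1 h2 h3; rewrite /BB /pf (lap_pdens _ _ hd) H.
Qed.

Definition DB xi : R[i] := 1 - BB xi.

Lemma DB_le2 xi : 0 < Re xi -> cn (DB xi) <= 2.
Proof.
move=> e0; apply: (le_trans (cnB _ _)); rewrite cn1 -[2]/(1 + 1) lerD2l.
exact: ltW (cn_BB1 _ e0).
Qed.

Let rs xi : R := Re xi + Im xi.

Lemma cn_ge_rs xi : 0 <= Re xi -> 0 <= Im xi -> rs xi <= 2 * cn xi.
Proof.
move=> e0 k0; have h1 := Re_cn xi; have h2 := Im_cn xi.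
by rewrite !ger0_norm// in h1 h2; rewrite /rs; lra.
Qed.

Lemma cn_ce_le1 xi : 0 <= Re xi -> cn (ce xi 1) <= 1.
Proof. by move=> e0; rewrite cn_ce mulr1 expRN_le1. Qed.

Lemma cn_1Q_DB xi : 0 < Re xi -> cn (1 - QC N p (BB xi)) <= q * cn (DB xi).
Proof.
move=> e0; rewrite -{1}(QC1 N p p_sum1); apply: cn_QCB => //; first by rewrite cn1.
exact: ltW (cn_BB1 _ e0).
Qed.

Lemma cn_MB xi : 0 < Re xi -> 0 <= Im xi -> cn (MB xi) <= 2 * theta * cn (DB xi) / rs xi.
Proof.
move=> e0 k0; have r0 : 0 < rs xi by rewrite ltr_wpDr.
rewrite (MB_eq _ e0) !cnM cnV cnC (gtr0_norm c_gt0).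
have x0 : 0 < cn xi.
  by rewrite cn_gt0; apply/eqP => E; move: e0; rewrite E ltxx.
have h : (cn xi)^-1 <= 2 / rs xi.
  have r2 : 0 < rs xi / 2 by rewrite divr_gt0.
  have -> : 2 / rs xi = (rs xi / 2)^-1 by field; rewrite gt_eqF.
  rewrite lef_pV2 ?posrE// ler_pdivrMr// mulrC; exact: cn_ge_rs (ltW e0) k0.
have -> : 2 * theta * cn (DB xi) / rs xi = c * 1 * (2 / rs xi) * (q * cn (DB xi)).
  by rewrite /c; field; rewrite !gt_eqF.
have i0 : 0 <= (cn xi)^-1 by rewrite invr_ge0 cn_ge0.
have cc0 : 0 <= c * cn (ce xi 1) := mulr_ge0 (ltW c_gt0) (cn_ge0 _).
apply: ler_pM (mulr_ge0 cc0 i0) (cn_ge0 _) _ (cn_1Q_DB _ e0).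
apply: ler_pM cc0 i0 _ h.
by apply: ler_wpM2l; [exact: ltW c_gt0|rewrite cn_ce_le1// ltW].
Qed.

Definition ND xi (r : R) : R := cn (DB (r%:C * xi)) ^+ 2.

Definition dND xi (r : R) : R :=
  2 * Re ((DB (r%:C * xi))^* * (xi * MB (r%:C * xi))).

Lemma ReZ (r : R) xi : Re (r%:C * xi) = r * Re xi.
Proof. by case: xi => a b /=; rewrite mul0r subr0. Qed.

Lemma ImZ (r : R) xi : Im (r%:C * xi) = r * Im xi.
Proof. by case: xi => a b /=; rewrite mul0r addr0. Qed.

Lemma is_derive_ND xi (r : R) : 0 < Re xi -> 0 < r -> is_derive r (1 : R) (ND xi) (dND xi r).
Proof.
move=> e0 r0; have [h1 h2] := is_derive_lap pf xi r pf_causal pf_LTall e0 r0.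
have E : ND xi = fun r => (1 - Re (lap pf (r%:C * xi))) ^+ 2 + (Im (lap pf (r%:C * xi))) ^+ 2.
  apply: funext => s; rewrite /ND /DB /BB cn_sq; case: (lap _ _) => x y /=.
  by rewrite sub0r sqrrN.
have K (A B : R -> R) (dA dB : R) : is_derive r (1 : R) A dA -> is_derive r (1 : R) B dB ->
    is_derive r (1 : R) (fun r => (1 - A r) ^+ 2 + (B r) ^+ 2) (- 2 * (1 - A r) * dA + 2 * B r * dB).
  by move=> hA hB; apply: is_derive_eq; rewrite /GRing.scale/=; ring.
have := K _ _ _ _ h1 h2; rewrite E; congr (is_derive _ _ _ _).
rewrite /dND /DB /BB /MB; set L := lap pf _; set M := lap _ _; clearbody L M.
case: L => x y; case: M => u v; case: (xi) => a b /=; ring.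
Qed.

Lemma r_dND xi (r : R) : 0 < Re xi -> 0 < r ->
  r * dND xi r = 2 * c * Re ((DB (r%:C * xi))^* * (ce (r%:C * xi) 1 * (1 - QC N p (BB (r%:C * xi))))).
Proof.
move=> e0 r0; set z := r%:C * xi.
have ez : 0 < Re z by rewrite /z ReZ mulr_gt0.
have z0 : z != 0 by apply/eqP => E; move: ez; rewrite E ltxx.
have -> : r * dND xi r = 2 * Re ((DB z)^* * (z * MB z)).
  have G (M Dc : R[i]) : r * (2 * Re (Dc * (xi * M))) = 2 * Re (Dc * (r%:C * xi * M)).
    by case: M => u v; case: Dc => x y; case: (xi) => a b /=; ring.
  exact: G.
rewrite (MB_eq _ ez) (_ : z * (c%:C * ce z 1 / z * (1 - QC N p (BB z))) = (ce z 1 * (1 - QC N p (BB z))) * c%:C); last by field.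
by rewrite mulrA ReMr; ring.
Qed.

Lemma cn_conj (z : R[i]) : cn z^* = cn z.
Proof. by rewrite /cn; case: z => x y /=; rewrite sqrrN. Qed.

(** By [MB_eq] the logarithmic derivative of [|1 - B(s xi)|^2] in [ln s] is at most [2 theta] in
    absolute value, since [(theta / q) |1 - Q(B)| <= theta |1 - B|]. Integrating it in both
    directions gives the two inequalities. *)
Lemma harnack xi (r : R) : 0 < Re xi -> 0 < r -> r < 1 ->
  cn (DB xi) ^+ 2 * r `^ (2 * theta) <= cn (DB (r%:C * xi)) ^+ 2 /\
  cn (DB (r%:C * xi)) ^+ 2 * r `^ (2 * theta) <= cn (DB xi) ^+ 2.
Proof.
move=> e0 r0 r1.
have B (s : R) : r < s < 1 -> `|s * dND xi s| <= 2 * theta * ND xi s.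
  move=> /andP[rs' _]; have s0 : 0 < s := lt_trans r0 rs'.
  have ez : 0 < Re (s%:C * xi) by rewrite ReZ mulr_gt0.
  rewrite (r_dND _ _ e0 s0) normrM normrM (gtr0_norm c_gt0) (ger0_norm (ler0n R 2)).
  have -> : 2 * theta * ND xi s = 2 * c * (cn (DB (s%:C * xi)) * (1 * (q * cn (DB (s%:C * xi))))).
    by rewrite /ND /c; field; rewrite gt_eqF.
  apply: ler_wpM2l; first exact: mulr_ge0 (ler0n R 2) (ltW c_gt0).
  apply: (le_trans (Re_cn _)); rewrite !cnM cn_conj.
  apply: ler_wpM2l; first exact: cn_ge0.
  apply: ler_pM; rewrite ?cn_ge0 ?cn_ce_le1 ?(ltW ez)//.
  exact: cn_1Q_DB.
have E1 : ND xi 1 = cn (DB xi) ^+ 2 by rewrite /ND rmorph1 mul1r.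
split.
  rewrite -E1; apply: (derive_ratio _ (dND xi) _ _ r0 r1) => [s s0|s /B].
    exact: is_derive_ND.
  by move=> h; apply: le_trans (ler_norm _) h.
have K : ND xi r <= ND xi 1 * r `^ (- (2 * theta)).
  apply: (derive_ratio_ge _ (dND xi) _ _ r0 r1) => [s s0|s /B].
    exact: is_derive_ND.
  by rewrite ler_norml mulNr => /andP[].
rewrite -E1 -[X in X * _ <= _]/(ND xi r).
apply: (le_trans (ler_wpM2r (powR_ge0 _ _) K)).
by rewrite -mulrA -powRD ?addNr ?powRr0 ?mulr1// (gt_eqF r0) implybT.
Qed.

Lemma DB_small (d : R) : 0 < d -> exists2 r0 : R, 0 < r0 &
  forall xi, 0 < Re xi -> 0 <= Im xi -> rs xi <= r0 -> cn (DB xi) <= d.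
Proof.
move=> d0; have [hd _ _ _] := etaP; have [f1 fc f0 fm] := density_pdens _ hd.
have d2 : 0 < d / 2 by rewrite divr_gt0.
have [r0 r00 H] := hrd_small _ _ f1 fc d2.
exists r0 => // xi e0 k0 hr.
have := cn_Itg_lap _ xi f1 fc (ltW e0) k0; rewrite fm rmorph1 /DB /BB /pf (lap_pdens _ xi hd) => h.
apply: (le_trans h); have := H _ (addr_ge0 (ltW e0) k0) hr; lra.
Qed.

(** Near the origin [e^(- xi)] is close to 1 and [1 - Q(B)] close to [q (1 - B)], so the logarithmic
    derivative of [harnack] is close to [2 theta] and stays above [2 th']. *)
Lemma harnack_upper (th' : R) : th' < theta -> exists2 r0 : R, 0 < r0 &
  forall xi (r : R), 0 < Re xi -> 0 <= Im xi -> rs xi <= r0 -> 0 < r -> r < 1 ->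
  cn (DB (r%:C * xi)) ^+ 2 <= cn (DB xi) ^+ 2 * r `^ (2 * th').
Proof.
move=> tt; have q20 := q2_ge0 N p p_ge0.
(* [d] bounds the quadratic remainder of [Q] and [r2], below, the deviation of [e^(- xi)] from 1;
   each error takes half of the gap [theta - th']. *)
pose d := (theta - th') / (2 * (c * q2 N p + 1)).
have cq : 0 < c * q2 N p + 1 by rewrite ltr_wpDl// mulr_ge0// ltW.
have d0 : 0 < d by rewrite divr_gt0 ?mulr_gt0// subr_gt0.
have [r1 r10 H] := DB_small _ d0.
pose r2 := (theta - th') / (4 * theta).
have r20 : 0 < r2 by rewrite divr_gt0 ?mulr_gt0// subr_gt0.
exists (Num.min r1 r2); first by rewrite lt_min r10.
move=> xi r e0 k0; rewrite le_min => /andP[h1 h2] r0 rr1.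
have -> : cn (DB xi) ^+ 2 = ND xi 1 by rewrite /ND rmorph1 mul1r.
apply: (derive_ratio_ge _ (dND xi) _ _ r0 rr1) => [s s0|s /andP[rs' s1]].
  exact: is_derive_ND.
have s0 : 0 < s := lt_trans r0 rs'; rewrite (r_dND _ _ e0 s0) /ND.
have ez : 0 < Re (s%:C * xi) by rewrite ReZ mulr_gt0.
have kz : 0 <= Im (s%:C * xi) by rewrite ImZ mulr_ge0// ltW.
have rz : rs (s%:C * xi) <= rs xi.
  by rewrite /rs ReZ ImZ -mulrDr ler_piMl ?(ltW s1)// addr_ge0// ltW.
move: ez kz rz; set z := s%:C * xi => ez kz rz.
have Dd := H z ez kz (le_trans rz h1).
have e1 := cn_1ce z 1 (ltW ez) kz ler01.
have {}e1 : cn (1 - ce z 1) <= 2 * rs z.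
  by apply: (le_trans e1); rewrite ler_wpM2l// mulr1 ge_min lexx orbT.
have hQ := cn_QC_lin N p p_ge0 p_sum1 (BB z) (ltW (cn_BB1 _ ez)).
set D := DB z in Dd *; set e := ce z 1 in e1 *.
set E := 1 - QC N p (BB z) - q%:C * D in hQ.
have -> : 1 - QC N p (BB z) = q%:C * D + E by rewrite /E; ring.
have X1 : Re (D^* * ((1 - e) * D)) <= 2 * rs z * cn D ^+ 2.
  rewrite (le_trans (ler_norm _))// (le_trans (Re_cn _))// !cnM cn_conj.
  rewrite (_ : 2 * rs z * cn D ^+ 2 = cn D * (2 * rs z * cn D)); last by ring.
  by rewrite ler_wpM2l ?cn_ge0// ler_wpM2r ?cn_ge0.
have X2 : - Re (D^* * (e * E)) <= q2 N p * d * cn D ^+ 2.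
  rewrite (le_trans (ler_norm _))// normrN (le_trans (Re_cn _))// !cnM cn_conj.
  have h3 : cn e * cn E <= 1 * (q2 N p * cn D ^+ 2).
    by apply: ler_pM; rewrite ?cn_ge0// cn_ce_le1// ltW.
  apply: (le_trans (ler_wpM2l (cn_ge0 D) h3)); rewrite mul1r.
  rewrite (_ : q2 N p * d * cn D ^+ 2 = d * (q2 N p * cn D ^+ 2)); last by ring.
  by rewrite ler_wpM2r// mulr_ge0// sqr_ge0.
have X3 : Re (D^* * (e * (q%:C * D + E))) = q * cn D ^+ 2 - q * Re (D^* * ((1 - e) * D)) + Re (D^* * (e * E)).
  rewrite cn_sq; move: (D) (e) (E) => [x y] [u v] [a b] /=; ring.
rewrite X3; have N0 := sqr_ge0 (cn D).
have Y1 : 2 * theta * rs z <= (theta - th') / 2.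
  have : rs z <= r2 := le_trans rz h2.
  by rewrite /r2 ler_pdivlMr ?mulr_gt0//; lra.
have Y2 : c * q2 N p * d <= (theta - th') / 2.
  rewrite /d mulrA ler_pdivrMr ?mulr_gt0//.
  rewrite (_ : (theta - th') / 2 * (2 * (c * q2 N p + 1)) = (c * q2 N p + 1) * (theta - th')); last by field.
  by rewrite ler_wpM2r ?subr_ge0 ?(ltW tt)// lerDl.
have Z1 : c * (q * Re (D^* * ((1 - e) * D))) <= 2 * theta * rs z * cn D ^+ 2.
  rewrite (_ : 2 * theta * rs z * cn D ^+ 2 = c * q * (2 * rs z * cn D ^+ 2)); last by rewrite /c; field; rewrite gt_eqF.
  by rewrite mulrA; apply: ler_wpM2l; [exact: mulr_ge0 (ltW c_gt0) (ltW q_gt0)|exact: X1].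
have Z2 : - (c * Re (D^* * (e * E))) <= c * q2 N p * d * cn D ^+ 2.
  have -> : c * q2 N p * d * cn D ^+ 2 = c * (q2 N p * d * cn D ^+ 2) by ring.
  by rewrite -mulrN; apply: ler_wpM2l; [exact: ltW c_gt0|exact: X2].
have W1 := ler_wpM2r N0 Y1; have W2 := ler_wpM2r N0 Y2.
have -> : 2 * c * (q * cn D ^+ 2 - q * Re (D^* * ((1 - e) * D)) + Re (D^* * (e * E))) =
   2 * (theta * cn D ^+ 2) - 2 * (c * (q * Re (D^* * ((1 - e) * D)))) - 2 * - (c * Re (D^* * (e * E))).
  by rewrite /c; field; rewrite gt_eqF.
move: Z1 Z2 W1 W2; move: (c * (q * Re _)) (- (c * Re _)) (cn D ^+ 2) (2 * theta * rs z) (c * q2 N p * d) => a b n y1 y2.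
rewrite -!mulrA !mulrBl; lra.
Qed.

(** The spectral gap gives a lower bound on the segment [Re xi + Im xi = 1], and [harnack]
    transports it along rays to the origin. *)
Lemma DB_lower : exists2 c0 : R, 0 < c0 &
  forall xi, 0 < Re xi -> 0 <= Im xi -> rs xi <= 1 -> c0 * rs xi `^ theta <= cn (DB xi).
Proof.
have [k k0 H] := BB_gap 1 ltr01; exists k => // xi e0 i0 r1.
have r0 : 0 < rs xi by rewrite ltr_wpDr.
have gap z : 0 < Re z -> 0 <= Im z -> rs z = 1 -> k <= cn (DB z).
  move=> h1 h2 h3; have h4 := H z h1 h2; have := cn_le_add 1 (BB z); rewrite cn1 /DB.
  have h5 : cn (BB z) <= 1 - k by apply: h4; rewrite -[X in _ <= X]/(rs z) h3.
  by move: h5; lra.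
move: r1; rewrite le_eqVlt => /predU1P[r1|r1].
  by rewrite r1 powR1 mulr1 gap.
pose z := (rs xi)^-1%:C * xi.
have ez : 0 < Re z by rewrite /z ReZ mulr_gt0// invr_gt0.
have kz : 0 <= Im z by rewrite /z ImZ mulr_ge0// invr_ge0 ltW.
have rz : rs z = 1 by rewrite /rs /z ReZ ImZ -mulrDr mulVf// gt_eqF.
have [h _] := harnack z (rs xi) ez r0 r1.
have E : (rs xi)%:C * z = xi by rewrite /z mulrA -rmorphM mulfV ?gt_eqF// mul1r.
rewrite E in h.
rewrite -ler_sqr ?nnegrE ?cn_ge0 ?mulr_ge0 ?powR_ge0 ?(ltW k0)//; apply: le_trans h.
rewrite exprMn -(powR_mulrn 2 (powR_ge0 _ _)) -powRrM (mulrC theta).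
by rewrite ler_wpM2r ?powR_ge0// ler_sqr ?nnegrE ?cn_ge0 ?(ltW k0)// gap.
Qed.

Section Finite.
Variable al : R.
Hypotheses (al_gt : 2^-1 < al) (al_lt : al < 1) (al_th : al < theta + 1 / 2).

Lemma meas2_MB : meas2 (fun e k => cn (MB (e +i* k)) ^+ 2).
Proof. exact: measurable_cnlap _ (LT_meas _ _ (LTall_id _ pf_causal pf_LTall 1 ltr01)). Qed.

Definition MB2 (e k : R) : R := cn (MB (e +i* k)) ^+ 2.

(** The moment is dominated by a function of [e + k]: of order [r^(th' - 1)] at the origin by
    [harnack_upper], and of order [1 / r] elsewhere. *)
Lemma II_MB : (II al MB2 < +oo)%E.
Proof.
have a1 := al_gt; have a2 := al_lt; have a3 := al_th; have t0 := theta_gt0.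
(* Any exponent strictly between [al - 1/2] and [theta] would do: the first makes the radial
   integral converge at 0, the second allows [harnack_upper]. *)
pose th' := (al - 1 / 2 + theta) / 2.
have tt : th' < theta by rewrite /th'; lra.
have [r0 r00 H] := harnack_upper _ tt.
pose K := (4 * theta) ^+ 2.
pose Fl (r : R) : R := if (0 < r) && (r <= r0) then (K * (r0 `^ (- (2 * th')) * r `^ (2 * th' - 2))) else 0.
pose Fh (r : R) : R := if (0 < r) && (r0 <= r) then K * r `^ (- 2) else 0.
pose Fr (r : R) : R := Fl r + Fh r.
have mF : measurable_fun setT Fr by rewrite /Fr /Fl /Fh; mfun.
have K0 : 0 <= K := sqr_ge0 _.
have Fl0 r : 0 <= Fl r by rewrite /Fl; case: ifP => // _; exact: mulr_ge0 K0 (mulr_ge0 (powR_ge0 _ _) (powR_ge0 _ _)).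
have Fh0 r : 0 <= Fh r by rewrite /Fh; case: ifP => // _; exact: mulr_ge0 K0 (powR_ge0 _ _).
have F0 r : 0 <= Fr r by rewrite addr_ge0.
have mm : meas2 (fun e k : R => Fr (e + k)).
  have m : measurable_fun setT (fun z : R * R => z.1 + z.2) by mfun.
  exact: (measurable_comp_real _ _ _ _ mF m).
apply: (@le_lt_trans _ _ (II al (fun e k => Fr (e + k)%R))).
  apply: II_le => //; first exact: meas2_MB.
  move=> e k e0 k0; rewrite /MB2 sqr_ge0/=.
  have r0' : 0 < e + k by rewrite ltr_wpDr.
  have h := cn_MB (e +i* k) e0 k0; rewrite /rs/= in h.
  have h2 : cn (MB (e +i* k)) ^+ 2 <= (2 * theta * cn (DB (e +i* k)) / (e + k)) ^+ 2.
    by rewrite lerXn2r ?nnegrE ?cn_ge0// (le_trans _ h)// cn_ge0.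
  have p2 : (e + k) `^ (- 2) = (e + k)^-1 ^+ 2 by rewrite powRN (powR_mulrn 2 (ltW r0')) exprVn.
  apply: (le_trans h2); have [hr|hr] := leP (e + k) r0; last first.
    have nhr : (e + k <= r0) = false by rewrite leNgt hr.
    rewrite /Fr /Fl /Fh r0' nhr (ltW hr) /= add0r p2 -exprMn.
    have D2 := DB_le2 (e +i* k) e0.
    rewrite lerXn2r ?nnegrE ?mulr_ge0 ?invr_ge0 ?cn_ge0 ?(ltW r0') ?(ltW t0)//.
    rewrite ler_wpM2r ?invr_ge0 ?(ltW r0')//.
    by rewrite (_ : 4 * theta = 2 * theta * 2) ?ler_wpM2l ?mulr_ge0 ?(ltW t0)//; ring.
  apply: (@le_trans _ _ (Fl (e + k))); last by rewrite /Fr lerDl.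
  rewrite /Fl r0' hr/=; pose z := (r0 / (e + k))%:C * (e +i* k).
  have s0 : 0 < r0 / (e + k) by rewrite divr_gt0.
  have ez : 0 < Re z by rewrite /z ReZ mulr_gt0.
  have kz : 0 <= Im z by rewrite /z ImZ mulr_ge0// ltW.
  have rz : rs z = r0 by rewrite /rs /z ReZ ImZ -mulrDr/= divfK// gt_eqF.
  have DD : cn (DB (e +i* k)) ^+ 2 <= 4 * (r0 `^ (- (2 * th')) * (e + k) `^ (2 * th')).
    move: hr; rewrite le_eqVlt => /predU1P[hr|hr].
      rewrite hr -powRD ?addNr ?powRr0 ?mulr1; last by rewrite (gt_eqF r00) implybT.
      by rewrite (_ : 4 = 2 ^+ 2) ?lerXn2r ?nnegrE ?cn_ge0 ?DB_le2//; ring.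
    have hl : (e + k) / r0 < 1 by rewrite ltr_pdivrMr// mul1r.
    have hl0 : 0 < (e + k) / r0 by rewrite divr_gt0.
    have := H z ((e + k) / r0) ez kz (eq_ind_r (fun t => t <= r0) (lexx r0) rz) hl0 hl.
    have -> : ((e + k) / r0)%:C * z = e +i* k.
      rewrite /z mulrA -rmorphM (_ : (e + k) / r0 * (r0 / (e + k)) = 1) ?mul1r//.
      by field; rewrite !gt_eqF.
    move=> h3; apply: (le_trans h3).
    rewrite powRM ?(ltW r0') ?invr_ge0 ?(ltW r00)// (_ : r0^-1 `^ (2 * th') = r0 `^ (- (2 * th'))); last first.
      by rewrite -(powR_inv1 (ltW r00)) -powRrM mulN1r.
    rewrite [X in _ * X]mulrC ler_wpM2r ?mulr_ge0 ?powR_ge0//.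
    by rewrite (_ : 4 = 2 ^+ 2) ?lerXn2r ?nnegrE ?cn_ge0 ?DB_le2//; ring.
  have -> : (e + k) `^ (2 * th' - 2) = (e + k) `^ (2 * th') * (e + k) `^ (- 2).
    by rewrite -powRD// (gt_eqF r0') implybT.
  rewrite p2 /K.
  have -> : (2 * theta * cn (DB (e +i* k)) / (e + k)) ^+ 2 = (2 * theta) ^+ 2 * (e + k)^-1 ^+ 2 * cn (DB (e +i* k)) ^+ 2 by ring.
  have -> : (4 * theta) ^+ 2 * (r0 `^ (- (2 * th')) * ((e + k) `^ (2 * th') * (e + k)^-1 ^+ 2)) =
    (2 * theta) ^+ 2 * (e + k)^-1 ^+ 2 * (4 * (r0 `^ (- (2 * th')) * (e + k) `^ (2 * th'))) by ring.
  by rewrite ler_wpM2l// mulr_ge0 ?sqr_ge0.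
rewrite (II_radial _ al_gt al_lt _ mF F0).
apply: lte_mul_pinfty => //.
  rewrite lee_fin Itg_ge0// => e; case: ifP => // _; exact: (wt_ge0 al).
have b1 : -1 < 2 - 2 * al + (2 * th' - 2) by rewrite /th'; lra.
have b2 : 2 - 2 * al + - 2 < -1 by lra.
have l1 := L1_powR_near0 _ _ b1 r00; have l2 := L1_powR_oo _ _ b2 r00.
have L := L1D _ _ (L1Z (K * r0 `^ (- (2 * th'))) _ l1) (L1Z K _ l2).
apply: le_lt_trans (ltry (\int[mu]_r (K * r0 `^ (- (2 * th')) * (if (0 < r) && (r <= r0) then r `^ (2 - 2 * al + (2 * th' - 2)) else 0) + K * (if r0 <= r then r `^ (2 - 2 * al + - 2) else 0)))).
rewrite (EFin_Itg _ L) le_eqVlt; apply/orP; left; apply/eqP; apply: eq_integral => r _; congr EFin.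
rewrite /Fr /Fl /Fh; case: (ltP 0 r) => h /=; last by rewrite leNgt (le_lt_trans h r00) !mulr0 addr0.
have D x : r `^ (2 - 2 * al + x) = r `^ (2 - 2 * al) * r `^ x by rewrite powRD// (gt_eqF h) implybT.
by rewrite !D; case: ifP => _; case: ifP => _; ring.
Qed.
End Finite.

End Profile.

(** * The evolution equation in Laplace variables *)

Section Evolution.
Context {R : realType}.
Local Notation mu := (@lebesgue_measure R).
Implicit Types (G : R -> R) (g a : R -> R[i]).

(* Cut [s, t] into n equal pieces: the sum of the squares of the masses of [G]
   is at most the total mass times the largest one. *)
Lemma quad_const (D : R -> R[i]) G (C s t : R) : L1 G -> (forall x, 0 <= G x) -> 0 <= C -> s <= t ->
  (forall x y, s <= x -> x <= y -> y <= t -> cn (D y - D x) <= C * (prim G y - prim G x) ^+ 2) ->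
  D t = D s.
Proof.
move=> G1 G0 C0 st H; apply/eqP; rewrite -subr_eq0 -cn_eq0 eq_le cn_ge0 andbT.
have mono x y : x <= y -> prim G x <= prim G y.
  move=> xy; rewrite -subr_ge0 (prim_ooc _ _ _ G1 xy) Itg_ge0// => z.
  by rewrite /ooc; case: ifP.
pose I := prim G t - prim G s; have I0 : 0 <= I by rewrite subr_ge0 mono.
apply/ler_addgt0Pl => k k0; rewrite addr0.
pose e := k / (2 * (C * I + 1)).
have CI : 0 < C * I + 1 by rewrite ltr_wpDl// mulr_ge0.
have e0 : 0 < e by rewrite divr_gt0 ?mulr_gt0.
have [M M0 hM] := big_part_small G e G1 e0.
pose n := (Num.truncn (M * (t - s) / e)).+1.
have n0 : 0 < n%:R :> R by rewrite ltr0n.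
have hn : M * (t - s) / e < n%:R := truncnS_gt _.
pose h := (t - s) / n%:R; have h0 : 0 <= h by rewrite divr_ge0 ?subr_ge0// ltW.
have Mh : M * h <= e.
  move: hn; rewrite ltr_pdivrMr// => /ltW hn'.
  by rewrite /h mulrA ler_pdivrMr// [leRHS]mulrC.
pose x (i : nat) : R := s + i%:R * h.
have x0 : x 0%N = s by rewrite /x mul0r addr0.
have xn : x n = t by rewrite /x /h mulrC divfK ?gt_eqF// addrC subrK.
have xS i : x i <= x i.+1 by rewrite /x -natr1 mulrDl mul1r lerD2l lerDl.
have xs i : s <= x i by rewrite /x lerDl mulr_ge0.
have xt i : (i <= n)%N -> x i <= t by move=> hi; rewrite -xn /x lerD2l ler_wpM2r// ler_nat.
have step i : prim G (x i.+1) - prim G (x i) <= 2 * e.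
  apply: (le_trans (ler_norm _)); apply: (le_trans (norm_primB _ _ _ G1 (xS i))).
  apply: (le_trans (ooc_le_trunc M _ _ _ G1 M0 (xS i))).
  have -> : x i.+1 - x i = h by rewrite /x -natr1; ring.
  have L := L1_big_part M G G1.
  have : \int[mu]_y ooc (x i) (x i.+1) (big_part M G) y <= \int[mu]_y big_part M G y.
    apply: (Itg_le _ _ (L1_ooc _ _ _ L) L) => y; rewrite /ooc; case: ifP => // _.
    by rewrite /big_part; case: ifP.
  by move: Mh hM; lra.
have T : D t - D s = \sum_(0 <= i < n) (D (x i.+1) - D (x i)) by rewrite telescope_sumr// xn x0.
have TG : I = \sum_(0 <= i < n) (prim G (x i.+1) - prim G (x i)) by rewrite telescope_sumr// xn x0.
apply: (@le_trans _ _ (C * (2 * e) * I)); last first.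
  have -> : C * (2 * e) * I = k * (C * I / (C * I + 1)) by rewrite /e; field; rewrite gt_eqF.
  by rewrite ler_piMr ?(ltW k0)// ler_pdivrMr// mul1r lerDl.
rewrite T (le_trans (cn_sum _ _ _ _))// TG mulr_sumr big_nat [leRHS]big_nat.
apply: ler_sum => i /andP[_ hi]; apply: (le_trans (H _ _ (xs i) (xS i) (xt _ hi))).
have d0 : 0 <= prim G (x i.+1) - prim G (x i) by rewrite subr_ge0 mono.
by rewrite -mulrA ler_wpM2l// expr2 ler_wpM2r.
Qed.

Lemma poly_bound (P : {poly R[i]}) : exists2 C : R, 0 <= C & forall z, cn z <= 1 -> cn P.[z] <= C.
Proof.
exists (\sum_(i < size P) cn P`_i); first by apply: sumr_ge0 => i _; exact: cn_ge0.
move=> z z1; rewrite horner_coef (le_trans (cn_sum _ _ _ _))//; apply: ler_sum => i _.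
by rewrite cnM cnX ler_piMr ?cn_ge0// exprn_ile1// cn_ge0.
Qed.

Lemma poly_lip (P : {poly R[i]}) : exists2 C : R, 0 <= C &
  forall z w, cn z <= 1 -> cn w <= 1 -> cn (P.[z] - P.[w]) <= C * cn (z - w).
Proof.
have [C C0 H] := poly_bound P^`(); exists C => // z w z1 w1.
have := poly_mvi P z w 0 C; rewrite mul0r subr0; apply => s s01; rewrite subr0; apply: H.
by rewrite (le_trans (cn_segment _ _ _ s01))// ge_max z1.
Qed.

Lemma poly_quad (P : {poly R[i]}) : exists2 C : R, 0 <= C &
  forall z w, cn z <= 1 -> cn w <= 1 ->
    cn (P.[z] - P.[w] - P^`().[w] * (z - w)) <= C * cn (z - w) ^+ 2.
Proof.
have [C C0 H] := poly_lip P^`(); exists C => // z w z1 w1.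
rewrite expr2 mulrA; apply: poly_mvi => s s01.
apply: (le_trans (H _ _ _ w1)).
  by rewrite (le_trans (cn_segment _ _ _ s01))// ge_max z1.
rewrite addrAC subrr add0r cnM cnC ler_wpM2l//; case/andP: s01 => s0 s1.
by rewrite ger0_norm// ler_piMl// cn_ge0.
Qed.

Section EvolutionQ.
Variables (N : nat) (p : nat -> R).
Hypotheses (p_ge0 : forall j, (1 <= j <= N)%N -> 0 <= p j)
  (p_sum1 : \sum_(1 <= j < N.+1) p j = 1).

Definition coc (l r : R) (F : R -> R[i]) (x : R) : R[i] := if (l < x) && (x <= r) then F x else 0.

Lemma cL1_coc l r F : cL1 F -> cL1 (coc l r F).
Proof.
move=> [F1 F2]; split.
  by apply: (eq_L1 _ _ _ (L1_ooc l r _ F1)) => x; rewrite /ooc /coc; case: ifP.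
by apply: (eq_L1 _ _ _ (L1_ooc l r _ F2)) => x; rewrite /ooc /coc; case: ifP.
Qed.

Lemma cI_coc_split l m r F : cL1 F -> l <= m -> m <= r ->
  cI (coc l r F) = cI (coc l m F) + cI (coc m r F).
Proof.
move=> F1 lm mr; rewrite -(cID _ _ (cL1_coc l m _ F1) (cL1_coc m r _ F1)).
apply: eq_cI => x; rewrite /coc; case: (ltP l x) => h1 /=.
  case: (leP x m) => h2 /=; first by rewrite (le_trans h2 mr) addr0.
  by rewrite add0r.
by rewrite add0r (ltNge m x) (le_trans h1 lm).
Qed.

Lemma cI_coc_le l r F G : cL1 F -> L1 G -> l <= r -> (forall x, l < x -> x <= r -> cn (F x) <= G x) ->
  cn (cI (coc l r F)) <= prim G r - prim G l.
Proof.
move=> F1 G1 lr FG; rewrite (prim_ooc _ _ _ G1 lr).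
apply: (cI_cn _ _ (cL1_cmeas _ (cL1_coc l r _ F1)) (L1_ooc l r _ G1)) => x.
by rewrite /coc /ooc; case: ifPn => [/andP[h1 h2]|_]; [exact: FG|rewrite cn0].
Qed.

Lemma cmeas_QC (F : R -> R[i]) : cmeas _ _ F -> cmeas _ _ (fun x => QC N p (F x)).
Proof.
move=> mF; rewrite /QC; elim: N => [|n IH].
  by under eq_fun do rewrite big_geq//; exact: cmeas_cst.
under eq_fun do rewrite big_nat_recr//=.
apply: cmeasD IH _; apply: cmeasM; first exact: cmeas_cst.
elim: n.+1 => [|m IHm]; first exact: cmeas_cst.
by under eq_fun do rewrite exprS; exact: cmeasM.
Qed.

(** An abstract form of the equation along one characteristic, which both the solution and the
    profile satisfy: [a s] is the transform at frequency [e^s xi], [g s] is the boundary flux times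
    [e^(- xi e^s)], and [G] an integrable majorant of [g]. *)
Variables (e : R) (g a : R -> R[i]) (G : R -> R).
Hypotheses (e_gt0 : 0 < e) (mg : cmeas _ _ g) (G1 : L1 G) (gG : forall x, cn (g x) <= G x)
  (ma : cmeas _ _ a) (a_le : forall s, 0 <= s -> cn (a s) <= expR (- e * expR s))
  (evol : forall s t, 0 <= s -> s <= t ->
     a t - a s = - cI (coc s t (fun x => g x * (1 - QC N p (a x))))).

Let G0 x : 0 <= G x. Proof. exact: le_trans (cn_ge0 _) (gG x). Qed.

Let a1 s : 0 <= s -> cn (a s) <= 1.
Proof. by move=> s0; rewrite (le_trans (a_le s s0))// mulNr expRN_le1// mulr_ge0 ?expR_ge0// ltW. Qed.

(* [a] is only meaningful on [0, +oo[ *)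
Let a' (x : R) : R[i] := if 0 <= x then a x else 0.

Let a'1 x : cn (a' x) <= 1.
Proof. by rewrite /a'; case: ifP => [/a1//|_]; rewrite cn0. Qed.

Let a'E s : 0 <= s -> a' s = a s. Proof. by rewrite /a' => ->. Qed.

Let ma' : cmeas _ _ a'.
Proof.
have m1 := ma.1; have m2 := ma.2; split; rewrite /a'.
  have m : measurable_fun setT (fun x : R => if 0 <= x then Re (a x) else 0) by mfun.
  by rewrite (_ : (fun x => _) = fun x : R => if 0 <= x then Re (a x) else 0)//; apply: funext => x; case: ifP.
have m : measurable_fun setT (fun x : R => if 0 <= x then Im (a x) else 0) by mfun.
by rewrite (_ : (fun x => _) = fun x : R => if 0 <= x then Im (a x) else 0)//; apply: funext => x; case: ifP.
Qed.

Let cL1_g (F : R -> R[i]) (C : R) : cmeas _ _ F -> (forall x, cn (F x) <= C) ->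
  cL1 (fun x => g x * F x).
Proof.
move=> mF FC; apply: (cL1_le _ _ (cmeasM _ _ _ _ mg mF) (L1Z C _ G1)) => x.
by rewrite cnM mulrC; apply: ler_pM; rewrite ?cn_ge0.
Qed.

Let cn_1Q z : cn z <= 1 -> cn (1 - QC N p z) <= 2.
Proof.
move=> z1; rewrite (le_trans (cnB _ _))// cn1 -[2]/(1 + 1) lerD2l.
exact: le_trans (cn_QC N p p_ge0 p_sum1 _ z1) z1.
Qed.

Let L1Q : cL1 (fun x => g x * (1 - QC N p (a' x))).
Proof.
apply: (cL1_g _ 2); last by move=> x; exact: cn_1Q.
by apply: cmeasD; [exact: cmeas_cst|apply: cmeasN; exact: cmeas_QC].
Qed.

Let cmeas_horner (P : {poly R[i]}) : cmeas _ _ (fun x => P.[a' x]).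
Proof.
elim/poly_ind: P => [|P z IH].
  by under eq_fun do rewrite horner0; exact: cmeas_cst.
under eq_fun do rewrite hornerMXaddC.
by apply: cmeasD; [exact: cmeasM IH ma'|exact: cmeas_cst].
Qed.

Let evol' s t : 0 <= s -> s <= t -> a' t - a' s = - cI (coc s t (fun x => g x * (1 - QC N p (a' x)))).
Proof.
move=> s0 st; rewrite (a'E s s0) (a'E t (le_trans s0 st)) (evol s t s0 st).
apply: congr1; apply: eq_cI => x; rewrite /coc; case: ifPn => // /andP[h _].
by rewrite (a'E x (ltW (le_lt_trans s0 h))).
Qed.

Let a'_mod s t : 0 <= s -> s <= t -> cn (a' t - a' s) <= 2 * (prim G t - prim G s).
Proof.
move=> s0 st; rewrite (evol' _ _ s0 st) cnN.
have E x : prim (fun x => 2 * G x) x = 2 * prim G x.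
  by rewrite /prim RintegralZl//; exact: (L1_on _ _ (measurable_itv _) G1).
have := cI_coc_le s t _ _ L1Q (L1Z 2 _ G1) st; rewrite !E -mulrBr; apply => x _ _.
by rewrite cnM mulrC; apply: ler_pM; rewrite ?cn_ge0 ?cn_1Q.
Qed.

Let mono x y : x <= y -> prim G x <= prim G y.
Proof.
move=> xy; rewrite -subr_ge0 (prim_ooc _ _ _ G1 xy) Itg_ge0// => z.
by rewrite /ooc; case: ifP.
Qed.

(** A chain rule for an [a] known only through its integral equation. The Taylor remainder of [P]
    and the oscillation of the derivative over a small interval are both quadratic in the mass of
    [G], so [quad_const] shows that the difference of the two sides is constant. *)
Lemma evol_chain (P : {poly R[i]}) s t : 0 <= s -> s <= t ->
  P.[a' t] - P.[a' s] = - cI (coc s t (fun x => g x * (1 - QC N p (a' x)) * P^`().[a' x])).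
Proof.
move=> s0 st.
have [C1 C10 H1] := poly_quad P; have [C2 C20 H2] := poly_lip P^`(); have [C3 C30 H3] := poly_bound P^`().
pose F x := g x * (1 - QC N p (a' x)) * P^`().[a' x].
have mF0 : cmeas _ _ (fun x => (1 - QC N p (a' x)) * P^`().[a' x]).
  apply: cmeasM; last exact: cmeas_horner.
  by apply: cmeasD; [exact: cmeas_cst|apply: cmeasN; exact: cmeas_QC].
have LF : cL1 F.
  have h x : cn ((1 - QC N p (a' x)) * P^`().[a' x]) <= 2 * C3.
    by rewrite cnM; apply: ler_pM; rewrite ?cn_ge0 ?cn_1Q ?H3.
  have := cL1_g _ _ mF0 h; congr cL1; by apply: funext => x; rewrite /F mulrA.
pose D t := P.[a' t] + cI (coc s t F).
have E : D t = D s.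
  apply: (quad_const D G (4 * C1 + 4 * C2) s t G1 G0 _ st); first by rewrite addr_ge0 ?mulr_ge0.
  move=> x y sx xy yt; have x0 := le_trans s0 sx.
  set m := prim G y - prim G x; have m0 : 0 <= m by rewrite subr_ge0 mono.
  have hm := a'_mod x y x0 xy; rewrite -/m in hm.
  have -> : D y - D x = (P.[a' y] - P.[a' x] - P^`().[a' x] * (a' y - a' x)) +
      cI (coc x y (fun z => F z - P^`().[a' x] * (g z * (1 - QC N p (a' z))))).
    rewrite /D (cI_coc_split s x y _ LF sx xy).
    have -> : cI (coc x y (fun z => F z - P^`().[a' x] * (g z * (1 - QC N p (a' z))))) =
       cI (coc x y F) - P^`().[a' x] * cI (coc x y (fun z => g z * (1 - QC N p (a' z)))).
      have l2 := cL1Z (P^`().[a' x]) _ (cL1_coc x y _ L1Q).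
      rewrite -(cIZ _ _ (cL1_coc x y _ L1Q)) -(cIB _ _ (cL1_coc x y _ LF) l2).
      by apply: eq_cI => z; rewrite /coc; case: ifP => _; rewrite ?mulr0 ?subr0.
    by rewrite (evol' x y x0 xy); ring.
  apply: (le_trans (cnD _ _)); rewrite mulrDl; apply: lerD.
    apply: (le_trans (H1 _ _ (a'1 y) (a'1 x))).
    rewrite [4 * C1]mulrC -mulrA ler_wpM2l// (_ : 4 * m ^+ 2 = (2 * m) ^+ 2); last by ring.
    by rewrite lerXn2r ?nnegrE ?cn_ge0 ?mulr_ge0.
  have Ez k z : prim (fun x => k * G x) z = k * prim G z.
    by rewrite /prim RintegralZl//; exact: (L1_on _ _ (measurable_itv _) G1).
  have l2 := cL1Z (P^`().[a' x]) _ L1Q.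
  have := cI_coc_le x y _ _ (cL1D _ _ LF (cL1N _ l2)) (L1Z (4 * C2 * m) _ G1) xy.
  rewrite !Ez -mulrBr -/m expr2 mulrA; apply => z xz zy.
  have -> : F z - P^`().[a' x] * (g z * (1 - QC N p (a' z))) =
    g z * ((1 - QC N p (a' z)) * (P^`().[a' z] - P^`().[a' x])) by rewrite /F; ring.
  rewrite cnM mulrC; apply: ler_pM; rewrite ?cn_ge0// cnM.
  rewrite (_ : 4 * C2 * m = 2 * (C2 * (2 * m))); last by ring.
  apply: ler_pM; rewrite ?cn_ge0 ?cn_1Q//.
  apply: (le_trans (H2 _ _ (a'1 z) (a'1 x))); rewrite ler_wpM2l//.
  apply: (le_trans (a'_mod x z x0 (ltW xz))); rewrite ler_wpM2l// lerD2r.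
  exact: mono.
move: E; rewrite /D -/F.
have -> : cI (coc s s F) = 0.
  rewrite (eq_cI _ (fun=> 0)); first by rewrite /cI/= /Rintegral integral0.
  by move=> x; rewrite /coc ltNge; case: leP.
by rewrite addr0 => <-; ring.
Qed.

Lemma cL1_gtail t : cL1 (fun x => if t < x then g x else 0).
Proof.
have mt : measurable_fun setT (fun x : R => if t < x then 1 else 0 : R) by mfun.
have C1 x : cn ((if t < x then 1 else 0 : R)%:C) <= (1 : R).
  by rewrite cnC; case: ifP => _; rewrite ?normr1 ?normr0.
have := cL1_g _ _ (cmeasC _ _ _ mt) C1; congr cL1.
by apply: funext => x; case: ifP => _; rewrite ?mulr1 ?mulr0.
Qed.

(** For [P = Phi n] the integrand of [evol_chain] is [g (1 - Q(a)^n)]. As the final time [T] tends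
    to infinity [a T] tends to 0, where [Phi n] vanishes; only the term with [Q(a)^n] is left as an
    error. *)
Lemma evol_Phi_bound t n : 0 <= t ->
  cn ((Phi N p n).[a t] - cI (fun x => if t < x then g x else 0)) <=
  expR (- e * expR t) ^+ n * \int[mu]_x G x.
Proof.
move=> t0; set r := expR _; set J := \int[mu]_x G x.
have r0 : 0 <= r := expR_ge0 _.
have [C C0 HC] := poly_lip (Phi N p n).
pose tG (k : nat) x : R := if t + k%:R < x then G x else 0.
have mG := L1_meas _ G1.
have mtG k : measurable_fun setT (tG k) by rewrite /tG; mfun.
have tGG k x : `|tG k x| <= G x by rewrite /tG; case: ifP => _; rewrite ?normr0// ger0_norm.
have m0 : measurable_fun setT (fun _ : R => 0 : R) by mfun.
have F0 : {ae mu, forall x, tG k x @[k --> \oo] --> (0 : R)}.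
  apply: aeW => x; apply: cvg_near_cst.
  exists (Num.truncn `|x - t|).+1 => // k /= hk; rewrite /tG ltNge.
  have h : `|x - t| < k%:R by rewrite (lt_le_trans (truncnS_gt _))// ler_nat.
  by have := ler_norm (x - t) => h2; rewrite (_ : x <= t + k%:R)//; lra.
have [_ tlim] := dct tG (fun=> 0) _ mtG m0 G1 tGG F0.
rewrite (_ : \int[mu]_x 0 = 0) in tlim; last by rewrite /Rintegral integral0.
have elim : expR (- e) ^+ k @[k --> \oo] --> (0 : R).
  by apply: cvg_expr; rewrite ger0_norm ?expR_ge0// -expR0 ltr_expR oppr_lt0.
have lim : C * expR (- e) ^+ k + \int[mu]_x tG k x + r ^+ n * J @[k --> \oo] --> C * 0 + 0 + r ^+ n * J.
  apply: cvgD; last exact: cvg_cst.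
  by apply: cvgD; [apply: cvgM; [exact: cvg_cst|exact: elim]|exact: tlim].
rewrite mulr0 !add0r in lim; apply: (cvgr_to_ge lim); apply: nearW => k.
pose T := t + k%:R; have tT : t <= T by rewrite /T lerDl.
have T0 : 0 <= T := le_trans t0 tT.
have := evol_chain (Phi N p n) t T t0 tT.
have LQn : cL1 (fun x => g x * QC N p (a' x) ^+ n).
  apply: (cL1_g _ 1).
    elim: (n) => [|m IHm]; first exact: cmeas_cst.
    by under eq_fun do rewrite exprS; exact: cmeasM (cmeas_QC _ ma') IHm.
  move=> x; rewrite cnX exprn_ile1 ?cn_ge0//.
  exact: le_trans (cn_QC N p p_ge0 p_sum1 _ (a'1 x)) (a'1 x).
have Lg : cL1 g by apply: (cL1_le _ _ mg G1 gG).
have -> : cI (coc t T (fun x => g x * (1 - QC N p (a' x)) * (Phi N p n)^`().[a' x])) =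
    cI (coc t T g) - cI (coc t T (fun x => g x * QC N p (a' x) ^+ n)).
  rewrite -(cIB _ _ (cL1_coc t T _ Lg) (cL1_coc t T _ LQn)); apply: eq_cI => x.
  rewrite /coc; case: ifP => _; last by rewrite subr0.
  by rewrite -mulrA Phi_deriv; ring.
rewrite (a'E t t0) => E.
have Es : cI (fun x => if t < x then g x else 0) = cI (coc t T g) + cI (fun x => if T < x then g x else 0).
  rewrite -(cID _ _ (cL1_coc t T _ Lg) (cL1_gtail T)); apply: eq_cI => x.
  rewrite /coc; case: (leP x T) => h; first by rewrite andbT addr0.
  by rewrite (le_lt_trans tT h) andbF add0r.
have -> : (Phi N p n).[a t] - cI (fun x => if t < x then g x else 0) =
   (Phi N p n).[a' T] - cI (fun x => if T < x then g x else 0) - cI (coc t T (fun x => g x * QC N p (a' x) ^+ n)).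
  rewrite Es -[(Phi N p n).[a' T]](subrK (Phi N p n).[a t]) E; ring.
apply: (le_trans (cnB _ _)); apply: lerD; first (apply: (le_trans (cnB _ _)); apply: lerD).
- have := HC (a' T) 0 (a'1 T); rewrite Phi0 !subr0 cn0 => /(_ ler01) h.
  apply: (le_trans h); rewrite ler_wpM2l// (a'E T T0) (le_trans (a_le T T0))//.
  rewrite -expRM_natl ler_expR mulNr mulrN lerN2 mulrC ler_wpM2l ?(ltW e_gt0)//.
  have h3 : k%:R <= T by rewrite /T lerDr.
  by have h4 := expR_ge1Dx T; lra.
- apply: (cI_cn _ _ (cL1_cmeas _ (cL1_gtail T)) (L1_le _ _ (mtG k) (tGG k) G1)) => x.
  by rewrite /tG -/T; case: ifP => _; rewrite ?cn0.
have Ez k' z : prim (fun x => k' * G x) z = k' * prim G z.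
  by rewrite /prim RintegralZl//; exact: (L1_on _ _ (measurable_itv _) G1).
have := cI_coc_le t T _ _ LQn (L1Z (r ^+ n) _ G1) tT.
rewrite !Ez -mulrBr => H; apply: (le_trans (H _)) => [x tx xT|]; last first.
  rewrite ler_wpM2l ?exprn_ge0// (prim_ooc _ _ _ G1 tT).
  by apply: (Itg_le _ _ (L1_ooc _ _ _ G1) G1) => x; rewrite /ooc; case: ifP.
have x0 : 0 <= x := ltW (le_lt_trans t0 tx).
rewrite cnM mulrC cnX; apply: ler_pM; rewrite ?exprn_ge0 ?cn_ge0//.
rewrite lerXn2r ?nnegrE ?cn_ge0// (le_trans (cn_QC N p p_ge0 p_sum1 _ (a'1 x)))//.
rewrite (a'E x x0) (le_trans (a_le x x0))// ler_expR !mulNr lerN2 ler_wpM2l ?(ltW e_gt0)//.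
by rewrite ler_expR ltW.
Qed.

Lemma evol_Phi_lim t : 0 <= t -> Phi_lim N p (a t) (cI (fun x => if t < x then g x else 0)).
Proof.
move=> t0; rewrite /Phi_lim.
have L : expR (- e * expR t) ^+ n * \int[mu]_x G x @[n --> \oo] --> 0 * \int[mu]_x G x.
  apply: cvgM; last exact: cvg_cst.
  apply: cvg_expr; rewrite ger0_norm ?expR_ge0// -expR0 ltr_expR mulNr oppr_lt0.
  by rewrite mulr_gt0 ?expR_gt0.
rewrite mul0r in L; apply: (squeeze_cvgr _ (cvg_cst 0) L).
by apply: nearW => n; rewrite cn_ge0/= evol_Phi_bound.
Qed.

End EvolutionQ.
End Evolution.

(** * Testing the integral equation against bounded kernels *)

Section Bochner.
Context {R : realType}.
Local Notation mu := (@lebesgue_measure R).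
Implicit Types (f h w psi : R -> R).

Lemma L1_exp_subst f : L1 (fun x => if 0 < x then f x else 0) -> measurable_fun setT f ->
  L1 (fun t => f (expR t) * expR t) /\
  \int[mu]_t (f (expR t) * expR t) = \int[mu]_x (if 0 < x then f x else 0).
Proof.
move=> f1 mf.
have me : measurable_fun setT (fun t : R => f (expR t) * expR t).
  have m1 : measurable_fun setT (@expR R) by mfun.
  have m2 := measurable_comp_real _ _ _ _ mf m1; mfun.
have pos (g : R -> R) : measurable_fun setT g -> (forall x, 0 <= g x) -> L1 (fun x => if 0 < x then g x else 0) ->
    L1 (fun t => g (expR t) * expR t) /\
    \int[mu]_t (g (expR t) * expR t) = \int[mu]_x (if 0 < x then g x else 0).
  move=> mg g0 g1.
  have m1 : measurable_fun setT (@expR R) by mfun.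
  have m2 := measurable_comp_real _ _ _ _ mg m1.
  have m3 : measurable_fun setT (fun t : R => g (expR t) * expR t) by mfun.
  have E := ge0_integral_exp g mg g0; rewrite -(EFin_Itg _ g1) in E.
  have g0' t : 0 <= g (expR t) * expR t by rewrite mulr_ge0 ?expR_ge0.
  have [l1 _] := ge0_L1 _ _ m3 g0' (eq_ind _ (fun z => (z <= (\int[mu]_x (if 0 < x then g x else 0))%:E)%E) (lexx _) _ E).
  by split => //; apply: EFin_inj; rewrite (EFin_Itg _ l1) E.
pose fp x := Num.max (f x) 0; pose fn x := Num.max (- f x) 0.
have mp : measurable_fun setT fp by rewrite /fp; exact: measurable_maxr.
have mn : measurable_fun setT fn by rewrite /fn; apply: measurable_maxr => //; mfun.
have p0 x : 0 <= fp x by rewrite /fp le_max lexx orbT.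
have n0 x : 0 <= fn x by rewrite /fn le_max lexx orbT.
have fE x : f x = fp x - fn x.
  by rewrite /fp /fn; case: (leP (f x) 0) => h; case: (leP (- f x) 0) => h2; lra.
have bp x : `|fp x| <= `|f x| by rewrite ger0_norm// /fp ge_max ler_norm normr_ge0.
have bn x : `|fn x| <= `|f x| by rewrite ger0_norm// /fn ge_max normr_ge0 andbT -normrN ler_norm.
have L (g : R -> R) : measurable_fun setT g -> (forall x : R, `|g x| <= `|f x|) -> L1 (fun x => if 0 < x then g x else 0).
  move=> mg gf; have m : measurable_fun setT (fun x : R => if 0 < x then g x else 0) by mfun.
  apply: (L1_le _ _ m _ (L1_norm _ f1)) => x; case: ifP => _; rewrite ?normr0//.
have [a1 a2] := pos _ mp p0 (L _ mp bp); have [b1 b2] := pos _ mn n0 (L _ mn bn).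
have E x : fp (expR x) * expR x - fn (expR x) * expR x = f (expR x) * expR x by rewrite [in RHS]fE mulrBl.
split; first exact: (eq_L1 _ _ E (L1B _ _ a1 b1)).
rewrite -(eq_Itg _ _ E) (ItgB _ _ a1 b1) a2 b2 -(ItgB _ _ (L _ mp bp) (L _ mn bn)).
by apply: eq_Itg => x; case: ifP => _; rewrite ?subrr// [in RHS]fE.
Qed.

Lemma cvg_shift_real (u : nat -> R) (l : R) (n0 : nat) : u @ \oo --> l ->
  (fun n => u (n + n0)%N) @ \oo --> l.
Proof. by move=> h; apply: (cvg_comp (addn^~ n0) u (cvg_addnr n0) h). Qed.

Lemma Itg_indic (A : set R) : measurable A -> (mu A < +oo)%E ->
  L1 (\1_A : R -> R) /\ \int[mu]_x (\1_A x) = fine (mu A).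
Proof.
move=> mA Ao; have i : (\int[mu]_x (\1_A x)%:E = mu A)%E by rewrite integral_indic// setIT.
have l : L1 (\1_A : R -> R).
  apply: L1P; first exact: measurable_indic.
  by under eq_integral => x _ do rewrite ger0_norm//; rewrite i.
by split => //; rewrite /Rintegral i.
Qed.

Lemma in_L1B w1 w2 : in_L1 w1 -> in_L1 w2 -> in_L1 (w1 \- w2).
Proof.
move=> /L1_cut h1 /L1_cut h2; apply/L1_cut; apply: (eq_L1 _ _ _ (L1B _ _ h1 h2)) => y.
by rewrite /cut; case: ifP => _ //=; rewrite subr0.
Qed.

Lemma in_L1_sum n (c : 'I_n -> R) (w : 'I_n -> R -> R) : (forall i, in_L1 (w i)) ->
  in_L1 (fun y => \sum_i c i * w i y).
Proof.
move=> hw; apply/L1_cut.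
have [h _] := Itg_sum n (fun i y => c i * cut (w i) y) (fun i => L1Z (c i) _ ((L1_cut (w i)).1 (hw i))).
apply: (eq_L1 _ _ _ h) => y; rewrite /cut; case: ifP => _ //.
by rewrite big1// => i _; rewrite mulr0.
Qed.

Definition TT psi w : R := \int[mu]_y (ext0 w y * psi y).

Definition bounded_kernel psi := measurable_fun setT psi /\ forall y, 1 <= y -> `|psi y| <= 1.

Lemma L1_TT psi w : bounded_kernel psi -> in_L1 w ->
  L1 (fun y => ext0 w y * psi y) /\ `|TT psi w| <= \int[mu]_y `|ext0 w y|.
Proof.
move=> [mp p1] hw; have L := L1_ext0 w hw; have mw := L1_meas _ L.
have m : measurable_fun setT (fun y => ext0 w y * psi y) by mfun.
have b y : `|ext0 w y * psi y| <= `|ext0 w y|.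
  have [y1|y1] := ltP y 1; first by rewrite ext0_lt1// mul0r.
  by rewrite normrM ler_piMr// p1.
split; first exact: (L1_le _ _ m b (L1_norm _ L)).
exact: (Itg_norm_le _ _ (L1_norm _ L) m b).
Qed.

Lemma TTB psi w1 w2 : bounded_kernel psi -> in_L1 w1 -> in_L1 w2 ->
  TT psi (w1 \- w2) = TT psi w1 - TT psi w2.
Proof.
move=> hp h1 h2; rewrite /TT -(ItgB _ _ (L1_TT _ _ hp h1).1 (L1_TT _ _ hp h2).1).
by apply: eq_Itg => y; rewrite /ext0 /=; case: ifP => _; rewrite ?mul0r ?subr0// mulrBl.
Qed.

Lemma TT_sum psi n (c : 'I_n -> R) (w : 'I_n -> R -> R) : bounded_kernel psi -> (forall i, in_L1 (w i)) ->
  TT psi (fun y => \sum_i c i * w i y) = \sum_i c i * TT psi (w i).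
Proof.
move=> hp hw; have l i := (L1_TT _ _ hp (hw i)).1.
have [_ h] := Itg_sum n (fun i y => c i * (ext0 (w i) y * psi y)) (fun i => L1Z (c i) _ (l i)).
transitivity (\int[mu]_y \sum_i c i * (ext0 (w i) y * psi y)).
  apply: eq_Itg => y; rewrite /ext0; case: ifP => _.
    by rewrite mulr_suml; apply: eq_bigr => i _; rewrite mulrA.
  by rewrite mul0r big1// => i _; rewrite mulr0.
by rewrite h; apply: eq_bigr => i _; rewrite (ItgZ _ _ (l i)).
Qed.

(** The pairing [TT psi] is linear and bounded by the L^1 norm, so it carries simple approximants to
    scalar ones. These approximants [h] and their error bounds [Nn] are returned because
    measurability of the scalar integrand is established only where it is used. *)
Lemma bochner_test (a b : R) (F : R -> R -> R) (I psi : R -> R) :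
  is_bochner_integral a b F I -> bounded_kernel psi ->
  exists h Nn : nat -> R -> R,
  [/\ forall n, L1 (h n) /\ L1 (Nn n),
      forall n s, a <= s <= b -> `|TT psi (F s) - h n s| <= Nn n s,
      forall n s, ~~ (a <= s <= b) -> h n s = 0 /\ Nn n s = 0,
      \int[mu]_s Nn n s @[n --> \oo] --> (0 : R) &
      \int[mu]_s h n s @[n --> \oo] --> TT psi I].
Proof.
move=> [hF hI [g [mN N0 I0]]] hp.
pose D : set R := `[a, b]%classic.
have mD : measurable D by exact: measurable_itv.
have Do : (mu D < +oo)%E.
  by rewrite /D lebesgue_measure_itv/= -EFinD; case: ifP; rewrite ?ltry.
have DE s : (\1_D s : R) = if a <= s <= b then 1 else 0.
  rewrite indicE; case: ifPn => h; first by rewrite mem_set//= in_itv.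
  have -> : (s \in D) = false by apply/negbTE; rewrite notin_setE /D/= in_itv/=; exact/negP.
  by [].
have inS n s : in_L1 (simple_eval (g n) s).
  exact: (in_L1_sum (pieces (g n)) (fun i => \1_(@piece _ (g n) i) s) _ (@piece_val_L1 _ (g n))).
pose NN n s := \1_D s * fine (L1norm (F s \- simple_eval (g n) s)).
pose hh n s := \sum_i (TT psi (@piece_val _ (g n) i)) * (\1_(D `&` @piece _ (g n) i) s).
have inD n s : a <= s <= b -> in_L1 (F s \- simple_eval (g n) s).
  by move=> hs; apply: in_L1B; [exact: hF|exact: inS].
have NE n s : a <= s <= b -> (NN n s)%:E = L1norm (F s \- simple_eval (g n) s).
  by move=> hs; rewrite /NN DE hs mul1r (L1normE _ (inD n s hs)).
have mNN n : measurable_fun setT (NN n).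
  have m1 : measurable_fun D (fun s => fine (L1norm (F s \- simple_eval (g n) s))).
    exact: measurableT_comp (mN n).
  have [h _] := meas_mkcond D (fun s => fine (L1norm (F s \- simple_eval (g n) s))) mD.
  rewrite (_ : NN n = fun s => fine (L1norm (F s \- simple_eval (g n) s)) * \1_D s); first exact: h.
  by apply: funext => s; rewrite /NN mulrC.
have NN0 n s : 0 <= NN n s.
  rewrite /NN DE; case: ifPn => hs; rewrite ?mul0r// mul1r (L1normE _ (inD n s hs))/=.
  by apply: Itg_ge0 => y; exact: normr_ge0.
have IN n : (\int[mu]_s (NN n s)%:E = \int[mu]_(s in D) L1norm (F s \- simple_eval (g n) s)%R)%E.
  rewrite [RHS]integral_mkcond; apply: eq_integral => s _; rewrite patchE.
  case: ifPn => hs; first by rewrite NE//; move: hs; rewrite inE /D/= in_itv.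
  rewrite /NN indicE (negbTE hs) mul0r//.
have {}N0 : (\int[mu]_s (NN n s)%:E)%E @[n --> \oo] --> 0%E.
  by under eq_fun do rewrite IN.
(* The error integrals are known to be finite only from some index on, so all sequences are shifted
   by [n0]. *)
have [n0 _ hn0] : \forall n \near \oo, (\int[mu]_s (NN n s)%:E < 1)%E.
  by have := N0; move=> /fine_cvgP[h1 /cvgrPdist_lt /(_ _ ltr01) h2]; near=> n;
     have -> : (\int[mu]_s (NN n s)%:E = (fine (\int[mu]_s (NN n s)%:E))%:E)%E by
       [rewrite fineK//; near: n|]; rewrite lte_fin;
     apply: le_lt_trans (ler_norm _) _; rewrite -normrN -sub0r; near: n.
have LN n : L1 (NN (n + n0)%N).
  apply: (ae0_le_L1 _ (mNN _) (NN0 _)); apply: lt_trans (hn0 _ _) (ltry _) => //=.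
  exact: leq_addl.
have mpi n i : measurable (D `&` @piece _ (g n) i) by apply: measurableI => //; exact: measurable_piece.
have poo n i : (mu (D `&` @piece _ (g n) i) < +oo)%E.
  by apply: le_lt_trans Do; apply: (le_measure _ _ _); [rewrite inE; exact: mpi|rewrite inE|exact: subIsetl].
have Lpi n i := Itg_indic _ (mpi n i) (poo n i).
have Ls n := Itg_sum (pieces (g n)) (fun i s => TT psi (@piece_val _ (g n) i) * \1_(D `&` @piece _ (g n) i) s)
  (fun i => L1Z (TT psi (@piece_val _ (g n) i)) _ (Lpi n i).1).
have hE n s : a <= s <= b -> hh n s = TT psi (simple_eval (g n) s).
  move=> hs; rewrite (TT_sum psi _ _ _ hp (@piece_val_L1 _ (g n))); apply: eq_bigr => i _.
  by rewrite mulrC indicI/= DE hs mul1r.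
have Ih n : \int[mu]_s hh n s = TT psi (simple_integral a b (g n)).
  rewrite (Ls n).2 (TT_sum psi _ _ _ hp (@piece_val_L1 _ (g n))); apply: eq_bigr => i _.
  by rewrite (ItgZ _ _ (Lpi n i).1) (Lpi n i).2 mulrC.
have inI n : in_L1 (simple_integral a b (g n)).
  exact: (in_L1_sum (pieces (g n)) (fun i => fine (mu (`[a, b]%classic `&` @piece _ (g n) i))) _ (@piece_val_L1 _ (g n))).
exists (fun n => hh (n + n0)%N), (fun n => NN (n + n0)%N); split.
- by move=> n; split; [exact: (Ls _).1|exact: LN].
- move=> n s hs; rewrite (hE _ _ hs) -(TTB _ _ _ hp (hF s hs) (inS _ s)).
  have [_ h] := L1_TT _ _ hp (inD (n + n0)%N s hs); apply: (le_trans h).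
  by rewrite -lee_fin (NE _ _ hs) (L1normE _ (inD _ s hs)).
- move=> n s hs; have D0 : (\1_D s : R) = 0 by rewrite DE (negbTE hs).
  split; last by rewrite /NN D0 mul0r.
  by rewrite /hh big1// => i _; rewrite indicI/= D0 mul0r mulr0.
- exact: (cvg_shift_real (fun n => \int[mu]_s NN n s) 0 n0 (fine_cvg N0)).
- apply: (cvg_shift_real (fun n => \int[mu]_s hh n s) (TT psi I) n0).
  have B n : `|\int[mu]_s hh n s - TT psi I| <= fine (L1norm (I \- simple_integral a b (g n))).
    rewrite Ih distrC -(TTB _ _ _ hp hI (inI n)).
    have [_ h] := L1_TT _ _ hp (in_L1B _ _ hI (inI n)); apply: (le_trans h).
    by rewrite (L1normE _ (in_L1B _ _ hI (inI n))).
  apply/subr_cvg0; apply: norm_cvg0; apply: (squeeze_cvgr _ (cvg_cst 0) (fine_cvg I0)).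
  by apply: nearW => n; rewrite normr_ge0/= B.
Unshelve. all: by end_near. Qed.

Definition TS (sg : R) psi w : R := \int[mu]_z (if expR sg <= z then ext0 w z * psi (expR (- sg) * z) else 0).

Lemma TT_S sg psi w : 0 <= sg -> bounded_kernel psi -> in_L1 w -> TT psi (S_op sg w) = TS sg psi w.
Proof.
move=> s0 [mp p1] hw; have L := L1_ext0 w hw; have mw := L1_meas _ L.
have e1 : 1 <= expR sg by rewrite -expR0 ler_expR.
pose f z := if expR sg <= z then ext0 w z * psi (expR (- sg) * z) else 0.
have m1 : measurable_fun setT (fun z : R => expR (- sg) * z) by mfun.
have m2 := measurable_comp_real _ _ _ _ mp m1.
have mf : measurable_fun setT f by rewrite /f; mfun.
have Lf : L1 f.
  apply: (L1_le _ _ mf _ (L1_norm _ L)) => z; rewrite /f; case: ifP => hz; last by rewrite normr0.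
  rewrite normrM ler_piMr// p1// mulrC -ler_pdivrMr ?expR_gt0// expRN invrK mul1r//.
have [h0 h] := L1_affine (expR sg) 0 f (expR_gt0 sg) Lf.
have E y : ext0 (S_op sg w) y * psi y = expR sg * f (expR sg * y + 0).
  rewrite addr0 /f -[X in X <= _]mulr1 ler_pM2l ?expR_gt0// /ext0 /S_op.
  case: (leP 1 y) => y1; last by rewrite mul0r mulr0.
  rewrite (_ : 1 <= expR sg * y); last by rewrite mulr_ege1.
  have -> : expR (- sg) * (expR sg * y) = y by rewrite mulrA -expRD addNr expR0 mul1r.
  by rewrite mulrA.
rewrite /TT (eq_Itg _ _ E) (ItgZ _ _ h0) h mulrA divff ?mul1r//.
by rewrite gt_eqF ?expR_gt0.
Qed.

Lemma TT_Z psi (c : R) w : bounded_kernel psi -> in_L1 w -> TT psi (fun y => c * w y) = c * TT psi w.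
Proof.
move=> hp hw; rewrite /TT -(ItgZ _ _ (L1_TT _ _ hp hw).1); apply: eq_Itg => y.
by rewrite /ext0; case: ifP => _; rewrite ?mul0r ?mulr0// mulrA.
Qed.

Lemma in_L1_S sg w : 0 <= sg -> in_L1 w -> in_L1 (S_op sg w).
Proof.
move=> s0 /L1_cut hw; apply/L1_cut.
have e1 : 1 <= expR sg by rewrite -expR0 ler_expR.
have [h _] := L1_affine (expR sg) 0 _ (expR_gt0 sg) hw.
have h2 := L1Z (expR sg) _ h; have mh := L1_meas _ h2.
have m : measurable_fun setT (fun y : R => if 1 < y then expR sg * cut w (expR sg * y + 0) else 0) by mfun.
have h3 : L1 (fun y : R => if 1 < y then expR sg * cut w (expR sg * y + 0) else 0).
  by apply: (L1_le _ _ m _ (L1_norm _ h2)) => y; case: ifP => _; rewrite ?normr0.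
apply: (eq_L1 _ _ _ h3) => y; rewrite /cut /S_op; case: ifPn => // y1.
by rewrite addr0 (ltW y1) (_ : 1 < expR sg * y)// (lt_le_trans y1)// ler_peMl// (le_trans ler01)// ltW.
Qed.

Section Restart.
Variables (N : nat) (p : nat -> R) (eta0 : R -> R) (eta : R -> R -> R) (beta : R -> R).
Hypotheses (in0 : in_L1 eta0) (in1 : forall s, 0 <= s -> in_L1 (eta s))
  (boch : forall tau : R, 0 <= tau -> is_bochner_integral 0 tau
     (fun s y => beta s * S_op (tau - s) (T1 (Qconv N p (eta s))) y) (eta tau \- S_op tau eta0)).
Variable K : R -> R.
Hypotheses (mK : measurable_fun setT K) (K1 : forall x, 0 <= x -> `|K x| <= 1).

Let W s := T1 (Qconv N p (eta s)).

Let inW s : 0 <= s -> in_L1 (W s).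
Proof.
move=> s0; apply/L1_cut; have h := L1_T1 N p _ (in1 s s0); have mh := L1_meas _ h.
have m : measurable_fun setT (cut (W s)) by rewrite /cut; mfun.
by apply: (L1_le _ _ m _ (L1_norm _ h)) => y; rewrite /cut; case: ifP => _; rewrite ?normr0.
Qed.

Definition KT (t : R) (y : R) : R := K (expR t * y).
Definition KTcut (t d : R) (y : R) : R := if expR d <= y then K (expR t * y) else 0.
Definition kK s : R := \int[mu]_z (T1 (Qconv N p (eta s)) z * K (expR s * z)).

Lemma KT_bounded t : bounded_kernel (KT t).
Proof.
split; last by move=> y y1; rewrite /KT K1// mulr_ge0 ?expR_ge0// (le_trans ler01).
have m1 : measurable_fun setT (fun z : R => expR t * z) by mfun.
exact: measurable_comp_real _ _ _ _ mK m1.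
Qed.

Lemma KTcut_bounded t d : bounded_kernel (KTcut t d).
Proof.
have [m1 h1] := KT_bounded t; rewrite /KT in m1 h1; rewrite /KTcut; split; first by mfun.
by move=> y y1; case: ifP => _; rewrite ?normr0// h1.
Qed.

(** Cutting at [e^(t2 - t1)] discards at time [t1] exactly the mass that the dilation will have
    pushed below 1 at time [t2]. *)
Let TS_eq s t1 t2 w : t1 <= t2 -> TS (t1 - s) (KTcut t1 (t2 - t1)) w = TS (t2 - s) (KT t2) w.
Proof.
move=> t12; apply: eq_Itg => z; rewrite /KTcut /KT.
have D a : expR (- (a - s)) * z = z / expR (a - s) by rewrite expRN mulrC.
have Ka a : expR a * (expR (- (a - s)) * z) = expR s * z.
  by rewrite mulrA -expRD (_ : a + - (a - s) = s)//; ring.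
rewrite !Ka D ler_pdivlMr ?expR_gt0// -expRD (_ : t2 - t1 + (t1 - s) = t2 - s); last by ring.
case: ifPn => h1; case: ifPn => h2 //; first by rewrite mulr0.
by move: h1; rewrite (le_trans _ h2)// ler_expR lerD2r.
Qed.

(** The source lives on [[2, +oo[], and a dilation by at most 2 keeps all of it above 1; hence the
    restriction to time steps of length [ln 2]. *)
Let TS_kK s t2 : 0 <= s -> s <= t2 -> t2 - s <= ln 2 -> TS (t2 - s) (KT t2) (W s) = kK s.
Proof.
move=> s0 st ts; apply: eq_Itg => z; rewrite /KT mulrA -expRD (_ : t2 + - (t2 - s) = s); last by ring.
rewrite /ext0 /W /T1; case: (leP 2 z) => z2; last by rewrite mul0r; do 2! (case: ifP => // _); rewrite mul0r.
have z1 : 1 <= z by apply: le_trans z2; rewrite ler1n.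
have ez : expR (t2 - s) <= z by apply: le_trans z2; rewrite -[leRHS]lnK ?posrE// ler_expR.
by rewrite z1 ez.
Qed.

(** The integral equation is tested at time [t2] with [KT t2] and at time [t1] with the truncated
    kernel. By [TS_eq] the contributions of [eta0] and of all sources up to [t1] coincide and
    cancel, leaving the sources between [t1] and [t2], none of which has yet reached the
    boundary. *)
Lemma restart t1 t2 : 0 <= t1 -> t1 <= t2 -> t2 - t1 <= ln 2 ->
  measurable_fun setT (ooc t1 t2 (fun s => beta s * kK s)) ->
  L1 (ooc t1 t2 (fun s => beta s * kK s)) /\
  TT (KT t2) (eta t2) - TT (KTcut t1 (t2 - t1)) (eta t1) = \int[mu]_s ooc t1 t2 (fun s => beta s * kK s) s.
Proof.
move=> t10 t12 t21 mX; have t20 := le_trans t10 t12.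
set psi2 := KT t2; set psi1 := KTcut t1 (t2 - t1).
have b2 : bounded_kernel psi2 := KT_bounded t2.
have b1 : bounded_kernel psi1 := KTcut_bounded t1 (t2 - t1).
pose XX s := beta s * TS (t2 - s) psi2 (W s).
have X2 s : 0 <= s <= t2 -> TT psi2 (fun y => beta s * S_op (t2 - s) (W s) y) = XX s.
  move=> /andP[s0 st]; have ts : 0 <= t2 - s by rewrite subr_ge0.
  by rewrite (TT_Z psi2 (beta s) _ b2 (in_L1_S _ _ ts (inW s s0))) (TT_S _ _ _ ts b2 (inW s s0)).
have X1 s : 0 <= s <= t1 -> TT psi1 (fun y => beta s * S_op (t1 - s) (W s) y) = XX s.
  move=> /andP[s0 st]; have ts : 0 <= t1 - s by rewrite subr_ge0.
  rewrite (TT_Z psi1 (beta s) _ b1 (in_L1_S _ _ ts (inW s s0))) (TT_S _ _ _ ts b1 (inW s s0)).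
  by rewrite TS_eq.
have X3 s : t1 < s -> s <= t2 -> XX s = beta s * kK s.
  by move=> ts st; rewrite /XX TS_kK//; lra.
have [h2 [N2 [L2 hN2 hz2 N20 lim2]]] := bochner_test _ _ _ _ psi2 (boch t2 t20) b2.
have [h1 [N1 [L1' hN1 hz1 N10 lim1]]] := bochner_test _ _ _ _ psi1 (boch t1 t10) b1.
have N2p n s : 0 <= N2 n s.
  case: (boolP (0 <= s <= t2)) => hs; last by rewrite (hz2 n s hs).2.
  exact: le_trans (hN2 n s hs).
have N1p n s : 0 <= N1 n s.
  case: (boolP (0 <= s <= t1)) => hs; last by rewrite (hz1 n s hs).2.
  exact: le_trans (hN1 n s hs).
set X := ooc t1 t2 _ in mX *.
have XE s : X s = ooc t1 t2 XX s.
  by rewrite /X /ooc; case: ifPn => // /andP[a1 a2]; rewrite X3.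
have bnd n s : `|h2 n s - h1 n s - X s| <= N2 n s + N2 n s + N1 n s.
  rewrite XE /ooc; case: (ltP t1 s) => ts1 /=.
    have h1z : h1 n s = 0 by apply: (hz1 n s _).1; rewrite negb_and -!ltNge ts1 orbT.
    rewrite h1z subr0; case: (leP s t2) => ts2.
      have hs : 0 <= s <= t2 by rewrite ts2 (le_trans t10 (ltW ts1)).
      have := hN2 n s hs; rewrite X2// distrC => h; apply: (le_trans h).
      by rewrite -addrA lerDl addr_ge0.
    rewrite (hz2 n s _).1 ?subr0 ?normr0 ?addr_ge0//.
    by rewrite negb_and -!ltNge ts2 orbT.
  rewrite subr0; case: (leP 0 s) => s0.
    have hs2 : 0 <= s <= t2 by rewrite s0 (le_trans ts1 t12).
    have hs1 : 0 <= s <= t1 by rewrite s0 ts1.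
    have a2 := hN2 n s hs2; have a1 := hN1 n s hs1; rewrite X2// distrC in a2; rewrite X1// in a1.
    have := ler_normD (h2 n s - XX s) (XX s - h1 n s); rewrite subrKA => a3.
    by have := N2p n s; lra.
  have h2z : h2 n s = 0 by apply: (hz2 n s _).1; rewrite negb_and -!ltNge s0.
  have h1z : h1 n s = 0 by apply: (hz1 n s _).1; rewrite negb_and -!ltNge s0.
  by rewrite h2z h1z subrr normr0 !addr_ge0.
have LNN n := L1D _ _ (L1D _ _ (L2 n).2 (L2 n).2) (L1' n).2.
have LH n := L1B _ _ (L2 n).1 (L1' n).1.
have LX : L1 X.
  apply: (L1_le _ _ mX _ (L1D _ _ (L1_norm _ (LH 0%N)) (LNN 0%N))) => s.
  have := bnd 0%N s; have := ler_normD (h2 0%N s - h1 0%N s) (- (h2 0%N s - h1 0%N s - X s)).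
  by rewrite normrN opprB addrC subrK => a1 a2; lra.
split; first exact: LX.
have lim : \int[mu]_s h2 n s - \int[mu]_s h1 n s @[n --> \oo] --> TT psi2 (eta t2 \- S_op t2 eta0) - TT psi1 (eta t1 \- S_op t1 eta0).
  exact: cvgB.
have limX : \int[mu]_s h2 n s - \int[mu]_s h1 n s @[n --> \oo] --> \int[mu]_s X s.
  have C : \int[mu]_s N2 n s + \int[mu]_s N2 n s + \int[mu]_s N1 n s @[n --> \oo] --> (0 + 0 + 0 : R).
    by apply: cvgD => //; exact: cvgD.
  rewrite !addr0 in C; apply/subr_cvg0; apply: norm_cvg0; apply: (squeeze_cvgr _ (cvg_cst 0) C).
  apply: nearW => n; rewrite normr_ge0/= -(ItgB _ _ (L2 n).1 (L1' n).1) -(ItgB _ _ (LH n) LX).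
  rewrite -(ItgD _ _ (L2 n).2 (L2 n).2) -(ItgD _ _ (L1D _ _ (L2 n).2 (L2 n).2) (L1' n).2).
  exact: (Itg_norm_le _ _ (LNN n) (L1_meas _ (L1B _ _ (LH n) LX)) (bnd n)).
have := cvg_unique _ lim limX; move=> /(_ _) E.
have i2 := in_L1_S _ _ t20 in0; have i1 := in_L1_S _ _ t10 in0.
rewrite -E; last exact: Rhausdorff.
rewrite (TTB _ _ _ b2 (in1 t2 t20) i2) (TTB _ _ _ b1 (in1 t1 t10) i1).
rewrite (TT_S _ _ _ t20 b2 in0) (TT_S _ _ _ t10 b1 in0).
have := TS_eq 0 t1 t2 eta0 t12; rewrite !subr0 -/psi1 -/psi2 => ->; ring.
Qed.

(* The mass that crosses the moving boundary between [t1] and [t2]. *)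
Lemma boundary_flux t1 t2 : 0 <= t1 -> t1 <= t2 -> t2 - t1 <= ln 2 ->
  measurable_fun setT (ooc t1 t2 beta) ->
  {ae mu, forall t, t1 <= t <= t1 + ln 2 -> beta t = expR (t - t1) * eta t1 (expR (t - t1))} ->
  L1 (ooc t1 t2 (fun s => beta s * K (expR s))) /\
  TT (KT t1) (eta t1) - TT (KTcut t1 (t2 - t1)) (eta t1) = \int[mu]_s ooc t1 t2 (fun s => beta s * K (expR s)) s /\
  \int[mu]_s `|ooc t1 t2 (fun s => beta s * K (expR s)) s| <= \int[mu]_y `|ext0 (eta t1) y|.
Proof.
move=> t10 t12 t21 mb hb.
have b1 := KT_bounded t1; have b2 := KTcut_bounded t1 (t2 - t1).
have l1 := (L1_TT _ _ b1 (in1 t1 t10)).1; have l2 := (L1_TT _ _ b2 (in1 t1 t10)).1.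
have L := L1B _ _ l1 l2; rewrite /TT -(ItgB _ _ l1 l2).
pose f y := ext0 (eta t1) y * KT t1 y - ext0 (eta t1) y * KTcut t1 (t2 - t1) y.
have fE y : f y = if expR (t2 - t1) <= y then 0 else ext0 (eta t1) y * K (expR t1 * y).
  by rewrite /f /KT /KTcut; case: ifP => _; rewrite ?subrr// mulr0 subr0.
have f0 y : (if 0 < y then f y else 0) = f y.
  case: ltP => // y0; rewrite /f ext0_lt1 ?mul0r ?subrr//; exact: le_lt_trans y0 ltr01.
have Lf : L1 (fun y => if 0 < y then f y else 0) by apply: (eq_L1 _ _ _ L) => y; rewrite f0.
have [e1 e2] := L1_exp_subst f Lf (L1_meas _ L).
rewrite (eq_Itg _ _ f0) in e2; rewrite -[X in X = _]e2.
have [s1 s2] := L1_shift (- t1) _ e1; rewrite -s2.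
have mk : measurable_fun setT (fun s => K (expR s)).
  have m1 : measurable_fun setT (@expR R) by mfun.
  exact: measurable_comp_real _ _ _ _ mK m1.
have m : measurable_fun setT (ooc t1 t2 (fun s => beta s * K (expR s))).
  rewrite (_ : ooc _ _ _ = fun s => ooc t1 t2 beta s * K (expR s)); first by mfun.
  by apply: funext => s; rewrite /ooc; case: ifP => _; rewrite ?mul0r.
have ae2 : {ae mu, forall s, s != t1 /\ s != t2}.
  have P (c : R) : {ae mu, forall s, s != c}.
    exists [set c]; split; [exact: measurable_set1|exact: lebesgue_measure_set1|].
    by move=> y /= /negP; rewrite negbK => /eqP.
  exact: (aeS2 _ _ _ (fun x (a1 : x != t1) (a2 : x != t2) => conj a1 a2) (P t1) (P t2)).
have AE : {ae mu, forall s, f (expR (s + - t1)) * expR (s + - t1) = ooc t1 t2 (fun s => beta s * K (expR s)) s}.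
  apply: (aeS2 _ _ _ _ hb ae2) => s hs [n1 n2].
  rewrite fE ler_expR lerD2r /ooc; case: (leP t2 s) => st2.
    by rewrite mul0r (_ : (s <= t2) = false) ?andbF//; apply/negbTE; rewrite -ltNge lt_neqAle eq_sym n2.
  rewrite (ltW st2) andbT; case: (ltP t1 s) => st1.
    rewrite hs; last by rewrite (ltW st1)/=; lra.
    rewrite /ext0 (_ : 1 <= expR (s - t1)); last by rewrite -expR0 ler_expR subr_ge0 ltW.
    rewrite -expRD (_ : t1 + (s - t1) = s); last by ring.
    by ring.
  rewrite ext0_lt1 ?mul0r// -expR0 ltr_expR subr_lt0 lt_neqAle n1//.
have Lo := ae_eq_L1 _ _ m AE s1.
split; first exact: Lo.
split; first exact: (ae_eq_Itg _ _ (L1_meas _ s1) m AE).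
have AEn : {ae mu, forall s, `|f (expR (s + - t1)) * expR (s + - t1)| = `|ooc t1 t2 (fun s => beta s * K (expR s)) s|}.
  by apply: (aeS _ _ _ AE) => s ->.
rewrite -(ae_eq_Itg _ _ (L1_meas _ (L1_norm _ s1)) (L1_meas _ (L1_norm _ Lo)) AEn).
have fn0 y : (if 0 < y then `|f y| else 0) = `|f y|.
  by rewrite -[in RHS]f0; case: ifP => _; rewrite ?normr0.
have Lfn : L1 (fun y => if 0 < y then `|f y| else 0) by apply: (eq_L1 _ _ _ (L1_norm _ L)) => y; rewrite fn0.
have mfn := L1_meas _ (L1_norm _ L).
have [e3 e4] := L1_exp_subst (fun y => `|f y|) Lfn mfn.
have [s3 s4] := L1_shift (- t1) _ e3.
have En s : `|f (expR (s + - t1)) * expR (s + - t1)| = `|f (expR (s + - t1))| * expR (s + - t1).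
  by rewrite normrM (ger0_norm (expR_ge0 _)).
rewrite (eq_Itg _ _ En) s4 e4 (eq_Itg _ _ fn0).
have Le := L1_norm _ (L1_ext0 _ (in1 t1 t10)).
apply: (Itg_le _ _ (L1_norm _ L) Le) => y; rewrite -[leLHS]/(`|f y|) fE; case: ifP => _; first by rewrite normr0.
have [y1|y1] := ltP y 1; first by rewrite ext0_lt1// mul0r normr0.
by rewrite normrM ler_piMr// K1// mulr_ge0 ?expR_ge0// (le_trans ler01).
Qed.

End Restart.
End Bochner.

(** * Evolution of the transform of the solution *)

Section Solution.
Context {R : realType}.
Local Notation mu := (@lebesgue_measure R).
Implicit Types (f h w psi : R -> R) (xi : R[i]).
Variables (N : nat) (p : nat -> R).
Hypotheses (p_ge0 : forall j, (1 <= j <= N)%N -> 0 <= p j)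
  (p_sum1 : \sum_(1 <= j < N.+1) p j = 1).
Variables (eta0 : R -> R) (eta : R -> R -> R) (beta : R -> R).
Hypotheses (eta0P : is_density eta0) (etaP : forall tau : R, 0 <= tau -> is_density (eta tau))
  (eta_cont : continuous_L1 eta) (beta_loc : loc_integrable_from 0 beta)
  (boch : forall tau : R, 0 <= tau -> is_bochner_integral 0 tau
     (fun s y => beta s * S_op (tau - s) (T1 (Qconv N p (eta s))) y) (eta tau \- S_op tau eta0))
  (bdry : forall tau0 : R, 0 <= tau0 ->
          {ae mu, forall tau : R, tau0 <= tau <= tau0 + ln 2 ->
            beta tau = expR (tau - tau0) * eta tau0 (expR (tau - tau0))}).

Let in0 : in_L1 eta0. Proof. by have [] := eta0P. Qed.
Let in1 s : 0 <= s -> in_L1 (eta s). Proof. by move=> /etaP[]. Qed.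

Definition bt s : R := if 0 <= s then beta s else 0.

Lemma measurable_bt : measurable_fun setT bt.
Proof.
pose D : set R := `[0, +oo[%classic.
have mD : measurable D by exact: measurable_itv.
pose En (n : nat) : set R := `[0, n%:R]%classic.
have mE n : measurable (En n) by exact: measurable_itv.
have DE : D = \bigcup_n En n.
  apply/seteqP; split => s; rewrite /D /En /=.
    rewrite in_itv/= andbT => s0; exists (Num.truncn s).+1 => //=.
    by rewrite in_itv/= s0 ltW// truncnS_gt.
  by case=> n _ /=; rewrite !in_itv/= => /andP[-> _].
have mb : measurable_fun D beta.
  rewrite DE; apply/(measurable_fun_bigcup _ mE) => n.
  by have /integrableP[/measurable_EFinP] := beta_loc n%:R.
have [h _] := meas_mkcond D beta mD.
rewrite (_ : bt = fun s => beta s * \1_D s); first exact: h.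
apply: funext => s; rewrite /bt indicE; case: ifPn => hs.
  by rewrite mem_set ?mulr1// /D/= in_itv/= hs.
by rewrite (_ : (s \in D) = false) ?mulr0//; apply/negbTE; rewrite notin_setE /D/= in_itv/= andbT; exact/negP.
Qed.

Lemma ooc_bt t1 t2 (k : R -> R) : 0 <= t1 -> ooc t1 t2 (fun s => beta s * k s) = ooc t1 t2 (fun s => bt s * k s).
Proof.
move=> t0; apply: funext => s; rewrite /ooc /bt; case: ifPn => // /andP[ts _].
by rewrite (le_trans t0 (ltW ts)).
Qed.

Lemma measurable_ooc t1 t2 f : measurable_fun setT f -> measurable_fun setT (ooc t1 t2 f).
Proof. by move=> mf; rewrite /ooc; mfun. Qed.

Let mob t1 t2 : 0 <= t1 -> measurable_fun setT (ooc t1 t2 beta).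
Proof.
move=> t0; have h := measurable_ooc t1 t2 _ measurable_bt.
rewrite (_ : ooc t1 t2 beta = ooc t1 t2 bt); first exact: h.
apply: funext => s; rewrite /ooc /bt; case: ifPn => // /andP[ts _].
by rewrite (le_trans t0 (ltW ts)).
Qed.

Lemma Itg_ext0_1 s : 0 <= s -> \int[mu]_y `|ext0 (eta s) y| = 1.
Proof. by move=> /etaP /density_pdens[_ _ _]. Qed.

(** The flux over a time at most [ln 2] is part of the mass present at its beginning, which is 1. *)
Lemma cell_mass t1 t2 : 0 <= t1 -> t1 <= t2 -> t2 - t1 <= ln 2 ->
  L1 (ooc t1 t2 bt) /\ \int[mu]_s `|ooc t1 t2 bt s| <= 1.
Proof.
move=> t0 t12 t21.
have m1 : measurable_fun setT (fun _ : R => 1 : R) by mfun.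
have b1 (x : R) : 0 <= x -> `|1 : R| <= 1 by rewrite normr1.
have [l [_ h]] := boundary_flux eta beta in1 _ m1 b1 t1 t2 t0 t12 t21 (mob t1 t2 t0) (bdry t1 t0).
have E : ooc t1 t2 (fun s => beta s * 1) = ooc t1 t2 bt.
  by rewrite ooc_bt//; apply: funext => s; rewrite /ooc mulr1.
by rewrite E in l h; rewrite Itg_ext0_1 in h.
Qed.

Definition GG (t e : R) (s : R) : R := if t < s then `|bt s| * expR (- e * expR (s - t)) else 0.

Lemma measurable_GG t e : measurable_fun setT (GG t e).
Proof.
have m := measurable_bt; rewrite /GG; mfun.
Qed.

Lemma GG_ge0 t e s : 0 <= GG t e s.
Proof. by rewrite /GG; case: ifP => // _; rewrite mulr_ge0 ?expR_ge0. Qed.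

Lemma expR_ln2 (n : nat) : n%:R <= expR (n%:R * ln 2) :> R.
Proof.
rewrite expRM_natl lnK ?posrE// -natrX ler_nat; exact: ltnW (ltn_expl _ _).
Qed.

(** Time is cut into cells of length [ln 2]. On the n-th cell the flux has mass at most 1 and
    [e^(s - t) >= 2^n >= n], so the weight is at most [e^(- e n)] and the sum is geometric. *)
Lemma L1_GG t e : 0 <= t -> 0 < e -> L1 (GG t e).
Proof.
move=> t0 e0; have mG := measurable_GG t e; have G0 := GG_ge0 t e.
have l2 : 0 < ln 2 :> R by rewrite ln_gt0 ?ltr1n.
pose T (n : nat) : R := t + n%:R * ln 2.
have TS n : T n <= T n.+1 by rewrite /T lerD2l ler_wpM2r ?(ltW l2)// ler_nat.
have T0 n : 0 <= T n by rewrite addr_ge0// mulr_ge0// ltW.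
have TT1 n : T n.+1 - T n <= ln 2 by rewrite /T -natr1 mulrDl mul1r; lra.
have x1 : expR (- e) < 1 by rewrite -expR0 ltr_expR oppr_lt0.
have cell n : L1 (ooc (T n) (T n.+1) (GG t e)) /\ \int[mu]_s ooc (T n) (T n.+1) (GG t e) s <= expR (- e) ^+ n.
  have [l h] := cell_mass _ _ (T0 n) (TS n) (TT1 n).
  have b s : ooc (T n) (T n.+1) (GG t e) s <= expR (- e) ^+ n * `|ooc (T n) (T n.+1) bt s|.
    rewrite /ooc; case: ifPn => [/andP[s1 s2]|_]; last by rewrite normr0 mulr0.
    rewrite /GG; case: ifPn => ts; last by rewrite mulr_ge0// exprn_ge0// expR_ge0.
    rewrite mulrC ler_wpM2r// -expRM_natl ler_expR mulNr mulrN lerN2 mulrC ler_wpM2l ?(ltW e0)//.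
    apply: (le_trans (expR_ln2 n)); rewrite ler_expR.
    by move: s1; rewrite /T; lra.
  have o0 s : `|ooc (T n) (T n.+1) (GG t e) s| <= expR (- e) ^+ n * `|ooc (T n) (T n.+1) bt s|.
    by rewrite ger0_norm// /ooc; case: ifP.
  have lB := L1Z (expR (- e) ^+ n) _ (L1_norm _ l).
  have lo := L1_le _ _ (measurable_ooc (T n) (T n.+1) _ mG) o0 lB.
  split; first exact: lo.
  apply: (le_trans (Itg_le _ _ lo lB b)); rewrite (ItgZ _ _ (L1_norm _ l)).
  by rewrite ler_piMr ?exprn_ge0 ?expR_ge0.
pose M : R := (1 - expR (- e))^-1.
have M1 : 0 < 1 - expR (- e) by rewrite subr_gt0.
have part n : L1 (ooc t (T n) (GG t e)) /\ \int[mu]_s ooc t (T n) (GG t e) s <= M * (1 - expR (- e) ^+ n).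
  elim: n => [|n [IH1 IH2]].
    have E s : 0 = ooc t (T 0%N) (GG t e) s.
      by rewrite /ooc /T mul0r addr0 ltNge; case: leP.
    split; first exact: (eq_L1 _ _ E L1_0).
    by rewrite expr0 subrr mulr0 -(eq_Itg _ _ E) /Rintegral integral0.
  have tT : t <= T n by rewrite /T lerDl mulr_ge0// ltW.
  have E s : ooc t (T n) (GG t e) s + ooc (T n) (T n.+1) (GG t e) s = ooc t (T n.+1) (GG t e) s.
    rewrite /ooc; case: (leP s (T n)) => h.
      by rewrite (le_trans h (TS n))/= addr0.
    by rewrite andbF add0r (le_lt_trans tT h).
  have [c1 c2] := cell n.
  split; first exact: (eq_L1 _ _ E (L1D _ _ IH1 c1)).
  rewrite -(eq_Itg _ _ E) (ItgD _ _ IH1 c1); apply: (le_trans (lerD IH2 c2)).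
  rewrite exprS le_eqVlt; apply/orP; left; apply/eqP; rewrite /M; field.
  by rewrite gt_eqF.
apply: (ae0_le_L1 _ mG G0).
apply: (@le_lt_trans _ _ M%:E); last exact: ltry.
apply: (Fatou_bound (fun n => ooc t (T n) (GG t e))) => //.
- by move=> n; exact: measurable_ooc.
- by move=> n s; rewrite /ooc; case: ifP.
- apply: aeW => s; apply: cvg_near_cst.
  exists (Num.truncn (`|s - t| / ln 2)).+1 => // n /= hn; rewrite /ooc.
  have h : `|s - t| / ln 2 < n%:R by rewrite (lt_le_trans (truncnS_gt _))// ler_nat.
  rewrite ltr_pdivrMr// in h; have h2 := ler_norm (s - t).
  rewrite (_ : s <= T n); last by rewrite /T; lra.
  by rewrite andbT /GG; case: (t < s).
move=> n; have [l h] := part n; rewrite -(EFin_Itg _ l) lee_fin (le_trans h)//.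
by rewrite ler_piMr ?invr_ge0 ?(ltW M1)// gerBl exprn_ge0// expR_ge0.
Qed.

Definition AA (s : R) xi : R[i] := lap (ext0 (eta s)) xi.

Lemma cn_AA s xi : 0 <= s -> 0 <= Re xi -> cn (AA s xi) <= expR (- Re xi).
Proof.
move=> s0 e0; have [h _ _] := etaP s s0; rewrite /AA.
have -> := lap_pdens _ xi (etaP s s0).
exact: (cn_lap_density _ xi (density_pdens _ (etaP s s0)) e0).
Qed.

Section SolutionRay.
Variable xi : R[i].
Hypothesis e_gt0 : 0 < Re xi.
Let e := Re xi.

(** The transform followed along the characteristic through [xi]. Freezing time at 0 for negative
    [s] makes it continuous, hence measurable, on the whole line. *)
Definition aa (s : R) : R[i] := AA (Num.max s 0) ((expR (Num.max s 0))%:C * xi).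

Lemma ReZ' (r : R) : Re (r%:C * xi) = r * Re xi.
Proof. by case: xi => a b /=; rewrite mul0r subr0. Qed.

Let er s : 0 < Re ((expR s)%:C * xi). Proof. by rewrite ReZ' mulr_gt0 ?expR_gt0. Qed.

Lemma aaE s : 0 <= s -> aa s = AA s ((expR s)%:C * xi).
Proof. by move=> s0; rewrite /aa max_l. Qed.

Lemma eta_causal s : causal (ext0 (eta s)).
Proof. by move=> y y0; apply: ext0_lt1; exact: lt_trans ltr01. Qed.

Lemma AA_diff s t z : 0 <= s -> 0 <= t -> 0 <= Re z ->
  cn (AA s z - AA t z) <= fine (L1norm (eta s \- eta t)).
Proof.
move=> s0 t0 z0; have hs := L1_ext0 _ (in1 s s0); have ht := L1_ext0 _ (in1 t t0).
have ls := L1_LT _ _ z0 (eta_causal s) hs; have lt := L1_LT _ _ z0 (eta_causal t) ht.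
have h := in_L1B _ _ (in1 s s0) (in1 t t0); have l := L1_ext0 _ h.
rewrite /AA -(lapB _ _ z ls lt) (L1normE _ h)/=.
have E y : ext0 (eta s) y - ext0 (eta t) y = ext0 (eta s \- eta t) y.
  by rewrite /ext0; case: ifP => _ //=; rewrite subr0.
rewrite (eq_lap _ _ z E).
have ln := L1_norm _ l.
have nc y : y < 0 -> `|ext0 (eta s \- eta t) y| = 0.
  by move=> y0; rewrite ext0_lt1 ?normr0//; exact: lt_trans ltr01.
have LN := L1_LT _ _ z0 nc ln.
apply: (le_trans (cn_lap _ _ z LN (L1_meas _ l) (fun y => lexx _))).
apply: (Itg_le _ _ LN ln) => y; have [y0|y0] := ltP y 0; first by rewrite nc// mulr0.
by rewrite ler_piMl// mulNr expRN_le1// mulr_ge0.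
Qed.

Lemma aa_cont (s : R) : (fun t => cn (aa t - aa s)) @ s --> (0 : R).
Proof.
set m := Num.max s 0; have m0 : 0 <= m by rewrite le_max lexx orbT.
have cm : (fun t : R => Num.max t 0) @ s --> m.
  by apply: (@continuous_max _ _ id (cst 0) s); [exact: cvg_id|exact: cvg_cst].
have C1 : (fun t => fine (L1norm (eta (Num.max t 0) \- eta m))) @ s --> (0 : R).
  apply: fine_cvg; have [_ /(_ m m0) h] := eta_cont.
  apply: (cvg_comp (fun t : R => Num.max t 0) (fun t => L1norm (eta t \- eta m)) _ h).
  move=> A /= hA; have hA' := cm _ hA; apply: (@filterS R (nbhs s) _ _ _ _ hA') => t /= ht.
  by apply: ht; rewrite in_itv/= andbT le_max lexx orbT.
have dl := is_derive_lap (ext0 (eta m)) xi (expR m) (eta_causal m) (ext0_LTall _ (in1 m m0)) e_gt0 (expR_gt0 m).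
have ce1 : (fun t : R => expR (Num.max t 0)) @ s --> expR m.
  by apply: (cvg_comp _ _ cm); exact: continuous_expR.
have CR : (fun t => Re (AA m ((expR (Num.max t 0))%:C * xi))) @ s --> Re (AA m ((expR m)%:C * xi)).
  apply: (cvg_comp _ (fun r => Re (lap (ext0 (eta m)) (r%:C * xi))) ce1).
  by apply: derivable_cont; exact: (@ex_derive _ _ _ _ _ _ _ dl.1).
have CI : (fun t => Im (AA m ((expR (Num.max t 0))%:C * xi))) @ s --> Im (AA m ((expR m)%:C * xi)).
  apply: (cvg_comp _ (fun r => Im (lap (ext0 (eta m)) (r%:C * xi))) ce1).
  by apply: derivable_cont; exact: (@ex_derive _ _ _ _ _ _ _ dl.2).
pose B t : R := fine (L1norm (eta (Num.max t 0) \- eta m)) +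
  (`|Re (AA m ((expR (Num.max t 0))%:C * xi)) - Re (AA m ((expR m)%:C * xi))| +
   `|Im (AA m ((expR (Num.max t 0))%:C * xi)) - Im (AA m ((expR m)%:C * xi))|).
have CB : B @ s --> 0 + (`|0 : R| + `|0 : R|).
  apply: cvgD; first exact: C1.
  by apply: cvgD; apply: cvg_norm; apply/subr_cvg0.
rewrite normr0 !addr0 in CB.
apply: (squeeze_cvgr _ (cvg_cst 0) CB); apply: nearW => t; rewrite cn_ge0/= /B.
rewrite /aa -/m; set M := Num.max t 0; have M0 : 0 <= M by rewrite le_max lexx orbT.
apply: (le_trans (cn_tri _ _ (AA m ((expR M)%:C * xi)))); apply: lerD.
  by apply: AA_diff => //; exact: ltW (er M).
apply: (le_trans (cn_ReIm _)).
by case: (AA m _) => x1 y1; case: (AA m _) => x2 y2 /=.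
Qed.

Lemma cmeas_aa : cmeas _ _ aa.
Proof.
split; apply: continuous_measurable_fun => s.
  apply/subr_cvg0; apply: norm_cvg0; apply: (squeeze_cvgr _ (cvg_cst 0) (aa_cont s)).
  apply: nearW => t; rewrite normr_ge0/=; apply: le_trans (Re_cn _).
  by rewrite (_ : Re (aa t) - Re (aa s) = Re (aa t - aa s))//; case: (aa t) => x1 y1; case: (aa s).
apply/subr_cvg0; apply: norm_cvg0; apply: (squeeze_cvgr _ (cvg_cst 0) (aa_cont s)).
apply: nearW => t; rewrite normr_ge0/=; apply: le_trans (Im_cn _).
by rewrite (_ : Im (aa t) - Im (aa s) = Im (aa t - aa s))//; case: (aa t) => x1 y1; case: (aa s).
Qed.

Definition gg (s : R) : R[i] := (if 0 < s then (bt s)%:C * ce xi (expR s) else 0).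

Lemma cmeas_ceexp : cmeas _ _ (fun s : R => ce xi (expR s)).
Proof. by apply: cmeas_comp; [exact: cmeas_ce|mfun]. Qed.

Lemma cmeas_gg : cmeas _ _ gg.
Proof.
have m := measurable_bt; have [m1 m2] := cmeasM _ _ _ _ (cmeasC _ _ _ m) cmeas_ceexp.
split.
  have h : measurable_fun setT (fun s : R => if 0 < s then Re ((bt s)%:C * ce xi (expR s)) else 0) by mfun.
  rewrite (_ : (fun s => _) = fun s : R => if 0 < s then Re ((bt s)%:C * ce xi (expR s)) else 0)//.
  by apply: funext => s; rewrite /gg; case: ifP.
have h : measurable_fun setT (fun s : R => if 0 < s then Im ((bt s)%:C * ce xi (expR s)) else 0) by mfun.
rewrite (_ : (fun s => _) = fun s : R => if 0 < s then Im ((bt s)%:C * ce xi (expR s)) else 0)//.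
by apply: funext => s; rewrite /gg; case: ifP.
Qed.

Lemma cn_gg s : cn (gg s) <= GG 0 e s.
Proof. by rewrite /gg /GG subr0; case: ifP => _; rewrite ?cn0// cnM cnC cn_ce. Qed.

Let HH x := gg x * (1 - QC N p (aa x)).

Lemma cn_aa s : cn (aa s) <= 1.
Proof.
have m0 : 0 <= Num.max s 0 by rewrite le_max lexx orbT.
by rewrite /aa (le_trans (cn_AA _ _ m0 (ltW (er _))))// expRN_le1// ltW.
Qed.

Lemma cL1_HH : cL1 HH.
Proof.
apply: (cL1_le _ _ _ (L1Z 2 _ (L1_GG 0 e (lexx _) e_gt0))) => [|x].
  apply: cmeasM cmeas_gg _; apply: cmeasD; first exact: cmeas_cst.
  by apply: cmeasN; exact: cmeas_QC cmeas_aa.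
rewrite /HH cnM mulrC; apply: ler_pM; rewrite ?cn_ge0 ?cn_gg//.
rewrite (le_trans (cnB _ _))// cn1 -[2]/(1 + 1) lerD2l.
exact: le_trans (cn_QC N p p_ge0 p_sum1 _ (cn_aa x)) (cn_aa x).
Qed.

(** The change of the transform is the source of [restart] minus the outflow of [boundary_flux]:
    both are relative to the same truncated pairing, which cancels. The functional [P] treats real
    and imaginary parts together. *)
Let evol_comp (P : R[i] -> R) s t : (P = @complex.Re R \/ P = @complex.Im R) ->
  0 <= s -> s <= t -> t - s <= ln 2 ->
  P (aa t) - P (aa s) = - \int[mu]_x ooc s t (fun x => P (HH x)) x.
Proof.
move=> HP s0 st ts; have t0 := le_trans s0 st.
have PB (z w : R[i]) : P (z - w) = P z - P w.
  by case: HP => ->; case: z => x1 y1; case: w => x2 y2.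
have PM (r : R) z : P (r%:C * z) = r * P z.
  by case: HP => ->; case: z => a b /=; rewrite mul0r ?subr0 ?addr0.
have Pcn z : `|P z| <= cn z by case: HP => ->; [exact: Re_cn|exact: Im_cn].
have PcI F : P (cI F) = \int[mu]_x P (F x) by case: HP => ->.
have PcL F : cL1 F -> L1 (fun x => P (F x)) by case: HP => -> [].
pose K x := P (ce xi x).
have mK : measurable_fun setT K.
  by have [m1 m2] := @cmeas_ce R xi; rewrite /K; case: HP => ->.
have K1 x : 0 <= x -> `|K x| <= 1.
  by move=> x0; rewrite (le_trans (Pcn _))// cn_ce mulNr expRN_le1// mulr_ge0// ltW.
have TTa r : 0 <= r -> TT (KT K r) (eta r) = P (aa r).
  move=> r0; rewrite (aaE r r0) /AA /lap PcI; apply: eq_Itg => y.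
  by rewrite PM /KT /K ceZ.
have kKE r : 0 <= r -> kK N p eta K r = P (ce xi (expR r) * QC N p (aa r)).
  move=> r0; rewrite (aaE r r0) /AA.
  have <- : ce ((expR r)%:C * xi) 1 = ce xi (expR r) by rewrite ceZ mulr1.
  rewrite -(lap_T1 N p (eta r) _ (in1 r r0) (er r)) /lap PcI; apply: eq_Itg => y.
  by rewrite PM /K ceZ.
have oE : ooc s t (fun x => beta x * kK N p eta K x) = ooc s t (fun x => bt x * P (ce xi (expR x) * QC N p (aa x))).
  rewrite (ooc_bt _ _ _ s0); apply: funext => x; rewrite /ooc; case: ifPn => // /andP[sx _].
  by rewrite kKE// (le_trans s0 (ltW sx)).
have mX : measurable_fun setT (ooc s t (fun x => beta x * kK N p eta K x)).
  rewrite oE; apply: measurable_ooc; have m := measurable_bt.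
  have [m1 m2] := cmeasM _ _ _ _ cmeas_ceexp (cmeas_QC N p _ cmeas_aa).
  by case: HP => ->; mfun.
have [l1 r1] := restart N p eta0 eta beta in0 in1 boch K mK K1 s t s0 st ts mX.
have [l2 [r2 _]] := boundary_flux eta beta in1 K mK K1 s t s0 st ts (mob s t s0) (bdry s s0).
have SB (a b y i j : R) : a - y = i -> b - y = j -> a - b = i - j by move=> <- <-; ring.
have e1 := etrans (congr1 (fun z => z - TT (KTcut K s (t - s)) (eta s)) (esym (TTa t t0))) r1.
have e2 := etrans (congr1 (fun z => z - TT (KTcut K s (t - s)) (eta s)) (esym (TTa s s0))) r2.
apply: (etrans (SB _ _ _ _ _ e1 e2)).
apply: (etrans (esym (ItgB _ _ l1 l2))).
have Lo := L1_ooc s t _ (PcL _ cL1_HH).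
apply: (etrans _ (ItgN _ Lo)); apply: eq_Itg => x.
rewrite oE (ooc_bt _ _ _ s0) /ooc; case: ifPn => [/andP[sx _]|_]; last by rewrite subr0 oppr0.
rewrite /HH /gg (le_lt_trans s0 sx) -mulrA PM /K -mulrBr -mulrN; congr (_ * _).
by rewrite mulrBr mulr1 PB opprB.
Qed.

Let evol_short s t : 0 <= s -> s <= t -> t - s <= ln 2 -> aa t - aa s = - cI (coc s t HH).
Proof.
move=> s0 st ts.
have h1 := evol_comp _ s t (or_introl erefl) s0 st ts.
have h2 := evol_comp _ s t (or_intror erefl) s0 st ts.
have E1 : \int[mu]_x ooc s t (fun x => Re (HH x)) x = \int[mu]_x Re (coc s t HH x).
  by apply: eq_Itg => x; rewrite /ooc /coc; case: ifP.
have E2 : \int[mu]_x ooc s t (fun x => Im (HH x)) x = \int[mu]_x Im (coc s t HH x).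
  by apply: eq_Itg => x; rewrite /ooc /coc; case: ifP.
rewrite E1 in h1; rewrite E2 in h2; move: h1 h2; rewrite /cI.
case: (aa t) => x1 y1; case: (aa s) => x2 y2 /= h1 h2.
by apply/eqP; rewrite eq_complex/= h1 h2 !eqxx.
Qed.

(** An arbitrary time interval is split into steps of length at most [ln 2]. *)
Lemma evol_aa s t : 0 <= s -> s <= t -> aa t - aa s = - cI (coc s t HH).
Proof.
have l2 : 0 < ln 2 :> R by rewrite ln_gt0 ?ltr1n.
move=> s0 st; have [n hn] : exists n : nat, t - s <= n%:R * ln 2.
  exists (Num.truncn ((t - s) / ln 2)).+1; rewrite -ler_pdivrMr//; exact: ltW (truncnS_gt _).
elim: n t st hn => [|n IH] t st hn.
  by apply: evol_short => //; move: hn; rewrite mul0r; lra.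
have [h|h] := leP (t - s) (ln 2); first exact: evol_short.
pose m := t - ln 2; have sm : s <= m by rewrite /m; lra.
have mt : m <= t by rewrite /m; lra.
have h1 := IH m sm; rewrite -natr1 mulrDl mul1r in hn.
have {}h1 : aa m - aa s = - cI (coc s m HH) by apply: h1; rewrite /m; lra.
have h2 : aa t - aa m = - cI (coc m t HH).
  by apply: evol_short => //; [exact: le_trans s0 sm|rewrite /m; lra].
have SB (a b y i j : R[i]) : y - b = - i -> a - y = - j -> a - b = - (i + j).
  by move=> E1 E2; rewrite opprD -E1 -E2; ring.
exact: etrans (SB _ _ _ _ _ h1 h2) (congr1 -%R (esym (cI_coc_split s m t _ cL1_HH sm mt))).
Qed.

Lemma aa_Phi_lim t : 0 <= t -> Phi_lim N p (aa t) (cI (fun x => if t < x then gg x else 0)).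
Proof.
move=> t0; apply: (evol_Phi_lim N p p_ge0 p_sum1 e gg aa (GG 0 e) e_gt0 cmeas_gg (L1_GG 0 e (lexx _) e_gt0) cn_gg cmeas_aa _ evol_aa t t0).
move=> s s0; rewrite (aaE s s0); apply: (le_trans (cn_AA s _ s0 (ltW (er s)))).
by rewrite ler_expR ReZ' mulNr lerN2 mulrC.
Qed.

End SolutionRay.

Definition uu (t y : R) : R := if 1 < y then bt (t + ln y) / y else 0.

Lemma measurable_uu t : measurable_fun setT (uu t).
Proof.
have m := measurable_bt; have m1 : measurable_fun setT (fun y : R => t + ln y) by mfun.
have m2 := measurable_comp_real _ _ _ _ m m1; rewrite /uu; mfun.
Qed.

Lemma uu_exp t s (K : R -> R) : uu t (expR s) * K (expR s) * expR s = if 0 < s then bt (t + s) * K (expR s) else 0.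
Proof.
rewrite /uu -[X in X < expR s]expR0 ltr_expR; case: ifP => _; last by rewrite !mul0r.
by rewrite expRK; field; rewrite gt_eqF ?expR_gt0.
Qed.

Lemma uu_LTall t : 0 <= t -> LTall (uu t).
Proof.
move=> t0 e e0; have mu1 := measurable_uu t.
pose F y := `|expR (- e * y) * uu t y|.
have mF : measurable_fun setT F by rewrite /F; mfun.
have F0 y : 0 <= F y := normr_ge0 _.
have E := ge0_integral_exp F mF F0.
have m : measurable_fun setT (fun y => expR (- e * y) * uu t y) by mfun.
apply: L1P => //; rewrite -/F.
have F00 (y : R) : F y = if 0 < y then F y else 0.
  by case: ltP => // y0; rewrite /F /uu ltNge (le_trans y0 ler01)/= mulr0 normr0.
rewrite (_ : (\int[mu]_x `|expR (- e * x) * uu t x|%:E)%E = (\int[mu]_x (if (0 < x)%R then F x else 0)%:E)%E); last first.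
  by apply: eq_integral => y _; rewrite -F00.
rewrite E; have [s1 _] := L1_shift t _ (L1_GG t e t0 e0).
rewrite (_ : (\int[mu]_x (F (expR x) * expR x)%:E)%E = (\int[mu]_s GG t e (s + t))%:E); first exact: ltry.
rewrite (EFin_Itg _ s1); apply: eq_integral => s _; congr EFin.
rewrite /GG addrK ltrDr /F.
have -> : `|expR (- e * expR s) * uu t (expR s)| * expR s = `|uu t (expR s) * expR (- e * expR s) * expR s|.
  by rewrite [in RHS]normrM (ger0_norm (expR_ge0 _)) [in RHS](mulrC (uu _ _)).
rewrite (uu_exp t s (fun y => expR (- e * y))); case: ifP => _; last by rewrite normr0.
by rewrite normrM (ger0_norm (expR_ge0 _)) (addrC t).
Qed.

(** The characteristic through [z = e^(- t) xi] is at [xi] at time [t]; the substitution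
    [x = t + ln y] turns the remaining flux integral into the transform of [uu t]. *)
Lemma sol_Phi_lim t xi : 0 <= t -> 0 < Re xi -> Phi_lim N p (AA t xi) (lap (uu t) xi).
Proof.
move=> t0 e0; pose z := (expR (- t))%:C * xi.
have ez : 0 < Re z by rewrite /z ReZ' mulr_gt0 ?expR_gt0.
have h := aa_Phi_lim z ez t t0.
have zE : (expR t)%:C * z = xi by rewrite /z mulrA -rmorphM -expRD addrN expR0 rmorph1 mul1r.
rewrite (aaE z t t0) zE in h.
suff -> : lap (uu t) xi = cI (fun x => if t < x then gg z x else 0) by [].
have mu1 := measurable_uu t; have hL := lap_cL1 _ _ (uu_LTall t t0 _ e0).
have P (K : R -> R) : measurable_fun setT K -> L1 (fun y => uu t y * K y) ->
    \int[mu]_y (uu t y * K y) = \int[mu]_x (if t < x then bt x * K (expR (- t) * expR x) else 0).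
  move=> mK L; have f0 y : (if 0 < y then uu t y * K y else 0) = uu t y * K y.
    by case: ltP => // y0; rewrite /uu ltNge (le_trans y0 ler01)/= mul0r.
  have Lf : L1 (fun y => if 0 < y then uu t y * K y else 0) by apply: (eq_L1 _ _ _ L) => y; rewrite f0.
  have [e1 e2] := L1_exp_subst _ Lf (L1_meas _ L); rewrite (eq_Itg _ _ f0) in e2.
  have [_ s2] := L1_shift (- t) _ e1; rewrite -e2 -s2; apply: eq_Itg => x.
  rewrite uu_exp subr_gt0; case: ifP => // _; rewrite (addrC x) addrA addrN add0r.
  by rewrite expRD.
have [m1 m2] := @cmeas_ce R xi.
have L1' : L1 (fun y => uu t y * Re (ce xi y)).
  by apply: (eq_L1 _ _ _ hL.1) => y; case: (ce xi y) => a b /=; rewrite mul0r subr0.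
have L2' : L1 (fun y => uu t y * Im (ce xi y)).
  by apply: (eq_L1 _ _ _ hL.2) => y; case: (ce xi y) => a b /=; rewrite mul0r addr0.
have G x : t < x -> gg z x = (bt x)%:C * ce xi (expR (- t) * expR x).
  by move=> tx; rewrite /gg (le_lt_trans t0 tx) /z ceZ.
have RM (r : R) (c : R[i]) : Re (r%:C * c) = r * Re c by case: c => a b /=; rewrite mul0r subr0.
have IM (r : R) (c : R[i]) : Im (r%:C * c) = r * Im c by case: c => a b /=; rewrite mul0r addr0.
have E1 : \int[mu]_y Re ((uu t y)%:C * ce xi y) = \int[mu]_x Re (if t < x then gg z x else 0).
  rewrite (eq_Itg _ _ (fun y => RM (uu t y) (ce xi y))) (P _ m1 L1').
  by apply: eq_Itg => x; case: ifPn => // tx; rewrite (G x tx) RM.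
have E2 : \int[mu]_y Im ((uu t y)%:C * ce xi y) = \int[mu]_x Im (if t < x then gg z x else 0).
  rewrite (eq_Itg _ _ (fun y => IM (uu t y) (ce xi y))) (P _ m2 L2').
  by apply: eq_Itg => x; case: ifPn => // tx; rewrite (G x tx) IM.
by rewrite /lap /cI E1 E2.
Qed.

End Solution.

(** * Differentiating the relation Phi(A) = L u along rays *)

Section Tangent.
Context {R : realType}.

Lemma touching_derive (f g : R -> R) (x d l : R) : 0 < d ->
  (forall r, `|r - x| < d -> derivable f r 1 /\ derivable g r 1) ->
  (forall r, `|r - x| < d -> 0 <= g r + f r) -> f x = 0 -> g x = 0 ->
  is_derive x (1 : R) f l -> is_derive x (1 : R) g 0 -> l = 0.
Proof.
move=> d0 D H fx gx df dg.
have xx : x \in `]x - d, x + d[%R by rewrite in_itv/=; apply/andP; split; lra.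
have IN (t : R) : t \in `]x - d, x + d[%R -> `|t - x| < d.
  by rewrite in_itv/= => /andP[h1 h2]; rewrite ltr_norml; apply/andP; split; lra.
have h : is_derive x (1 : R) (g \+ f) 0.
  apply: (@derive1_at_min _ _ (x - d) (x + d) x) => //; first by lra.
    by move=> t /IN /D[h1 h2]; exact: derivableD.
  by move=> t /IN /H; rewrite /= fx gx addr0.
have h2 : is_derive x (1 : R) (g \+ f) (0 + l) by exact: is_deriveD.
by rewrite -(@derive_val _ _ _ _ _ _ _ h) (@derive_val _ _ _ _ _ _ _ h2) add0r.
Qed.

(** A function dominated in modulus by [g], where [g] and its derivative vanish at [x], has zero
    derivative there. The combination is one component of [u - C - k (f - A)] for complex [f], [u],
    [k], so that two uses give a complex identity. *)
Lemma touching_comb (f1 f2 u g : R -> R) (x d a b c A B C k1 k2 : R) : 0 < d ->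
  (forall r, `|r - x| < d -> [/\ derivable f1 r 1, derivable f2 r 1, derivable u r 1 & derivable g r 1]) ->
  (forall r, `|r - x| < d -> `|u r - C - ((f1 r - A) * k1 - (f2 r - B) * k2)| <= g r) ->
  f1 x = A -> f2 x = B -> u x = C -> g x = 0 ->
  is_derive x (1 : R) f1 a -> is_derive x (1 : R) f2 b -> is_derive x (1 : R) u c ->
  is_derive x (1 : R) g 0 -> c - (a * k1 - b * k2) = 0.
Proof.
move=> d0 D H e1 e2 e3 e4 h1 h2 h3 h4.
pose E := (u - cst C) - ((f1 - cst A) * cst k1 - (f2 - cst B) * cst k2) : R -> R.
have dE r : derivable f1 r 1 -> derivable f2 r 1 -> derivable u r 1 -> derivable E r 1.
  move=> d1 d2 d3; have dc (t : R) : derivable (cst t : R -> R) r 1 := derivable_cst _ _ _.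
  exact: derivableB (derivableB d3 (dc C)) (derivableB (derivableM (derivableB d1 (dc A)) (dc k1)) (derivableM (derivableB d2 (dc B)) (dc k2))).
apply: (touching_derive E g x d _ d0).
- by move=> r /D[d1 d2 d3 d4]; split; [exact: dE|exact: d4].
- move=> r /H; rewrite ler_norml => /andP[h _]; rewrite -[E r]/(u r - C - ((f1 r - A) * k1 - (f2 r - B) * k2)); lra.
- by rewrite -[E x]/(u x - C - ((f1 x - A) * k1 - (f2 x - B) * k2)) e1 e2 e3 !subrr !mul0r !subr0.
- exact: e4.
- have dc (t : R) : is_derive x (1 : R) (cst t : R -> R) 0 by exact: is_derive_cst.
  have H1 := is_deriveM (is_deriveB h1 (dc A)) (dc k1).
  have H2 := is_deriveM (is_deriveB h2 (dc B)) (dc k2).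
  have H3 := is_deriveB (is_deriveB h3 (dc C)) (is_deriveB H1 H2).
  apply: (is_derive_eq H3); rewrite !scaler0 !subr0 !add0r.
  by rewrite -[cst k1 x *: a]/(k1 * a) -[cst k2 x *: b]/(k2 * b) (mulrC k1) (mulrC k2).
Qed.

End Tangent.

Section Relation.
Context {R : realType}.
Local Notation mu := (@lebesgue_measure R).
Implicit Types (f g h w u : R -> R) (xi : R[i]).
Variables (N : nat) (p : nat -> R).
Hypotheses (p_ge0 : forall j, (1 <= j <= N)%N -> 0 <= p j)
  (p_sum1 : \sum_(1 <= j < N.+1) p j = 1).
Local Notation q := (qcst N p).

(* Differentiating [u = Phi (lap f)] along rays, where [Phi' = 1 / (1 - Q)]. *)
Lemma Phi_lim_radial f u xi : causal f -> LTall f -> causal u -> LTall u -> 0 < Re xi ->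
  (forall z, 0 < Re z -> cn (lap f z) < 1) ->
  (forall z, 0 < Re z -> Phi_lim N p (lap f z) (lap u z)) ->
  lap (fun y => y * f y) xi = (1 - QC N p (lap f xi)) * lap (fun y => y * u y) xi.
Proof.
move=> cf hf cu hu e0 f1 PL.
have q1 : 1 <= q := q_ge1 N p p_ge0 p_sum1.
have q0 : 0 < q := lt_le_trans ltr01 q1.
pose b := lap f xi; have b1 : cn b < 1 := f1 xi e0.
have Qb := QC_neq1 N p p_ge0 p_sum1 b b1.
pose m := cn (1 - QC N p b); have m0 : 0 < m by rewrite /m cn_gt0.
have ReZ' (r : R) : Re (r%:C * xi) = r * Re xi by case: (xi) => a c /=; rewrite mul0r subr0.
have x1 : (1 : R)%:C * xi = xi by rewrite rmorph1 mul1r.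
have df (r : R) (r0 : 0 < r) := is_derive_lap f xi r cf hf e0 r0.
have du (r : R) (r0 : 0 < r) := is_derive_lap u xi r cu hu e0 r0.
pose fr (r : R) := Re (lap f (r%:C * xi)); pose fi (r : R) := Im (lap f (r%:C * xi)).
pose ur (r : R) := Re (lap u (r%:C * xi)); pose ui (r : R) := Im (lap u (r%:C * xi)).
pose C := 4 / 3 * q / m ^+ 2.
have C0 : 0 < C by rewrite /C divr_gt0 ?exprn_gt0// mulr_gt0// divr_gt0.
(* The right-hand side of [Phi_lim_rel], quadratic in [lap f (r xi) - b]; it is written with squares
   of components so as to be differentiable at [r = 1]. *)
pose g (r : R) := C * ((fr r - Re b) ^+ 2 + (fi r - Im b) ^+ 2).
have fr1 : fr 1 = Re b by rewrite /fr x1.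
have fi1 : fi 1 = Im b by rewrite /fi x1.
have gE (r : R) : g r = C * cn (lap f (r%:C * xi) - b) ^+ 2.
  rewrite /g cn_sq /fr /fi; case: (lap f _) => x y; case: (b) => x' y'; by [].
pose k := (1 - QC N p b)^-1.
pose E (r : R) := lap u (r%:C * xi) - lap u xi - (lap f (r%:C * xi) - b) * k.
(* [Phi_lim_rel] is available only where [4 q |A - b| <= m]; continuity gives such a neighbourhood,
   and [d < 1] keeps [r] positive. *)
have near1 : exists2 d : R, 0 < d & d < 1 /\ forall r, `|r - 1| < d -> 4 * q * cn (lap f (r%:C * xi) - b) <= m.
  have cr : {for 1, continuous fr} by apply: derivable_cont; exact: (@ex_derive _ _ _ _ _ _ _ (df 1 ltr01).1).
  have ci : {for 1, continuous fi} by apply: derivable_cont; exact: (@ex_derive _ _ _ _ _ _ _ (df 1 ltr01).2).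
  pose e := m / (8 * q); have ee : 0 < e by rewrite divr_gt0 ?mulr_gt0.
  have /cvgr_distC_lt/(_ e ee) n1 := cr; have /cvgr_distC_lt/(_ e ee) n2 := ci.
  have [d /= d0 H1] := n1; have [d' /= d0' H2] := n2.
  exists (Num.min (2^-1) (Num.min d d')); first by rewrite !lt_min d0 d0' invr_gt0 ltr0n.
  split; first by rewrite gt_min; apply/orP; left; rewrite invf_lt1// ltr1n.
  move=> r; rewrite !lt_min => /and3P[_ h1 h2].
  have a1 := H1 r; have a2 := H2 r; rewrite /ball /= distrC in a1 a2; have {}a1 := a1 h1; have {}a2 := a2 h2.
  rewrite fr1 in a1; rewrite fi1 in a2.
  have h := cn_ReIm (lap f (r%:C * xi) - b).
  have hr : Re (lap f (r%:C * xi) - b) = fr r - Re b by rewrite /fr; case: (lap f _) => x y; case: (b).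
  have hi : Im (lap f (r%:C * xi) - b) = fi r - Im b by rewrite /fi; case: (lap f _) => x y; case: (b).
  rewrite hr hi in h.
  have h3 : cn (lap f (r%:C * xi) - b) <= 2 * e by lra.
  have h4 : 4 * q * cn (lap f (r%:C * xi) - b) <= 4 * q * (2 * e) by apply: ler_wpM2l => //; exact: mulr_ge0 _ (ltW q0).
  apply: (le_trans h4); rewrite /e le_eqVlt; apply/orP; left; apply/eqP; field.
  by rewrite gt_eqF.
have [d d0 [d1 Hd]] := near1.
have pos (r : R) : `|r - 1| < d -> 0 < r by rewrite ltr_norml => /andP[h _]; lra.
have EB (r : R) : `|r - 1| < d -> cn (E r) <= g r.
  move=> h; have r0 := pos r h; have er : 0 < Re (r%:C * xi) by rewrite ReZ' mulr_gt0.
  have := Phi_lim_rel N p p_ge0 p_sum1 _ b _ _ (f1 _ er) b1 (PL _ er) (PL _ e0) (Hd r h).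
  rewrite gE -/m -/k -/(E r) => H; apply: (le_trans H); rewrite /C le_eqVlt; apply/orP; left; apply/eqP.
  by move: (cn (lap f _ - b)) => X; field; rewrite gt_eqF.
have dg (r : R) : 0 < r -> derivable g r 1.
  move=> r0; have [h1 h2] := df r r0.
  have e1 : derivable fr r 1 := @ex_derive _ _ _ _ _ _ _ h1.
  have e2 : derivable fi r 1 := @ex_derive _ _ _ _ _ _ _ h2.
  have dc (t : R) : derivable (cst t : R -> R) r 1 := derivable_cst _ _ _.
  have b1' := derivableB e1 (dc (Re b)); have b2' := derivableB e2 (dc (Im b)).
  exact: derivableM (dc C) (derivableD (derivableM b1' b1') (derivableM b2' b2')).
have dg1 : is_derive (1 : R) (1 : R) g 0.
  apply: (@derive1_at_min _ _ (1 - d) (1 + d) 1).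
  - by move: d0; lra.
  - by move=> t; rewrite in_itv/= => /andP[t1 t2]; apply: dg; move: d1 t1; lra.
  - by rewrite in_itv/=; apply/andP; split; move: d0; lra.
  move=> t _; rewrite {1}/g fr1 fi1 !subrr expr0n/= addr0 mulr0 gE.
  exact: mulr_ge0 (ltW C0) (sqr_ge0 _).
have P1 : k * (xi * lap (fun y => y * f y) xi) = xi * lap (fun y => y * u y) xi.
  have [f1r f1i] := df 1 ltr01; have [u1r u1i] := du 1 ltr01.
  rewrite !x1 in f1r f1i u1r u1i.
  set X := xi * lap _ xi in f1r f1i *; set Y := xi * lap _ xi in u1r u1i *.
  have ErE r : ur r - Re (lap u xi) - ((fr r - Re b) * Re k - (fi r - Im b) * Im k) = Re (E r).
    by rewrite /E /ur /fr /fi; case: (lap u _) => ? ?; case: (lap f _) => ? ?; case: (lap u _) => ? ?; case: (b) => ? ?; case: (k).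
  have EiE r : ui r - Im (lap u xi) - ((fr r - Re b) * Im k - (fi r - Im b) * - Re k) = Im (E r).
    rewrite /E /ui /fr /fi; case: (lap u _) => ? ?; case: (lap f _) => ? ?; case: (lap u _) => ? ?; case: (b) => ? ?; case: (k) => ? ? /=.
    by rewrite mulrN opprK.
  have ur1 : ur 1 = Re (lap u xi) by rewrite /ur x1.
  have ui1 : ui 1 = Im (lap u xi) by rewrite /ui x1.
  have g1 : g 1 = 0 by rewrite gE x1 subrr cn0 expr0n/= mulr0.
  have dd (r : R) : `|r - 1| < d -> [/\ derivable fr r 1, derivable fi r 1, derivable ur r 1 & derivable g r 1].
    move=> /pos r0; have [a1 a2] := df r r0; have [a3 a4] := du r r0.
    by split; [exact: (@ex_derive _ _ _ _ _ _ _ a1)|exact: (@ex_derive _ _ _ _ _ _ _ a2)|exact: (@ex_derive _ _ _ _ _ _ _ a3)|exact: (dg r r0)].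
  have dd' (r : R) : `|r - 1| < d -> [/\ derivable fr r 1, derivable fi r 1, derivable ui r 1 & derivable g r 1].
    move=> /pos r0; have [a1 a2] := df r r0; have [a3 a4] := du r r0.
    by split; [exact: (@ex_derive _ _ _ _ _ _ _ a1)|exact: (@ex_derive _ _ _ _ _ _ _ a2)|exact: (@ex_derive _ _ _ _ _ _ _ a4)|exact: (dg r r0)].
  have Br (r : R) : `|r - 1| < d -> `|ur r - Re (lap u xi) - ((fr r - Re b) * Re k - (fi r - Im b) * Im k)| <= g r.
    by move=> h; rewrite ErE; exact: le_trans (Re_cn _) (EB r h).
  have Bi (r : R) : `|r - 1| < d -> `|ui r - Im (lap u xi) - ((fr r - Re b) * Im k - (fi r - Im b) * - Re k)| <= g r.
    by move=> h; rewrite EiE; exact: le_trans (Im_cn _) (EB r h).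
  have Hr := touching_comb fr fi ur g 1 d _ _ _ _ _ _ _ _ d0 dd Br fr1 fi1 ur1 g1 f1r f1i u1r dg1.
  have Hi := touching_comb fr fi ui g 1 d _ _ _ _ _ _ _ _ d0 dd' Bi fr1 fi1 ui1 g1 f1r f1i u1i dg1.
  move: Hr Hi; case: (k) => k1 k2; case: (X) => a1 a2; case: (Y) => c1 c2 /= Hr Hi.
  by apply/eqP; rewrite eq_complex/=; apply/andP; split; apply/eqP; lra.
have xi0 : xi != 0 by apply/eqP => h; move: e0; rewrite h ltxx.
have : xi * lap (fun y => y * f y) xi = xi * ((1 - QC N p b) * lap (fun y => y * u y) xi).
  by rewrite mulrCA -P1 /k mulrA mulfV// mul1r.
by move/(mulfI xi0).
Qed.

End Relation.

(** * Growth over bounded times *)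

Section Gronwall.
Context {R : realType}.
Local Notation mu := (@lebesgue_measure R).

(** Time is cut into [n] cells on which [K] times the mass of [B] is at most [1/2]; [D] at most
    doubles over each. The constant [2^n] depends on [B], [T], [K] but not on [D], which yields
    bounds uniform in the frequency. *)
Lemma gronwall (B : R -> R) (T K : R) : L1 B -> (forall x, 0 <= B x) -> 0 <= T -> 0 < K ->
  exists2 C : R, 0 < C & forall D : R -> R, (forall x, 0 <= D x <= 2) ->
    (forall s x (M : R), 0 <= s -> s <= x -> x <= T -> (forall y, s <= y -> y <= x -> D y <= M) ->
       D x <= D s + M * (K * (prim B x - prim B s))) ->
    forall t, 0 <= t <= T -> D t <= C * D 0.
Proof.
move=> B1 B0 T0 K0; pose e := (4 * K)^-1; have e0 : 0 < e by rewrite invr_gt0 mulr_gt0.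
have [M M0 hM] := big_part_small B e B1 e0.
pose n := (Num.truncn (M * T / e)).+1; have n0 : 0 < n%:R :> R by rewrite ltr0n.
have hn : M * T / e < n%:R := truncnS_gt _.
have C0 : 0 < 2 ^+ n :> R by rewrite exprn_gt0.
exists (2 ^+ n) => // D D2 H t /andP[t0 tT].
pose h := t / n%:R; have h0 : 0 <= h by rewrite divr_ge0// ltW.
have Mh : M * h <= e.
  have h1 : M * t <= M * T by rewrite ler_wpM2l// ltW.
  move: hn; rewrite ltr_pdivrMr// => /ltW hn'.
  by rewrite /h mulrA ler_pdivrMr// [leRHS]mulrC (le_trans h1).
pose x (i : nat) : R := i%:R * h.
have x0 : x 0%N = 0 by rewrite /x mul0r.
have xn : x n = t by rewrite /x /h mulrC divfK ?gt_eqF.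
have xS i : x i <= x i.+1 by rewrite /x -natr1 mulrDl mul1r lerDl.
have x_ge0 i : 0 <= x i by rewrite /x mulr_ge0.
have xt i : (i <= n)%N -> x i <= t by move=> hi; rewrite -xn /x ler_wpM2r// ler_nat.
have mono (a b : R) : a <= b -> prim B a <= prim B b.
  move=> ab; rewrite -subr_ge0 (prim_ooc _ _ _ B1 ab) Itg_ge0// => z.
  by rewrite /ooc; case: ifP.
have step i : prim B (x i.+1) - prim B (x i) <= 2 * e.
  apply: (le_trans (ler_norm _)); apply: (le_trans (norm_primB _ _ _ B1 (xS i))).
  apply: (le_trans (ooc_le_trunc M _ _ _ B1 M0 (xS i))).
  have -> : x i.+1 - x i = h by rewrite /x -natr1; ring.
  have L := L1_big_part M B B1.
  have : \int[mu]_y ooc (x i) (x i.+1) (big_part M B) y <= \int[mu]_y big_part M B y.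
    apply: (Itg_le _ _ (L1_ooc _ _ _ L) L) => y; rewrite /ooc; case: ifP => // _.
    by rewrite /big_part; case: ifP.
  by move: Mh hM; lra.
have cell i : (i < n)%N -> D (x i.+1) <= 2 * D (x i).
  move=> hi; have Ds0 : 0 <= D (x i) by case/andP: (D2 (x i)).
  (* Starting from the crude bound [D <= 2], each use of the integral inequality halves the excess
     over [2 D(x_i)]. *)
  have it (k : nat) : forall y, x i <= y -> y <= x i.+1 -> D y <= 2 * D (x i) + 2 * 2^-1 ^+ k.
    elim: k => [|k IH] y y1 y2; first by rewrite expr0 mulr1; case/andP: (D2 y) => _ h2; lra.
    set m := 2 * D (x i) + 2 * 2^-1 ^+ k in IH.
    have m0 : 0 <= m by rewrite /m addr_ge0// mulr_ge0// exprn_ge0// invr_ge0.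
    have h1 := H (x i) y m (x_ge0 i) y1 (le_trans y2 (le_trans (xt i.+1 hi) tT)) (fun z z1 z2 => IH z z1 (le_trans z2 y2)).
    have h2 : K * (prim B y - prim B (x i)) <= K * (2 * e).
      apply: ler_wpM2l; first exact: ltW.
      by have := mono _ _ y2; have := step i; lra.
    have h3 : K * (2 * e) = 2^-1 by rewrite /e; field; rewrite gt_eqF.
    rewrite h3 in h2; have h4 := ler_wpM2l m0 h2.
    have h5 : m * 2^-1 = D (x i) + 2 * 2^-1 ^+ k.+1 by rewrite /m exprS; field.
    by lra.
  have L : 2 * D (x i) + 2 * 2^-1 ^+ k @[k --> \oo] --> 2 * D (x i) + 2 * (0 : R).
    apply: cvgD; first exact: cvg_cst.
    apply: cvgM; first exact: cvg_cst.
    by apply: cvg_expr; rewrite ger0_norm ?invr_ge0// invf_lt1// ltr1n.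
  rewrite mulr0 addr0 in L; apply: (cvgr_to_ge L); apply: nearW => k.
  exact: it (xS i) (lexx _).
have ch i : (i <= n)%N -> D (x i) <= 2 ^+ i * D 0.
  elim: i => [|i IH] hi; first by rewrite x0 expr0 mul1r.
  have h1 := cell i hi; have h2 := IH (ltnW hi).
  by rewrite exprS -mulrA; lra.
by have := ch n (leqnn n); rewrite xn.
Qed.

End Gronwall.

Section Growth.
Context {R : realType}.
Local Notation mu := (@lebesgue_measure R).
Variables (N : nat) (p : nat -> R).
Hypotheses (p_ge0 : forall j, (1 <= j <= N)%N -> 0 <= p j)
  (p_sum1 : \sum_(1 <= j < N.+1) p j = 1).
Variables (eta0 : R -> R) (eta : R -> R -> R) (beta : R -> R).
Hypotheses (eta0P : is_density eta0) (etaP : forall tau : R, 0 <= tau -> is_density (eta tau))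
  (eta_cont : continuous_L1 eta) (beta_loc : loc_integrable_from 0 beta)
  (boch : forall tau : R, 0 <= tau -> is_bochner_integral 0 tau
     (fun s y => beta s * S_op (tau - s) (T1 (Qconv N p (eta s))) y) (eta tau \- S_op tau eta0))
  (bdry : forall tau0 : R, 0 <= tau0 ->
          {ae mu, forall tau : R, tau0 <= tau <= tau0 + ln 2 ->
            beta tau = expR (tau - tau0) * eta tau0 (expR (tau - tau0))}).
Local Notation q := (qcst N p).

(** Along characteristics the derivative of [a] is at most [q |beta| |1 - a|] in modulus, because
    [Q(1) = 1] and [Q] is [q]-Lipschitz on the disc. *)
Lemma sol_growth (T : R) : 0 <= T -> exists2 C : R, 0 < C &
  forall (xi : R[i]) t, 0 < Re xi -> 0 <= t <= T ->
    cn (1 - AA eta t ((expR t)%:C * xi)) <= C * cn (1 - AA eta 0 xi).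
Proof.
move=> T0; have q0 : 0 < q := lt_le_trans ltr01 (q_ge1 N p p_ge0 p_sum1).
pose B (x : R) := if (0 <= x) && (x <= T) then `|beta x| else 0.
have B1 : L1 B.
  have [h _] := L1_mkcond (`[0, T]%classic : set R) beta (measurable_itv _).
  apply: (eq_L1 _ _ _ (L1_norm _ (h (beta_loc T)))) => x; rewrite /B indicE.
  case: ifPn => hx; first by rewrite mem_set ?mulr1//= in_itv.
  by rewrite memNset ?mulr0 ?normr0//= in_itv/=; exact/negP.
have B0 x : 0 <= B x by rewrite /B; case: ifP.
have [C C0 HC] := gronwall B T q B1 B0 T0 q0.
exists C => // xi t e0 t0T; have /andP[t0 tT] := t0T.
pose D x := cn (1 - aa eta xi x).
have aE0 : aa eta xi 0 = AA eta 0 xi by rewrite aaE// expR0 rmorph1 mul1r.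
have := HC D _ _ t t0T; rewrite /D aE0 (aaE _ _ _ t0); apply.
  move=> x; rewrite cn_ge0/= (le_trans (cnB _ _))// cn1 -[2]/(1 + 1) lerD2l.
  exact: cn_aa etaP _ e0 x.
move=> s x M s0 sx xT HM.
have M0 : 0 <= M := le_trans (cn_ge0 _) (HM s (lexx _) sx).
have ev := evol_aa N p p_ge0 p_sum1 eta0 eta beta eta0P etaP eta_cont beta_loc boch bdry xi e0 s x s0 sx.
have cH := cL1_HH N p p_ge0 p_sum1 eta beta etaP eta_cont beta_loc bdry xi e0.
have LG := L1Z (M * q) _ B1.
have bd y : s < y -> y <= x -> cn (gg beta xi y * (1 - QC N p (aa eta xi y))) <= M * q * B y.
  move=> sy yx; have y0 : 0 < y := le_lt_trans s0 sy.
  have yT := le_trans yx xT.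
  rewrite cnM /B (ltW y0) yT/= mulrC; apply: ler_pM; rewrite ?cn_ge0//.
    have h1 : cn (1 : R[i]) <= 1 by rewrite cn1.
    have h2 : cn (aa eta xi y) <= 1 by exact: cn_aa etaP _ e0 y.
    have h3 := cn_QCB N p p_ge0 _ _ h1 h2; rewrite (QC1 N p p_sum1) in h3.
    apply: (le_trans h3); rewrite mulrC.
    by apply: ler_wpM2r; [exact: ltW q0|exact: HM (ltW sy) yx].
  rewrite (le_trans (cn_gg beta xi y))// /GG subr0; case: ifP => // _.
  rewrite /bt (ltW y0) ler_piMr// mulNr expRN_le1// mulr_ge0 ?expR_ge0// ltW//.
have K := cI_coc_le s x _ _ cH LG sx bd.
have Ez z : prim (fun x => M * q * B x) z = M * q * prim B z.
  by rewrite /prim RintegralZl//; exact: (L1_on _ _ (measurable_itv _) B1).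
rewrite !Ez -mulrBr in K.
have SB (a b j : R[i]) : a - b = - j -> 1 - a = (1 - b) + j.
  by move=> h; have -> : a = b - j; [rewrite -h addrC subrK|ring].
have {}ev := f_equal (@cn R) (SB _ _ _ ev); apply: (le_trans (eq_ind_r (fun z => z <= _) (cnD _ _) ev)).
by rewrite mulrA lerD2l.
Qed.

End Growth.

(** * The profile as a stationary solution *)

Section FTC.
Context {R : realType}.
Local Notation mu := (@lebesgue_measure R).

Lemma FTC_ooc (F f : R -> R) (s t : R) : s < t -> continuous f -> (forall x, is_derive x (1 : R) F (f x)) ->
  F t - F s = \int[mu]_x ooc s t f x.
Proof.
move=> st cf dF.
have cF x : {for x, continuous F} := derivable_cont _ _ (@ex_derive _ _ _ _ _ _ _ (dF x)).
have mf : measurable_fun setT f := continuous_measurable_fun cf.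
have E := @continuous_FTC2 R f F s t st.
have {}E : (\int[mu]_(x in `[s, t]) (f x)%:E = (F t)%:E - (F s)%:E)%E.
  apply: E.
  - by apply: continuous_subspaceT.
  - split.
    + by move=> x _; exact: (@ex_derive _ _ _ _ _ _ _ (dF x)).
    + by apply: cvg_at_right_filter; exact: cF.
    + by apply: cvg_at_left_filter; exact: cF.
  - by move=> x _; rewrite derive1E; exact: (@derive_val _ _ _ _ _ _ _ (dF x)).
have {}E : F t - F s = \int[mu]_(x in `[s, t]) f x by rewrite /Rintegral E.
rewrite E Itg_mkcond.
have m1 : measurable_fun setT (fun x => f x * \1_`[s, t] x).
  by apply: measurable_funM => //; exact: measurable_indic.
apply: (ae_eq_Itg _ _ m1 (measurable_ooc _ _ _ mf)).
have P : {ae mu, forall x : R, x != s}.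
  exists [set s]; split; [exact: measurable_set1|exact: lebesgue_measure_set1|].
  by move=> y /= /negP; rewrite negbK => /eqP.
apply: (aeS _ _ _ P) => x xs; rewrite /ooc indicE.
case: ifPn => [/andP[h1 h2]|h]; first by rewrite mem_set ?mulr1//= in_itv/= (ltW h1).
rewrite memNset ?mulr0//= in_itv/= => /andP[h1 h2]; move: h.
by rewrite h2 andbT lt_neqAle eq_sym xs h1.
Qed.

End FTC.

Section ProfileEvolution.
Context {R : realType}.
Local Notation mu := (@lebesgue_measure R).
Variables (N : nat) (p : nat -> R).
Hypotheses (p_ge0 : forall j, (1 <= j <= N)%N -> 0 <= p j)
  (p_sum1 : \sum_(1 <= j < N.+1) p j = 1).
Variables (theta : R) (eta : R -> R).
Hypotheses (theta_gt0 : 0 < theta) (etaP : is_profile N p theta eta).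
Local Notation q := (qcst N p).
Implicit Types (xi : R[i]).

Let c := theta / q.
Let q_gt0 : 0 < q. Proof. exact: lt_le_trans ltr01 (q_ge1 N p p_ge0 p_sum1). Qed.
Let c_gt0 : 0 < c. Proof. by rewrite divr_gt0. Qed.
Let in1 : in_L1 eta. Proof. by have [[]] := etaP. Qed.

Section ProfileRay.
Variable xi : R[i].
Hypothesis e_gt0 : 0 < Re xi.
Let e := Re xi.

Let a (s : R) : R[i] := BB eta ((expR s)%:C * xi).
Let g (s : R) : R[i] := if 0 < s then c%:C * ce xi (expR s) else 0.
Let G (s : R) : R := if 0 < s then c * expR (- e * expR s) else 0.
Let H (s : R) : R[i] := g s * (1 - QC N p (a s)).

Let RM (r : R) (z : R[i]) : Re (r%:C * z) = r * Re z.
Proof. by case: z => x y /=; rewrite mul0r subr0. Qed.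
Let IM (r : R) (z : R[i]) : Im (r%:C * z) = r * Im z.
Proof. by case: z => x y /=; rewrite mul0r addr0. Qed.

Let er s : 0 < Re ((expR s)%:C * xi). Proof. by rewrite RM mulr_gt0 ?expR_gt0. Qed.

Let mG : measurable_fun setT G. Proof. by rewrite /G; mfun. Qed.

Let G1 : L1 G.
Proof.
have h := L1Z c _ (hv_LT e e_gt0); apply: (L1_le _ _ mG _ h) => s.
rewrite /G; case: ifPn => s0.
  rewrite /hv (ltW s0) mulr1 ger0_norm; last exact: mulr_ge0 (ltW c_gt0) (expR_ge0 _).
  apply: ler_wpM2l; first exact: ltW c_gt0.
  rewrite ler_expR !mulNr lerN2 ler_wpM2l ?(ltW e_gt0)//.
  by apply: le_trans (expR_ge1Dx _); rewrite lerDr.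
rewrite normr0; apply: mulr_ge0 (ltW c_gt0) (mulr_ge0 (expR_ge0 _) _).
by rewrite /hv; case: ifP.
Qed.

Let gG s : cn (g s) <= G s.
Proof.
rewrite /g /G; case: ifP => _; last by rewrite cn0.
by rewrite cnM cnC cn_ce (gtr0_norm c_gt0).
Qed.

Let mg : cmeas _ _ g.
Proof.
have [m1 m2] := cmeasM _ _ _ _ (cmeas_cst _ _ c%:C) (@cmeas_ceexp R xi); split.
  rewrite (_ : (fun s => _) = fun s : R => if 0 < s then Re (c%:C * ce xi (expR s)) else 0); first by mfun.
  by apply: funext => s; rewrite /g; case: ifP.
rewrite (_ : (fun s => _) = fun s : R => if 0 < s then Im (c%:C * ce xi (expR s)) else 0); first by mfun.
by apply: funext => s; rewrite /g; case: ifP.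
Qed.

Let pos s : 0 < expR s :> R := expR_gt0 s.

Let dR s := is_derive_lap (pf eta) xi (expR s) (pf_causal eta) (pf_LTall N p theta eta etaP) e_gt0 (pos s).

Let dRe s : is_derive s (1 : R) (fun s => Re (a s)) (Re (- (xi * MB eta ((expR s)%:C * xi))) * expR s).
Proof. exact: is_derive1_comp (dR s).1 (is_derive_expR s). Qed.
Let dIm s : is_derive s (1 : R) (fun s => Im (a s)) (Im (- (xi * MB eta ((expR s)%:C * xi))) * expR s).
Proof. exact: is_derive1_comp (dR s).2 (is_derive_expR s). Qed.

Let ca1 s : {for s, continuous (fun s => Re (a s))}.
Proof. exact: derivable_cont _ _ (@ex_derive _ _ _ _ _ _ _ (dRe s)). Qed.
Let ca2 s : {for s, continuous (fun s => Im (a s))}.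
Proof. exact: derivable_cont _ _ (@ex_derive _ _ _ _ _ _ _ (dIm s)). Qed.

Let ma : cmeas _ _ a.
Proof. by split; apply: continuous_measurable_fun => s; [exact: ca1|exact: ca2]. Qed.

Let yc : causal (fun y => y * pf eta y).
Proof. by move=> y y0; rewrite pf_causal// mulr0. Qed.

Let yL : LTall (fun y => y * pf eta y) := LTall_id _ (pf_causal eta) (pf_LTall N p theta eta etaP).

Let dM s := is_derive_lap (fun y => y * pf eta y) xi (expR s) yc yL e_gt0 (pos s).

Let cM1 s : {for s, continuous (fun s => Re (MB eta ((expR s)%:C * xi)))}.
Proof. exact: derivable_cont _ _ (@ex_derive _ _ _ _ _ _ _ (is_derive1_comp (dM s).1 (is_derive_expR s))). Qed.
Let cM2 s : {for s, continuous (fun s => Im (MB eta ((expR s)%:C * xi)))}.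
Proof. exact: derivable_cont _ _ (@ex_derive _ _ _ _ _ _ _ (is_derive1_comp (dM s).2 (is_derive_expR s))). Qed.

Let cD (k1 k2 : R) : continuous (fun s => (k1 * Re (MB eta ((expR s)%:C * xi)) + k2 * Im (MB eta ((expR s)%:C * xi))) * expR s).
Proof.
move=> s; apply: cvgM; last exact: continuous_expR.
apply: cvgD; apply: cvgM; [exact: cvg_cst|exact: cM1|exact: cvg_cst|exact: cM2].
Qed.

(** Identifies [- H] with the derivative of [a]: the factor [1 / (e^s xi)] of [MB_eq] is cancelled
    by the derivative of [e^s xi]. *)
Let HE s : 0 < s -> - H s = (- (xi * MB eta ((expR s)%:C * xi))) * (expR s)%:C.
Proof.
move=> s0; rewrite (MB_eq N p theta eta etaP _ (er s)) /H /g s0 -/c.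
have -> : ce ((expR s)%:C * xi) 1 = ce xi (expR s) by rewrite ceZ mulr1.
rewrite -/(a s); have z0 : (expR s)%:C * xi != 0.
  by apply/eqP => E; have := er s; rewrite E ltxx.
have x0 : xi != 0 by apply: contraNneq z0 => ->; rewrite mulr0.
have r0 : (expR s)%:C != 0 :> R[i] by apply: contraNneq z0 => ->; rewrite mul0r.
move: r0 x0; move: (expR s)%:C (ce _ _) (QC _ _ _) c%:C => r z w k r0 x0.
by field; rewrite x0 r0.
Qed.

Let evol s t : 0 <= s -> s <= t -> a t - a s = - cI (coc s t H).
Proof.
move=> s0; rewrite le_eqVlt => /predU1P[<-|st].
  rewrite subrr (_ : coc s s H = fun=> 0); last first.
    by apply: funext => x; rewrite /coc; case: ltP => //= h; rewrite leNgt.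
  rewrite /cI /=; have -> : \int[mu]_x (0 : R) = 0 by rewrite /Rintegral integral0.
  by rewrite -[0 +i* 0]/(0 : R[i]) oppr0.
have LH : cL1 H.
  apply: (cL1_le _ _ _ (L1Z 2 _ G1)) => [|x].
    apply: cmeasM mg _; apply: cmeasD; first exact: cmeas_cst.
    by apply: cmeasN; exact: cmeas_QC ma.
  rewrite /H cnM mulrC; apply: ler_pM; rewrite ?cn_ge0 ?gG//.
  rewrite (le_trans (cnB _ _))// cn1 -[2]/(1 + 1) lerD2l.
  have h := ltW (cn_BB1 N p theta eta etaP _ (er x)).
  exact: le_trans (cn_QC N p p_ge0 p_sum1 _ h) h.
have [c1 c2] := cL1_coc s t _ LH.
have X (P : R[i] -> R) (k1 k2 : R) : (forall x, is_derive x (1 : R) (fun s => P (a s)) (P (- (xi * MB eta ((expR x)%:C * xi))) * expR x)) ->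
    (forall z, P (- (xi * z)) = k1 * Re z + k2 * Im z) -> (forall z (r : R), P (z * r%:C) = P z * r) ->
    (forall z, P (- z) = - P z) -> P 0 = 0 -> L1 (fun x => P (coc s t H x)) ->
    P (a t) - P (a s) = - \int[mu]_x P (coc s t H x).
  move=> d1 d2 d3 d4 d5 LP; rewrite -(ItgN _ LP).
  have cf : continuous (fun x : R => P (- (xi * MB eta ((expR x)%:C * xi))) * expR x).
    rewrite (_ : (fun x => _) = fun s => (k1 * Re (MB eta ((expR s)%:C * xi)) + k2 * Im (MB eta ((expR s)%:C * xi))) * expR s).
      exact: cD.
    by apply: funext => x; rewrite d2.
  apply: (etrans (FTC_ooc _ _ s t st cf d1)); apply: eq_Itg => x; rewrite /ooc /coc.
  case: ifPn => [/andP[sx _]|_]; last by rewrite d5 oppr0.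
  by rewrite -d4 (HE x (le_lt_trans s0 sx)) d3.
have E1 : Re (a t) - Re (a s) = - \int[mu]_x Re (coc s t H x).
  apply: (X (fun z => Re z) (- Re xi) (Im xi)) => //.
  - by move=> z; case: (xi) z => ? ? [? ?] /=; ring.
  - by move=> [? ?] r /=; ring.
  - by case.
have E2 : Im (a t) - Im (a s) = - \int[mu]_x Im (coc s t H x).
  apply: (X (fun z => Im z) (- Im xi) (- Re xi)) => //.
  - by move=> z; case: (xi) z => ? ? [? ?] /=; ring.
  - by move=> [? ?] r /=; ring.
  - by case.
move: E1 E2; rewrite /cI; case: (a t) => x1 y1; case: (a s) => x2 y2 /= h1 h2.
by apply/eqP; rewrite eq_complex/= h1 h2 !eqxx.
Qed.

(** Since the profile is stationary, its transform along a characteristic is [B(e^s xi)], which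
    satisfies the abstract evolution with the constant flux [c]; the conclusion is [evol_Phi_lim] at
    time 0. *)
Lemma prof_Phi_exp : Phi_lim N p (BB eta xi) (cI (fun x => if 0 < x then c%:C * ce xi (expR x) else 0)).
Proof.
have h := evol_Phi_lim N p p_ge0 p_sum1 e g a G e_gt0 mg G1 gG ma _ evol 0 (lexx 0).
have {}h : Phi_lim N p (a 0) (cI (fun x => if 0 < x then g x else 0)).
  apply: h => s s0; apply: (le_trans (cn_BB N p theta eta etaP _ (er s))).
  by rewrite ler_expR RM mulNr lerN2 mulrC.
have a0 : a 0 = BB eta xi by rewrite /a expR0 rmorph1 mul1r.
rewrite a0 in h; rewrite (_ : (fun x => _) = fun x => if 0 < x then g x else 0)//.
by apply: funext => x; rewrite /g; case: ifP => // ->.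
Qed.

End ProfileRay.
End ProfileEvolution.

(** * Comparison of the solution with the profile *)

Section Weighted.
Context {R : realType}.
Local Notation mu := (@lebesgue_measure R).

Lemma L1_wpow (w : R -> R) (gm s : R) : measurable_fun setT w -> (forall y, y < 1 -> w y = 0) ->
  L1 (fun y => y `^ (2 * gm) * w y ^+ 2) -> 2 * s - 2 * gm < -1 ->
  L1 (fun y => y `^ s * `|w y|) /\
  (\int[mu]_y (y `^ s * `|w y|)) ^+ 2 <=
    (\int[mu]_y (if 1 <= y then y `^ (2 * s - 2 * gm) else 0)) * \int[mu]_y (y `^ (2 * gm) * w y ^+ 2).
Proof.
move=> mw w1 w2 sg.
pose f (y : R) := if 1 <= y then y `^ (s - gm) else 0.
pose g (y : R) := y `^ gm * `|w y|.
have mf : measurable_fun setT f by rewrite /f; mfun.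
have mg : measurable_fun setT g by rewrite /g; mfun.
have P (y a : R) : (y `^ a) ^+ 2 = y `^ (2 * a).
  by rewrite -powR_mulrn ?powR_ge0// -powRrM mulrC.
have f2 y : f y ^+ 2 = if 1 <= y then y `^ (2 * s - 2 * gm) else 0.
  by rewrite /f; case: ifP => _; rewrite ?expr0n// P mulrBr.
have g2 y : g y ^+ 2 = y `^ (2 * gm) * w y ^+ 2 by rewrite /g exprMn P real_normK ?num_real.
have fg y : f y * g y = y `^ s * `|w y|.
  rewrite /f /g; case: (ltP y 1) => y1; first by rewrite w1// normr0 !mulr0.
  have y0 : y != 0 by rewrite gt_eqF// (lt_le_trans ltr01).
  by rewrite mulrA -powRD ?subrK//; apply/implyP.
have [h1 h2] := cauchy_schwarz f g mf mg (eq_L1 _ _ (fun y => esym (f2 y)) (L1_powR_oo _ _ sg ltr01)) (eq_L1 _ _ (fun y => esym (g2 y)) w2).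
split; first exact: (eq_L1 _ _ fg h1).
by rewrite -(eq_Itg _ _ fg) -(eq_Itg _ _ f2) -(eq_Itg _ _ g2).
Qed.

(** For [0 <= s <= 1] the minimum of 1 and [r y] is at most [(r y)^s], and [y^s |w|] is integrable
    by Cauchy-Schwarz. *)
Lemma hrd_pow (w : R -> R) (gm s : R) : measurable_fun setT w -> (forall y, y < 1 -> w y = 0) ->
  L1 w -> L1 (fun y => y `^ (2 * gm) * w y ^+ 2) -> 2 * s - 2 * gm < -1 -> 0 <= s -> s <= 1 ->
  exists2 C : R, 0 <= C & forall r, 0 < r -> hrd w r <= C * r `^ s.
Proof.
move=> mw w1 wL w2 sg s0 s1; have [h _] := L1_wpow w gm s mw w1 w2 sg.
exists (\int[mu]_y (y `^ s * `|w y|)).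
  by apply: Itg_ge0 => y; rewrite mulr_ge0 ?powR_ge0.
move=> r r0; rewrite mulrC -(ItgZ _ _ h) /hrd.
have mm : measurable_fun setT (fun y : R => Num.min 1 (r * y)).
  by apply: measurable_min; mfun.
have b y : `|w y| * Num.min 1 (r * y) <= r `^ s * (y `^ s * `|w y|).
  have [y1|y1] := ltP y 1; first by rewrite w1// normr0 mul0r !mulr0.
  have y0 : 0 < y := lt_le_trans ltr01 y1; have ry : 0 < r * y by rewrite mulr_gt0.
  rewrite mulrA -powRM ?(ltW r0) ?(ltW y0)// [leRHS]mulrC ler_wpM2l//.
  rewrite ge_min; apply/orP; have [h1|h1] := leP 1 (r * y).
    by left; rewrite -[X in X <= _](powRr0 (r * y)) ler_powR.
  right; rewrite -[X in X <= _](powRr1 (ltW ry)); apply: ger_powR => //.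
  by rewrite ry/= ltW.
have b0 y : `| `|w y| * Num.min 1 (r * y)| <= r `^ s * (y `^ s * `|w y|).
  rewrite ger0_norm//; have [y1|y1] := ltP y 1; first by rewrite w1// normr0 mul0r.
  by rewrite mulr_ge0// le_min ler01/= mulr_ge0// ltW// (lt_le_trans ltr01).
have m : measurable_fun setT (fun y => `|w y| * Num.min 1 (r * y)) by mfun.
by apply: (le_trans (ler_norm _)); exact: (Itg_norm_le _ _ (L1Z (r `^ s) _ h) m b0).
Qed.

Lemma lap_exp (u : R -> R) (xi : R[i]) : LT (Re xi) u -> (forall y, y <= 0 -> u y = 0) ->
  lap u xi = cI (fun x => (u (expR x) * expR x)%:C * ce xi (expR x)).
Proof.
move=> hu u0; have hL := lap_cL1 _ _ hu.
have X (P : R[i] -> R) : (forall (r : R) z, P (r%:C * z) = r * P z) -> L1 (fun y => P ((u y)%:C * ce xi y)) ->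
    \int[mu]_y P ((u y)%:C * ce xi y) = \int[mu]_x P ((u (expR x) * expR x)%:C * ce xi (expR x)).
  move=> PM L; have f0 y : (if 0 < y then P ((u y)%:C * ce xi y) else 0) = P ((u y)%:C * ce xi y).
    by case: ltP => // y0; rewrite PM u0// mul0r.
  have Lf := eq_L1 _ _ (fun y => esym (f0 y)) L.
  have [_ e2] := L1_exp_subst _ Lf (L1_meas _ L); rewrite (eq_Itg _ _ f0) in e2.
  by rewrite -e2; apply: eq_Itg => x; rewrite !PM; ring.
have E1 := X (fun z => Re z) (fun r z => _) hL.1; have E2 := X (fun z => Im z) (fun r z => _) hL.2.
have {}E1 := E1 (ltac:(by move=> r [a b] /=; rewrite mul0r subr0)).
have {}E2 := E2 (ltac:(by move=> r [a b] /=; rewrite mul0r addr0)).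
by rewrite /lap /cI E1 E2.
Qed.

End Weighted.

(** * Transforms of the initial data against those of the profile *)

Section DataAlgebra.
Context {R : realType}.

Lemma quotient_far (nu k : R) (X Y mw mb : R[i]) : 0 < nu -> 0 < k -> k <= cn X -> k <= cn Y ->
  cn ((mw + nu%:C * mb) / X - mb / Y) <= k^-1 * cn mw + (nu + 1) / k * cn mb.
Proof.
move=> nu0 k0 kX kY.
have -> : (mw + nu%:C * mb) / X - mb / Y = mw / X + nu%:C * mb / X - mb / Y by rewrite mulrDl.
have iv (Z : R[i]) : k <= cn Z -> (cn Z)^-1 <= k^-1.
  by move=> h; rewrite lef_pV2 ?posrE// (lt_le_trans k0 h).
have h1 := ler_wpM2l (cn_ge0 mw) (iv X kX).
have h2 := ler_wpM2l (mulr_ge0 (ltW nu0) (cn_ge0 mb)) (iv X kX).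
have h3 := ler_wpM2l (cn_ge0 mb) (iv Y kY).
apply: (le_trans (cnB _ _)); have := cnD (mw / X) (nu%:C * mb / X).
rewrite !cnM !cnV cnC (gtr0_norm nu0) => h4.
have -> : k^-1 * cn mw + (nu + 1) / k * cn mb = cn mw * k^-1 + nu * cn mb * k^-1 + cn mb * k^-1 by ring.
by move: h1 h2 h3 h4; move: (cn mw / cn X) (nu * cn mb / cn X) (cn mb / cn Y) => a b c; lra.
Qed.

(** The difference is [mw / X] plus [mb (nu Y - X) / (X Y)]. Since [D0] is within [nu |D| / 2] of
    [nu D], both denominators are comparable with [|D|]. In [nu Y - X] the linear parts leave only
    [q (D0 - nu D)], of size [q h]; the quadratic remainders are compensated by the denominator
    [|D|^2]. *)
Lemma quotient_near (q q2 nu T r h : R) (X Y D D0 mw mb : R[i]) :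
  0 < nu -> 1 <= q -> 0 <= q2 -> 0 < cn D -> 0 < r -> 0 <= T ->
  cn (D0 - nu%:C * D) <= h -> h <= nu / 2 * cn D ->
  cn (Y - q%:C * D) <= q2 * cn D ^+ 2 -> cn (X - q%:C * D0) <= q2 * cn D0 ^+ 2 ->
  q2 * cn D <= 2^-1 -> q2 * (3 / 2 * nu * cn D) <= 2^-1 ->
  cn mb <= T * cn D / r ->
  cn ((mw + nu%:C * mb) / X - mb / Y) <=
    4 / nu * (cn mw / cn D) + 8 * q * T / nu * (h / (r * cn D)) + 8 * q2 * (1 + 9 / 4 * nu) * cn mb.
Proof.
move=> nu0 q1 q20 d0 r0 T0 hW hh hY hX s1 s2 hmb.
have q0 : 0 < q := lt_le_trans ltr01 q1.
have h0 : 0 <= h := le_trans (cn_ge0 _) hW.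
set d := cn D in d0 hh hY s1 s2 hmb *.
have D0u : cn D0 <= 3 / 2 * nu * d.
  have := cnD (D0 - nu%:C * D) (nu%:C * D); rewrite subrK cnM cnC (gtr0_norm nu0) -/d.
  by move: hW hh; lra.
have D0l : nu / 2 * d <= cn D0.
  have := cnB (D0 - nu%:C * D) D0; rewrite addrAC subrr add0r cnN cnM cnC (gtr0_norm nu0) -/d.
  by move: hW hh; lra.
have low (Z E : R[i]) : cn (Z - q%:C * E) <= q2 * cn E ^+ 2 -> q2 * cn E <= 2^-1 -> cn E / 2 <= cn Z.
  move=> a1 a2; have := cnB Z (Z - q%:C * E); rewrite opprB addrC subrK cnM cnC (gtr0_norm q0).
  have a3 : q2 * cn E ^+ 2 <= 2^-1 * cn E by rewrite expr2 mulrA ler_wpM2r ?cn_ge0.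
  have a4 : cn E <= q * cn E by rewrite ler_peMl ?cn_ge0.
  by move: a1; lra.
have yl : d / 2 <= cn Y := low _ _ hY s1.
have xl : nu / 4 * d <= cn X.
  have s3 : q2 * cn D0 <= 2^-1 by apply: le_trans s2; exact: ler_wpM2l.
  by have := low _ _ hX s3; move: D0l; lra.
have x0 : 0 < nu / 4 * d by rewrite mulr_gt0 ?divr_gt0.
have y0 : 0 < d / 2 by rewrite divr_gt0.
have X0 : 0 < cn X := lt_le_trans x0 xl. have Y0 : 0 < cn Y := lt_le_trans y0 yl.
have Xn : X != 0 by rewrite -cn_gt0. have Yn : Y != 0 by rewrite -cn_gt0.
have ix : (cn X)^-1 <= 4 / (nu * d).
  have -> : 4 / (nu * d) = (nu / 4 * d)^-1 by field; rewrite !gt_eqF.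
  by rewrite lef_pV2.
have iy : (cn Y)^-1 <= 2 / d.
  have -> : 2 / d = (d / 2)^-1 by field; rewrite !gt_eqF.
  by rewrite lef_pV2.
have ixy : (cn X)^-1 * (cn Y)^-1 <= 8 / (nu * d ^+ 2).
  have -> : 8 / (nu * d ^+ 2) = 4 / (nu * d) * (2 / d) by field; rewrite !gt_eqF.
  by apply: ler_pM => //; rewrite invr_ge0 cn_ge0.
have -> : (mw + nu%:C * mb) / X - mb / Y = mw / X + mb * ((nu%:C * Y - X) * (X^-1 * Y^-1)).
  by field; rewrite Xn Yn.
have Z : cn (nu%:C * Y - X) <= q * h + q2 * (nu + 9 / 4 * nu ^+ 2) * d ^+ 2.
  have -> : nu%:C * Y - X = nu%:C * (Y - q%:C * D) - (X - q%:C * D0) - q%:C * (D0 - nu%:C * D) by ring.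
  apply: (le_trans (cnB _ _)); have := cnB (nu%:C * (Y - q%:C * D)) (X - q%:C * D0).
  rewrite !cnM !cnC (gtr0_norm q0) (gtr0_norm nu0).
  have b1 := ler_wpM2l (ltW nu0) hY; have b2 := ler_wpM2l (ltW q0) hW.
  have b3 : q2 * cn D0 ^+ 2 <= q2 * (3 / 2 * nu * d) ^+ 2.
    by apply: ler_wpM2l => //; rewrite lerXn2r// nnegrE ?cn_ge0// mulr_ge0 ?mulr_ge0 ?(ltW d0) ?(ltW nu0).
  have -> : q2 * (nu + 9 / 4 * nu ^+ 2) * d ^+ 2 = nu * (q2 * d ^+ 2) + q2 * (3 / 2 * nu * d) ^+ 2 by field.
  by move: hX; lra.
have t1 : cn (mw / X) <= 4 / nu * (cn mw / d).
  rewrite cnM cnV (_ : 4 / nu * (cn mw / d) = cn mw * (4 / (nu * d))); last by field; rewrite !gt_eqF.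
  by rewrite ler_wpM2l ?cn_ge0.
have t2 : cn (mb * ((nu%:C * Y - X) * (X^-1 * Y^-1))) <=
   cn mb * ((q * h + q2 * (nu + 9 / 4 * nu ^+ 2) * d ^+ 2) * (8 / (nu * d ^+ 2))).
  rewrite !cnM !cnV; apply: ler_wpM2l; first exact: cn_ge0.
  by apply: ler_pM => //; rewrite ?cn_ge0// mulr_ge0// invr_ge0 cn_ge0.
have t3 : cn mb * ((q * h + q2 * (nu + 9 / 4 * nu ^+ 2) * d ^+ 2) * (8 / (nu * d ^+ 2))) =
   cn mb * (8 * q * h / (nu * d ^+ 2)) + 8 * q2 * (1 + 9 / 4 * nu) * cn mb.
  by field; rewrite !gt_eqF.
have t4 : cn mb * (8 * q * h / (nu * d ^+ 2)) <= 8 * q * T / nu * (h / (r * d)).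
  have -> : 8 * q * T / nu * (h / (r * d)) = T * d / r * (8 * q * h / (nu * d ^+ 2)) by field; rewrite !gt_eqF.
  apply: ler_wpM2r => //; rewrite divr_ge0 ?mulr_ge0 ?exprn_ge0 ?(ltW q0) ?(ltW nu0) ?(ltW d0)//.
by apply: (le_trans (cnD _ _)); move: t1 t2 t4; rewrite t3; lra.
Qed.

End DataAlgebra.

Section DensityTransforms.
Context {R : realType}.
Local Notation mu := (@lebesgue_measure R).

Lemma Itg_ext0_density (w : R -> R) : is_density w -> \int[mu]_y ext0 w y = 1.
Proof.
move=> hw; have [h1 _ _] := hw; have L := L1_ext0 _ h1.
rewrite (ae_eq_Itg _ _ (L1_meas _ L) (L1_meas _ (L1_norm _ L)) (ae_pdens w hw)).
by have [_ _ _] := density_pdens _ hw.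
Qed.

Lemma ext0_gap (w : R -> R) (r : R) : is_density w -> 0 < r -> exists2 k : R, 0 < k &
  forall xi : R[i], 0 < Re xi -> 0 <= Im xi -> r <= Re xi + Im xi -> cn (lap (ext0 w) xi) <= 1 - k.
Proof.
move=> hd r0; have [k k0 H] := lap_density_gap _ r (density_pdens _ hd) r0.
by exists k => // -[e x] /= h1 h2 h3; rewrite (lap_pdens _ _ hd) H.
Qed.

Lemma cn_ext0_lt1 (w : R -> R) (xi : R[i]) : is_density w -> 0 < Re xi -> cn (lap (ext0 w) xi) < 1.
Proof.
move=> hd e0; rewrite (lap_pdens _ xi hd).
apply: (le_lt_trans (cn_lap_density _ xi (density_pdens _ hd) (ltW e0))).
by rewrite -expR0 ltr_expR oppr_lt0.
Qed.

Lemma ext0_causal (w : R -> R) : causal (ext0 w).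
Proof. by move=> y y0; apply: ext0_lt1; exact: lt_trans ltr01. Qed.

End DensityTransforms.

Section ProfileTail.
Context {R : realType}.
Local Notation mu := (@lebesgue_measure R).
Variables (N : nat) (p : nat -> R).
Hypotheses (p_ge0 : forall j, (1 <= j <= N)%N -> 0 <= p j)
  (p_sum1 : \sum_(1 <= j < N.+1) p j = 1).
Variables (theta : R) (eta : R -> R).
Hypotheses (theta_gt0 : 0 < theta) (etaP : is_profile N p theta eta).
Local Notation q := (qcst N p).
Let c := theta / q.
Let q_gt0 : 0 < q. Proof. exact: lt_le_trans ltr01 (q_ge1 N p p_ge0 p_sum1). Qed.
Let c_gt0 : 0 < c. Proof. by rewrite divr_gt0. Qed.

Definition uB (y : R) : R := if 1 < y then c / y else 0.

Lemma uB_lt1 y : y < 1 -> uB y = 0.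
Proof. by move=> y1; rewrite /uB ltNge (ltW y1). Qed.

Lemma uB_causal : causal uB.
Proof. by move=> y y0; apply: uB_lt1; exact: lt_trans ltr01. Qed.

Lemma measurable_uB : measurable_fun setT uB.
Proof. by rewrite /uB; mfun. Qed.

Lemma uB_LTall : LTall uB.
Proof.
move=> e e0; have mu1 := measurable_uB.
apply: (L1_le _ _ _ _ (L1Z c _ (hv_LT e e0))); first by mfun.
move=> y; rewrite normrM (ger0_norm (expR_ge0 _)) mulrCA; apply: ler_wpM2l; first exact: expR_ge0.
rewrite /uB /hv; case: ifPn => y1.
  have y0 := lt_trans ltr01 y1.
  rewrite (ltW y0) mulr1 ger0_norm; last by rewrite divr_ge0 ?(ltW c_gt0) ?(ltW y0).
  by rewrite ler_pdivrMr// ler_peMr ?(ltW c_gt0) ?(ltW y1).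
by rewrite normr0 mulr_ge0 ?(ltW c_gt0)//; case: ifP.
Qed.

Lemma prof_Phi_lim xi : 0 < Re xi -> Phi_lim N p (BB eta xi) (lap uB xi).
Proof.
move=> e0; have u0 y : y <= 0 -> uB y = 0 by move=> y0; apply: uB_lt1; exact: le_lt_trans y0 ltr01.
rewrite (lap_exp _ xi (uB_LTall _ e0) u0).
have h := prof_Phi_exp N p p_ge0 p_sum1 theta eta theta_gt0 etaP xi e0.
rewrite (_ : (fun x => _) = fun x => if 0 < x then c%:C * ce xi (expR x) else 0)//.
apply: funext => x; rewrite /uB -[X in X < expR x]expR0 ltr_expR.
by case: ifP => _; rewrite ?mul0r// divfK ?gt_eqF ?expR_gt0.
Qed.

Lemma prof_relation xi : 0 < Re xi -> MB eta xi = (1 - QC N p (BB eta xi)) * lap (fun y => y * uB y) xi.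
Proof.
move=> e0.
have L1' z : 0 < Re z -> cn (lap (pf eta) z) < 1 := cn_BB1 N p theta eta etaP z.
exact: (Phi_lim_radial N p p_ge0 p_sum1 (pf eta) uB xi (pf_causal eta) (pf_LTall N p theta eta etaP) uB_causal uB_LTall e0 L1' prof_Phi_lim).
Qed.

(* [1 - Q(B)] vanishes only at [B = 1], to first order. *)
Lemma cn_1Q_lower : exists2 k : R, 0 < k & forall xi, 0 < Re xi -> 0 <= Im xi ->
  k * cn (DB eta xi) <= cn (1 - QC N p (BB eta xi)).
Proof.
have q20 := q2_ge0 N p p_ge0; have q1 := q_ge1 N p p_ge0 p_sum1.
pose d := (2 * (q2 N p + 1))^-1.
have d0 : 0 < d by rewrite invr_gt0 mulr_gt0// ltr_wpDl.
have [r0 r00 H] := DB_small N p theta eta etaP d d0.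
have [k k0 Hk] := BB_gap N p theta eta etaP r0 r00.
exists (Num.min (2^-1) (k / 2)); first by rewrite lt_min invr_gt0 ltr0n divr_gt0.
move=> xi e0 i0; have B1 := cn_BB1 N p theta eta etaP xi e0.
have D0 := cn_ge0 (DB eta xi); case: (leP (Re xi + Im xi) r0) => h.
  apply: (le_trans (y := 2^-1 * cn (DB eta xi))).
    by apply: ler_wpM2r => //; rewrite ge_min lexx.
  have a1 := cn_QC_lin N p p_ge0 p_sum1 _ (ltW B1); have a2 := H xi e0 i0 h.
  rewrite -/(DB eta xi) in a1.
  have a3 := cnB (1 - QC N p (BB eta xi)) (1 - QC N p (BB eta xi) - q%:C * DB eta xi).
  rewrite opprB addrC subrK cnM cnC (gtr0_norm q_gt0) in a3.
  have a4 : q2 N p * cn (DB eta xi) ^+ 2 <= 2^-1 * cn (DB eta xi).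
    rewrite expr2 mulrA ler_wpM2r//; apply: (le_trans (ler_wpM2l q20 a2)).
    rewrite /d invfM mulrCA ler_piMr ?invr_ge0// ler_pdivrMr ?mul1r ?lerDl//.
    by rewrite ltr_wpDl.
  have a5 : cn (DB eta xi) <= q * cn (DB eta xi) by rewrite ler_peMl.
  by move: a1 a3 a4 a5; lra.
apply: (le_trans (y := k / 2 * cn (DB eta xi))).
  by apply: ler_wpM2r => //; rewrite ge_min lexx orbT.
have a1 := Hk xi e0 i0 (ltW h); have a2 := DB_le2 N p theta eta etaP xi e0.
have a3 := cn_QC N p p_ge0 p_sum1 _ (ltW B1); have a4 := cn_le_add 1 (QC N p (BB eta xi)).
rewrite cn1 in a4.
have a5 : k / 2 * cn (DB eta xi) <= k / 2 * 2 by apply: ler_wpM2l => //; rewrite divr_ge0// ltW.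
by move: a1 a3 a4 a5; lra.
Qed.

End ProfileTail.

Section RealAlgebra.
Context {R : realType}.

Lemma sum4_ge (T U Z Y : R) : 0 <= T -> 0 <= U -> 0 <= Z -> 0 <= Y ->
  [/\ T <= T + U + Z + Y, U <= T + U + Z + Y, Z <= T + U + Z + Y, Y <= T + U + Z + Y & 0 <= T + U + Z + Y].
Proof. by move=> *; split; lra. Qed.

Lemma cs5 (K1 K2 K3 K4 K5 x1 x2 x3 x4 x5 S V : R) : 0 <= V ->
  V <= K1 * x1 + K2 * x2 + K3 * x3 + K4 * x4 + K5 * x5 ->
  x1 ^+ 2 <= S -> x2 ^+ 2 <= S -> x3 ^+ 2 <= S -> x4 ^+ 2 <= S -> x5 ^+ 2 <= S -> 0 <= S ->
  V ^+ 2 <= (5 * (K1 ^+ 2 + K2 ^+ 2 + K3 ^+ 2 + K4 ^+ 2 + K5 ^+ 2) + 1) * S.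
Proof.
move=> V0 hV h1 h2 h3 h4 h5 S0.
have g (K x : R) : x ^+ 2 <= S -> (K * x) ^+ 2 <= K ^+ 2 * S.
  by move=> h; rewrite exprMn; apply: ler_wpM2l => //; exact: sqr_ge0.
move: (g K1 _ h1) (g K2 _ h2) (g K3 _ h3) (g K4 _ h4) (g K5 _ h5) hV.
rewrite mulrDl mul1r -mulrA !mulrDl.
move: (K1 * x1) (K2 * x2) (K3 * x3) (K4 * x4) (K5 * x5) => a b c d e.
move: (_ * S) (_ * S) (_ * S) (_ * S) (_ * S) => A' B' C' D' E' g1 g2 g3 g4 g5 hV.
have h : V ^+ 2 <= (a + b + c + d + e) ^+ 2 by rewrite lerXn2r// nnegrE// (le_trans V0).
apply: (le_trans h).
have X : (a + b + c + d + e) ^+ 2 <= 5 * (a ^+ 2 + b ^+ 2 + c ^+ 2 + d ^+ 2 + e ^+ 2).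
  rewrite -subr_ge0 (_ : _ - _ = (a - b) ^+ 2 + (a - c) ^+ 2 + (a - d) ^+ 2 + (a - e) ^+ 2 +
    (b - c) ^+ 2 + (b - d) ^+ 2 + (b - e) ^+ 2 + (c - d) ^+ 2 + (c - e) ^+ 2 + (d - e) ^+ 2); last by ring.
  by rewrite !addr_ge0// sqr_ge0.
lra.
Qed.

End RealAlgebra.

Section Data.
Context {R : realType}.
Local Notation mu := (@lebesgue_measure R).
Variables (N : nat) (p : nat -> R).
Hypotheses (p_ge0 : forall j, (1 <= j <= N)%N -> 0 <= p j)
  (p_sum1 : \sum_(1 <= j < N.+1) p j = 1).
Variables (al th : R) (es : R -> R).
Hypotheses (th_gt : 0 < th) (esP : is_profile N p th es).
Hypotheses (al_gt : 2^-1 < al) (al_lt : al < 1) (gm_lt : al + th < 3 / 2).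
Variables (eta0 : R -> R) (nu : R).
Hypotheses (eta0P : is_density eta0) (nu_gt0 : 0 < nu).
Local Notation q := (qcst N p).
Let w y := ext0 eta0 y - nu * pf es y.
Hypothesis w2 : L1 (fun y => y `^ (2 * (al + th)) * w y ^+ 2).

Let esd : is_density es. Proof. by have [] := esP. Qed.
Let inS : in_L1 es. Proof. by have [] := esd. Qed.
Let in0 : in_L1 eta0. Proof. by have [] := eta0P. Qed.
Let LS := L1_ext0 _ inS.
Let L0 := L1_ext0 _ in0.

Let w1 y : y < 1 -> w y = 0.
Proof. by move=> y1; rewrite /w /pf !ext0_lt1// mulr0 subr0. Qed.
Let wL : L1 w. Proof. exact: L1B _ _ L0 (L1Z nu _ LS). Qed.
Let mw : measurable_fun setT w := L1_meas _ wL.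

Definition A0 xi := lap (ext0 eta0) xi.
Definition M0 xi := lap (fun y => y * ext0 eta0 y) xi.
Let mW xi := lap (fun y => y * w y) xi.

Let lapW xi : 0 < Re xi -> lap w xi = A0 xi - nu%:C * BB es xi.
Proof.
move=> e0; have h0 := ext0_LTall _ in0 _ e0; have h1 := ext0_LTall _ inS _ e0.
by rewrite /w (lapB _ _ xi h0 (LTZ _ nu _ h1)) (lapZ nu _ xi h1).
Qed.

Let lapM xi : 0 < Re xi -> M0 xi = mW xi + nu%:C * MB es xi.
Proof.
move=> e0; have h0 := LTall_id _ (ext0_causal eta0) (ext0_LTall _ in0) _ e0.
have h1 := LTall_id _ (ext0_causal es) (ext0_LTall _ inS) _ e0.
rewrite /mW (eq_lap (fun y => y * w y) (fun y => y * ext0 eta0 y - nu * (y * ext0 es y)) xi); last first.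
  by move=> y; rewrite /w /pf; ring.
by rewrite (lapB _ _ xi h0 (LTZ _ nu _ h1)) (lapZ nu _ xi h1) subrK.
Qed.

Let DW xi : 0 < Re xi -> 0 <= Im xi -> cn (1 - A0 xi - nu%:C * DB es xi) <= 2 * hrd w (Re xi + Im xi).
Proof.
move=> e0 i0; have h := cn_Itg_lap w xi wL w1 (ltW e0) i0.
rewrite (lapW xi e0) in h.
have Iw : \int[mu]_y w y = 1 - nu.
  by rewrite /w (ItgB _ _ L0 (L1Z nu _ LS)) (ItgZ _ _ LS) (Itg_ext0_density _ eta0P) (Itg_ext0_density _ esd) mulr1.
rewrite Iw in h; rewrite (_ : 1 - A0 xi - nu%:C * DB es xi = (1 - nu)%:C - (A0 xi - nu%:C * BB es xi))//.
by rewrite rmorphB rmorph1 /DB; ring.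
Qed.

(* Both [1 - A0] and [nu (1 - B)] dominate [W = int w - lap w] near 0, because
   [hrd w r = O(r^s)] for some [s > th] while [|1 - B| >= c0 r^th]. *)
Let hrd_DB (d : R) : 0 < d -> exists2 r0 : R, 0 < r0 & forall xi, 0 < Re xi -> 0 <= Im xi ->
  Re xi + Im xi <= r0 -> hrd w (Re xi + Im xi) <= d * cn (DB es xi).
Proof.
move=> d0; have a1 := al_gt; have a2 := al_lt; have a3 := gm_lt; have t0 := th_gt.
(* Halfway between [th], which must be exceeded to beat [DB_lower], and [al + th - 1/2], the limit
   allowed by [hrd_pow]. *)
pose s := th + (al - 1 / 2) / 2.
have sg : 2 * s - 2 * (al + th) < -1 by rewrite /s; lra.
have s0 : 0 <= s by rewrite /s; lra.
have s1 : s <= 1 by rewrite /s; lra.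
have [C C0 HC] := hrd_pow w (al + th) s mw w1 wL w2 sg s0 s1.
have [c0 c00 Hc] := DB_lower N p p_ge0 p_sum1 th es th_gt esP.
pose k := d * c0 / (C + 1); have C1 : 0 < C + 1 by rewrite ltr_wpDl.
have k0 : 0 < k by rewrite divr_gt0 ?mulr_gt0.
pose dl := (al - 1 / 2) / 2; have dl0 : 0 < dl by rewrite /dl; lra.
exists (Num.min 1 (k `^ dl^-1)); first by rewrite lt_min ltr01 powR_gt0.
move=> xi e0 i0; rewrite le_min => /andP[h1 h2]; set r := Re xi + Im xi in h1 h2 *.
have r0 : 0 < r by rewrite /r ltr_wpDr.
apply: (le_trans (HC r r0)); have h3 := Hc xi e0 i0 h1; rewrite -/r in h3.
have h4 : r `^ dl <= k.
  have E : k = (k `^ dl^-1) `^ dl by rewrite -powRrM mulVf ?gt_eqF// powRr1// ltW.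
  by rewrite [leRHS]E; apply: ge0_ler_powR; rewrite ?nnegrE ?powR_ge0 ?(ltW r0) ?(ltW dl0).
have rE : r `^ s = r `^ th * r `^ dl by rewrite -powRD//; apply/implyP => _; rewrite gt_eqF.
have h5 : C * r `^ s <= C * (r `^ th * k) by rewrite rE; apply: ler_wpM2l => //; rewrite ler_wpM2l ?powR_ge0.
apply: (le_trans h5); have h6 := ler_wpM2l (ltW d0) h3; apply: le_trans h6.
have -> : C * (r `^ th * k) = (C / (C + 1)) * (d * (c0 * r `^ th)) by rewrite /k; field; rewrite gt_eqF.
have D0 : 0 <= d * (c0 * r `^ th) := mulr_ge0 (ltW d0) (mulr_ge0 (ltW c00) (powR_ge0 _ _)).
by rewrite ler_piMl// ler_pdivrMr// mul1r lerDl.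
Qed.

(** Near the origin [1 - A0] is [nu (1 - B)] up to the negligible [hrd w]; away from it [|1 - B|] is
    bounded below and [|1 - A0|] is at most 2. *)
Lemma data_compare : exists2 C : R, 0 < C & forall xi, 0 < Re xi -> 0 <= Im xi ->
  cn (1 - A0 xi) <= C * cn (DB es xi).
Proof.
have [r0 r00 H] := hrd_DB 1 ltr01.
have [k k0 Hk] := BB_gap N p th es esP r0 r00.
exists (nu + 2 + 2 / k); first by rewrite addr_gt0// ?divr_gt0// addr_gt0.
move=> xi e0 i0; have D0 := cn_ge0 (DB es xi); case: (leP (Re xi + Im xi) r0) => h.
  have h1 := DW xi e0 i0; have h2 := H xi e0 i0 h.
  have h3 := cnD (1 - A0 xi - nu%:C * DB es xi) (nu%:C * DB es xi).
  rewrite subrK cnM cnC (gtr0_norm nu_gt0) in h3.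
  have h4 : 0 <= 2 / k * cn (DB es xi) by rewrite mulr_ge0// divr_ge0// ltW.
  by rewrite !mulrDl; move: h1 h2 h3 h4; lra.
have h1 := Hk xi e0 i0 (ltW h); have h2 := cn_le_add 1 (BB es xi); rewrite cn1 -/(DB es xi) in h2.
have h3 : k <= cn (DB es xi) by lra.
have h4 : 2 <= 2 / k * cn (DB es xi) by rewrite mulrAC ler_pdivlMr// ler_wpM2l.
have h5 := cnB 1 (A0 xi); rewrite cn1 in h5.
have h6 := ltW (cn_ext0_lt1 eta0 xi eta0P e0); rewrite -/(A0 xi) in h6.
have h7 : 0 <= (nu + 2) * cn (DB es xi) by rewrite mulr_ge0// addr_ge0// ltW.
by rewrite mulrDl; lra.
Qed.

(* [V = P_0 - P_B] is bounded by a gap argument away from the origin and by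
   [quotient_near] close to it. *)
Lemma data_cases : exists K1 K2 K3 K4 K5 : R, forall xi, 0 < Re xi -> 0 <= Im xi ->
  let V := cn (M0 xi / (1 - QC N p (A0 xi)) - MB es xi / (1 - QC N p (BB es xi))) in
  let r := Re xi + Im xi in
  V <= K4 * cn (mW xi) + K5 * cn (MB es xi) \/
  (r < 1 /\ V <= K1 * (cn (mW xi) * r `^ (- th)) + K2 * (hrd w r * (r^-1 * r `^ (- th))) + K3 * cn (MB es xi)).
Proof.
have q1 := q_ge1 N p p_ge0 p_sum1; have q20 := q2_ge0 N p p_ge0.
have q0 : 0 < q := lt_le_trans ltr01 q1.
have nu4 : 0 < nu / 4 by rewrite divr_gt0.
have [r1 r10 H1] := hrd_DB _ nu4.
(* Makes both smallness conditions of [quotient_near] hold at once, for [|D|] and for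
   [3/2 nu |D|]. *)
pose dd := (2 * (q2 N p + 1) * (1 + 3 / 2 * nu))^-1.
have n1 : 0 < 1 + 3 / 2 * nu by rewrite addr_gt0// mulr_gt0.
have dd0 : 0 < dd by rewrite invr_gt0 !mulr_gt0// ltr_wpDl.
have [r2 r20 H2] := DB_small N p th es esP dd dd0.
have [c0 c00 Hc] := DB_lower N p p_ge0 p_sum1 th es th_gt esP.
pose r0 := Num.min (2^-1) (Num.min r1 r2).
have r00 : 0 < r0 by rewrite !lt_min invr_gt0 ltr0n r10.
have [k1 k10 G1] := BB_gap N p th es esP r0 r00.
have [k2 k20 G2] := ext0_gap eta0 r0 eta0P r00.
pose k := Num.min k1 k2; have k0 : 0 < k by rewrite lt_min k10.
pose K1 := 4 / nu / c0; pose K2 := 16 * q * (2 * th) / nu / c0; pose K3 := 8 * q2 N p * (1 + 9 / 4 * nu).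
pose K4 := k^-1; pose K5 := (nu + 1) / k.
exists K1, K2, K3, K4, K5 => xi e0' x0' V r.
have A1 := cn_ext0_lt1 eta0 xi eta0P e0'; rewrite -/(A0 xi) in A1.
have B1 := cn_BB1 N p th es esP xi e0'.
case: (leP (Re xi + Im xi) r0) => h; last first.
  have lowk (a : R[i]) kk : k <= kk -> cn a < 1 -> cn a <= 1 - kk -> k <= cn (1 - QC N p a).
    move=> h1 h2 h3; have h4 := cn_QC N p p_ge0 p_sum1 _ (ltW h2).
    by have := cn_le_add 1 (QC N p a); rewrite cn1; lra.
  have kX : k <= cn (1 - QC N p (A0 xi)).
    by apply: (lowk _ k2) => //; [rewrite ge_min lexx orbT|exact: G2 e0' x0' (ltW h)].
  have kY : k <= cn (1 - QC N p (BB es xi)).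
    by apply: (lowk _ k1) => //; [rewrite ge_min lexx|exact: G1 e0' x0' (ltW h)].
  have := quotient_far nu k _ _ (mW xi) (MB es xi) nu_gt0 k0 kX kY.
  by rewrite -(lapM xi e0') -/V -/K4 -/K5 => hV; left.
have hr1 : Re xi + Im xi <= r1 by apply: (le_trans h); rewrite !ge_min lexx orbT.
have hr2 : Re xi + Im xi <= r2 by apply: (le_trans h); rewrite !ge_min lexx !orbT.
have hlt1 : Re xi + Im xi < 1 by apply: (le_lt_trans h); rewrite gt_min invf_lt1// ltr1n.
have r0' : 0 < Re xi + Im xi by rewrite ltr_wpDr.
have hD := H1 xi e0' x0' hr1; have hs := H2 xi e0' x0' hr2; have hl := Hc xi e0' x0' (ltW hlt1).
have hMB := cn_MB N p p_ge0 p_sum1 th es th_gt esP xi e0' x0'.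
have hW := DW xi e0' x0'.
rewrite -/r in hD hl hMB hW hlt1 r0'.
have rth : 0 < r `^ th by rewrite powR_gt0.
have D0 : 0 < cn (DB es xi) by apply: lt_le_trans hl; rewrite mulr_gt0.
have hh : 2 * hrd w r <= nu / 2 * cn (DB es xi) by move: hD; lra.
have sm1 : q2 N p * cn (DB es xi) * (1 + 3 / 2 * nu) <= 2^-1.
  have a1 : q2 N p * cn (DB es xi) <= (q2 N p + 1) * dd.
    by apply: ler_pM => //; rewrite ?cn_ge0// lerDl.
  apply: (le_trans (ler_wpM2r (ltW n1) a1)); rewrite /dd le_eqVlt; apply/orP; left; apply/eqP.
  field; rewrite gt_eqF ?gt_eqF//=; first by rewrite ltr_wpDl.
  by move: n1; lra.
have sm0 : 0 <= q2 N p * cn (DB es xi) by rewrite mulr_ge0 ?cn_ge0.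
have sm2 : 0 <= q2 N p * cn (DB es xi) * (3 / 2 * nu).
  by apply: mulr_ge0 => //; rewrite mulr_ge0 ?(ltW nu_gt0).
have s1 : q2 N p * cn (DB es xi) <= 2^-1 by move: sm1 sm2; rewrite mulrDr mulr1; lra.
have s2 : q2 N p * (3 / 2 * nu * cn (DB es xi)) <= 2^-1.
  rewrite (_ : q2 N p * (3 / 2 * nu * cn (DB es xi)) = q2 N p * cn (DB es xi) * (3 / 2 * nu)); last by ring.
  by move: sm1 sm0; rewrite mulrDr mulr1; lra.
have lin1 := cn_QC_lin N p p_ge0 p_sum1 _ (ltW B1).
have lin2 := cn_QC_lin N p p_ge0 p_sum1 _ (ltW A1).
have th2 : 0 <= 2 * th by rewrite mulr_ge0// ltW.
have := quotient_near q (q2 N p) nu (2 * th) r (2 * hrd w r) (1 - QC N p (A0 xi)) (1 - QC N p (BB es xi)) (DB es xi) (1 - A0 xi) (mW xi) (MB es xi) nu_gt0 q1 q20 D0 r0' th2 hW hh lin1 lin2 s1 s2 hMB.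
rewrite -(lapM xi e0') -/V -/K3 => hV.
have hrd0 : 0 <= hrd w r by exact: hrd_ge0 _ _ w1 r0'.
have iD : (cn (DB es xi))^-1 <= (c0 * r `^ th)^-1 by rewrite lef_pV2// ?posrE ?mulr_gt0.
have v1 : 4 / nu * (cn (mW xi) / cn (DB es xi)) <= K1 * (cn (mW xi) * r `^ (- th)).
  have -> : K1 * (cn (mW xi) * r `^ (- th)) = 4 / nu * (cn (mW xi) * (c0 * r `^ th)^-1).
    by rewrite /K1 powRN; field; rewrite !gt_eqF.
  apply: ler_wpM2l; first by rewrite divr_ge0// ltW.
  by rewrite ler_wpM2l ?cn_ge0.
have v2 : 8 * q * (2 * th) / nu * (2 * hrd w r / (r * cn (DB es xi))) <= K2 * (hrd w r * (r^-1 * r `^ (- th))).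
  have -> : K2 * (hrd w r * (r^-1 * r `^ (- th))) = 8 * q * (2 * th) / nu * (2 * hrd w r / r * (c0 * r `^ th)^-1).
    by rewrite /K2 powRN; field; rewrite !gt_eqF.
  have -> : 2 * hrd w r / (r * cn (DB es xi)) = 2 * hrd w r / r * (cn (DB es xi))^-1 by field; rewrite !gt_eqF.
  apply: ler_wpM2l; first by rewrite divr_ge0 ?mulr_ge0 ?(ltW q0) ?(ltW nu_gt0) ?(ltW th_gt).
  by rewrite ler_wpM2l// divr_ge0 ?mulr_ge0// ltW.
right; split; first exact: hlt1.
by apply: (le_trans hV); rewrite lerD2r; apply: lerD.
Qed.

(** The squares of the terms of [data_cases] are exactly [kernF], [hrdF], [MB2] and the squared
    transform of [y w], all of finite integral; [cs5] squares the sum. *)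
Lemma data_bound : exists2 C : R, 0 < C & forall e k : R, 0 < e -> 0 <= k ->
  cn (M0 (e +i* k) / (1 - QC N p (A0 (e +i* k))) - MB es (e +i* k) / (1 - QC N p (BB es (e +i* k)))) ^+ 2 <=
    C * (kernF th w e k + hrdF th w (e + k) + MB2 es e k + cn (mW (e +i* k)) ^+ 2).
Proof.
have [K1 [K2 [K3 [K4 [K5 H]]]]] := data_cases.
have S x : 0 <= x ^+ 2 :> R := sqr_ge0 x.
exists (5 * (K1 ^+ 2 + K2 ^+ 2 + K3 ^+ 2 + K4 ^+ 2 + K5 ^+ 2) + 1).
  by rewrite ltr_wpDl// mulr_ge0// !addr_ge0.
move=> e k e0 k0; have := H (e +i* k) e0 k0; rewrite /=.
set V := cn (_ - _) => HV; have V0 : 0 <= V := cn_ge0 _.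
have T0 : 0 <= kernF th w e k by rewrite /kernF; case: ifP => // _; exact: mulr_ge0 (powR_ge0 _ _) (sqr_ge0 _).
have U0 : 0 <= hrdF th w (e + k) by exact: hrdF_ge0.
have Z0 : 0 <= MB2 es e k by exact: sqr_ge0.
have Y0 : 0 <= cn (mW (e +i* k)) ^+ 2 by exact: sqr_ge0.
have [h1 h2 h3 h4 h5] := sum4_ge _ _ _ _ T0 U0 Z0 Y0.
case: HV => [hV|[r1 hV]].
  apply: (cs5 _ _ _ _ _ 0 0 0 (cn (mW (e +i* k))) (cn (MB es (e +i* k))) _ _ V0); rewrite ?expr0n//=.
  by rewrite !mulr0 !add0r.
have r0 : 0 < e + k by rewrite ltr_wpDr.
have sP (a : R) : ((e + k) `^ a) ^+ 2 = (e + k) `^ (2 * a) by rewrite -powR_mulrn ?powR_ge0// -powRrM mulrC.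
have TE : (cn (mW (e +i* k)) * (e + k) `^ (- th)) ^+ 2 = kernF th w e k.
  by rewrite /kernF r1 exprMn sP mulrC mulrN.
have UE : (hrd w (e + k) * ((e + k)^-1 * (e + k) `^ (- th))) ^+ 2 = hrdF th w (e + k).
  rewrite /hrdF r0 !exprMn sP mulrC; congr (_ * _).
  rewrite exprVn -powR_mulrn ?(ltW r0)// -powRN -powRD; last by apply/implyP => _; rewrite gt_eqF.
  by congr (_ `^ _); ring.
apply: (cs5 _ _ _ _ _ (cn (mW (e +i* k)) * (e + k) `^ (- th)) (hrd w (e + k) * ((e + k)^-1 * (e + k) `^ (- th))) (cn (MB es (e +i* k))) 0 0 _ _ V0).
- by rewrite !mulr0 !addr0.
- by rewrite TE.
- by rewrite UE.
- exact: h3.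
- by rewrite expr0n.
- by rewrite expr0n.
- exact: h5.
Qed.

End Data.

(** * Decay of the difference *)

Section Final.
Context {R : realType}.
Local Notation mu := (@lebesgue_measure R).
Variables (N : nat) (p : nat -> R).
Hypotheses (p_ge0 : forall j, (1 <= j <= N)%N -> 0 <= p j)
  (p_sum1 : \sum_(1 <= j < N.+1) p j = 1).
Variables (al th : R) (es : R -> R).
Hypotheses (th_gt : 0 < th) (esP : is_profile N p th es).
Hypotheses (al_gt : 2^-1 < al) (al_lt : al < 1) (gm_lt : al + th < 3 / 2) (al_th : al < th + 1 / 2).
Variables (eta0 : R -> R) (nu : R).
Hypotheses (eta0P : is_density eta0) (nu_gt0 : 0 < nu).
Hypothesis w2 : L1 (fun y => y `^ (2 * (al + th)) * (ext0 eta0 y - nu * pf es y) ^+ 2).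
Variables (eta : R -> R -> R) (beta : R -> R).
Hypotheses (etaP : forall tau : R, 0 <= tau -> is_density (eta tau))
  (eta_cont : continuous_L1 eta) (beta_loc : loc_integrable_from 0 beta)
  (boch : forall tau : R, 0 <= tau -> is_bochner_integral 0 tau
     (fun s y => beta s * S_op (tau - s) (T1 (Qconv N p (eta s))) y) (eta tau \- S_op tau eta0))
  (bdry : forall tau0 : R, 0 <= tau0 ->
          {ae mu, forall tau : R, tau0 <= tau <= tau0 + ln 2 ->
            beta tau = expR (tau - tau0) * eta tau0 (expR (tau - tau0))}).
(* [eta 0] and [eta0] are equal in L^1, hence have the same transform. *)
Hypothesis eta_init : forall xi : R[i], 0 < Re xi ->
  AA eta 0 xi = A0 eta0 xi /\ lap (fun y => y * ext0 (eta 0) y) xi = M0 eta0 xi.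
Local Notation q := (qcst N p).
Local Notation uB := (uB N p th).
Local Notation uu := (uu beta).
Local Notation AA := (AA eta).
Let q1 : 1 <= q := q_ge1 N p p_ge0 p_sum1.
Let q0 : 0 < q := lt_le_trans ltr01 q1.
Let c := th / q.

Let v (t y : R) : R := uu t y - uB y.
Let VV (t : R) xi : R[i] := lap (fun y => y * v t y) xi.
Let MT (t : R) xi : R[i] := lap (fun y => y * ext0 (eta t) y) xi.
Let PB xi : R[i] := lap (fun y => y * uB y) xi.

Let uL t : 0 <= t -> LTall (uu t).
Proof. by move=> t0; exact: (uu_LTall eta beta etaP beta_loc bdry t t0). Qed.
Let uBL : LTall uB. Proof. by apply: uB_LTall. Qed.
Let u_lt1 t y : y < 1 -> uu t y = 0.
Proof. by move=> y1; rewrite /Submission.uu ltNge (ltW y1). Qed.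
Let uB_lt1' y : y < 1 -> uB y = 0.
Proof. by move=> y1; rewrite /Submission.uB ltNge (ltW y1). Qed.
Let u_causal t : causal (uu t).
Proof. by move=> y y0; apply: u_lt1; exact: lt_trans ltr01. Qed.
Let uB_caus : causal uB.
Proof. by move=> y y0; apply: uB_lt1'; exact: lt_trans ltr01. Qed.
Let v_lt1 t y : y < 1 -> v t y = 0.
Proof. by move=> y1; rewrite /v u_lt1// uB_lt1'// subr0. Qed.
Let v_causal t : causal (v t).
Proof. by move=> y y0; apply: v_lt1; exact: lt_trans ltr01. Qed.
Let vL t : 0 <= t -> LTall (v t).
Proof. by move=> t0 e e0; exact: LTB _ _ _ (uL t t0 e e0) (uBL e e0). Qed.
Let mv t : 0 <= t -> measurable_fun setT (v t).
Proof. by move=> t0; exact: LT_meas _ _ (vL t t0 1 ltr01). Qed.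

Let lapv t xi : 0 <= t -> 0 < Re xi -> lap (v t) xi = lap (uu t) xi - lap uB xi.
Proof. by move=> t0 e0; exact: lapB _ _ xi (uL t t0 _ e0) (uBL _ e0). Qed.

Let VVE t xi : 0 <= t -> 0 < Re xi -> VV t xi = lap (fun y => y * uu t y) xi - PB xi.
Proof.
move=> t0 e0; have h1 := LTall_id _ (u_causal t) (uL t t0) _ e0.
have h2 := LTall_id _ uB_caus uBL _ e0; rewrite /VV /PB -(lapB _ _ xi h1 h2).
by apply: eq_lap => y; rewrite /v mulrBr.
Qed.

Let A_lt1 t xi : 0 <= t -> 0 < Re xi -> cn (AA t xi) < 1.
Proof. by move=> t0 e0; exact: cn_ext0_lt1 (eta t) xi (etaP t t0) e0. Qed.

Let B_lt1 xi : 0 < Re xi -> cn (BB es xi) < 1.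
Proof. exact: (cn_BB1 N p th es esP xi). Qed.

Let solP t xi : 0 <= t -> 0 < Re xi -> Phi_lim N p (AA t xi) (lap (uu t) xi).
Proof. by move=> t0 e0; exact: (sol_Phi_lim N p p_ge0 p_sum1 eta0 eta beta eta0P etaP eta_cont beta_loc boch bdry t xi t0 e0). Qed.

Let profP xi : 0 < Re xi -> Phi_lim N p (BB es xi) (lap uB xi).
Proof. by move=> e0; exact: (prof_Phi_lim N p p_ge0 p_sum1 th es th_gt esP xi e0). Qed.

Let MTE t xi : 0 <= t -> 0 < Re xi -> MT t xi = (1 - QC N p (AA t xi)) * (VV t xi + PB xi).
Proof.
move=> t0 e0; rewrite (VVE t xi t0 e0) subrK; have [h1 _ _] := etaP t t0.
exact: (Phi_lim_radial N p p_ge0 p_sum1 (ext0 (eta t)) (uu t) xi (ext0_causal _) (ext0_LTall _ h1) (u_causal t) (uL t t0) e0 (fun z => A_lt1 t z t0) (fun z => solP t z t0)).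
Qed.

Let MBE xi : 0 < Re xi -> MB es xi = (1 - QC N p (BB es xi)) * PB xi.
Proof. by move=> e0; exact: (prof_relation N p p_ge0 p_sum1 th es th_gt esP xi e0). Qed.

Let w y := ext0 eta0 y - nu * pf es y.
Let w1 y : y < 1 -> w y = 0.
Proof. by move=> y1; rewrite /w /pf !ext0_lt1// mulr0 subr0. Qed.
Let mw : measurable_fun setT w.
Proof.
have [h1 _ _] := eta0P; have [[h2 _ _] _ _ _] := esP.
exact: L1_meas _ (L1B _ _ (L1_ext0 _ h1) (L1Z nu _ (L1_ext0 _ h2))).
Qed.
Let wLT : LTall w := w_LTall al th al_gt th_gt w mw w1 w2.

Let pw (y a : R) : 0 < y -> y `^ (2 * a - 2) * y ^+ 2 = y `^ (2 * a).
Proof.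
move=> y0; rewrite -powR_mulrn ?(ltW y0)// -powRD ?subrK//.
by apply/implyP => _; rewrite gt_eqF.
Qed.

Let F (t y : R) := y `^ (2 * al) * v t y ^+ 2.

Let FE t y : y `^ (2 * al - 2) * (y * v t y) ^+ 2 = F t y.
Proof.
rewrite /F; case: (ltP y 1) => y1; first by rewrite v_lt1// mulr0 expr0n/= !mulr0.
by rewrite exprMn mulrA pw// (lt_le_trans ltr01).
Qed.

Let NrmV t : 0 <= t -> Nrm al (fun y => y * v t y) = ((K0 * gam al)%:E * \int[mu]_y (F t y)%:E)%E.
Proof.
move=> t0; have h := LTall_id _ (v_causal t) (vL t t0).
have h1 y : y < 1 -> y * v t y = 0 by move=> y1; rewrite v_lt1// mulr0.
rewrite (NrmE al al_gt al_lt _ h h1); congr (_ * _)%E.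
by apply: eq_integral => y _; rewrite FE.
Qed.

Let Kg : 0 < K0 * gam al.
Proof. by rewrite mulr_gt0 ?arctan_mass_gt0// gam_gt0. Qed.

Let mF t : 0 <= t -> measurable_fun setT (F t).
Proof. by move=> t0; have m := mv t t0; rewrite /F; mfun. Qed.
Let F_ge0 t y : 0 <= F t y. Proof. by rewrite /F mulr_ge0 ?powR_ge0 ?sqr_ge0. Qed.

Let Nrm_w : (II al (fun e k => cn (lap (fun y => (y * w y)%R) (e +i* k)) ^+ 2)%R < +oo)%E.
Proof.
rewrite -NrmII; have wc := w_causal w w1; have h := LTall_id _ wc wLT.
have h1 y : y < 1 -> y * w y = 0 by move=> y1; rewrite w1// mulr0.
rewrite (NrmE al al_gt al_lt _ h h1); apply: lte_mul_pinfty => //; first by rewrite lee_fin ltW// Kg.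
have mw' := mw; have w2' : L1 (fun y => y `^ (2 * (al + th)) * w y ^+ 2) := w2.
apply: (le_lt_trans _ (L1_fin _ w2')).
apply: ge0_integral_le; [by mfun|by mfun|move=> y].
case: (ltP y 1) => y1; first by rewrite w1// mulr0 expr0n/= !mulr0 normr0 lexx.
have y0 : 0 < y := lt_le_trans ltr01 y1.
rewrite exprMn mulrA pw// (mulr_ge0 (powR_ge0 _ _) (sqr_ge0 _))/= ger0_norm; last exact: mulr_ge0 (powR_ge0 _ _) (sqr_ge0 _).
apply: ler_wpM2r; first exact: sqr_ge0.
by rewrite ler_powR//; have t0 := th_gt; lra.
Qed.

(** At time 0 the relations [MTE] and [MBE] express [VV 0] as the difference of quotients bounded in
    [data_bound]; Plancherel's formula turns the finite integral over frequencies into a weighted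
    norm of [v 0]. *)
Let F0_fin : L1 (F 0).
Proof.
have [C C0 HC] := data_bound N p p_ge0 p_sum1 al th es th_gt esP al_gt al_lt gm_lt eta0 nu eta0P nu_gt0 w2.
have m1 : meas2 (kernF th w) by exact: (meas2_kernF al th al_gt th_gt w mw w1 w2).
have m2 : meas2 (fun e k => hrdF th w (e + k)).
  have m : measurable_fun setT (fun z : R * R => z.1 + z.2) by mfun.
  exact: (measurable_comp_real _ _ _ _ (measurable_hrdF th w mw) m).
have m3 : meas2 (MB2 es) := meas2_MB N p th es esP.
have m4 : meas2 (fun e k => cn (lap (fun y => y * w y) (e +i* k)) ^+ 2).
  apply: measurable_cnlap; have mw' := mw; by mfun.
have n1 e k : 0 <= kernF th w e k.
  by rewrite /kernF; case: ifP => // _; exact: mulr_ge0 (powR_ge0 _ _) (sqr_ge0 _).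
have n2 e k : 0 <= hrdF th w (e + k) by exact: hrdF_ge0.
have n3 e k : 0 <= MB2 es e k by exact: sqr_ge0.
have n4 e k : 0 <= cn (lap (fun y => y * w y) (e +i* k)) ^+ 2 by exact: sqr_ge0.
have m12 : meas2 (fun e k => kernF th w e k + hrdF th w (e + k)) by rewrite /meas2 in m1 m2 *; mfun.
have m123 : meas2 (fun e k => kernF th w e k + hrdF th w (e + k) + MB2 es e k) by rewrite /meas2 in m12 m3 *; mfun.
have mS : meas2 (fun e k => kernF th w e k + hrdF th w (e + k) + MB2 es e k + cn (lap (fun y => y * w y) (e +i* k)) ^+ 2).
  by rewrite /meas2 in m123 m4 *; mfun.
have mv0 := mv 0 (lexx 0).
have mV : meas2 (fun e k => cn (lap (fun y => y * v 0 y) (e +i* k)) ^+ 2) by apply: measurable_cnlap; mfun.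
have i1 := II_kernF al th al_gt al_lt th_gt gm_lt w mw w1 w2.
have i2 := II_hrdF al th al_gt al_lt th_gt gm_lt w mw w1 w2.
have i3 := II_MB N p p_ge0 p_sum1 th es th_gt esP al al_gt al_lt al_th.
have fin : (II al (fun e k => C * (kernF th w e k + hrdF th w (e + k) + MB2 es e k + cn (lap (fun y => y * w y) (e +i* k)) ^+ 2)%R)%R < +oo)%E.
  rewrite (II_Z al C _ (ltW C0) mS); last by move=> e k _ _; rewrite !addr_ge0.
  rewrite (II_D al _ _ m123 m4) => [|e k _ _|e k _ _]; [|by rewrite !addr_ge0|exact: n4].
  rewrite (II_D al _ _ m12 m3) => [|e k _ _|e k _ _]; [|by rewrite addr_ge0|exact: n3].
  rewrite (II_D al _ _ m1 m2) => [|e k _ _|e k _ _]; [|exact: n1|exact: n2].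
  apply: lte_mul_pinfty => //; first by rewrite lee_fin ltW.
  by apply: lte_add_pinfty; [apply: lte_add_pinfty; [apply: lte_add_pinfty; [exact: i1|exact: i2]|exact: i3]|exact: Nrm_w].
have H : (Nrm al (fun y => (y * v 0 y)%R) < +oo)%E.
  rewrite NrmII; apply: le_lt_trans fin; apply: II_le => //.
    by rewrite /meas2 in mS *; mfun.
  move=> e k e0 k0; rewrite sqr_ge0/=; apply: le_trans (HC e k e0 k0); set xi := e +i* k.
  have e0' : 0 < Re xi by [].
  have [E1 E2] := eta_init xi e0'.
  have h1 := MTE 0 xi (lexx 0) e0'; rewrite /MT E2 E1 in h1.
  have X0 := QC_neq1 N p p_ge0 p_sum1 _ (A_lt1 0 xi (lexx 0) e0'); rewrite E1 in X0.
  have Y0 := QC_neq1 N p p_ge0 p_sum1 _ (B_lt1 xi e0').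
  have SB (X Y a b m n : R[i]) : X != 0 -> Y != 0 -> m = X * (a + b) -> n = Y * b -> a = m / X - n / Y.
    by move=> X1 Y1 -> ->; field; rewrite X1 Y1.
  by rewrite -(SB _ _ _ _ _ _ X0 Y0 h1 (MBE xi e0')).
rewrite (NrmV 0 (lexx 0)) in H.
apply: (ae0_le_L1 _ (mF 0 (lexx 0)) (F_ge0 0)).
rewrite ltNge leye_eq; apply/negP => /eqP E; move: H; rewrite E.
by rewrite mulry gtr0_sg ?Kg// mul1e ltxx.
Qed.

Let n0 : R := \int[mu]_y F 0 y.
Let n0_ge0 : 0 <= n0. Proof. by apply: Itg_ge0 => y; exact: F_ge0. Qed.

(** For [y > 1] one has [v t y = e^t v 0 (e^t y)], so [F t y] is [e^((2 - 2 al) t)] times [F 0] at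
    [e^t y]. The change of variables contributes [e^(- t)], and only the part of [F 0] beyond [e^t]
    is seen. *)
Let F_scale t : 0 <= t -> L1 (F t) /\ \int[mu]_y F t y <= expR (- (2 * al - 1) * t) * n0.
Proof.
move=> t0; have [h1 h2] := L1_affine (expR t) 0 (F 0) (expR_gt0 t) F0_fin.
have b y : F t y <= expR ((2 - 2 * al) * t) * F 0 (expR t * y + 0).
  rewrite addr0; have [y1|y1] := leP y 1.
    rewrite {1}/F (_ : v t y = 0); last first.
      by rewrite /v /Submission.uu /Submission.uB ltNge y1/= subr0.
    by rewrite expr0n/= mulr0 mulr_ge0 ?expR_ge0.
  have y0 : 0 < y := lt_trans ltr01 y1.
  have ety : 1 < expR t * y.
    by rewrite (lt_le_trans y1)// ler_peMl ?(ltW y0)// -expR0 ler_expR.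
  rewrite /F /v /Submission.uu /Submission.uB y1 ety lnM ?posrE ?expR_gt0// expRK add0r.
  rewrite powRM ?expR_ge0 ?(ltW y0)// -expRM.
  rewrite -!mulrBl le_eqVlt; apply/orP; left; apply/eqP.
  have -> : expR ((2 - 2 * al) * t) = expR t ^+ 2 * expR (- (t * (2 * al))).
    by rewrite -expRM_natl -expRD; congr expR; ring.
  rewrite invfM !exprMn expRN exprVn; move: (bt _ _ - _) => z.
  by field; rewrite !gt_eqF ?expR_gt0.
have LB := L1Z (expR ((2 - 2 * al) * t)) _ h1.
have b0 y : `|F t y| <= expR ((2 - 2 * al) * t) * F 0 (expR t * y + 0) by rewrite ger0_norm.
have LF := L1_le _ _ (mF t t0) b0 LB; split; first exact: LF.
apply: (le_trans (Itg_le _ _ LF LB b)); rewrite (ItgZ _ _ h1) h2 -/n0 mulrA -expRN -expRD.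
by rewrite (_ : (2 - 2 * al) * t + - t = - (2 * al - 1) * t)//; ring.
Qed.

Let kap := al - 1 / 2.
Let kap0 : 0 < kap. Proof. by rewrite /kap; have h := al_gt; lra. Qed.

(** The transform is bounded by the L^1 norm, itself bounded by the weighted norm through
    Cauchy-Schwarz because [2 al > 1]; this is uniform in the frequency. *)
Let v_small : exists2 K : R, 0 <= K & forall t xi, 0 <= t -> 0 < Re xi ->
  cn (lap (uu t) xi - lap uB xi) <= K * expR (- kap * t).
Proof.
pose J : R := \int[mu]_y (if 1 <= y then y `^ (2 * 0 - 2 * al) else 0).
have J0 : 0 <= J by apply: Itg_ge0 => y; case: ifP => // _; exact: powR_ge0.
exists (Num.sqrt (J * n0)); first exact: sqrtr_ge0.
move=> t xi t0 e0; rewrite -(lapv t xi t0 e0).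
have [LF hF] := F_scale t t0.
have sg : 2 * 0 - 2 * al < -1 by have h := al_gt; lra.
have [h1 h2] := L1_wpow (v t) al 0 (mv t t0) (v_lt1 t) LF sg; rewrite -/J in h2.
have h1' : L1 (fun y => `|v t y|) by apply: (eq_L1 _ _ _ h1) => y; rewrite powRr0 mul1r.
have E : \int[mu]_y (y `^ 0 * `|v t y|) = \int[mu]_y `|v t y|.
  by apply: eq_Itg => y; rewrite powRr0 mul1r.
rewrite E in h2.
have vn y : y < 0 -> `|v t y| = 0 by move=> y0; rewrite v_causal// normr0.
have LN := L1_LT _ _ (ltW e0) vn h1'.
have h3 : cn (lap (v t) xi) <= \int[mu]_y `|v t y|.
  apply: (le_trans (cn_lap _ _ xi LN (mv t t0) (fun y => lexx _))).
  apply: (Itg_le _ _ LN h1') => y; have [y0|y0] := ltP y 0; first by rewrite vn// mulr0.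
  by rewrite ler_piMl// mulNr expRN_le1// mulr_ge0// ltW.
apply: (le_trans h3); rewrite -ler_sqr ?nnegrE; last 2 first.
- by apply: Itg_ge0.
- by rewrite mulr_ge0 ?sqrtr_ge0 ?expR_ge0.
apply: (le_trans h2); rewrite exprMn sqr_sqrtr ?mulr_ge0// -expRM_natl.
rewrite (_ : 2 * (- kap * t) = - (2 * al - 1) * t); last by rewrite /kap; field.
rewrite -mulrA; apply: ler_wpM2l; first exact: J0.
by rewrite [leRHS]mulrC; exact: hF.
Qed.

Let cn_dist (a b : R[i]) : `|cn a - cn b| <= cn (a - b).
Proof.
have h1 := cn_le_add a b; have h2 := cn_le_add b a; rewrite (cnBC b a) in h2.
by rewrite ler_norml; apply/andP; split; lra.
Qed.

Let AA_time_cont xi (s : R) : 0 < Re xi ->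
  (fun t => cn (AA (Num.max t 0) xi - AA (Num.max s 0) xi)) @ s --> (0 : R).
Proof.
move=> e0; set m := Num.max s 0; have m0 : 0 <= m by rewrite le_max lexx orbT.
have cm : (fun t : R => Num.max t 0) @ s --> m.
  by apply: (@continuous_max _ _ id (cst 0) s); [exact: cvg_id|exact: cvg_cst].
have C1 : (fun t => fine (L1norm (eta (Num.max t 0) \- eta m))) @ s --> (0 : R).
  apply: fine_cvg; have [_ /(_ m m0) h] := eta_cont.
  apply: (cvg_comp (fun t : R => Num.max t 0) (fun t => L1norm (eta t \- eta m)) _ h).
  move=> A /= hA; have hA' := cm _ hA; apply: (@filterS R (nbhs s) _ _ _ _ hA') => t /= ht.
  by apply: ht; rewrite in_itv/= andbT le_max lexx orbT.
apply: (squeeze_cvgr _ (cvg_cst 0) C1); apply: nearW => t; rewrite cn_ge0/=.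
have M0 : 0 <= Num.max t 0 by rewrite le_max lexx orbT.
exact: AA_diff etaP _ _ _ M0 m0 (ltW e0).
Qed.

(* The ratio [|A - B| / |1 - Q(B)|] is small as [t -> oo], and by [Phi_lim_close]
   it can never cross the value [1 / (4 q)] backwards in time. *)
Let close_large : exists2 T0 : R, 0 <= T0 & forall t xi, T0 <= t -> 0 < Re xi ->
  4 * q * cn (AA t xi - BB es xi) <= cn (1 - QC N p (BB es xi)).
Proof.
have [K K00 HK] := v_small; have k0 := kap0; have Q0 := q0.
have expS (d t : R) : 0 < d -> K / (kap * d) <= t -> K * expR (- kap * t) <= d.
  move=> d0; rewrite ler_pdivrMr ?mulr_gt0// => h.
  rewrite mulNr expRN ler_pdivrMr ?expR_gt0//; apply: (le_trans h).
  rewrite (_ : t * (kap * d) = d * (kap * t)); last by ring.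
  apply: ler_wpM2l; first exact: ltW.
  by apply: le_trans (expR_ge1Dx _); rewrite lerDr.
(* Chosen so that [3/2 dl m] is half of the critical value [vv = m / (4 q)]. *)
pose dl := (12 * q)^-1; have dl0 : 0 < dl by rewrite invr_gt0 mulr_gt0.
have T00 : 0 <= K / (kap * dl) by rewrite divr_ge0// mulr_ge0// ltW.
exists (K / (kap * dl)) => // t xi tT e0.
have t0 := le_trans T00 tT.
have Y0 := QC_neq1 N p p_ge0 p_sum1 _ (B_lt1 xi e0).
set m := cn (1 - QC N p (BB es xi)); have m0 : 0 < m by rewrite /m cn_gt0.
rewrite leNgt; apply/negP => H.
pose phi s := cn (AA (Num.max s 0) xi - BB es xi).
have cphi : continuous phi.
  move=> s; apply/subr_cvg0; apply: norm_cvg0.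
  apply: (squeeze_cvgr _ (cvg_cst 0) (AA_time_cont xi s e0)); apply: nearW => z.
  rewrite normr_ge0/=; apply: (le_trans (cn_dist _ _)).
  by rewrite (_ : _ - _ - _ = AA (Num.max z 0) xi - AA (Num.max s 0) xi)//; ring.
have phiE s : 0 <= s -> phi s = cn (AA s xi - BB es xi) by move=> s0; rewrite /phi max_l.
pose d2 := m / (16 * q); have d20 : 0 < d2 by rewrite divr_gt0 ?mulr_gt0.
(* This time depends on [xi] through [m], unlike the threshold of the lemma; it only provides an
   endpoint where [Phi_lim_le2] puts [phi] below [vv], as the intermediate value theorem
   requires. *)
pose T := Num.max t (K / (kap * d2)).
have tT' : t <= T by rewrite le_max lexx.
have T0' := le_trans t0 tT'.
pose vv := m / (4 * q).
have hT : phi T <= vv.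
  rewrite (phiE T T0').
  have h1 := Phi_lim_le2 N p p_ge0 p_sum1 _ _ _ _ (A_lt1 T xi T0' e0) (B_lt1 xi e0) (solP T xi T0' e0) (profP xi e0).
  have h2 := HK T xi T0' e0.
  have h3 : K * expR (- kap * T) <= d2 by apply: expS => //; rewrite le_max lexx orbT.
  have h4 : 2 * d2 <= vv.
    rewrite (_ : vv = 2 * (2 * d2)); last by rewrite /vv /d2; field; rewrite gt_eqF.
    by rewrite ler_peMl ?ler1n// mulr_ge0// ltW.
  by move: h1 h2 h3 h4; lra.
have ht : vv < phi t.
  by rewrite (phiE t t0) /vv ltr_pdivrMr ?mulr_gt0// mulrC.
have IV := @IVT R phi t T vv tT' (continuous_subspaceT cphi).
have [|s sI sE] := IV.
  by rewrite ge_min hT orbT/= le_max (ltW ht).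
have ts : t <= s by move: sI; rewrite in_itv/= => /andP[].
have s0 := le_trans t0 ts.
rewrite (phiE s s0) in sE.
have hyp : 4 * q * cn (AA s xi - BB es xi) <= m.
  by rewrite sE /vv mulrC divfK// mulf_neq0 ?gt_eqF.
have h1 := Phi_lim_close N p p_ge0 p_sum1 _ _ _ _ (A_lt1 s xi s0 e0) (B_lt1 xi e0) (solP s xi s0 e0) (profP xi e0) hyp.
have h2 := HK s xi s0 e0.
have h3 := expS dl s dl0 (le_trans tT ts).
rewrite sE -/m in h1.
have h4 : 3 / 2 * cn (lap (uu s) xi - lap uB xi) * m <= 3 / 2 * dl * m.
  apply: ler_wpM2r; first exact: ltW.
  by apply: ler_wpM2l; [rewrite divr_ge0|exact: le_trans h2 h3].
have h5 : vv <= 2^-1 * vv.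
  have -> : 2^-1 * vv = 3 / 2 * dl * m by rewrite /vv /dl; field; rewrite gt_eqF.
  exact: le_trans h1 h4.
have vv0 : 0 < vv by rewrite divr_gt0 ?mulr_gt0.
by move: h5 vv0; lra.
Qed.

(** For [t >= T0] this is [Phi_lim_close] with [v_small]. On the bounded range it suffices to
    dominate both [1 - A] and [1 - B] by [1 - Q(B)], the exponential being compensated by the
    constant [e^(kap T0)]. *)
Let close_all : exists2 K : R, 0 <= K & forall t xi, 0 <= t -> 0 < Re xi -> 0 <= Im xi ->
  cn (AA t xi - BB es xi) <= K * expR (- kap * t) * cn (1 - QC N p (BB es xi)).
Proof.
have [K K00 HK] := v_small; have [T0 T00 HT] := close_large; have k0 := kap0.
have [Cg Cg0 HCg] := sol_growth N p p_ge0 p_sum1 eta0 eta beta eta0P etaP eta_cont beta_loc boch bdry T0 T00.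
have [Cd Cd0 HCd] := data_compare N p p_ge0 p_sum1 al th es th_gt esP al_gt al_lt gm_lt eta0 nu eta0P nu_gt0 w2.
have [k kk0 Hk] := cn_1Q_lower N p p_ge0 p_sum1 th es esP.
(* [Cg] is the growth from time 0, at frequency [z = e^(- t) xi]; [Cd] compares data and profile
   there; [e^(th T0)] is the cost in [harnack] of returning from [z] to [xi]. The [1] stands for
   [|1 - B|] in the triangle inequality, and [k] passes from [1 - B] to [1 - Q(B)]. *)
pose C2 := (Cg * (Cd * expR (th * T0)) + 1) / k.
have C20 : 0 <= C2 by rewrite divr_ge0 ?(ltW kk0)// addr_ge0// !mulr_ge0 ?expR_ge0// ltW.
exists (3 / 2 * K + C2 * expR (kap * T0)).
  apply: addr_ge0; last exact: mulr_ge0 C20 (expR_ge0 _).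
  by apply: mulr_ge0; [rewrite divr_ge0|exact: K00].
move=> t xi t0 e0 i0; set m := cn (1 - QC N p (BB es xi)).
have m0 : 0 <= m := cn_ge0 _.
rewrite -mulrA mulrDl.
have p1 : 0 <= C2 * expR (kap * T0) * (expR (- kap * t) * m).
  exact: mulr_ge0 (mulr_ge0 C20 (expR_ge0 _)) (mulr_ge0 (expR_ge0 _) m0).
have h32 : 0 <= 3 / 2 :> R by rewrite divr_ge0.
have p2 : 0 <= 3 / 2 * K * (expR (- kap * t) * m).
  exact: mulr_ge0 (mulr_ge0 h32 K00) (mulr_ge0 (expR_ge0 _) m0).
case: (leP T0 t) => h.
  have h1 := Phi_lim_close N p p_ge0 p_sum1 _ _ _ _ (A_lt1 t xi t0 e0) (B_lt1 xi e0) (solP t xi t0 e0) (profP xi e0) (HT t xi h e0).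
  have h2 := HK t xi t0 e0.
  have h3 : 3 / 2 * cn (lap (uu t) xi - lap uB xi) * m <= 3 / 2 * K * (expR (- kap * t) * m).
    rewrite (_ : 3 / 2 * K * (expR (- kap * t) * m) = 3 / 2 * (K * expR (- kap * t)) * m); last by ring.
    by apply: ler_wpM2r; [exact: m0|apply: ler_wpM2l; [exact: h32|exact: h2]].
  rewrite -/m in h1; apply: (le_trans h1); apply: (le_trans h3).
  by rewrite lerDl.
pose r := expR (- t); have r0 : 0 < r := expR_gt0 _.
pose z := r%:C * xi.
have zE : (expR t)%:C * z = xi by rewrite /z mulrA -rmorphM -expRD addrN expR0 rmorph1 mul1r.
have ez : 0 < Re z by rewrite /z ReZ mulr_gt0.
have iz : 0 <= Im z by rewrite /z ImZ mulr_ge0// ltW.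
have tT0 : 0 <= t <= T0 by rewrite t0 ltW.
have h1 := HCg z t ez tT0; rewrite zE (eta_init z ez).1 in h1.
have h2 := HCd z ez iz.
have D0 := cn_ge0 (DB es xi).
have h3 : cn (DB es z) <= expR (th * T0) * cn (DB es xi).
  have e1 : 1 <= expR (th * T0) by rewrite -expR0 ler_expR; exact: mulr_ge0 (ltW th_gt) T00.
  move: (t0); rewrite le_eqVlt => /predU1P[t0'|t0'].
    by rewrite /z /r -t0' oppr0 expR0 rmorph1 mul1r ler_peMl.
  have r1 : r < 1 by rewrite /r -expR0 ltr_expR oppr_lt0.
  have [_ hh] := harnack N p p_ge0 p_sum1 th es th_gt esP xi r e0 r0 r1.
  rewrite -/z in hh.
  have rE : r `^ (2 * th) = expR (- (th * t)) ^+ 2.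
    by rewrite /r -expRM -expRM_natl; congr expR; ring.
  have x0 : 0 <= cn (DB es z) * expR (- (th * t)) := mulr_ge0 (cn_ge0 _) (expR_ge0 _).
  rewrite rE -exprMn ler_sqr ?nnegrE// in hh.
  rewrite expRN ler_pdivrMr ?expR_gt0// in hh.
  apply: (le_trans hh); rewrite mulrC; apply: ler_wpM2r; first exact: D0.
  by rewrite ler_expR; apply: ler_wpM2l; [exact: ltW th_gt|exact: ltW h].
have h4 := Hk xi e0 i0; rewrite -/m in h4.
pose C3 := Cg * (Cd * expR (th * T0)).
have C30 : 0 <= C3 := mulr_ge0 (ltW Cg0) (mulr_ge0 (ltW Cd0) (expR_ge0 _)).
have h5 : cn (1 - AA t xi) <= C3 * cn (DB es xi).
  apply: (le_trans h1); rewrite /C3 -mulrA; apply: ler_wpM2l; first exact: ltW.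
  apply: (le_trans h2); rewrite -mulrA; apply: ler_wpM2l; first exact: ltW.
  exact: h3.
have h6 : cn (AA t xi - BB es xi) <= cn (DB es xi) + cn (1 - AA t xi).
  by rewrite (_ : AA t xi - BB es xi = DB es xi - (1 - AA t xi)) ?cnB//; rewrite /DB; ring.
have h7 : cn (AA t xi - BB es xi) <= C2 * m.
  rewrite /C2 -/C3 mulrAC ler_pdivlMr//.
  have X0 : 0 <= C3 + 1 := addr_ge0 C30 ler01.
  apply: (le_trans (y := (C3 + 1) * (k * cn (DB es xi)))); last by apply: ler_wpM2l; [exact: X0|exact: h4].
  rewrite (mulrC k) mulrA; apply: ler_wpM2r; first exact: ltW.
  by apply: (le_trans h6); rewrite mulrDl mul1r [leRHS]addrC lerD2l.
have h8 : C2 * m <= C2 * expR (kap * T0) * (expR (- kap * t) * m).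
  rewrite (_ : C2 * expR (kap * T0) * (expR (- kap * t) * m) = expR (kap * T0) * expR (- kap * t) * (C2 * m)); last by ring.
  rewrite ler_peMl//; first exact: mulr_ge0 C20 m0.
  rewrite -expRD -expR0 ler_expR mulNr -mulrBr; apply: mulr_ge0; first exact: ltW k0.
  by rewrite subr_ge0 ltW.
by apply: (le_trans h7); apply: (le_trans h8); rewrite lerDr.
Qed.

(** In the second term of the splitting, [|Q(B) - Q(A)|] is at most [q K e^(- kap t) |1 - Q(B)|],
    and [|1 - Q(B)| |PB|] is just [|MB|], whose integral is finite by [II_MB]. Closeness relative to
    [|1 - Q(B)|] is thus exactly what is needed, since [PB] alone is not controlled. *)
Lemma transform_decay : exists2 C : R, 0 <= C & forall t, 0 <= t ->
  (\int[mu]_y (y `^ (2 * al) * (ext0 (eta t) y - pf es y) ^+ 2)%:E <= (C * expR (- (2 * al - 1) * t))%:E)%E.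
Proof.
have [K K00 HK] := close_all; have Q0 := q0; have Kg0 := Kg.
have i3 := II_MB N p p_ge0 p_sum1 th es th_gt esP al al_gt al_lt al_th.
have m3 : meas2 (MB2 es) := meas2_MB N p th es esP.
have n3 e k : 0 <= MB2 es e k by exact: sqr_ge0.
have II0 : (0 <= II al (MB2 es))%E by apply: II_ge0 => e k _ _; exact: n3.
pose J := fine (II al (MB2 es)).
have JE : II al (MB2 es) = J%:E by rewrite /J fineK// ge0_fin_numE.
have J0 : 0 <= J by rewrite /J fine_ge0.
pose C := (8 * (K0 * gam al) * n0 + 2 * (q * K) ^+ 2 * J) / (K0 * gam al).
exists C.
  by rewrite divr_ge0 ?(ltW Kg0)// addr_ge0// mulr_ge0 ?n0_ge0 ?sqr_ge0// mulr_ge0 ?(ltW Kg0) ?sqr_ge0.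
move=> t t0; have [hd _ _] := etaP t t0; have [[hs _ _] _ _ _] := esP.
set E := expR (- (2 * al - 1) * t).
have EE : expR (- kap * t) ^+ 2 = E.
  by rewrite -expRM_natl /E; congr expR; rewrite /kap; field.
pose g y := ext0 (eta t) y - pf es y.
have g1 y : y < 1 -> g y = 0 by move=> y1; rewrite /g /pf !ext0_lt1// subrr.
have gL : LTall g by move=> e e0; exact: LTB _ _ _ (ext0_LTall _ hd _ e0) (ext0_LTall _ hs _ e0).
have gc : causal g by move=> y y0; apply: g1; exact: lt_trans ltr01.
have ygL := LTall_id _ gc gL.
have yg1 y : y < 1 -> y * g y = 0 by move=> y1; rewrite g1// mulr0.
have mg := LT_meas _ _ (gL 1 ltr01).
have lapg xi : 0 < Re xi -> lap (fun y => y * g y) xi = MT t xi - MB es xi.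
  move=> e0; have h1 := LTall_id _ (ext0_causal (eta t)) (ext0_LTall _ hd) _ e0.
  have h2 := LTall_id _ (ext0_causal es) (ext0_LTall _ hs) _ e0.
  by rewrite /MT /MB -(lapB _ _ xi h1 h2); apply: eq_lap => y; rewrite /g mulrBr.
have bd e k : 0 < e -> 0 <= k -> cn (lap (fun y => y * g y) (e +i* k)) ^+ 2 <=
    8 * cn (VV t (e +i* k)) ^+ 2 + 2 * (q * K) ^+ 2 * E * MB2 es e k.
  move=> e0 k0; set xi := e +i* k; have e0' : 0 < Re xi by []. have k0' : 0 <= Im xi by [].
  rewrite (lapg xi e0') (MTE t xi t0 e0') (MBE xi e0').
  have A1 := A_lt1 t xi t0 e0'; have B1 := B_lt1 xi e0'.
  have -> : (1 - QC N p (AA t xi)) * (VV t xi + PB xi) - (1 - QC N p (BB es xi)) * PB xi =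
     (1 - QC N p (AA t xi)) * VV t xi + (QC N p (BB es xi) - QC N p (AA t xi)) * PB xi by ring.
  have a1 : cn ((1 - QC N p (AA t xi)) * VV t xi) <= 2 * cn (VV t xi).
    rewrite cnM; apply: ler_wpM2r; first exact: cn_ge0.
    apply: (le_trans (cnB _ _)); rewrite cn1 -[2]/(1 + 1) lerD2l.
    exact: le_trans (cn_QC N p p_ge0 p_sum1 _ (ltW A1)) (ltW A1).
  have a2 : cn ((QC N p (BB es xi) - QC N p (AA t xi)) * PB xi) <= q * K * expR (- kap * t) * cn (MB es xi).
    have b1 := cn_QCB N p p_ge0 _ _ (ltW B1) (ltW A1); rewrite (cnBC (BB es xi)) in b1.
    have b2 := HK t xi t0 e0' k0'.
    have cMB := f_equal (@cn R) (MBE xi e0'); rewrite cnM in cMB; rewrite cMB cnM.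
    rewrite (_ : q * K * expR (- kap * t) * (cn (1 - QC N p (BB es xi)) * cn (PB xi)) =
      q * (K * expR (- kap * t) * cn (1 - QC N p (BB es xi))) * cn (PB xi)); last by ring.
    apply: ler_wpM2r; first exact: cn_ge0.
    by apply: (le_trans b1); apply: ler_wpM2l; [exact: ltW Q0|exact: b2].
  have -> : 2 * (q * K) ^+ 2 * E * MB2 es e k = 2 * (q * K * expR (- kap * t) * cn (MB es xi)) ^+ 2.
    by rewrite -EE /MB2 -/xi; ring.
  have a3 := cnD ((1 - QC N p (AA t xi)) * VV t xi) ((QC N p (BB es xi) - QC N p (AA t xi)) * PB xi).
  have x0 := cn_ge0 (VV t xi).
  have y0 : 0 <= q * K * expR (- kap * t) * cn (MB es xi).
    by rewrite !mulr_ge0 ?cn_ge0 ?expR_ge0// ltW.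
  move: a1 a2 a3 x0 y0; set s1 := cn (_ + _); set x := cn (VV t xi); set y := _ * cn (MB es xi).
  move: (cn (_ * VV t xi)) (cn (_ * PB xi)) => s2 s3 a1 a2 a3 x0 y0.
  have h1 : s1 <= 2 * x + y by lra.
  have h2 : s1 ^+ 2 <= (2 * x + y) ^+ 2.
    by rewrite lerXn2r// ?nnegrE ?cn_ge0// addr_ge0// mulr_ge0.
  apply: (le_trans h2); rewrite -subr_ge0.
  rewrite (_ : _ - _ = (2 * x - y) ^+ 2); last by ring.
  exact: sqr_ge0.
have mVt := mv t t0.
have mV : meas2 (fun e k => cn (VV t (e +i* k)) ^+ 2) by apply: measurable_cnlap; mfun.
have nV e k : 0 <= cn (VV t (e +i* k)) ^+ 2 by exact: sqr_ge0.
have mL : meas2 (fun e k => cn (lap (fun y => y * g y) (e +i* k)) ^+ 2) by apply: measurable_cnlap; mfun.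
have E0 : 0 <= E := expR_ge0 _.
have c0' : 0 <= 2 * (q * K) ^+ 2 * E by rewrite mulr_ge0// mulr_ge0// sqr_ge0.
have m8V : meas2 (fun e k => 8 * cn (VV t (e +i* k)) ^+ 2) by rewrite /meas2 in mV *; mfun.
have mcM : meas2 (fun e k => 2 * (q * K) ^+ 2 * E * MB2 es e k) by rewrite /meas2 in m3 *; mfun.
have mS : meas2 (fun e k => 8 * cn (VV t (e +i* k)) ^+ 2 + 2 * (q * K) ^+ 2 * E * MB2 es e k).
  by rewrite /meas2 in m8V mcM *; mfun.
have H : (Nrm al (fun y => (y * g y)%R) <= (8 * (K0 * gam al) * n0 * E + 2 * (q * K) ^+ 2 * E * J)%:E)%E.
  rewrite NrmII; apply: (le_trans (II_le al _ _ mL mS _)) => [e k e0 k0|].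
    by rewrite sqr_ge0/= bd.
  rewrite (II_D al _ _ m8V mcM) => [|e k _ _|e k _ _]; last 2 first.
  - by rewrite mulr_ge0.
  - by rewrite mulr_ge0.
  rewrite (II_Z al 8 _ _ mV) => [|//|e k _ _]; last exact: nV.
  rewrite (II_Z al _ _ c0' m3) => [|e k _ _]; last exact: n3.
  have JE' : II al (fun e k => MB2 es e k) = J%:E := JE.
  rewrite JE' (EFinD (8 * (K0 * gam al) * n0 * E)); apply: leeD; last by rewrite -EFinM.
  have := NrmV t t0; rewrite NrmII => ->.
  have [LF hF] := F_scale t t0; rewrite -(EFin_Itg _ LF) -!EFinM lee_fin.
  rewrite (_ : 8 * (K0 * gam al) * n0 * E = 8 * ((K0 * gam al) * (E * n0))); last by ring.
  by apply: ler_wpM2l => //; apply: ler_wpM2l; [exact: ltW Kg0|exact: hF].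
have XZ (y z : R) : 0 < y -> y `^ (2 * al - 2) * (y * z) ^+ 2 = y `^ (2 * al) * z ^+ 2.
  by move=> y0; rewrite exprMn mulrA pw.
rewrite (NrmE al al_gt al_lt _ ygL yg1) in H.
have -> : (\int[mu]_y (y `^ (2 * al) * (ext0 (eta t) y - pf es y) ^+ 2)%:E =
    \int[mu]_y (y `^ (2 * al - 2) * (y * g y) ^+ 2)%:E)%E.
  apply: eq_integral => y _; congr EFin; rewrite -/(g y); case: (ltP y 1) => y1.
    by rewrite g1// mulr0 expr0n/= !mulr0.
  exact: esym (XZ y (g y) (lt_le_trans ltr01 y1)).
have CE : (C * E)%:E = ((K0 * gam al)^-1%:E * (8 * (K0 * gam al) * n0 * E + 2 * (q * K) ^+ 2 * E * J)%:E)%E.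
  have XC (gg n cc j ee : R) : gg != 0 -> (8 * gg * n + cc * j) / gg * ee = gg^-1 * (8 * gg * n * ee + cc * ee * j).
    by move=> gg0; field.
  by rewrite -EFinM; congr EFin; apply: XC; rewrite gt_eqF.
by rewrite CE lee_pdivlMl.
Qed.

End Final.

(** * Initial value and passage to the stated norms *)

Section Endpoints.
Context {R : realType}.
Local Notation mu := (@lebesgue_measure R).

(** Simple integrals over the null interval [[0, 0]] vanish, so the Bochner integral at time 0 has
    zero norm and [eta 0] agrees with [eta0] almost everywhere. *)
Lemma initial_value (N : nat) (p : nat -> R) (eta0 : R -> R) (eta : R -> R -> R) (beta : R -> R) :
  is_density eta0 -> is_density (eta 0) ->
  is_bochner_integral 0 0 (fun s y => beta s * S_op (0 - s) (T1 (Qconv N p (eta s))) y) (eta 0 \- S_op 0 eta0) ->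
  {ae mu, forall y, ext0 (eta 0) y = ext0 eta0 y}.
Proof.
move=> [i0 _ _] [i1 _ _] [_ hI [g [_ _ g3]]].
pose I := eta 0 \- S_op 0 eta0.
have sI n : simple_integral 0 0 (g n) = fun=> 0.
  apply: funext => y; rewrite /simple_integral big1// => i _.
  have m1 : measurable (`[0, 0]%classic `&` @piece R (g n) i : set R).
    by apply: measurableI; [exact: measurable_itv|exact: measurable_piece].
  have sub : `[0, 0]%classic `&` @piece R (g n) i `<=` [set 0 : R].
    by move=> x [/=]; rewrite in_itv/= => /andP[h1 h2] _; apply/eqP; rewrite eq_le h1 h2.
  have mz : mu [set (0 : R)] = 0%E := lebesgue_measure_set1 0.
  have -> : mu (`[0, 0]%classic `&` @piece R (g n) i) = 0%E.
    by apply/eqP; rewrite -measure_le0 -mz; apply: le_measure; rewrite ?inE//; exact: measurable_set1.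
  by rewrite mul0r.
have E0 : L1norm I = 0%E.
  have C : (fun n => L1norm (I \- simple_integral 0 0 (g n))) @ \oo --> L1norm I.
    rewrite (_ : (fun n => _) = fun=> L1norm I); first exact: cvg_cst.
    apply: funext => n; rewrite sI; congr L1norm; apply: funext => y /=; exact: subr0.
  exact: (cvg_unique (@ereal_hausdorff R) C g3).
rewrite (L1normE _ hI) in E0; have L := L1_ext0 _ hI.
have m : measurable_fun setT (EFin \o ext0 I) by apply/measurable_EFinP; exact: L1_meas.
have E1 : (\int[mu]_x `|(EFin \o ext0 I) x| = 0)%E.
  rewrite -[RHS]E0 (EFin_Itg _ (L1_norm _ L)); exact: eq_integral.
have [/(_ E1) ae _] := ae_eq_integral_abs mu measurableT m.
apply: (aeS _ _ _ ae) => y /(_ Logic.I) /= [].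
rewrite /I /ext0 /=; case: ifPn => // y1.
by rewrite /S_op y1 expR0 !mul1r => /eqP; rewrite subr_eq0 => /eqP.
Qed.

Lemma poweR_half_lty (x : \bar R) : (x `^ 2^-1 < +oo)%E -> (x < +oo)%E.
Proof.
case: x => [r| |] h; [exact: ltry| |by []].
by move: h; rewrite poweRyr ?invr_eq0 ?pnatr_eq0// ltxx.
Qed.

Lemma norm2_ext0 (al : R) (f g : R -> R) : in_L1 f -> in_L1 g ->
  (\int[mu]_(y in `]1%R, +oo[%classic) (y `^ (2 * al) * `|f y - g y| ^+ 2)%:E =
   \int[mu]_y (y `^ (2 * al) * (ext0 f y - ext0 g y) ^+ 2)%:E)%E.
Proof.
move=> hf hg; pose W y := y `^ (2 * al) * `|f y - g y| ^+ 2.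
have mW : measurable_fun (`]1, +oo[%classic : set R) W.
  apply: measurable_funM; first exact: measurable_funTS (measurable_powR _).
  apply: measurable_funX; apply: measurableT_comp => //.
  by apply: measurable_funB; exact: in_L1_meas.
have m1 : measurable_fun setT (fun _ : R => 1 : R) by mfun.
have H := Itg_in_ext0 _ _ mW m1.
rewrite (_ : (\int[mu]_(y in `]1%R, +oo[%classic) (y `^ (2 * al) * `|f y - g y| ^+ 2)%:E)%E =
  (\int[mu]_(y in `]1%R, +oo[%classic) (W y * 1)%:E)%E); last first.
  by apply: eq_integral => y _; rewrite mulr1.
rewrite H; apply: eq_integral => y _; congr EFin; rewrite mulr1 /ext0 /W.
by case: ifP => _; [rewrite real_normK ?num_real|rewrite subrr expr0n/= mulr0].
Qed.

End Endpoints.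

Theorem theorem5p7 (R : realType) (N : nat) (p : nat -> R)
    (N_ge1 : (1 <= N)%N)
    (p_ge0 : forall j, (1 <= j <= N)%N -> 0 <= p j)
    (p_sum1 : \sum_(1 <= j < N.+1) p j = 1)
    (theta gamma : R)
    (theta_gt0 : 0 < theta) (theta_lt1 : theta < 1)
    (gamma_gt : theta + 1 / 2 < gamma)
    (gamma_lt : gamma < Num.min (3 / 2) (2 * theta + 1 / 2))
    (eta_star : R -> R) (eta_starP : is_profile N p theta eta_star)
    (eta0 : R -> R) (eta0P : is_density eta0)
    (eta0_close : exists2 nu : R, 0 < nu &
       in_L2 gamma (fun y => eta0 y - nu * eta_star y))
    (eta : R -> R -> R) (etaP : forall tau : R, 0 <= tau -> is_density (eta tau))
    (eta_sol : is_solution N p eta0 eta) :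
  exists2 C : R, 0 < C &
    forall tau : R, 0 <= tau ->
      (norm2 (gamma - theta) (fun y => eta tau y - eta_star y)%R
         <= (C * expR (- (gamma - theta - 1 / 2) * tau))%:E)%E.
Proof.
have [nu nu0 [_ w2]] := eta0_close.
have [eta_cont [beta [beta_loc boch bdry]]] := eta_sol.
have [esd _ _ _] := eta_starP; have [esL _ _] := esd; have [e0L _ _] := eta0P.
move: gamma_lt; rewrite lt_min => /andP[g1 g2].
pose al := gamma - theta.
have al_gt : 2^-1 < al by rewrite /al; lra.
(* Half the sum of the two upper bounds [al < 3/2 - theta] and [al < theta + 1/2]. *)
have al_lt : al < 1 by rewrite /al; lra.
have alE : al + theta = gamma by rewrite /al subrK.
have gm_lt : al + theta < 3 / 2 by rewrite alE.
have al_th : al < theta + 1 / 2 by rewrite /al; lra.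
have nsL : in_L1 (fun y => nu * eta_star y).
  apply/L1_cut; apply: (eq_L1 _ _ _ (L1Z nu _ ((L1_cut _).1 esL))) => y.
  by rewrite /cut; case: ifP; rewrite ?mulr0.
have W2 : L1 (fun y => y `^ (2 * (al + theta)) * (ext0 eta0 y - nu * pf eta_star y) ^+ 2).
  have E y : ext0 (fun y => nu * eta_star y) y = nu * pf eta_star y.
    by rewrite /pf /ext0; case: ifP => _; rewrite ?mulr0.
  have mW : measurable_fun setT (fun y => ext0 eta0 y - nu * pf eta_star y).
    exact: L1_meas _ (L1B _ _ (L1_ext0 _ e0L) (L1Z nu _ (L1_ext0 _ esL))).
  apply: ae0_le_L1; first by mfun.
    by move=> y; rewrite mulr_ge0 ?powR_ge0 ?sqr_ge0.
  move: w2; rewrite /norm2 (norm2_ext0 gamma _ _ e0L nsL) alE.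
  have -> : (\int[lebesgue_measure]_y (y `^ (2 * gamma) * (ext0 eta0 y - ext0 (fun y => nu * eta_star y) y) ^+ 2)%:E =
             \int[lebesgue_measure]_y (y `^ (2 * gamma) * (ext0 eta0 y - nu * pf eta_star y) ^+ 2)%:E)%E.
    by apply: eq_integral => y _; rewrite E.
  exact: poweR_half_lty.
have ini := initial_value N p eta0 eta beta eta0P (etaP 0 (lexx 0)) (boch 0 (lexx 0)).
have [e1L _ _] := etaP 0 (lexx 0).
have m0 := L1_meas _ (L1_ext0 _ e0L); have m1 := L1_meas _ (L1_ext0 _ e1L).
have eta_init (xi : R[i]) : 0 < Re xi ->
    AA eta 0 xi = A0 eta0 xi /\ lap (fun y => y * ext0 (eta 0) y) xi = M0 eta0 xi.
  move=> _; split; first exact: (ae_eq_lap _ _ xi m1 m0 ini).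
  have m0' : measurable_fun setT (fun y : R => y * ext0 eta0 y) by mfun.
  have m1' : measurable_fun setT (fun y : R => y * ext0 (eta 0) y) by mfun.
  by apply: (ae_eq_lap _ _ xi m1' m0'); apply: (aeS _ _ _ ini) => y ->.
have [C C0 H] := transform_decay N p p_ge0 p_sum1 al theta eta_star theta_gt0 eta_starP al_gt al_lt gm_lt al_th
  eta0 nu eta0P nu0 W2 eta beta etaP eta_cont beta_loc boch bdry eta_init.
(* The square root undoes the squared norm; [C] is only known to be nonnegative, so 1 is added for
   strict positivity. *)
exists (C `^ 2^-1 + 1); first by rewrite ltr_wpDl// powR_ge0.
move=> tau tau0; have [etL _ _] := etaP tau tau0.
rewrite /norm2 -/al (norm2_ext0 al _ _ etL esL).
have h := H tau tau0; rewrite /pf in h.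
have h2 : (0 <= 2^-1 :> R)%R by rewrite invr_ge0.
apply: (le_trans (gt0_ler_poweR h2 _ _ h)).
- by rewrite in_itv/= leey andbT integral_ge0// => y _; rewrite lee_fin mulr_ge0 ?powR_ge0 ?sqr_ge0.
- by rewrite in_itv/= leey andbT lee_fin mulr_ge0 ?expR_ge0.
rewrite poweR_EFin lee_fin powRM ?expR_ge0// -expRM.
rewrite (_ : - (2 * al - 1) * tau * 2^-1 = - (al - 1 / 2) * tau); last by field.
by rewrite ler_wpM2r ?expR_ge0// lerDl.
Qed.
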